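(* Let $p,q$ be coprime integers with $p\ge 2$, and let $F$ be a connected closed surface embedded in the lens space $L(p,q)\cong V_1\cup_\partial V_2$ that is in standard form, i.e. $F$ is obtained from a meridian disk $D_1$ of $V_1$ by performing a finite number of non-trivial band sum operations in $V_1$ and capping off the boundary circle of the resulting surface by a meridian disk $D_2$ of $V_2$. Then for each of these band sum operations, the slopes (on $\partial V_1$) of the boundary circles of the surfaces in $V_1$ before and after the operation are connected by an edge of the graph $\mathbb{D}_2$.
   Context: Slopes. A solid torus is $V\cong D^2\times S^1$. For coprime integers $r,s$, a circle on $\partial V\cong(\partial D^2)\times S^1$ is of $(r,s)$-slope (or $r/s$-slope) if it is isotopic to the circle $\theta\mapsto((\cos 2\pi s\theta,\sin 2\pi s\theta),(\cos 2\pi r\theta,\sin 2\pi r\theta))$, $0\le\theta\le 1$. A circle of $(0,1)$-slope is a meridian. Every essential circle in $\partial V$ (one not bounding a disk in $\partial V$) has an $(r,s)$-slope for some coprime $r,s$. Lens space. $L(p,q)$ is obtained from solid tori $V_1,V_2$ by gluing their boundaries by a homeomorphism which maps the meridian circle on $\partial V_2$ to a circle of $(p,q)$-slope on $\partial V_1$. Band sum. Let $M$ be a compact 3-manifold with non-empty boundary, $F$ a compact surface properly embedded in $M$, and $\beta$ an arc embedded in $\partial M$ with $\beta\cap\partial F=\partial\beta$. Take a tubular neighbourhood $N(\beta)\cong\beta\times I$ of $\beta$ in $\partial M$ with $\partial F\cap N(\beta)=(\partial\beta)\times I$, and isotope the interior of $F\cup N(\beta)$ slightly into the interior of $M$ with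 its boundary fixed; the resulting properly embedded surface is obtained from $F$ by a band sum along $\beta$. The band sum is trivial if the union of $\beta$ and a subarc of $\partial F$ forms a circle bounding a disk in $\partial M$. If $\partial M$ is a torus and $\partial F$ is a single essential circle, a non-trivial band sum yields a surface whose boundary is again a single essential circle. Graph $\mathbb{D}_2$. An irreducible fractional number is $r/s$ with $r,s$ coprime integers ($r/s$ and $(-r)/(-s)$ are identified; $1/0=(-1)/0=\infty$). The distance of two irreducible fractional numbers is $d(p/q,r/s)=|ps-rq|$. The vertices of $\mathbb{D}_2$ are the irreducible fractional numbers with even numerator; two vertices are connected by an edge if and only if their distance is $2$. The vertex $r/s$ corresponds to the $(r,s)$-slope on $\partial V_1$. *)

(* Defs.v *)
From HB Require Import structures.
From mathcomp Require Import all_boot all_order all_algebra.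
From mathcomp Require Import all_classical all_reals all_analysis.
Import Order.TTheory GRing.Theory Num.Theory.
Import numFieldNormedType.Exports.

Set Implicit Arguments.
Unset Strict Implicit.
Unset Printing Implicit Defensive.

Local Open Scope classical_set_scope.
Local Open Scope ring_scope.

(* Everything is done in the topological category: surfaces and manifolds are
   topological, and "properly embedded" includes local flatness.  Subsets of
   a topological space carry the subspace topology. *)

Definition homeo_on (S T : topologicalType) (A : set S) (B : set T)
    (f : S -> T) : Prop :=
  exists g : T -> S,
    [/\ {within A, continuous f}, {within B, continuous g}, f @` A = B &
        forall x, A x -> g (f x) = x].

Definition embedding_on (S T : topologicalType) (A : set S) (f : S -> T) : Prop :=
  homeo_on A (f @` A) f.

Section Models.
Context (R : realType).

Definition unit_interval : set R := `[0, 1].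
Definition disk : set (R * R) := [set x | x.1 ^+ 2 + x.2 ^+ 2 <= 1].
Definition circle : set (R * R) := [set x | x.1 ^+ 2 + x.2 ^+ 2 = 1].
Definition square : set (R * R) := unit_interval `*` unit_interval.

End Models.
Arguments unit_interval R : clear implicits.
Arguments disk R : clear implicits.
Arguments circle R : clear implicits.
Arguments square R : clear implicits.

Section Manifolds.
Context (R : realType) (T : topologicalType).
Implicit Types (X C : set T).

Definition is_arc X := exists f : R -> T, homeo_on (unit_interval R) X f.

Definition bounds_disk X C : Prop :=
  exists (D : set T) (f : R * R -> T),
    [/\ D `<=` X, homeo_on (disk R) D f & f @` circle R = C].

(* Isotopy of circles in X, as unparametrized subsets. *)
Definition isotopic_circles X C C' : Prop :=
  exists H : R * (R * R) -> T,
    [/\ {within unit_interval R `*` circle R, continuous H},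
        forall t, unit_interval R t ->
          embedding_on (circle R) (fun x => H (t, x)) /\
          (fun x => H (t, x)) @` circle R `<=` X,
        (fun x => H (0, x)) @` circle R = C &
        (fun x => H (1, x)) @` circle R = C'].

(* In what follows M is a 3-manifold with boundary bM, both given as subsets
   of T. *)

(* Near each of its points, (M, bM, F) is homeomorphic to an open subset of
   (R^2 x [0,+oo[, R^2 x {0}, {0} x R x [0,+oo[).  In particular F is a surface,
   whose boundary is F `&` bM. *)
Definition properly_embedded (M bM F : set T) : Prop :=
  [/\ F `<=` M, compact F &
      forall x, F x ->
        exists (U : set T) (W : set (R * R * R)) (f : T -> R * R * R),
        [/\ open U /\ U x, open W,
            homeo_on (M `&` U) (W `&` [set y | 0 <= y.2]) f,
            f @` (bM `&` U) = W `&` [set y | y.2 = 0] &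
            f @` (F `&` U) = W `&` [set y | 0 <= y.2 /\ y.1.1 = 0]]].

(* F' is obtained from F by a band sum along beta.  The map h is the
   identification beta x I ~ N(beta), with beta = beta x {1/2}; the equation on
   bM `&` F `&` N makes beta an arc meeting the boundary of F exactly in its
   endpoints.  K is the boundary of F `|` N.  The isotopy phi keeps K fixed and
   moves the rest of F `|` N off bM as soon as t > 0. *)
Definition band_sum (M bM F beta F' : set T) : Prop :=
  exists h : R * R -> T,
  let I := unit_interval R in
  let N := h @` square R in
  let K := ((F `&` bM) `\` h @` ([set 0; 1] `*` `]0, 1[))
           `|` h @` (I `*` [set 0; 1]) in
  [/\ embedding_on (square R) h, N `<=` bM,
      h @` (I `*` [set 2^-1]) = beta,
      (F `&` bM) `&` N = h @` ([set 0; 1] `*` I) &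
      exists phi : R * T -> T,
      [/\ {within I `*` (F `|` N), continuous phi},
          forall t, I t -> embedding_on (F `|` N) (fun x => phi (t, x)),
          (forall x, (F `|` N) x -> phi (0, x) = x) /\
          (forall t x, I t -> K x -> phi (t, x) = x),
          forall t, 0 < t <= 1 ->
            let Ft := (fun x => phi (t, x)) @` (F `|` N) in
            properly_embedded M bM Ft /\ Ft `&` bM = K &
          (fun x => phi (1, x)) @` (F `|` N) = F']].

Definition trivial_band (bM F beta : set T) : Prop :=
  exists alpha : set T,
    [/\ alpha `<=` F `&` bM, is_arc alpha & bounds_disk bM (beta `|` alpha)].

Definition nontrivial_band_sum (M bM F beta F' : set T) : Prop :=
  band_sum M bM F beta F' /\ ~ trivial_band bM F beta.

End Manifolds.

Section SolidTorus.
Context (R : realType).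
Notation space := ((R * R) * (R * R))%type.

Definition V : set space := disk R `*` circle R.
Definition bV : set space := circle R `*` circle R.

(* A pair (r, s) of coprime integers stands for the fraction r / s. *)

Definition slope_curve (v : int * int) : set space :=
  (fun theta : R =>
     ((cos (2 * pi * v.2%:~R * theta), sin (2 * pi * v.2%:~R * theta)),
      (cos (2 * pi * v.1%:~R * theta), sin (2 * pi * v.1%:~R * theta))))
  @` unit_interval R.

Definition has_slope (C : set space) (v : int * int) : Prop :=
  coprimez v.1 v.2 /\ isotopic_circles R bV C (slope_curve v).

Definition meridian_disk (D : set space) : Prop :=
  [/\ properly_embedded R V bV D,
      exists f : R * R -> space, homeo_on (disk R) D f &
      has_slope (D `&` bV) (0, 1)].

(* L is the quotient of the disjoint union of two copies V_1, V_2 of V by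
   the identification of each y in the boundary of V_2 with g y in the boundary
   of V_1; i1 and i2 are the inclusions of V_1 and V_2.  Preimages are taken in
   subspace V, so that the last clause says L has the quotient topology. *)
Definition lens_space (p q : int) (g : space -> space) (L : topologicalType)
    (i1 i2 : space -> L) : Prop :=
  [/\ homeo_on bV bV g /\ has_slope (g @` slope_curve (0, 1)) (p, q),
      i1 @` V `|` i2 @` V = [set: L],
      set_inj V i1 /\ set_inj V i2,
      forall x y, V x -> V y -> (i1 x = i2 y <-> bV y /\ x = g y) &
      forall A : set L, open A <->
        open (i1 @^-1` A : set (subspace V)) /\
        open (i2 @^-1` A : set (subspace V))].

Definition closed_surface (L : topologicalType) (F : set L) : Prop :=
  properly_embedded R [set: L] set0 F.

(* The n band sums turn Fs 0 = D_1 into Fs 1, ..., Fs n, the i-th one being along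
   beta i. *)
Definition standard_form (g : space -> space) (L : topologicalType)
    (i1 i2 : space -> L) (F : set L) (n : nat) (Fs beta : nat -> set space)
    (D2 : set space) : Prop :=
  [/\ meridian_disk (Fs 0%N),
      forall i, (i < n)%N -> nontrivial_band_sum R V bV (Fs i) (beta i) (Fs i.+1),
      meridian_disk D2,
      g @` (D2 `&` bV) = Fs n `&` bV &
      F = i1 @` Fs n `|` i2 @` D2].

End SolidTorus.
Arguments V R : clear implicits.
Arguments bV R : clear implicits.

(* The notions below are invariant under (r, s) |-> (- r, - s), hence depend
   only on the fraction r / s. *)

Definition D2_vertex (v : int * int) : Prop :=
  coprimez v.1 v.2 /\ (2 %| v.1)%Z.

Definition frac_dist (v w : int * int) : int := `|v.1 * w.2 - w.1 * v.2|.

Definition D2_edge (v w : int * int) : Prop :=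
  [/\ D2_vertex v, D2_vertex w & frac_dist v w = 2].

(* Main.v *)
(* The plane covers the boundary torus, and a simple closed curve C on the torus lifts to a line l
   with l (t + 1) = l t + e; up to sign, e is determined by C and invariant under isotopy.  If e is
   primitive, then C is isotopic to the linear curve of class e: with the theorem of Schoenflies, arcs
   of l are pushed across the discs that they cobound with horizontal chords, until l is almost
   horizontal (in a basis of the lattice beginning with e).  So having slope r / s means having class
   (s, r) or (- s, - r).

   For a band sum, the band lifts to a strip from l to l + k.  Put j = det (e, k).  If |j| > 1, a
   translate of l would miss the closed curve of class k made of an edge of the strip and an arc of l;
   this is impossible, as curves of independent classes meet.  If j = 0, the core of the band and an
   arc of C cobound a disc, and the band sum is trivial.  If |j| = 1, the two ends of the band run
   along l in the same direction, since otherwise the band would cut C into two disjoint curves of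
   independent classes; the new boundary then is a single curve, of class - (2 k + e).  Its
   determinant with e is - 2 j, so the distance of the two slopes is 2; and starting from the slope
   0 / 1 of a meridian, the numerators remain even. *)

Require Import Defs.
From mathcomp Require Import all_boot all_order all_algebra.
From mathcomp Require Import all_classical all_reals all_analysis.
From mathcomp Require Import ring lra zify.
Import Order.TTheory GRing.Theory Num.Theory.
Import numFieldNormedType.Exports.

Set Implicit Arguments.
Unset Strict Implicit.
Unset Printing Implicit Defensive.

Local Open Scope classical_set_scope.
Local Open Scope ring_scope.

(** * Continuity, compactness and rotations *)

Section Continuity.
Context (R : realType).
Implicit Types (T : topologicalType) (V W : normedModType R).

(** The obstacle is plane topology, and the tool is the continuous argument, that is, the lift to
    the line of a map into the punctured plane. Eilenberg's criterion (two points off a compact set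
    lie in one component of its complement if and only if the quotient of [z - p] by [z - q] has a
    continuous argument on the set) replaces homology: it shows that arcs do not separate the plane,
    and yields Janiszewski's theorem and with it the lemma on crosscuts. Only the existence of a
    point around which a Jordan curve turns exactly once is obtained by hand. The Schoenflies
    theorem is proved for two Jordan curves at once, by cutting both insides along corresponding
    crosscuts, which on one side are chords of a line. A wild curve may have infinitely many chords
    on a line, but those separating points well above it from points well below it have length
    bounded below, so finitely many cuts suffice. The same induction straightens curves on the
    torus, where the chords become pieces of the new curve. For [j = 0], the bound [|m| <= 1] for a
    simple closed curve whose class is [m] times a primitive one decides which arc of the curve
    cobounds the disc with the core of the band. *)

Lemma ctD T V (f g : T -> V) x : continuous_at x f -> continuous_at x g ->
  continuous_at x (fun y => f y + g y).
Proof. exact: cvgD. Qed.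

Lemma ctN T V (f : T -> V) x : continuous_at x f ->
  continuous_at x (fun y => - f y).
Proof. exact: cvgN. Qed.

Lemma ctZ T V (f : T -> R) (g : T -> V) x : continuous_at x f -> continuous_at x g ->
  continuous_at x (fun y => f y *: g y).
Proof. by move=> cf cg; exact: cvgZ. Qed.

Lemma ctM T (f g : T -> R) x : continuous_at x f -> continuous_at x g ->
  continuous_at x (fun y => f y * g y).
Proof. by move=> cf cg; exact: cvgM. Qed.

Lemma ctX T (f : T -> R) n x : continuous_at x f ->
  continuous_at x (fun y => f y ^+ n).
Proof.
move=> cf; elim: n => [|n IH]; first exact: cst_continuous.
have -> : (fun y => f y ^+ n.+1) = (fun y => f y * f y ^+ n).
  by apply/funext=> y; rewrite exprS.
by apply: ctM.
Qed.

Lemma ctV T (f : T -> R) x : f x != 0 -> continuous_at x f ->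
  continuous_at x (fun y => (f y)^-1).
Proof. exact: cvgV. Qed.

Lemma ct_fst T V W (f : T -> V * W) x : continuous_at x f ->
  continuous_at x (fun y => (f y).1).
Proof. by move=> cf; apply: continuous_comp => //; exact: cvg_fst. Qed.

Lemma ct_snd T V W (f : T -> V * W) x : continuous_at x f ->
  continuous_at x (fun y => (f y).2).
Proof. by move=> cf; apply: continuous_comp => //; exact: cvg_snd. Qed.

Lemma ct_pair T V W (f : T -> V) (g : T -> W) x :
  continuous_at x f -> continuous_at x g -> continuous_at x (fun y => (f y, g y)).
Proof. exact: cvg_pair. Qed.

Lemma ct_norm T V (f : T -> V) x : continuous_at x f ->
  continuous_at x (fun y => `|f y|).
Proof. exact: cvg_norm. Qed.

Lemma ct_max T (f g : T -> R) x : continuous_at x f -> continuous_at x g ->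
  continuous_at x (fun y => Num.max (f y) (g y)).
Proof. by move=> cf cg; apply: continuous_max. Qed.

Lemma ct_min T (f g : T -> R) x : continuous_at x f -> continuous_at x g ->
  continuous_at x (fun y => Num.min (f y) (g y)).
Proof. by move=> cf cg; apply: continuous_min. Qed.

Lemma ct_comp T (U U' : topologicalType) (h : U -> U') (f : T -> U) x :
  continuous h -> continuous_at x f -> continuous_at x (fun y => h (f y)).
Proof. by move=> ch cf; apply: continuous_comp => //; exact: ch. Qed.

Lemma ct_cst T (U : topologicalType) (a : U) (x : T) : continuous_at x (fun=> a).
Proof. exact: cst_continuous. Qed.

Lemma ct_id T (x : T) : continuous_at x (fun y => y).
Proof. exact: cvg_id. Qed.

Lemma ct_cos T (f : T -> R) x : continuous_at x f -> continuous_at x (fun y => cos (f y)).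
Proof. by apply: ct_comp; exact: continuous_cos. Qed.

Lemma ct_sin T (f : T -> R) x : continuous_at x f -> continuous_at x (fun y => sin (f y)).
Proof. by apply: ct_comp; exact: continuous_sin. Qed.

Lemma ct_atan T (f : T -> R) x : continuous_at x f -> continuous_at x (fun y => atan (f y)).
Proof. by apply: ct_comp => z; exact: continuous_atan. Qed.

Lemma ct_sqrt T (f : T -> R) x : continuous_at x f -> continuous_at x (fun y => Num.sqrt (f y)).
Proof. by apply: ct_comp; exact: sqrt_continuous. Qed.

End Continuity.

(** Continuity is proved pointwise, along the syntax of the function, because inverses and maps that
    are continuous only off some set have side conditions at the point. The last case composes with
    a map whose continuity is found in the context or in the hint base [cont]. *)
Ltac cont_step :=
  lazymatch goal with
  | |- forall _, _ => let x := fresh "x" in intro x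
  | |- continuous_at _ (fun=> ?a) => apply: ct_cst
  | |- continuous_at _ (fun y => y) => apply: ct_id
  | |- continuous_at _ (fun y => @?f y + @?g y) => apply: (@ctD _ _ _ f g)
  | |- continuous_at _ (fun y => - @?f y) => apply: (@ctN _ _ _ f)
  | |- continuous_at _ (fun y => @?f y *: @?g y) => apply: (@ctZ _ _ _ f g)
  | |- continuous_at _ (fun y => @?f y * @?g y) => apply: (@ctM _ _ f g)
  | |- continuous_at _ (fun y => @?f y ^+ _) => apply: (@ctX _ _ f)
  | |- continuous_at _ (fun y => (@?f y)^-1) => apply: (@ctV _ _ f)
  | |- continuous_at _ (fun y => (@?f y).1) => apply: (@ct_fst _ _ _ _ f)
  | |- continuous_at _ (fun y => (@?f y).2) => apply: (@ct_snd _ _ _ _ f)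
  | |- continuous_at _ (fun y => (@?f y, @?g y)) => apply: (@ct_pair _ _ _ _ f g)
  | |- continuous_at _ (fun y => `|@?f y|) => apply: (@ct_norm _ _ _ f)
  | |- continuous_at _ (fun y => Num.max (@?f y) (@?g y)) => apply: (@ct_max _ _ f g)
  | |- continuous_at _ (fun y => Num.min (@?f y) (@?g y)) => apply: (@ct_min _ _ f g)
  | |- continuous_at _ (fun y => cos (@?f y)) => apply: (@ct_cos _ _ f)
  | |- continuous_at _ (fun y => sin (@?f y)) => apply: (@ct_sin _ _ f)
  | |- continuous_at _ (fun y => atan (@?f y)) => apply: (@ct_atan _ _ f)
  | |- continuous_at _ (fun y => Num.sqrt (@?f y)) => apply: (@ct_sqrt _ _ f)
  | H : continuous ?h |- continuous_at _ ?h => exact: H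
  | H : continuous_at ?x ?h |- continuous_at ?x ?h => exact: H
  | H : continuous_at ?x (fun _ => _) |- continuous_at ?x _ => exact: H
  | |- continuous_at _ (fun y => ?h (@?f y)) =>
      apply: (@ct_comp _ _ _ h f); [solve [assumption | typeclasses eauto with cont]|]
  end.
Ltac cont := repeat cont_step.
Create HintDb cont.

(* [lra] fails in the presence of equations between elements of a normed module, is slowed down by
   irrelevant hypotheses, and cannot be used after clearing a section hypothesis. *)
Ltac hlra :=
  repeat match goal with
  | K : realType, H : @eq ?T _ _ |- _ => assert_fails (unify T (Real.sort K)); clear H
  end; lra.
Ltac xlra :=
  repeat match goal with
  | H : ?A |- _ => lazymatch type of A with Prop => lazymatch A with
      | is_true _ => fail | not _ => fail | and _ _ => fail | or _ _ => fail | @eq _ _ _ => fail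
      | _ => clear H end end
  end; hlra.

(* With False as goal, [lra] may choose to work with hypotheses on integers instead of those on R. *)
Ltac flra :=
  match goal with
  | K : realType |- False =>
      let H := fresh in assert (H : (1 <= (0 : K))%R); [xlra | by move: H; rewrite ler10]
  end.

Section Compactness.
Context (R : realType).
Implicit Types V W : normedModType R.

Lemma ct_epsP V W (f : V -> W) x : continuous_at x f <->
  forall e, 0 < e -> exists2 d, 0 < d & forall y, `|x - y| < d -> `|f x - f y| < e.
Proof.
split.
  move=> cf e e0; move/cvgrPdist_lt: cf => /(_ e e0) /nbhs_ballP [d /= d0 H].
  by exists d => // y xy; apply: H; rewrite -ball_normE.
move=> H; apply/cvgrPdist_lt => e e0; have [d d0 Hd] := H e e0.
by apply/nbhs_ballP; exists d => //= y; rewrite -ball_normE /=; exact: Hd.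
Qed.

Lemma open_epsP V (A : set V) : open A <->
  forall x, A x -> exists2 d, 0 < d & forall y, `|x - y| < d -> A y.
Proof.
split.
  move=> oA x Ax; have /nbhs_ballP [d /= d0 H] : nbhs x A by exact: open_nbhs_nbhs.
  by exists d => // y xy; apply: H; rewrite -ball_normE.
move=> H; rewrite openE => x Ax; have [d d0 Hd] := H x Ax.
by apply/nbhs_ballP; exists d => //= y; rewrite -ball_normE /=; exact: Hd.
Qed.

Lemma closed_epsP V (A : set V) : closed A <->
  forall x, (forall d, 0 < d -> exists2 y, A y & `|x - y| < d) -> A x.
Proof.
split.
  move=> cA x H; apply: cA => B /nbhs_ballP [d /= d0 dB].
  have [y Ay xy] := H d d0; exists y; split => //; apply: dB.
  by rewrite -ball_normE.
move=> H x cx; apply: H => d d0.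
have [|y [Ay By]] := cx (ball x d); first exact: nbhsx_ballx.
by exists y => //; move: By; rewrite -ball_normE.
Qed.

(** A Lebesgue number argument: as smaller bounds work as well, a bound that can be chosen locally
    can be chosen for the whole compact set. *)
Lemma compact_unif V (K : set V) (Q : R -> V -> Prop) : compact K ->
  (forall d d' x, d' <= d -> Q d x -> Q d' x) ->
  (forall x, K x -> exists2 d, 0 < d & forall y, `|x - y| < d -> K y -> Q d y) ->
  exists2 d, 0 < d & forall x, K x -> Q d x.
Proof.
move=> /compact_near_coveringP cK Qm H.
pose P d x := K x -> Q d x.
have /= := cK R (nbhs 0^'+) P _.
case.
  move=> x /H [d d0 Hd].
  exists ([set y | `|x - y| < d], [set e | e <= d]) => /=.
    split; first by apply/nbhs_ballP; exists d => //= y; rewrite -ball_normE.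
    by exists d => //= y; rewrite /ball_ /= sub0r normrN => /ltW yd y0; rewrite (le_trans _ yd)// ler_norm.
  by move=> [y e] /= [xy ed] Ky; apply: (Qm d) => //; exact: Hd.
move=> d /= d0 Hd; exists (d / 2); first by rewrite divr_gt0.
move=> x Kx; apply: (Hd (d / 2)) => //=; last by rewrite divr_gt0.
by rewrite /ball_ /= sub0r normrN gtr0_norm ?divr_gt0 // ltr_pdivrMr // ltr_pMr // ltr1n.
Qed.

Lemma compact_ball (N : R) : compact [set z : R * R | `|z| <= N].
Proof.
have -> : [set z : R * R | `|z| <= N] = `[- N, N] `*` `[- N, N].
  apply/seteqP; split => z /=; rewrite !in_itv /= -!ler_norml prod_normE ge_max.
    by move=> /andP[].
  by move=> [-> ->].
by apply: compact_setX; exact: segment_compact.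
Qed.

Lemma compact_of_closed_bounded (K : set (R * R)) N :
  closed K -> (forall x, K x -> `|x| <= N) -> compact K.
Proof. by move=> cK bK; apply: subclosed_compact cK (@compact_ball N) _. Qed.

Lemma compact_bounded_by V (K : set V) : compact K -> exists2 N, 0 < N & forall x, K x -> `|x| <= N.
Proof.
move=> /compact_bounded [M [Mr H]]; exists (Num.max M 0 + 1).
  by rewrite ltr_pwDr // le_max lexx orbT.
move=> x Kx; apply: H => //; apply: (@le_lt_trans _ _ (Num.max M 0)).
  by rewrite le_max lexx.
by rewrite ltrDl.
Qed.

End Compactness.

Section Clamp.
Context (R : realType).

(** Composition with this retraction extends maps from an interval to the whole line, so that
    continuity need not be relative to the interval. *)
Definition clamp (a b t : R) := Num.max a (Num.min b t).

Lemma clamp_id a b t : a <= t <= b -> clamp a b t = t.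
Proof. by case/andP => at_ tb; rewrite /clamp (min_idPr tb) (max_idPr at_). Qed.

Lemma clamp_itv a b t : a <= b -> a <= clamp a b t <= b.
Proof. by move=> ab; rewrite /clamp le_max lexx /= ge_max ab ge_min lexx. Qed.

Lemma clamp_le a b t : a <= b -> t <= a -> clamp a b t = a.
Proof. by move=> ab ta; apply/max_idPl; rewrite ge_min ta orbT. Qed.

Lemma clamp_ge a b t : a <= b -> b <= t -> clamp a b t = b.
Proof. by move=> ab ta; rewrite /clamp (min_idPl ta) (max_idPr ab). Qed.

Lemma clamp_cont a b : continuous (clamp a b).
Proof. rewrite /clamp; cont. Qed.

Definition clamp2 (N : R) (z : R * R) := (clamp (- N) N z.1, clamp (- N) N z.2).

Lemma clamp2_cont N : continuous (clamp2 N).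
Proof. rewrite /clamp2 /clamp; cont. Qed.

Lemma clamp2_id N z : `|z| <= N -> clamp2 N z = z.
Proof.
rewrite prod_normE ge_max !ler_norml => /andP[h1 h2].
by rewrite /clamp2 !clamp_id //; case: z {h1 h2}.
Qed.

Lemma clamp2_bd N z : 0 <= N -> `|clamp2 N z| <= N.
Proof.
move=> N0; rewrite prod_normE ge_max !ler_norml /clamp2.
by rewrite !clamp_itv // ge0_cp.
Qed.

End Clamp.
#[export] Hint Resolve clamp_cont clamp2_cont : cont.

(** * Complex multiplication and directions in the plane *)

Section Rotation.
Context (R : realType).
Notation P := (R * R)%type.
Implicit Types (a b c : P) (s t : R).

Definition cmul a b : P := (a.1 * b.1 - a.2 * b.2, a.1 * b.2 + a.2 * b.1).
Definition cconj a : P := (a.1, - a.2).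
Definition sqn a : R := a.1 ^+ 2 + a.2 ^+ 2.
Definition cis t : P := (cos (2 * pi * t), sin (2 * pi * t)).

Lemma cis_cont : continuous cis.
Proof. by rewrite /cis; cont. Qed.

Lemma pair_eq a b : a.1 = b.1 -> a.2 = b.2 -> a = b.
Proof. by case: a b => [? ?] [? ?] /= -> ->. Qed.

Lemma cmulC a b : cmul a b = cmul b a.
Proof. by apply: pair_eq => /=; ring. Qed.
Lemma cmulA a b c : cmul a (cmul b c) = cmul (cmul a b) c.
Proof. by apply: pair_eq => /=; ring. Qed.
Lemma cmul1 a : cmul (1, 0) a = a.
Proof. by apply: pair_eq => /=; ring. Qed.
Lemma cmulZl t a b : cmul (t *: a) b = t *: cmul a b.
Proof. by apply: pair_eq => /=; rewrite /GRing.scale /=; ring. Qed.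
Lemma cmulZr t a b : cmul a (t *: b) = t *: cmul a b.
Proof. by rewrite cmulC cmulZl cmulC. Qed.
Lemma sqn_cmul a b : sqn (cmul a b) = sqn a * sqn b.
Proof. by rewrite /sqn /=; ring. Qed.
Lemma cmul_conj a : cmul a (cconj a) = (sqn a, 0).
Proof. by apply: pair_eq => /=; rewrite /sqn; ring. Qed.
Lemma sqn_ge0 a : 0 <= sqn a.
Proof. by rewrite addr_ge0 // sqr_ge0. Qed.
Lemma sqn_eq0 a : (sqn a == 0) = (a == 0).
Proof.
by rewrite /sqn paddr_eq0 ?sqr_ge0 // !sqrf_eq0; case: a => x y.
Qed.
Lemma sqn_gt0 a : (0 < sqn a) = (a != 0).
Proof. by rewrite lt0r sqn_eq0 sqn_ge0 andbT. Qed.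
Lemma sqnZ t a : sqn (t *: a) = t ^+ 2 * sqn a.
Proof. by rewrite /sqn /= /GRing.scale /=; ring. Qed.

Lemma sqn_cis t : sqn (cis t) = 1.
Proof. exact: cos2Dsin2. Qed.
Lemma cis_neq0 t : cis t != 0.
Proof. by rewrite -sqn_gt0 sqn_cis. Qed.
Lemma cisD s t : cis (s + t) = cmul (cis s) (cis t).
Proof. by rewrite /cis mulrDr cosD sinD; apply: pair_eq => //=; ring. Qed.
Lemma cisN t : cis (- t) = cconj (cis t).
Proof. by rewrite /cis /cconj mulrN cosN sinN. Qed.
Lemma cis0 : cis 0 = (1, 0).
Proof. by rewrite /cis mulr0 cos0 sin0. Qed.
Lemma cis_half : cis 2^-1 = (-1, 0).
Proof. by rewrite /cis mulrAC divff ?mul1r // cospi sinpi. Qed.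
Lemma cis1 : cis 1 = (1, 0).
Proof.
have e : 1 = 2^-1 + 2^-1 :> R by lra.
by rewrite [X in cis X]e cisD cis_half; apply: pair_eq => /=; ring.
Qed.
Lemma cisZ (n : int) : cis n%:~R = (1, 0).
Proof.
have H (k : nat) : cis k%:R = (1, 0).
  elim: k => [|k IH]; first by rewrite cis0.
  by rewrite -addn1 natrD cisD IH cmul1 cis1.
case: n => k; first exact: H.
by rewrite NegzE mulrNz cisN H /cconj /= oppr0.
Qed.
Lemma cisDz t (n : int) : cis (t + n%:~R) = cis t.
Proof. by rewrite cisD cisZ cmulC cmul1. Qed.

(** The cosine is injective on half a turn; this applies to the fractional part [f] of [t] if
    [f <= 1/2], and to [1 - f] otherwise. *)
Lemma cis_eq1 t : cis t = (1, 0) -> exists n : int, t = n%:~R.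
Proof.
move=> ct; exists (Num.floor t).
set f := t - (Num.floor t)%:~R.
have f0 : 0 <= f by rewrite subr_ge0 floor_le_tmp.
have f1 : f < 1 by rewrite ltrBlDl -intrD1 floorD1_gt.
have cf : cis f = (1, 0) by rewrite /f -mulrNz cisDz.
have pi0 : 0 < pi :> R := pi_gt0 R.
suff : f = 0 by move/eqP; rewrite subr_eq0 => /eqP.
have [f2|f2] := leP f 2^-1.
  have : cos (2 * pi * f) = cos 0 by rewrite cos0; case: cf.
  move/cos_inj; rewrite !in_itv /= => /(_ _ _) H.
  have := H _ _; rewrite lexx (ltW pi0).
  have -> : 0 <= 2 * pi * f <= pi.
    by rewrite !mulr_ge0 ?(ltW pi0) // mulrAC ger_pMl // -ler_pdivlMl // mulr1.
  move=> /(_ isT isT) /eqP; rewrite !mulf_eq0 pnatr_eq0 /= (gt_eqF pi0) /=.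
  by move/eqP.
have : cos (2 * pi * (1 - f)) = cos 0.
  by have := cisD 1 (- f); rewrite cisN cf cis1 /cis => -[-> _]; rewrite cos0 /=; ring.
move/cos_inj; rewrite !in_itv /= => /(_ _ _) H.
have := H _ _; rewrite lexx (ltW pi0).
have -> : 0 <= 2 * pi * (1 - f) <= pi.
  rewrite !mulr_ge0 ?(ltW pi0) ?subr_ge0 ?(ltW f1) //=.
  rewrite mulrAC ger_pMl // -ler_pdivlMl // mulr1; lra.
move=> /(_ isT isT) /eqP; rewrite !mulf_eq0 pnatr_eq0 /= (gt_eqF pi0) /=.
by rewrite subr_eq0 => /eqP f1'; move: f1; rewrite -f1' ltxx.
Qed.

Lemma cis_eq s t : cis s = cis t -> exists n : int, s = t + n%:~R.
Proof.
move=> st; have [] := @cis_eq1 (s - t).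
  by rewrite cisD cisN st cmul_conj sqn_cis.
by move=> n h; exists n; rewrite -h; ring.
Qed.

(** Equality of directions. Since arguments are compared only up to positive factors, quotients may
    be replaced by products with conjugates. *)
Definition sdir a b := exists2 r : R, 0 < r & a = r *: b.

Lemma sdir_refl a : sdir a a.
Proof. by exists 1; rewrite ?scale1r. Qed.
Lemma sdir_sym a b : sdir a b -> sdir b a.
Proof.
by move=> [r r0 ->]; exists r^-1; rewrite ?invr_gt0 // scalerA mulVf ?scale1r // gt_eqF.
Qed.
Lemma sdir_trans b a c : sdir a b -> sdir b c -> sdir a c.
Proof. by move=> [r r0 ->] [s s0 ->]; exists (r * s); rewrite ?mulr_gt0 // scalerA. Qed.
Lemma sdir_cmul a b c d : sdir a b -> sdir c d -> sdir (cmul a c) (cmul b d).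
Proof.
move=> [r r0 ->] [s s0 ->]; exists (r * s); rewrite ?mulr_gt0 //.
by rewrite cmulZl cmulZr scalerA.
Qed.
Lemma sdir_conj a b : sdir a b -> sdir (cconj a) (cconj b).
Proof.
by move=> [r r0 ->]; exists r => //; apply: pair_eq => //=; rewrite /GRing.scale /=; ring.
Qed.
Lemma sdir_cis s t : sdir (cis s) (cis t) -> exists n : int, s = t + n%:~R.
Proof.
move=> [r r0 h]; apply: cis_eq; rewrite h.
have : sqn (cis s) = r ^+ 2 * sqn (cis t) by rewrite h sqnZ.
rewrite !sqn_cis mulr1 => /esym/eqP; rewrite sqrf_eq1 => /orP[/eqP->|/eqP r1].
  by rewrite scale1r.
by move: r0; rewrite r1 ltr0N1.
Qed.
Lemma sdir_cancel a b c : a != 0 -> sdir (cmul a b) (cmul a c) -> sdir b c.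
Proof.
move=> a0 /(sdir_cmul (sdir_refl (cconj a))).
rewrite !cmulA ![cmul (cconj a) a]cmulC cmul_conj => h.
have e x : (sqn a)^-1 *: cmul (sqn a, 0) x = x.
  have n0 : sqn a != 0 by rewrite sqn_eq0.
  by apply: pair_eq => /=; rewrite /GRing.scale /=; field.
have : 0 < (sqn a)^-1 by rewrite invr_gt0 sqn_gt0.
move=> s0; case: h => r r0 h; exists r => //.
by rewrite -(e b) h scalerA mulrC -scalerA e.
Qed.

(** The principal argument, in full turns, of a point of the right half-plane. *)
Definition ang b : R := atan (b.2 / b.1) / (2 * pi).

Lemma angP b : 0 < b.1 -> sdir b (cis (ang b)).
Proof.
move=> b0; rewrite /cis /ang mulrC divfK; last first.
  by rewrite mulf_neq0 // gt_eqF // pi_gt0.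
set x := atan _.
have c0 : 0 < cos x.
  by apply: cos_gt0_pihalf; rewrite atan_gtNpi2 atan_ltpi2.
have t0 : tan x = b.2 / b.1 by rewrite atanK.
exists (b.1 / cos x); first by rewrite divr_gt0.
apply: pair_eq => /=; rewrite /GRing.scale /=.
  by rewrite divfK // gt_eqF.
rewrite mulrAC -mulrA -[sin x / cos x]/(tan x) t0 mulrC divfK // gt_eqF //.
Qed.

Lemma sdir_cis_exists (g : R * R) : g != 0 -> exists t, sdir g (cis t).
Proof.
move=> g0.
have [g1|g1] := ltP 0 g.1; first by exists (ang g); exact: angP.
have [g1'|g1'] := ltP g.1 0.
  exists (ang (- g) + 2^-1); rewrite cisD cis_half.
  have e : g = cmul (- g) (-1, 0) by apply: pair_eq => /=; ring.
  rewrite [X in sdir X _]e.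
  by apply: sdir_cmul; [apply: angP; rewrite /= oppr_gt0 | exact: sdir_refl].
have g10 : g.1 = 0 by apply/eqP; rewrite eq_le g1 g1'.
have g20 : g.2 != 0 by apply: contraNneq g0 => e; apply/eqP; apply: pair_eq.
have e : 2 * pi * 4^-1 = pi / 2 :> R by field.
have [g2|g2] := ltP 0 g.2.
  exists (4^-1); exists g.2 => //; apply: pair_eq => /=; rewrite /GRing.scale /= e.
    by rewrite cos_pihalf mulr0.
  by rewrite sin_pihalf mulr1.
exists (- 4^-1); exists (- g.2).
  by rewrite oppr_gt0 lt_neqAle g20.
apply: pair_eq => /=; rewrite /GRing.scale /= mulrN e.
  by rewrite cosN cos_pihalf mulr0.
by rewrite sinN sin_pihalf mulrNN mulr1.
Qed.

End Rotation.
#[export] Hint Resolve cis_cont : cont.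

(** * Arguments and winding numbers *)

Section Lifting.
Context (R : realType).
Notation P := (R * R)%type.

(** Otherwise the intermediate value theorem yields a value [m + 1/2]. In this way differences of
    arguments and lattice vectors are transported along paths. *)
Lemma integer_valued_const (f : R -> R) : continuous f ->
  (forall t, 0 <= t <= 1 -> exists n : int, f t = n%:~R) -> f 0 = f 1.
Proof.
move=> cf fZ; apply/eqP/negPn/negP => f01.
have [n0 e0] : exists n : int, f 0 = n%:~R by apply: fZ; rewrite lexx ler01.
have [n1 e1] : exists n : int, f 1 = n%:~R by apply: fZ; rewrite lexx ler01.
have fI : {within `[0, 1], continuous f} by exact: continuous_subspaceT.
pose m := Num.min n0 n1.
have hm : Num.min (f 0) (f 1) = m%:~R.
  by rewrite e0 e1 /m; case: (leP n0 n1) => h; [rewrite min_l // ler_int|rewrite min_r // ler_int ltW].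
have hM : m%:~R + 1 <= Num.max (f 0) (f 1).
  rewrite -intrD1 e0 e1 /m; move: f01; rewrite e0 e1 eqr_int.
  case: (ltgtP n0 n1) => // h _; rewrite le_max !ler_int; apply/orP.
    by right; lia.
  by left; lia.
have [|c] := @IVT R f 0 1 (m%:~R + 2^-1) ler01 fI _.
  by rewrite hm; apply/andP; split; [lra | apply: le_trans hM; lra].
rewrite in_itv /= => /fZ [k ->] /eqP.
have : 0 < (2^-1 : R) < 1 by lra.
move=> /andP[h1 h2] /eqP h.
have : (m < k)%R by rewrite -(ltr_int R) h ltrDl.
have : (k < m + 1)%R by rewrite -(ltr_int R) h intrD ltrD2l.
lia.
Qed.

(* A nowhere vanishing map has a continuous argument: the ray from 0 to z is cut into
   pieces along which the map turns by less than a quarter. *)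
Lemma lift_square (F : P -> P) N : 0 <= N -> continuous F ->
  (forall z, `|z| <= N -> F z != 0) ->
  exists2 th : P -> R, continuous th & forall z, `|z| <= N -> sdir (F z) (cis (th z)).
Proof.
move=> N0 cF F0.
(* [G] has no zeros on the whole plane, whereas [F] may vanish outside of the square. *)
pose G z := F (clamp2 N z).
have cG : continuous G by rewrite /G; cont.
have G0 z : G z != 0 by apply: F0; exact: clamp2_bd.
(* Up to a positive factor, the real part of the quotient of [G] at two points of a ray; it is
   positive when the direction differs by less than a quarter turn. *)
pose Phi (w : (P * R) * R) := (cmul (G (w.2 *: w.1.1)) (cconj (G (w.1.2 *: w.1.1)))).1.
have cPhi : continuous Phi by rewrite /Phi /cmul /cconj /=; cont.
have [d d0 Hd] : exists2 d, 0 < d & forall w, ([set z : P | `|z| <= N] `*` `[0, 1]) w ->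
    forall t, `|w.2 - t| < d -> 0 < Phi (w, t).
  apply: (@compact_unif R (P * R)%type _ (fun d w => forall t, `|w.2 - t| < d -> 0 < Phi (w, t))).
  - by apply: compact_setX; [exact: compact_ball | exact: segment_compact].
  - by move=> d d' w dd' H t wt; apply: H; exact: lt_le_trans wt dd'.
  move=> w _.
  have p0 : 0 < Phi (w, w.2) by rewrite -[Phi _]/((cmul (G (w.2 *: w.1)) (cconj (G (w.2 *: w.1)))).1) cmul_conj sqn_gt0.
  have [e e0 He] := (iffLR (ct_epsP _ _) (cPhi (w, w.2))) _ p0.
  exists (e / 2); first by rewrite divr_gt0.
  move=> w' ww' _ t w't.
  have : `|(w, w.2) - (w', t)| < e.
    rewrite prod_normE /= gt_max; apply/andP; split.
      by apply: lt_trans ww' _; rewrite ltr_pdivrMr // ltr_pMr // ltr1n.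
    have -> : w.2 - t = (w.2 - w'.2) + (w'.2 - t) by ring.
    rewrite (le_lt_trans (ler_normD _ _)) // [e]splitr ltrD //.
    by apply: le_lt_trans ww'; rewrite [leRHS]prod_normE le_max lexx orbT.
  by move/He; rewrite ltr_norml => /andP[_]; rewrite ltrBlDr ltrDl.
pose n := (Num.truncn d^-1).+1.
have n0 : (0 : R) < n%:R by rewrite ltr0n.
have nd : n%:R^-1 < d.
  by rewrite invf_plt ?posrE //; rewrite truncnS_gt.
pose st i z := cmul (G ((i.+1%:R / n%:R) *: z)) (cconj (G ((i%:R / n%:R) *: z))).
have st0 i z : (i < n)%N -> `|z| <= N -> 0 < (st i z).1.
  move=> ilt zN; apply: (Hd (z, i%:R / n%:R)) => /=.
    split => //=; rewrite in_itv /= divr_ge0 //= ler_pdivrMr // mul1r ler_nat ltnW //.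
  rewrite -mulrBl -natr1 opprD addrA subrr sub0r mulN1r normrN gtr0_norm ?invr_gt0 //.
have cst i : continuous (st i) by rewrite /st /cmul /cconj /=; cont.
have sum_ok k : (k <= n)%N -> exists2 th : P -> R, continuous th &
    forall z, `|z| <= N -> sdir (G ((k%:R / n%:R) *: z)) (cis (th z)).
  elim: k => [_|k IH kn].
    have [a Ha] := sdir_cis_exists (G0 0).
    exists (fun=> a); first by cont.
    by move=> z _; rewrite mul0r scale0r.
  have [th cth Hth] := IH (ltnW kn).
  pose b z := (Num.max (st k z).1 0, (st k z).2).
  (* [m] bounds the real part from below on the square. With [Num.max m] in the denominator the
     angle is continuous on the whole plane, and unchanged on the square. *)
  have [m m0 Hm] : exists2 m : R, 0 < m & forall z, `|z| <= N -> m <= (st k z).1.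
    have K0 : [set z : P | `|z| <= N] !=set0 by exists 0; rewrite /= normr0.
    have [|c] := @compact_EVT_min _ _ (fun z => (st k z).1) _ K0 (@compact_ball R N).
      by apply: continuous_subspaceT; cont.
    rewrite inE /= => cN Hc; exists (st k c).1; first exact: st0.
    by move=> z zN; apply: Hc; rewrite inE.
  exists (fun z => th z + atan ((st k z).2 / Num.max m (st k z).1) / (2 * pi)).
    cont => //; rewrite gt_eqF // lt_max m0 //.
  move=> z zN; rewrite cisD.
  have e : Num.max m (st k z).1 = (st k z).1 by apply/max_idPr/Hm.
  rewrite e -/(ang (st k z)).
  have h1 := Hth z zN; have h2 := angP (st0 k z kn zN).
  apply: sdir_trans (sdir_cmul h1 h2).
  rewrite /st; set g := G _; set g' := G ((k%:R / _) *: z).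
  rewrite [cmul g _]cmulC cmulA cmul_conj.
  exists (sqn g')^-1; first by rewrite invr_gt0 sqn_gt0 G0.
  have q0 : sqn g' != 0 by rewrite sqn_eq0 G0.
  by apply: pair_eq => /=; rewrite /GRing.scale /=; field.
have [th cth Hth] := sum_ok n (leqnn _).
exists th => // z zN; have := Hth z zN.
by rewrite divff ?gt_eqF // scale1r /G clamp2_id.
Qed.

End Lifting.

(** * Winding numbers around the origin *)

Section Winding.
Context (R : realType).

Lemma itv0 : 0 <= (0 : R) <= 1.
Proof. by rewrite lexx ler01. Qed.
Lemma itv1 : 0 <= (1 : R) <= 1.
Proof. by rewrite lexx ler01. Qed.

Notation P := (R * R)%type.
Implicit Types (f g : R -> P) (n m : int).

Lemma lift_path g : continuous g -> (forall t, 0 <= t <= 1 -> g t != 0) ->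
  exists2 th : R -> R, continuous th & forall t, 0 <= t <= 1 -> sdir (g t) (cis (th t)).
Proof.
move=> cg g0; pose F (z : P) := g (clamp 0 1 z.1).
have [|z _|th cth H] := @lift_square R F 1 ler01.
- by rewrite /F; cont.
- by apply: g0; apply: clamp_itv.
exists (fun t => th (t, 0)); first by cont.
move=> t t01; have := H (t, 0); rewrite /F /= clamp_id //; apply.
rewrite prod_normE /= normr0 ge_max ler01 andbT ler_norml.
by case/andP: t01 => h1 ->; rewrite (le_trans _ h1) // oppr_le0.
Qed.

Definition winds g n := exists2 th : R -> R, continuous th &
  (forall t, 0 <= t <= 1 -> sdir (g t) (cis (th t))) /\ th 1 = th 0 + n%:~R.

Lemma winds_ext f g n : (forall t, 0 <= t <= 1 -> f t = g t) -> winds f n -> winds g n.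
Proof.
by move=> fg [th cth [h1 h2]]; exists th => //; split => // t t01; rewrite -fg //; exact: h1.
Qed.

Lemma winds_uniq g n m : winds g n -> winds g m -> n = m.
Proof.
move=> [th cth [h1 h2]] [th' cth' [h1' h2']].
have : th 0 - th' 0 = th 1 - th' 1.
  apply: (@integer_valued_const R (fun t => th t - th' t)); first by cont.
  move=> t t01; have [k ->] := sdir_cis (sdir_trans (sdir_sym (h1 t t01)) (h1' t t01)).
  by exists k; rewrite addrC addKr.
rewrite h2 h2' => /eqP; rewrite -subr_eq0 => /eqP e.
by apply: (@intr_inj R); lra.
Qed.

Lemma winds_exists g : continuous g -> (forall t, 0 <= t <= 1 -> g t != 0) -> g 0 = g 1 ->
  exists n, winds g n.
Proof.
move=> cg g0 g01; have [th cth H] := lift_path cg g0.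
have := H 1; rewrite -g01 lexx ler01 => /(_ isT) h1.
have := H 0; rewrite lexx ler01 => /(_ isT) h0.
have [n e] := sdir_cis (sdir_trans (sdir_sym h1) h0).
by exists n, th.
Qed.

Lemma winds_mul f g n m : winds f n -> winds g m ->
  winds (fun t => cmul (f t) (g t)) (n + m).
Proof.
move=> [th cth [h1 h2]] [th' cth' [h1' h2']]; exists (fun t => th t + th' t); first by cont.
split; last by rewrite h2 h2' intrD; ring.
by move=> t t01; rewrite cisD; apply: sdir_cmul; [exact: h1 | exact: h1'].
Qed.

Lemma winds_conj f n : winds f n -> winds (fun t => cconj (f t)) (- n).
Proof.
move=> [th cth [h1 h2]]; exists (fun t => - th t); first by cont.
split; last by rewrite h2 mulrNz; ring.
by move=> t t01; rewrite cisN; apply: sdir_conj; exact: h1.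
Qed.

Lemma winds_cis n : winds (fun t => cis (n%:~R * t)) n.
Proof.
exists (fun t => n%:~R * t); first by cont.
by split; [move=> t _; exact: sdir_refl | rewrite mulr1 mulr0 add0r].
Qed.

Lemma winds_sdir f g n : (forall t, 0 <= t <= 1 -> sdir (g t) (f t)) -> winds f n -> winds g n.
Proof.
move=> fg [th cth [h1 h2]]; exists th => //; split => // t t01.
exact: sdir_trans (fg t t01) (h1 t t01).
Qed.

(** An argument exists on the whole square, and its increment along a row is an integer that depends
    continuously on the row. *)
Lemma winds_homotopy (F : P -> P) n : continuous F ->
  (forall t s, 0 <= t <= 1 -> 0 <= s <= 1 -> F (t, s) != 0) ->
  (forall s, 0 <= s <= 1 -> F (0, s) = F (1, s)) ->
  winds (fun t => F (t, 0)) n -> winds (fun t => F (t, 1)) n.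
Proof.
move=> cF F0 F01 W.
pose G (z : P) := F (clamp 0 1 z.1, clamp 0 1 z.2).
have [|z _|th cth H] := @lift_square R G 1 ler01.
- by rewrite /G; cont.
- by apply: F0; apply: clamp_itv.
have H' t s : 0 <= t <= 1 -> 0 <= s <= 1 -> sdir (F (t, s)) (cis (th (t, s))).
  move=> t01 s01; have := H (t, s); rewrite /G /= !clamp_id //; apply.
  rewrite prod_normE /= ge_max !ler_norml.
  by case/andP: t01 => h1 ->; case/andP: s01 => h2 ->; rewrite !(le_trans _ h1, le_trans _ h2) // oppr_le0.
have e : th (1, 0) - th (0, 0) = th (1, 1) - th (0, 1).
  apply: (@integer_valued_const R (fun s => th (1, s) - th (0, s))); first by cont.
  move=> s s01; have h1 := H' 1 s; have h0 := H' 0 s.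
  move: h1 h0; rewrite !lexx !ler01 F01 // => /(_ isT s01) h1 /(_ isT s01) h0.
  by have [k ->] := sdir_cis (sdir_trans (sdir_sym h1) h0); exists k; ring.
have W1 : exists m, winds (fun t => F (t, 1)) m.
  apply: winds_exists; [by cont | by move=> t t01; apply: F0; rewrite ?lexx ?ler01 // | by apply: F01; rewrite lexx ler01].
have i1 := itv1; have i0 := itv0.
have [k ek] : exists k : int, th (1, 0) - th (0, 0) = k%:~R.
  have h1 := H' 1 0 i1 i0; have h0 := H' 0 0 i0 i0; rewrite -F01 // in h1.
  by have [k ->] := sdir_cis (sdir_trans (sdir_sym h1) h0); exists k; ring.
have -> : n = k.
  apply: winds_uniq W _; exists (fun t => th (t, 0)); first by cont.
  by split; [move=> t t01; exact: H' | rewrite -ek; ring].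
exists (fun t => th (t, 1)); first by cont.
by split; [move=> t t01; exact: H' | rewrite -ek e; ring].
Qed.

Lemma winds_segment f g n : continuous f -> continuous g -> f 0 = f 1 -> g 0 = g 1 ->
  (forall t s, 0 <= t <= 1 -> 0 <= s <= 1 -> (1 - s) *: f t + s *: g t != 0) ->
  winds f n -> winds g n.
Proof.
move=> cf cg f01 g01 H W.
pose F (z : P) := (1 - z.2) *: f z.1 + z.2 *: g z.1.
have := @winds_homotopy F n; rewrite /F /= => K.
apply: winds_ext (K _ _ _ _).
- by move=> t _; rewrite subrr scale0r add0r scale1r.
- by cont.
- by move=> t s t01 s01; exact: H.
- by move=> s _; rewrite f01 g01.
by apply: winds_ext W => t _; rewrite subr0 scale1r scale0r addr0.
Qed.

Lemma winds_cst (a : P) : a != 0 -> winds (fun=> a) 0.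
Proof.
move=> /sdir_cis_exists [t h]; exists (fun=> t); first by cont.
by split => //; rewrite addr0.
Qed.

End Winding.

(** * Paths and Eilenberg's criterion *)

Section Joined.
Context (R : realType).
Implicit Types (V : normedModType R).

(* Paths are defined on the whole line, so that no restricted continuity is needed. *)
Definition joined V (U : set V) x y := exists f : R -> V,
  [/\ continuous f, forall t, U (f t), f 0 = x & f 1 = y].

Lemma joined_path V (U : set V) (f : R -> V) : continuous f ->
  (forall t, 0 <= t <= 1 -> U (f t)) -> joined U (f 0) (f 1).
Proof.
move=> cf Uf; exists (fun t => f (clamp 0 1 t)); split; first by cont.
- by move=> t; apply: Uf; exact: clamp_itv.
- by rewrite clamp_id // itv0.
by rewrite clamp_id // itv1.
Qed.

Lemma joined_subpath V (U : set V) (f : R -> V) a b : a <= b -> continuous f ->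
  (forall t, a <= t <= b -> U (f t)) -> joined U (f a) (f b).
Proof.
move=> ab cf Uf.
have := @joined_path V U (fun t => f (a + t * (b - a))).
have -> : a + 0 * (b - a) = a by ring.
have -> : a + 1 * (b - a) = b by ring.
apply; first by cont.
move=> t /andP[t0 t1]; apply: Uf.
have ab0 : 0 <= b - a by rewrite subr_ge0.
rewrite lerDl mulr_ge0 //= -lerBrDl -[leRHS]mul1r.
by rewrite ler_wpM2r.
Qed.

Lemma joined_in V (U : set V) x y : joined U x y -> U x /\ U y.
Proof. by move=> [f [_ Uf <- <-]]; split; exact: Uf. Qed.

Lemma joined_refl V (U : set V) x : U x -> joined U x x.
Proof. by move=> Ux; exists (fun=> x); split => //; cont. Qed.

Lemma joined_sym V (U : set V) x y : joined U x y -> joined U y x.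
Proof.
move=> [f [cf Uf f0 f1]]; exists (fun t => f (1 - t)).
by split; rewrite ?subr0 ?subrr //; cont.
Qed.

Lemma joined_trans V (U : set V) y x z : joined U x y -> joined U y z -> joined U x z.
Proof.
move=> [f [cf Uf f0 f1]] [g [cg Ug g0 g1]].
(* [f] has come to rest at [y] when [g] leaves it, so the sum minus [y] runs through both paths, and
   its continuity requires no pasting. *)
pose h t := f (Num.min (2 * t) 1) + g (Num.max (2 * t - 1) 0) - y.
have h0 : h 0 = x.
  by rewrite /h mulr0 sub0r min_l ?ler01 // max_r ?lerN10 // g0 f0 addrK.
have h1 : h 1 = z.
  by rewrite /h mulr1 min_r ?max_l ?f1; [rewrite addrAC subrr add0r -g1; congr g | |]; lra.
rewrite -h0 -h1; apply: joined_path; first by rewrite /h; cont.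
move=> t /andP[t0 t1]; rewrite /h; have [t2|t2] := leP (2 * t) 1.
  by rewrite max_r ?subr_le0 // g0 addrK.
by rewrite f1 addrAC subrr add0r.
Qed.

Lemma joined_sub V (U W : set V) x y : U `<=` W -> joined U x y -> joined W x y.
Proof. by move=> UW [f [cf Uf f0 f1]]; exists f; split => // t; apply: UW. Qed.

Lemma joined_segment V (U : set V) x y :
  (forall t, 0 <= t <= 1 -> U (x + t *: (y - x))) -> joined U x y.
Proof.
move=> H; have := @joined_path V U (fun t => x + t *: (y - x)).
by rewrite scale0r addr0 scale1r [x + (y - x)]addrC subrK; apply => //; cont.
Qed.

Lemma joined_ball V (U : set V) x d y : (forall z, `|x - z| < d -> U z) -> `|x - y| < d ->
  joined U x y.
Proof.
move=> H xy; apply: joined_segment => t /andP[t0 t1]; apply: H.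
rewrite opprD addrA subrr sub0r normrN normrZ ger0_norm // distrC.
by apply: le_lt_trans xy; rewrite ler_piMl.
Qed.

(** A locally constant property is constant along a path: its truth value, as a number, is
    continuous and integer valued. *)
Lemma joined_ind V (U Q : set V) x y :
  (forall u, U u -> exists2 d, 0 < d & forall v, U v -> `|u - v| < d -> (Q u <-> Q v)) ->
  joined U x y -> Q x -> Q y.
Proof.
move=> H [f [cf Uf f0 f1]] Qx.
pose h (t : R) : R := `[<Q (f t)>]%:R.
have hE t s : (Q (f t) <-> Q (f s)) -> h t = h s.
  by move=> e; rewrite /h (asbool_equiv_eq e).
have : h 0 = h 1.
  apply: integer_valued_const; last by move=> t _; exists `[<Q (f t)>]%:Z.
  move=> t; apply/ct_epsP => e e0; have [d d0 Hd] := H _ (Uf t).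
  have [d' d'0 Hd'] := (iffLR (ct_epsP _ _) (cf t)) d d0.
  exists d' => // s ts; rewrite (hE t s) ?subrr ?normr0 //.
  by apply: Hd => //; exact: Hd'.
rewrite /h f0 f1 (asboolT Qx); case: (asboolP (Q y)) => // _ /eqP.
by rewrite oner_eq0.
Qed.

Lemma joined_open V (U : set V) x : open U -> open [set y | joined U x y].
Proof.
move=> /open_epsP oU; apply/open_epsP => y /= xy.
have [d d0 Hd] := oU y (joined_in xy).2; exists d => // z yz.
by apply: joined_trans xy _; apply: joined_ball Hd yz.
Qed.

(** The frontier of [U] lies in [X], so membership in [U] is locally constant off [X]. *)
Lemma joined_cross V (U X : set V) x y : open U ->
  (forall u, closure U u -> U u \/ X u) -> joined (~` X) x y -> U x -> U y.
Proof.
move=> oU H xy Ux; apply: (joined_ind _ xy) Ux => u Xu.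
have [Uu|nUu] := pselect (U u).
  have [d d0 Hd] := (iffLR (open_epsP U) oU) u Uu; exists d => // v _ uv.
  by split => // _; exact: Hd.
have : ~ closure U u by move/H => [].
move=> nc; have : exists2 d, 0 < d & forall y, `|u - y| < d -> ~ U y.
  apply: contrapT => nd; apply: nc => B /nbhs_ballP [d /= d0 dB].
  apply: contrapT => nB; apply: nd; exists d => // z uz Uz; apply: nB.
  by exists z; split => //; apply: dB; rewrite -ball_normE.
by move=> [d d0 Hd]; exists d => // v _ uv; split => [//|Uv]; case: (Hd v uv).
Qed.

End Joined.

(** * Components of the complement of a compact set *)

Section Eilenberg.
Context (R : realType).
Notation P := (R * R)%type.
Implicit Types (X : set P) (p q : P).

Lemma sup_ge_half (a : P) : sqn a = 1 -> 2^-1 <= `|a|.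
Proof.
move=> e; rewrite prod_normE le_max -[2^-1 <= _]negbK -[X in _ || X]negbK -negb_and -!ltNge.
apply/negP => /andP[h1 h2]; move: e; rewrite /sqn -real_normK ?num_real // -[a.2 ^+ 2]real_normK ?num_real //.
have := normr_ge0 a.1; have := normr_ge0 a.2.
by move: `|a.1| `|a.2| h1 h2 => u v *; nra.
Qed.

Lemma far_joined (N : R) (x y : P) : 0 <= N -> N < `|x| -> N < `|y| -> joined [set z | N < `|z|] x y.
Proof.
move=> N0 xN yN.
have x0 : x != 0 by rewrite -normr_gt0; exact: le_lt_trans N0 xN.
have y0 : y != 0 by rewrite -normr_gt0; exact: le_lt_trans N0 yN.
have [a [r r0 xE]] := sdir_cis_exists x0.
have [b [s s0 yE]] := sdir_cis_exists y0.
(* [M] is at least [r] and [s], so that both points move outwards to the circle of radius [M]; this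
   circle stays beyond [N], because unit vectors have sup norm at least [1/2]. *)
pose M := r + s + 2 * N + 1.
have out z c k : N < `|z : P| -> 0 < k -> k <= M -> z = k *: cis c -> joined [set z | N < `|z|] z (M *: cis c).
  move=> zN k0 kM zE; apply: joined_segment => t /andP[t0 t1] /=.
  have -> : z + t *: (M *: cis c - z) = (1 + t * (M / k - 1)) *: z.
    rewrite zE; have kn : k != 0 by rewrite gt_eqF.
    by apply: pair_eq; rewrite /= /GRing.scale /=; field.
  rewrite normrZ; apply: lt_le_trans zN _; rewrite ler_peMl //.
  have h : 0 <= t * (M / k - 1) by rewrite mulr_ge0 // subr_ge0 ler_pdivlMr // mul1r.
  by rewrite ger0_norm ?lerDl // addr_ge0.
have xM := out x a r xN r0 _ xE; have yM := out y b s yN s0 _ yE.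
apply: joined_trans (xM _) _; first by rewrite /M; lra.
apply: joined_trans (joined_sym (yM _)); last by rewrite /M; lra.
have := @joined_path _ _ [set z : P | N < `|z|] (fun t => M *: cis (a + t * (b - a))).
have -> : a + 0 * (b - a) = a by ring.
have -> : a + 1 * (b - a) = b by ring.
apply; first by cont.
move=> t _ /=; rewrite normrZ ger0_norm; last by rewrite /M; lra.
have := sup_ge_half (sqn_cis (a + t * (b - a))); set u := `|_| => h.
have : M * 2^-1 <= M * u by rewrite ler_wpM2l // /M; lra.
by apply: lt_le_trans; rewrite /M; lra.
Qed.

(* The quotient (z - p) / (z - q) has a continuous argument on X. *)
Definition rotlift X p q := exists2 th : P -> R, continuous th &
  forall z, X z -> sdir (z - p) (cmul (cis (th z)) (z - q)).

Lemma rotlift_refl X p : rotlift X p p.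
Proof.
exists (fun=> 0); first by cont.
by move=> z _; rewrite cis0 cmul1; exact: sdir_refl.
Qed.

Lemma rotlift_sym X p q : rotlift X p q -> rotlift X q p.
Proof.
move=> [th cth H]; exists (fun z => - th z); first by cont.
move=> z /H h; apply: sdir_sym.
apply: (sdir_trans (sdir_cmul (sdir_refl (cis (- th z))) h)).
by rewrite cmulA -cisD addNr cis0 cmul1; exact: sdir_refl.
Qed.

Lemma rotlift_trans q X p r : rotlift X p q -> rotlift X q r -> rotlift X p r.
Proof.
move=> [th cth H] [th' cth' H']; exists (fun z => th z + th' z); first by cont.
move=> z Xz; apply: sdir_trans (H z Xz) _.
by rewrite cisD -cmulA; apply: sdir_cmul; [exact: sdir_refl | exact: H'].
Qed.

(** If [q] is much closer to [p] than [X] is, then from any point of [X] the two are seen in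
    directions differing by less than a quarter turn, so the principal argument of the quotient is
    continuous there. *)
Lemma rotlift_near X p : closed X -> ~ X p ->
  exists2 d, 0 < d & forall q, `|p - q| < d -> rotlift X p q.
Proof.
move=> cX nXp.
have [d d0 Hd] : exists2 d, 0 < d & forall z, X z -> d <= `|z - p|.
  have /open_epsP/(_ p nXp) [d d0 Hd] : open (~` X) by exact: closed_openC.
  by exists d => // z Xz; rewrite leNgt; apply/negP => /=; rewrite distrC => /Hd.
exists (d / 4); first by rewrite divr_gt0.
move=> q pq; pose w (z : P) := cmul (z - p) (cconj (z - q)).
have cw : continuous w by rewrite /w /cmul /cconj /=; cont.
pose m := d ^+ 2 / 2.
have m0 : 0 < m by rewrite divr_gt0 // exprn_gt0.
have Hm z : X z -> m <= (w z).1.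
  move=> /Hd dz.
  have -> : (w z).1 = sqn (z - p) + (z - p).1 * (p - q).1 + (z - p).2 * (p - q).2.
    by rewrite /w /sqn /=; ring.
  have : `|(p - q).1| < d / 4 /\ `|(p - q).2| < d / 4.
    by move: pq; rewrite [`|p - q|]prod_normE gt_max => /andP[].
  move: dz; rewrite [`|z - p|]prod_normE le_max /sqn; move: (z - p) (p - q) => a b.
  rewrite /m -(real_normK (num_real a.1)) -(real_normK (num_real a.2)).
  have h1 : - (`|a.1| * `|b.1|) <= a.1 * b.1 by rewrite -normrM lerNl -normrN ler_norm.
  have h2 : - (`|a.2| * `|b.2|) <= a.2 * b.2 by rewrite -normrM lerNl -normrN ler_norm.
  have := normr_ge0 a.1; have := normr_ge0 a.2; have := normr_ge0 b.1; have := normr_ge0 b.2.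
  move: (a.1 * b.1) (a.2 * b.2) h1 h2; move: `|a.1| `|a.2| `|b.1| `|b.2| => x y u v s t h1 h2 v0 u0 y0 x0 /orP dxy [ud vd].
  have k1 : x * u <= x * (d / 4) by rewrite ler_wpM2l // ltW.
  have k2 : y * v <= y * (d / 4) by rewrite ler_wpM2l // ltW.
  have q1 := sqr_ge0 (x - d / 8); have q2 := sqr_ge0 (y - d / 8).
  have dd : 0 < d * d by rewrite mulr_gt0.
  case: dxy => h.
    have q3 : 0 <= (x - d) * (x + 3 * d / 4) by rewrite mulr_ge0 ?subr_ge0 //; lra.
    by rewrite !expr2 in q1 q2 *; lra.
  have q3 : 0 <= (y - d) * (y + 3 * d / 4) by rewrite mulr_ge0 ?subr_ge0 //; lra.
  by rewrite !expr2 in q1 q2 *; lra.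
exists (fun z => atan ((w z).2 / Num.max m (w z).1) / (2 * pi)).
  by cont; rewrite gt_eqF // lt_max m0.
move=> z Xz; have mw := Hm z Xz.
have w0 : 0 < (w z).1 by exact: lt_le_trans m0 mw.
rewrite (max_idPr mw) -/(ang (w z)).
apply: sdir_trans (sdir_cmul (angP w0) (sdir_refl (z - q))).
have q0 : z - q != 0.
  by apply: contraTneq w0 => e; rewrite /w e /cmul /= oppr0 !mulr0 subrr ltxx.
rewrite /w -cmulA [cmul (cconj _) _]cmulC cmul_conj cmulC.
exists (sqn (z - q))^-1; first by rewrite invr_gt0 sqn_gt0.
have s0 : sqn (z - q) != 0 by rewrite sqn_eq0.
by apply: pair_eq => /=; rewrite /GRing.scale /=; field.
Qed.

(** One half of Eilenberg's criterion: lifts exist for nearby points and can be composed along a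
    path. *)
Lemma joined_rotlift X p q : closed X -> joined (~` X) p q -> rotlift X p q.
Proof.
move=> cX pq; have [nXp nXq] := joined_in pq.
apply: (@joined_ind _ _ (~` X) [set r | rotlift X p r] p q) => //; last exact: rotlift_refl.
move=> u nXu; have [d d0 Hd] := rotlift_near cX nXu; exists d => // v _ uv /=.
have h := Hd v uv; split => k; first exact: rotlift_trans k h.
exact: rotlift_trans k (rotlift_sym h).
Qed.

Lemma ct_comp_at (T U U' : topologicalType) (f : T -> U) (h : U -> U') x :
  continuous_at x f -> continuous_at (f x) h -> continuous_at x (fun y => h (f y)).
Proof. by move=> cf ch; apply: continuous_comp. Qed.

(** Two maps with the same directions on [X] become equal there after normalization, and can then be
    glued along [X]. *)
Definition nz (a : P) : P := (Num.sqrt (sqn a))^-1 *: a.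

Lemma sqrt_sqn_gt0 (a : P) : a != 0 -> 0 < Num.sqrt (sqn a).
Proof. by rewrite sqrtr_gt0 sqn_gt0. Qed.

Lemma nz_sdir (a : P) : a != 0 -> sdir (nz a) a.
Proof. by move=> /sqrt_sqn_gt0 h; exists (Num.sqrt (sqn a))^-1; rewrite ?invr_gt0. Qed.

Lemma nz_neq0 (a : P) : a != 0 -> nz a != 0.
Proof.
by move=> a0; rewrite /nz scaler_eq0 negb_or a0 andbT invr_eq0 gt_eqF // sqrt_sqn_gt0.
Qed.

Lemma sdir_nz (a b : P) : b != 0 -> sdir a b -> nz a = nz b.
Proof.
move=> b0 [r r0 ->]; rewrite /nz sqnZ sqrtrM ?sqr_ge0 // sqrtr_sqr gtr0_norm //.
have h := sqrt_sqn_gt0 b0; rewrite scalerA invfM mulrAC mulVf ?mul1r // gt_eqF //.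
Qed.

Lemma nz_cont (a : P) : a != 0 -> continuous_at a nz.
Proof.
move=> a0; have h := sqrt_sqn_gt0 a0; rewrite /nz /sqn.
by apply: ctZ; [apply: ctV; [rewrite gt_eqF|cont] | exact: ct_id].
Qed.

(* Off the component of p use z - p, on it a map without zeros whose argument agrees with
   that of z - p on X: the result has no zeros but turns once around a large circle. *)
Lemma component_bounded_no_lift X p (h : P -> P) (th : P -> R) N : closed X -> ~ X p ->
  (forall z, joined (~` X) p z -> `|z| <= N) -> continuous h ->
  (forall z, X z \/ joined (~` X) p z -> h z != 0) -> continuous th ->
  (forall z, X z -> sdir (z - p) (cmul (cis (th z)) (h z))) -> False.
Proof.
move=> cX nXp bd ch h0 cth H.
pose U := [set z | joined (~` X) p z].
have oX : open (~` X) by exact: closed_openC.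
have oU : open U by exact: joined_open.
have Up : U p by exact: joined_refl.
pose f1 (z : P) := nz (cmul (cis (th z)) (h z)).
pose f2 (z : P) := nz (z - p).
have k0 z : X z \/ U z -> cmul (cis (th z)) (h z) != 0.
  by move=> /h0 z0; rewrite -sqn_gt0 sqn_cmul sqn_cis mul1r sqn_gt0.
have c1 z : X z \/ U z -> continuous_at z f1.
  move=> /k0 z0; apply: (@ct_comp_at _ _ _ (fun z => cmul (cis (th z)) (h z)) (@nz)).
    by rewrite /cmul; cont.
  exact: nz_cont.
have c2 z : ~ U z -> continuous_at z f2.
  move=> nUz; apply: (@ct_comp_at _ _ _ (fun z : P => z - p) (@nz)).
    by cont.
  by apply: nz_cont; rewrite subr_eq0; apply/eqP => e; apply: nUz; rewrite e.
have fX z : X z -> f1 z = f2 z.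
  move=> Xz; apply/esym; apply: sdir_nz; last exact: H.
  by apply: k0; left.
pose F z := if `[<U z>] then f1 z else f2 z.
have cF : continuous F.
  move=> z; have [Uz|nUz] := pselect (U z).
    have := c1 z (or_intror Uz) => /ct_epsP c1z; apply/ct_epsP => e e0.
    have [d d0 Hd] := c1z e e0.
    have [d' d'0 Hd'] := (iffLR (open_epsP U) oU) z Uz.
    exists (Num.min d d'); first by rewrite lt_min d0.
    move=> y; rewrite lt_min => /andP[zy /Hd' Uy]; rewrite /F !asboolT //; exact: Hd.
  have := c2 z nUz => /ct_epsP c2z; apply/ct_epsP => e e0; have [d d0 Hd] := c2z e e0.
  have [Xz|nXz] := pselect (X z).
    have := c1 z (or_introl Xz) => /ct_epsP c1z; have [d' d'0 Hd'] := c1z e e0.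
    exists (Num.min d d'); first by rewrite lt_min d0.
    move=> y; rewrite lt_min => /andP[zy zy']; rewrite /F (asboolF nUz).
    case: asboolP => Uy; last exact: Hd.
    by rewrite -fX //; exact: Hd'.
  have [d' d'0 Hd'] := (iffLR (open_epsP (~` X)) oX) z nXz.
  exists (Num.min d d'); first by rewrite lt_min d0.
  move=> y; rewrite lt_min => /andP[zy zy']; rewrite /F (asboolF nUz) asboolF; first exact: Hd.
  by move=> Uy; apply: nUz; apply: joined_trans Uy _; apply: joined_sym; exact: joined_ball Hd' zy'.
have F0 z : F z != 0.
  rewrite /F; case: asboolP => Uz; first by apply: nz_neq0; apply: k0; right.
  by apply: nz_neq0; rewrite subr_eq0; apply/eqP => e; apply: Uz; rewrite e.
have N0 : 0 <= N by apply: le_trans (bd p Up).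
(* The circle of radius [r] around [p] lies beyond [N], as unit vectors have sup norm at least
   [1/2]; on it [F] is the normalized [z - p]. *)
pose r := 2 * (N + `|p| + 1).
have r0 : 0 < r by rewrite mulr_gt0 // ltr_wpDl // addr_ge0.
pose c t := p + r *: cis t.
have cc : continuous c by rewrite /c; cont.
have cb t : `|c t| <= `|p| + r.
  rewrite (le_trans (ler_normD _ _)) // lerD2l normrZ gtr0_norm // ger_pMr //.
  by rewrite prod_normE ge_max !ler_norml cos_geN1 cos_le1 sin_geN1 sin_le1.
have cN t : N < `|c t|.
  have rE : r = 2 * (N + `|p| + 1) by [].
  have := sup_ge_half (sqn_cis t); have := ler_normB (c t) p.
  rewrite {2}/c addrC addKr normrZ (gtr0_norm r0) => h1 h2.
  have : r * 2^-1 <= r * `|cis t| by rewrite ler_wpM2l // ltW.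
  move: h1 rE; rewrite -/(c t).
  clearbody r; move: (r * `|cis t|) `|c t| `|p| => x y z *; lra.
have Fc t : F (c t) = nz (r *: cis t).
  rewrite /F asboolF; first by rewrite /f2 /c addrC addKr.
  by move/bd; rewrite leNgt cN.
have [thF cthF HF] := @lift_square R F (`|p| + r) (addr_ge0 (normr_ge0 _) (ltW r0)) cF (fun z _ => F0 z).
have c01 : c 0 = c 1 by rewrite /c cis0 cis1.
have : winds (fun t => F (c t)) 0.
  exists (fun t => thF (c t)); first by cont.
  by split; [move=> t _; exact: HF | rewrite c01 addr0].
have : winds (fun t => F (c t)) 1.
  apply: winds_sdir (winds_cis R 1) => t _; rewrite Fc mul1r.
  apply: sdir_trans (nz_sdir _) _; last by exists r.
  by rewrite scaler_eq0 negb_or gt_eqF // cis_neq0.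
by move=> w1 w0; have := winds_uniq w1 w0.
Qed.

Lemma compact_closedP (V : normedModType R) (X : set V) : compact X -> closed X.
Proof. by apply: compact_closed; exact: norm_hausdorff. Qed.

Lemma component_bounded X N p : 0 <= N -> (forall z, X z -> `|z| <= N) ->
  (exists2 z, joined (~` X) p z & N < `|z|) \/ (forall z, joined (~` X) p z -> `|z| <= N).
Proof.
move=> N0 XN; have [h|h] := pselect (exists2 z, joined (~` X) p z & N < `|z|); first by left.
by right=> z pz; rewrite leNgt; apply/negP => zN; apply: h; exists z.
Qed.

(** The other half of the criterion. If the component of [p] or of [q] is bounded,
    [component_bounded_no_lift] applies with the difference from the other point as [h]; if both are
    unbounded, they are joined far away from [X]. *)
Lemma rotlift_joined X p q : compact X -> ~ X p -> ~ X q -> rotlift X p q -> joined (~` X) p q.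
Proof.
move=> kX nXp nXq pq; have cX := compact_closedP kX.
have [N N0 XN] := compact_bounded_by kX.
apply: contrapT => npq.
have key p' q' : ~ X p' -> ~ X q' -> rotlift X p' q' -> ~ joined (~` X) p' q' ->
    ~ (forall z, joined (~` X) p' z -> `|z| <= N).
  move=> np' nq' [th cth H] npq' bd.
  apply: (@component_bounded_no_lift X p' (fun z : P => z - q') th N) => //; first by cont.
  by move=> z [] Hz; rewrite subr_eq0; apply/eqP => e; [apply: nq'|apply: npq']; rewrite -e.
have [|b] := component_bounded p (ltW N0) XN; last exact: (key p q).
have [|b] := component_bounded q (ltW N0) XN; last first.
  move=> _; apply: (key q p nXq nXp (rotlift_sym pq)) b.
  by move/joined_sym.
move=> [z qz zN] [y py yN]; apply: npq.
apply: joined_trans py (joined_trans _ (joined_sym qz)).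
apply: joined_sub (far_joined (ltW N0) yN zN).
by move=> w /= wN /XN; rewrite leNgt wN.
Qed.

(** Tietze's extension theorem, with the bound supplied by compactness. *)
Lemma compact_extend X (f : P -> R) : compact X -> {within X, continuous f} ->
  exists2 g : P -> R, continuous g & forall x, X x -> g x = f x.
Proof.
move=> kX cf; have cX := compact_closedP kX.
have [M M0 HM] := @compact_bounded_by R R _ (continuous_compact cf kX).
have [|g [gf cg _]] := @continuous_bounded_extension P R (@pseudometric_normal R P) X cX f M M0 cf.
  by move=> x Xx; apply: HM; exists x.
by exists g => // x Xx; rewrite gf // inE.
Qed.

Lemma glue_cont X1 X2 (f1 f2 : P -> R) : compact X1 -> compact X2 ->
  continuous f1 -> continuous f2 -> (forall x, X1 x -> X2 x -> f1 x = f2 x) ->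
  exists g : P -> R, [/\ continuous g, forall x, X1 x -> g x = f1 x & forall x, X2 x -> g x = f2 x].
Proof.
move=> k1 k2 c1 c2 e; pose f x := if `[<X1 x>] then f1 x else f2 x.
have fX1 x : X1 x -> f x = f1 x by move=> Xx; rewrite /f asboolT.
have fX2 x : X2 x -> f x = f2 x by move=> Xx; rewrite /f; case: asboolP => // X1x; exact: e.
have [|g cg Hg] := @compact_extend (X1 `|` X2) f (compactU k1 k2).
  apply: withinU_continuous; [exact: compact_closedP | exact: compact_closedP | |].
    apply: (@subspace_eq_continuous _ X1 _ f1 f) => [x|]; first by rewrite inE => /fX1->.
    exact: continuous_subspaceT.
  apply: (@subspace_eq_continuous _ X2 _ f2 f) => [x|]; first by rewrite inE => /fX2->.
  exact: continuous_subspaceT.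
exists g; split => // x Xx; first by rewrite Hg; [exact: fX1 | left].
by rewrite Hg; [exact: fX2 | right].
Qed.

(* Arguments on X1 and X2 differ by an integer on the connected intersection. *)
Lemma janiszewski X1 X2 p q : compact X1 -> compact X2 -> ~ X2 q ->
  (forall x y, (X1 `&` X2) x -> (X1 `&` X2) y -> joined (X1 `&` X2) x y) ->
  rotlift X1 p q -> rotlift X2 p q -> rotlift (X1 `|` X2) p q.
Proof.
move=> k1 k2 nq J [th1 c1 H1] [th2 c2 H2].
have [n Hn] : exists n : int, forall x, X1 x -> X2 x -> th1 x = th2 x + n%:~R.
  have [[x0 [X1x0 X2x0]]|h] := pselect (exists x0, (X1 `&` X2) x0); last first.
    by exists 0 => x X1x X2x; case: h; exists x.
  have Z x : X1 x -> X2 x -> exists n : int, th1 x = th2 x + n%:~R.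
    move=> /H1 h1 X2x; have h2 := H2 x X2x; apply: sdir_cis.
    apply: (@sdir_cancel _ (x - q)).
      by rewrite subr_eq0; apply/eqP => e; apply: nq; rewrite -e.
    by rewrite ![cmul (x - q) _]cmulC; exact: sdir_trans (sdir_sym h1) h2.
  have [n en] := Z x0 X1x0 X2x0; exists n => x X1x X2x.
  have [f [cf Uf f0 f1]] := J x0 x (conj X1x0 X2x0) (conj X1x X2x).
  have : th1 (f 0) - th2 (f 0) = th1 (f 1) - th2 (f 1).
    apply: (@integer_valued_const R (fun t => th1 (f t) - th2 (f t))); first by cont.
    by move=> t _; have [a b] := Uf t; have [k ->] := Z _ a b; exists k; ring.
  by rewrite f0 f1 en => e; rewrite -[th1 x](subrK (th2 x)) -e; ring.
have [|g [cg g1 g2]] := @glue_cont X1 X2 th1 (fun z => th2 z + n%:~R) k1 k2 c1 _ Hn; first by cont.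
exists g => // z [X1z|X2z]; first by rewrite g1 //; exact: H1.
by rewrite g2 // cisDz; exact: H2.
Qed.

End Eilenberg.

(** * Arcs *)

Section Arcs.
Context (R : realType).
Implicit Types (V W : normedModType R).
Notation I := (unit_interval R).

(** A continuous map on a compact set is a quotient map onto its image. This provides continuous
    inverses of injective parametrizations, and maps on a circle from periodic ones. *)
Lemma compact_factor V W W' (K : set V) (f : V -> W) (h : V -> W') : compact K ->
  continuous f -> continuous h ->
  (forall s t, K s -> K t -> f s = f t -> h s = h t) ->
  exists2 g : W -> W', {within f @` K, continuous g} & forall t, K t -> g (f t) = h t.
Proof.
move=> kK cf ch e.
have [g Hg] : exists g : W -> W', forall t, K t -> g (f t) = h t.
  have H y : exists z : W', forall t, K t -> f t = y -> h t = z.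
    have [[t [Kt ft]]|n] := pselect (exists t, K t /\ f t = y).
      by exists (h t) => s Ks fs; apply: e => //; rewrite fs.
    by exists 0 => t Kt ft; case: n; exists t.
  by have [g Hg] := choice H; exists g => t Kt; rewrite -(Hg (f t) t).
exists g => //; apply/subspace_continuousP => x [s Ks <-].
rewrite /from_subspace; apply/cvgrPdist_lt => eps eps0; rewrite Hg //.
have [d d0 Hd] : exists2 d, 0 < d & forall t, K t -> `|f s - f t| < d -> `|h s - h t| < eps.
  apply: (@compact_unif R V K (fun d t => `|f s - f t| < d -> `|h s - h t| < eps)) => //.
    by move=> d d' t dd' H h'; apply: H; exact: lt_le_trans dd'.
  move=> t Kt; have [fts|fts] := eqVneq (f s) (f t).
    have [d d0 Hd] := (iffLR (ct_epsP _ _) (ch t)) eps eps0; exists d => // y ty Ky _.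
    by rewrite (e s t) //; exact: Hd.
  have p0 : 0 < `|f s - f t| / 2 by rewrite divr_gt0 // normr_gt0 subr_eq0.
  have [d d0 Hd] := (iffLR (ct_epsP _ _) (cf t)) _ p0.
  exists (Num.min d (`|f s - f t| / 2)); first by rewrite lt_min d0.
  move=> y; rewrite lt_min => /andP[ty _] Ky; rewrite lt_min => /andP[_ sy].
  have : `|f s - f t| < `|f s - f t|; last by rewrite ltxx.
  have -> : f s - f t = (f s - f y) - (f t - f y) by rewrite opprB addrA subrK.
  rewrite (le_lt_trans (ler_normB _ _)) // [ltRHS](_ : _ = `|f s - f t| / 2 + `|f s - f t| / 2); last first.
    by rewrite -splitr; congr `|_|; rewrite opprB addrA subrK.
  by rewrite ltrD // Hd.
apply/nbhs_ballP; exists d => //= y; rewrite -ball_normE /= => sy [t Kt ft].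
by rewrite -ft Hg //; apply: Hd => //; rewrite ft.
Qed.

Definition arc V (A : set V) p q := exists f : R -> V,
  [/\ continuous f, forall s t, I s -> I t -> f s = f t -> s = t,
      A = f @` I & f 0 = p /\ f 1 = q].

Lemma IE (t : R) : I t = (0 <= t <= 1) :> Prop.
Proof. by rewrite /unit_interval /= in_itv. Qed.
Lemma I0 : I 0. Proof. by rewrite IE itv0. Qed.
Lemma I1 : I 1. Proof. by rewrite IE itv1. Qed.
Lemma I_compact : compact I. Proof. exact: segment_compact. Qed.

Lemma arc_sym V (A : set V) p q : arc A p q -> arc A q p.
Proof.
move=> [f [cf fi fA [f0 f1]]]; exists (fun t => f (1 - t)); split.
- by cont.
- move=> s t; rewrite !IE => s01 t01 e.
  have K : I (1 - s) -> I (1 - t) -> 1 - s = 1 - t by move=> *; exact: fi.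
  have : 1 - s = 1 - t by apply: K; rewrite IE; xlra.
  by move/addrI/oppr_inj.
- have K t : I t -> I (1 - t) by rewrite !IE => h; xlra.
  rewrite fA; apply/seteqP; split => x [t It <-]; exists (1 - t); try exact: K.
    by congr f; ring.
  by [].
by rewrite subr0 subrr.
Qed.

Lemma arc_compact V (A : set V) p q : arc A p q -> compact A.
Proof.
move=> [f [cf _ -> _]]; apply: continuous_compact; last exact: segment_compact.
exact: continuous_subspaceT.
Qed.

Lemma arc_l V (A : set V) p q : arc A p q -> A p.
Proof. by move=> [f [_ _ -> [<- _]]]; exists 0 => //; exact: I0. Qed.

Lemma arc_r V (A : set V) p q : arc A p q -> A q.
Proof. by move=> [f [_ _ -> [_ <-]]]; exists 1 => //; exact: I1. Qed.

Lemma arc_neq V (A : set V) p q : arc A p q -> p <> q.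
Proof.
move=> [f [_ fi _ [<- <-]]] /(fi _ _ I0 I1) /eqP.
by rewrite eq_sym oner_eq0.
Qed.

Lemma arc_joined V (A : set V) p q x y : arc A p q -> A x -> A y -> joined A x y.
Proof.
move=> [f [cf _ fA _]]; rewrite fA => -[s Is <-] [t It <-].
have H a b : I a -> I b -> a <= b -> joined (f @` I) (f a) (f b).
  rewrite !IE => /andP[a0 _] /andP[_ b1] ab; apply: joined_subpath => // u /andP[au ub].
  by exists u => //; rewrite IE (le_trans a0 au) (le_trans ub b1).
have [st|/ltW ts] := leP s t; first exact: H.
by apply: joined_sym; exact: H.
Qed.

Lemma arc_param V (f : R -> V) a b : a < b -> continuous f ->
  (forall s t, a <= s <= b -> a <= t <= b -> f s = f t -> s = t) ->
  arc (f @` `[a, b]) (f a) (f b).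
Proof.
move=> ab cf fi; have ba : 0 < b - a by rewrite subr_gt0.
have bn : b - a != 0 by rewrite gt_eqF.
have B t : I t -> a <= a + t * (b - a) <= b.
  rewrite IE => /andP[t0 t1]; rewrite lerDl mulr_ge0 ?(ltW ba) //=.
  by rewrite -lerBrDl ger_pMl.
exists (fun t => f (a + t * (b - a))); split.
- by cont.
- by move=> s t Is It /(fi _ _ (B s Is) (B t It)) /addrI /(mulIf bn).
- apply/seteqP; split => x [t It <-].
    move: It; rewrite /= in_itv /= => /andP[h1 h2]; exists ((t - a) / (b - a)).
      by rewrite IE divr_ge0 ?subr_ge0 ?(ltW ab) //= ler_pdivrMr // mul1r lerD2r.
    by rewrite divfK // addrC subrK.
  by exists (a + t * (b - a)) => //=; rewrite in_itv /=; exact: B.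
by rewrite mul0r addr0 mul1r [a + _]addrC subrK.
Qed.

Lemma arc_split V (A : set V) p q r : arc A p q -> A r -> r <> p -> r <> q ->
  exists A1 A2, [/\ arc A1 p r, arc A2 r q, A = A1 `|` A2 & A1 `&` A2 `<=` [set r]].
Proof.
move=> [f [cf fi fA [f0 f1]]] + rp rq; rewrite {1}fA => -[t It ftr].
have t0 : 0 < t.
  rewrite lt_neqAle; move: (It); rewrite IE => /andP[-> _]; rewrite andbT.
  by apply/eqP => e; apply: rp; rewrite -ftr -e.
have t1 : t < 1.
  rewrite lt_neqAle; move: (It); rewrite IE => /andP[_ ->]; rewrite andbT.
  by apply/eqP => e; apply: rq; rewrite -ftr e.
have fi' s u : 0 <= s <= 1 -> 0 <= u <= 1 -> f s = f u -> s = u.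
  by move=> h1 h2; apply: fi; rewrite IE.
exists (f @` `[0, t]), (f @` `[t, 1]); split.
- rewrite -f0 -ftr; apply: arc_param => // s u h1 h2; apply: fi'; xlra.
- rewrite -f1 -ftr; apply: arc_param => // s u h1 h2; apply: fi'; xlra.
- rewrite fA; apply/seteqP; split => x.
    move=> [s]; rewrite IE => s01 <-; have [st|ts] := leP s t; [left|right]; exists s => //=; rewrite in_itv /=; xlra.
  by move=> [] [s]; rewrite /= in_itv /= => h <-; exists s => //; rewrite IE; xlra.
move=> x [[s] /=]; rewrite in_itv /= => h1 <- [u] /=; rewrite in_itv /= => h2 e.
have : s = t by have := fi' u s _ _ e => /(_ _ _) K; have := K _ _; xlra.
by move->.
Qed.

(** Concatenation at the common point [r], written as a sum so that continuity is immediate. *)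
Definition catp V (f g : R -> V) r (t : R) := f (Num.min (2 * t) 1) + g (Num.max (2 * t - 1) 0) - r.

Lemma catp_cont V (f g : R -> V) r : continuous f -> continuous g -> continuous (catp f g r).
Proof. by move=> cf cg; rewrite /catp; cont. Qed.

Lemma catp_l V (f g : R -> V) r t : g 0 = r -> t <= 2^-1 -> catp f g r t = f (2 * t).
Proof.
move=> g0 t2; rewrite /catp; have -> : Num.min (2 * t) 1 = 2 * t by apply/min_idPl; xlra.
have -> : Num.max (2 * t - 1) 0 = 0 by apply/max_idPr; xlra.
by rewrite g0 addrK.
Qed.

Lemma catp_r V (f g : R -> V) r t : f 1 = r -> 2^-1 <= t -> catp f g r t = g (2 * t - 1).
Proof.
move=> f1 t2; rewrite /catp; have -> : Num.min (2 * t) 1 = 1 by apply/min_idPr; xlra.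
have -> : Num.max (2 * t - 1) 0 = 2 * t - 1 by apply/max_idPl; xlra.
by rewrite f1 addrAC subrr add0r.
Qed.

Lemma catp_image V (f g : R -> V) r : f 1 = r -> g 0 = r ->
  catp f g r @` I = f @` I `|` g @` I.
Proof.
move=> f1 g0; apply/seteqP; split => x.
  move=> [t]; rewrite IE => t01 <-; have [h|h] := leP t 2^-1.
    by left; exists (2 * t); rewrite ?IE ?catp_l //; xlra.
  by right; exists (2 * t - 1); rewrite ?IE ?catp_r ?(ltW h) //; xlra.
move=> [] [t]; rewrite IE => t01 <-.
  exists (t / 2); first by rewrite IE; xlra.
  by rewrite catp_l //; [congr f; field | xlra].
exists ((t + 1) / 2); first by rewrite IE; xlra.
by rewrite catp_r //; [congr g; field | xlra].
Qed.

Lemma catp_ends V (f g : R -> V) r : f 1 = r -> g 0 = r ->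
  catp f g r 0 = f 0 /\ catp f g r 1 = g 1.
Proof.
have h0 : (0 : R) <= 2^-1 by xlra.
have h1 : (2^-1 : R) <= 1 by xlra.
move=> f1 g0; rewrite catp_l // catp_r //.
by split; [congr f; ring | congr g; ring].
Qed.

Lemma arc_cat V (A1 A2 : set V) p q r : arc A1 p r -> arc A2 r q ->
  A1 `&` A2 `<=` [set r] -> arc (A1 `|` A2) p q.
Proof.
move=> [f [cf fi fA [f0 f1]]] [g [cg gi gA [g0 g1]]] D.
have [e0 e1] := catp_ends f1 g0.
exists (catp f g r); split.
- exact: catp_cont.
- have X s t : s <= 2^-1 -> 2^-1 <= t -> I s -> I t -> catp f g r s = catp f g r t -> s = t.
    move=> s2 t2; rewrite !IE => s01 t01; rewrite catp_l ?catp_r // => e.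
    have Is : I (2 * s) by rewrite IE; xlra.
    have It : I (2 * t - 1) by rewrite IE; xlra.
    have fr : f (2 * s) = r.
      by apply: D; split; [rewrite fA; exists (2 * s) | rewrite e gA; exists (2 * t - 1)].
    have : 2 * s = 1 by apply: fi => //; [exact: I1 | rewrite fr f1].
    have : 2 * t - 1 = 0 by apply: gi => //; [exact: I0 | rewrite -e fr g0].
    by xlra.
  move=> s t Is It; have [s2|s2] := leP s 2^-1; have [t2|t2] := leP t 2^-1.
  - rewrite !catp_l // => /fi H.
    have : 2 * s = 2 * t by apply: H; move: Is It; rewrite !IE => ? ?; xlra.
    by move=> e; xlra.
  - exact: X (ltW t2) Is It.
  - by move=> e; apply/esym; apply: X (ltW s2) It Is _.
  - rewrite !catp_r ?ltW // => /gi H.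
    have : 2 * s - 1 = 2 * t - 1 by apply: H; move: Is It; rewrite !IE => ? ?; xlra.
    by move=> e; xlra.
- by rewrite catp_image // fA gA.
by rewrite e0 e1.
Qed.

Lemma arc_trim V (A : set V) p q d : arc A p q -> 0 < d ->
  exists A' p', [/\ arc A' p' q, A' `<=` A, ~ A' p & forall x, A x -> A' x \/ `|p - x| < d].
Proof.
move=> [f [cf fi fA [f0 f1]]] d0.
have [e e0 He] := (iffLR (ct_epsP _ _) (cf 0)) d d0.
pose t := Num.min (e / 2) 2^-1.
have t0 : 0 < t by rewrite lt_min divr_gt0 // invr_gt0 ltr0n.
have t1 : t < 1 by rewrite gt_min; apply/orP; right; xlra.
have te : t < e by rewrite gt_min; apply/orP; left; xlra.
clearbody t.
exists (f @` `[t, 1]), (f t); split.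
- rewrite -f1; apply: arc_param => // s u s01 u01 e'; apply: fi => //; rewrite IE; xlra.
- by rewrite fA => x [s]; rewrite /= in_itv /= => s01 <-; exists s => //; rewrite IE; xlra.
- move=> [s]; rewrite /= in_itv /= => s01; rewrite -f0 => e'.
  have : s = 0 by apply: fi => //; [rewrite IE; xlra | exact: I0].
  by xlra.
move=> x; rewrite fA => -[s]; rewrite IE => s01 <-; have [ts|st] := leP t s.
  by left; exists s => //=; rewrite in_itv /=; xlra.
right; rewrite -f0; apply: He; rewrite sub0r normrN ger0_norm; xlra.
Qed.

Definition jarcs V (J A B : set V) p q :=
  [/\ arc A p q, arc B p q, A `&` B `<=` [set p; q] & J = A `|` B].

Lemma jarcs_swap V (J A B : set V) p q : jarcs J A B p q -> jarcs J B A p q.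
Proof. by move=> [a b ab ->]; split => //; [rewrite setIC|rewrite setUC]. Qed.

Lemma jarcs_sym V (J A B : set V) p q : jarcs J A B p q -> jarcs J A B q p.
Proof.
move=> [a b ab ->]; split => //; [exact: arc_sym|exact: arc_sym|].
by rewrite [[set q; p]]setUC.
Qed.

(** The arc containing [r] is cut there and its second part is appended to the other arc. Moving
    both ends in turn splits the curve at any two of its points. *)
Lemma jarcs_move V (J A B : set V) p q r : jarcs J A B p q -> J r -> r <> p ->
  exists A' B', jarcs J A' B' p r.
Proof.
have K (A0 B0 : set V) : jarcs J A0 B0 p q -> A0 r -> r <> p -> exists A' B', jarcs J A' B' p r.
  move=> [a b ab ->] Ar rp; have [rq|/eqP rq] := eqVneq r q.
    by exists A0, B0; split => //; rewrite rq.
  have [A1 [A2 [a1 a2 AE A12]]] := arc_split a Ar rp rq.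
  exists A1, (B0 `|` A2); split => //.
  - apply: arc_cat b (arc_sym a2) _ => x [Bx A2x].
    have [xp|//] : [set p; q] x by apply: ab; split => //; rewrite AE; right.
    have : [set r] p by apply: A12; split; [exact: arc_l a1 | rewrite -xp].
    by move=> /= e; case: rp.
  - move=> x [A1x [Bx|A2x]]; last by right; apply: A12.
    have [->|xq] : [set p; q] x by apply: ab; split => //; rewrite AE; left.
      by left.
    have : [set r] q by apply: A12; split; [rewrite -xq | exact: arc_r a2].
    by move=> /= e; case: rq.
  by rewrite AE; apply/seteqP; split => x /=; tauto.
move=> j; have [_ _ _ JE] := j; rewrite JE => -[Ar|Br] rp; rewrite -JE; first exact: K j Ar rp.
exact: K (jarcs_swap j) Br rp.
Qed.

(** In this form a curve is cut at two points without reference to a parametrization. The ambient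
    space is arbitrary, because graphs of homeomorphisms between plane curves, as subsets of
    [P * P], are also treated as Jordan curves. *)
Definition jordan V (J : set V) := exists A B p q, jarcs J A B p q.

Lemma jordan_split V (J : set V) p q : jordan J -> J p -> J q -> p <> q ->
  exists A B, jarcs J A B p q.
Proof.
move=> [A [B [a [b j]]]] Jp Jq pq.
have [pa|/eqP pa] := eqVneq p a.
  by move: j; rewrite -pa => j; apply: jarcs_move j Jq _ => e; apply: pq.
have [A' [B' /jarcs_sym j']] := jarcs_move j Jp pa.
by apply: jarcs_move j' Jq _ => e; apply: pq.
Qed.

Lemma jordan_compact V (J : set V) : jordan J -> compact J.
Proof. by move=> [A [B [a [b [cA cB _ ->]]]]]; apply: compactU; [exact: arc_compact cA | exact: arc_compact cB]. Qed.

(** The argument is lifted along the parameter interval, carried over to the arc by injectivity, and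
    extended to the plane. *)
Lemma arc_rotlift (A : set (R * R)) a b p q : arc A a b -> ~ A p -> ~ A q -> rotlift A p q.
Proof.
move=> [f [cf fi fA _]] nAp nAq.
have fp r : ~ A r -> forall t, 0 <= t <= 1 -> f t - r != 0.
  by move=> nAr t t01; rewrite subr_eq0; apply/eqP => e; apply: nAr; rewrite -e fA; exists t; rewrite ?IE.
pose w (t : R) := cmul (f t - p) (cconj (f t - q)).
have cw : continuous w by rewrite /w /cmul /cconj; cont.
have [|th cth Hth] := lift_path cw.
  move=> t t01; rewrite -sqn_gt0 sqn_cmul mulr_gt0 // sqn_gt0; first exact: fp.
  have := fp q nAq t t01; apply: contraNN => /eqP [/eqP e1 /eqP e2].
  by apply/eqP; apply: pair_eq; apply/eqP; rewrite // -oppr_eq0.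
have [|g cg Hg] := @compact_factor R _ R I f th I_compact cf cth.
  by move=> s t Is It /(fi _ _ Is It) ->.
have [||h ch Hh] := @compact_extend R A g.
- by rewrite fA; apply: continuous_compact I_compact; exact: continuous_subspaceT.
- by rewrite fA.
exists h => // z; rewrite fA => -[t It <-]; rewrite Hh; last by rewrite fA; exists t.
rewrite Hg // ; move: It; rewrite IE => t01.
apply: sdir_trans (sdir_cmul (Hth t t01) (sdir_refl (f t - q))).
rewrite /w -cmulA [cmul (cconj _) _]cmulC cmul_conj cmulC.
have q0 := fp q nAq t t01; have s0 : sqn (f t - q) != 0 by rewrite sqn_eq0.
exists (sqn (f t - q))^-1; first by rewrite invr_gt0 sqn_gt0.
by apply: pair_eq => /=; rewrite /GRing.scale /=; field.
Qed.

Lemma arc_not_separating (A : set (R * R)) a b p q : arc A a b -> ~ A p -> ~ A q -> joined (~` A) p q.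
Proof.
move=> aA nAp nAq; apply: rotlift_joined => //; first exact: arc_compact aA.
exact: arc_rotlift aA nAp nAq.
Qed.

End Arcs.

(** * The Jordan curve theorem *)

Section SlitArguments.
Context (R : realType).
Notation P := (R * R)%type.
Implicit Types (v w : P).

(* The argument in (-1/2, 1/2) turns off the closed negative half-line, as twice that
   of the square root. *)
Definition slit w : R := 2 * ang (w.1 + Num.sqrt (sqn w), w.2).

Lemma slit_pos w : 0 < w.1 \/ w.2 != 0 -> 0 < w.1 + Num.sqrt (sqn w).
Proof.
move=> h; have s0 := sqrtr_ge0 (sqn w).
case: h => h; first by rewrite ltr_wpDr.
have : `|w.1| < Num.sqrt (sqn w).
  by rewrite -sqrtr_sqr ltr_sqrt /sqn ?ltrDl ?exprn_even_gt0 // ltr_wpDl ?sqr_ge0 // exprn_even_gt0.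
by have := ler_norm (- w.1); rewrite normrN; move: `|w.1| => n; xlra.
Qed.

Lemma slitP w : 0 < w.1 \/ w.2 != 0 -> sdir w (cis (slit w)).
Proof.
move=> /slit_pos h; rewrite /slit; set z := (_, _).
have z1 : 0 < z.1 by [].
have := sdir_cmul (angP z1) (angP z1); rewrite -cisD (_ : ang z + ang z = 2 * ang z) => [k|]; last by ring.
apply: sdir_trans k.
exists (2 * z.1)^-1; first by rewrite invr_gt0 mulr_gt0.
have zn : z.1 != 0 by rewrite gt_eqF.
have e : Num.sqrt (sqn w) ^+ 2 = w.1 ^+ 2 + w.2 ^+ 2 by rewrite sqr_sqrtr // sqn_ge0.
have e1 : z.1 * z.1 - z.2 * z.2 = 2 * z.1 * w.1.
  rewrite /z /=; set s := Num.sqrt _ in e *.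
  transitivity (w.1 ^+ 2 + 2 * w.1 * s + s ^+ 2 - w.2 * w.2); first by ring.
  by rewrite e; ring.
rewrite /z /= in e1 zn; apply: pair_eq; rewrite /cmul /= /GRing.scale /=.
  by rewrite e1; field.
by field.
Qed.

Lemma slit_cont w : 0 < w.1 \/ w.2 != 0 -> continuous_at w slit.
Proof.
move=> /slit_pos h; rewrite /slit /ang /sqn; cont => //.
by rewrite gt_eqF.
Qed.

Lemma ang_bounds (b : P) : - 4^-1 < ang b < 4^-1.
Proof.
have p0 : 0 < 2 * pi :> R by rewrite mulr_gt0 // pi_gt0.
rewrite /ang ltr_pdivlMr // ltr_pdivrMr //.
have := atan_gtNpi2 (b.2 / b.1); have := atan_ltpi2 (b.2 / b.1).
by move: (atan _) => a; xlra.
Qed.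

Lemma ang_gt0 (b : P) : 0 < b.1 -> 0 < b.2 -> 0 < ang b.
Proof.
move=> b1 b2; have p0 : 0 < 2 * pi :> R by rewrite mulr_gt0 // pi_gt0.
rewrite /ang divr_gt0 // -[X in X < _](@atan0 R) lt_atan ?divr_gt0 //.
Qed.

Lemma ang_lt0 (b : P) : 0 < b.1 -> b.2 < 0 -> ang b < 0.
Proof.
move=> b1 b2; have := @ang_gt0 (b.1, - b.2) b1; rewrite /= oppr_gt0 => /(_ b2).
by rewrite /ang /= mulNr atanN mulNr oppr_gt0.
Qed.

Lemma slit_up w : 0 < w.2 -> 0 < slit w < 2^-1.
Proof.
move=> h; have p : 0 < w.1 + Num.sqrt (sqn w) by apply: slit_pos; right; rewrite gt_eqF.
have := @ang_gt0 (w.1 + Num.sqrt (sqn w), w.2) p h; have := ang_bounds (w.1 + Num.sqrt (sqn w), w.2).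
by rewrite /slit; move: (ang _) => a; xlra.
Qed.

Lemma slit_down w : w.2 < 0 -> - 2^-1 < slit w < 0.
Proof.
move=> h; have p : 0 < w.1 + Num.sqrt (sqn w) by apply: slit_pos; right; rewrite lt_eqF.
have := @ang_lt0 (w.1 + Num.sqrt (sqn w), w.2) p h; have := ang_bounds (w.1 + Num.sqrt (sqn w), w.2).
by rewrite /slit; move: (ang _) => a; xlra.
Qed.

(** Branches of the argument, [argup] cut along the downward and [argdn] along the upward vertical
    half-line. They agree on the right and differ by a full turn on the left; a crossing of the
    vertical line above or below a point is detected by comparing them. *)
Definition argup v := slit (v.2, - v.1) + 4^-1.
Definition argdn v := slit (- v.2, v.1) - 4^-1.

Lemma cis_quarter : cis (4^-1 : R) = (0, 1).
Proof.
have e : 2 * pi * 4^-1 = pi / 2 :> R by field.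
by rewrite /cis e cos_pihalf sin_pihalf.
Qed.

Lemma argupP v : v.1 != 0 \/ 0 < v.2 -> sdir v (cis (argup v)).
Proof.
move=> h; rewrite /argup cisD cis_quarter.
have e : v = cmul (v.2, - v.1) (0, 1) by apply: pair_eq; rewrite /=; ring.
rewrite [X in sdir X _]e; apply: sdir_cmul (sdir_refl _); apply: slitP => /=.
by case: h => h; [right; rewrite oppr_eq0|left].
Qed.

Lemma argdnP v : v.1 != 0 \/ v.2 < 0 -> sdir v (cis (argdn v)).
Proof.
move=> h; rewrite /argdn cisD cisN cis_quarter /cconj /=.
have e : v = cmul (- v.2, v.1) (0, -1) by apply: pair_eq; rewrite /=; ring.
rewrite [X in sdir X _]e; apply: sdir_cmul (sdir_refl _); apply: slitP => /=.
by case: h => h; [right|left; rewrite oppr_gt0].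
Qed.

Lemma argup_cont v : v.1 != 0 \/ 0 < v.2 -> continuous_at v argup.
Proof.
move=> h; apply: ctD; last by cont.
apply: (@ct_comp_at _ _ _ (fun v : P => (v.2, - v.1)) slit); first by cont.
by apply: slit_cont; case: h => h; [right; rewrite oppr_eq0|left].
Qed.

Lemma argdn_cont v : v.1 != 0 \/ v.2 < 0 -> continuous_at v argdn.
Proof.
move=> h; apply: (@ctD _ _ _ (fun v : P => slit (- v.2, v.1)) (fun=> - 4^-1)); last by cont.
apply: (@ct_comp_at _ _ _ (fun v : P => (- v.2, v.1)) slit); first by cont.
by apply: slit_cont; case: h => h; [right|left; rewrite oppr_gt0].
Qed.

Lemma arg_right v : 0 < v.1 -> argup v = argdn v.
Proof.
move=> h; have hn : v.1 != 0 by rewrite gt_eqF.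
have [n e] := sdir_cis (sdir_trans (sdir_sym (argupP (or_introl hn))) (argdnP (or_introl hn))).
have := @slit_down (v.2, - v.1); rewrite /= oppr_lt0 => /(_ h).
have := @slit_up (- v.2, v.1) h; move: e; rewrite /argup /argdn; move: (slit _) (slit _) => a b e ha hb.
have : (-1 < n)%R by rewrite -(ltr_int R); xlra.
have : (n < 1)%R by rewrite -(ltr_int R); xlra.
move=> n1 n2; have n0 : n = 0 by clear -n1 n2; lia.
by rewrite e n0 mulr0z addr0.
Qed.

Lemma arg_left v : v.1 < 0 -> argup v = argdn v + 1.
Proof.
move=> h; have hn : v.1 != 0 by rewrite lt_eqF.
have [n e] := sdir_cis (sdir_trans (sdir_sym (argupP (or_introl hn))) (argdnP (or_introl hn))).
have := @slit_up (v.2, - v.1); rewrite /= oppr_gt0 => /(_ h).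
have := @slit_down (- v.2, v.1) h; move: e; rewrite /argup /argdn; move: (slit _) (slit _) => a b e ha hb.
have : (0 < n)%R by rewrite -(ltr_int R); xlra.
have : (n < 2)%R by rewrite -(ltr_int R); xlra.
move=> n1 n2; have n0 : n = 1 by clear -n1 n2; lia.
by rewrite e n0.
Qed.

End SlitArguments.

Section Jordan.
Context (R : realType).
Notation P := (R * R)%type.
Notation I := (unit_interval R).
Implicit Types (X J A B : set P) (f g u : R -> P).

(** The angle, in full turns, that the path sweeps as seen from [z]. *)
Definition turning g (z : P) (a : R) := exists2 th : R -> R, continuous th &
  (forall t, I t -> sdir (g t - z) (cis (th t))) /\ a = th 1 - th 0.

Lemma turning_fun (g : R -> P) z (arg : P -> R) : continuous g ->
  (forall t, I t -> continuous_at (g t - z) arg) ->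
  (forall t, I t -> sdir (g t - z) (cis (arg (g t - z)))) ->
  turning g z (arg (g 1 - z) - arg (g 0 - z)).
Proof.
move=> cg ca H; exists (fun t => arg (g (clamp 0 1 t) - z)); last first.
  split; first by move=> t It; rewrite clamp_id; [exact: H | move: It; rewrite IE].
  by rewrite !clamp_id ?itv0 ?itv1.
move=> t; apply: (@ct_comp_at _ _ _ (fun t => g (clamp 0 1 t) - z) arg); first by cont.
by apply: ca; rewrite IE; exact: clamp_itv.
Qed.

Definition loop f g : R -> P := catp f (fun t => g (1 - t)) (f 1).

Lemma loop_cont f g : continuous f -> continuous g -> continuous (loop f g).
Proof. by move=> cf cg; apply: catp_cont => //; cont. Qed.

Lemma loop_image f g : f 1 = g 1 -> loop f g @` I = f @` I `|` g @` I.
Proof.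
move=> e; rewrite /loop catp_image ?subr0 //; congr (_ `|` _).
have K t : I t -> I (1 - t) by rewrite !IE => h; xlra.
apply/seteqP; split => x [t It <-]; exists (1 - t) => //; try exact: K.
by congr g; ring.
Qed.

Lemma loop_closed f g : f 0 = g 0 -> f 1 = g 1 -> loop f g 0 = loop f g 1.
Proof.
rewrite /loop => e0 e1; have [|-> ->] := @catp_ends R _ f (fun t => g (1 - t)) (f 1) erefl.
  by rewrite subr0.
by rewrite subrr.
Qed.

Lemma winds_loop f g z a b (n : int) : f 1 = g 1 -> turning f z a -> turning g z b ->
  a - b = n%:~R -> winds (fun t => loop f g t - z) n.
Proof.
move=> e1 [th cth [h1 ->]] [th' cth' [h1' ->]] e.
have [k ek] : exists k : int, th 1 = th' 1 + k%:~R.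
  have H1 := h1 1 (I1 R); have H1' := h1' 1 (I1 R); rewrite e1 in H1.
  exact: sdir_cis (sdir_trans (sdir_sym H1) H1').
pose th2 (t : R) : R := catp (th : R -> R^o) (fun t => th' (1 - t) + k%:~R) (th 1) t.
have g1 : (fun t => g (1 - t)) 0 = f 1 by rewrite /= subr0 e1.
have g1' : (fun t => th' (1 - t) + k%:~R) 0 = th 1 by rewrite /= subr0 ek.
exists th2; first by apply: catp_cont => //; cont.
split.
  move=> t t01; have [t2|t2] := leP t 2^-1.
    rewrite /loop /th2 !catp_l //; apply: h1; rewrite IE; xlra.
  rewrite /loop /th2 !catp_r ?(ltW t2) // cisDz; apply: h1'; rewrite IE; xlra.
have [h0 h1e] := @catp_ends R R^o th (fun t => th' (1 - t) + k%:~R) (th 1) erefl g1'.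
by rewrite /th2 h0 h1e subrr; move: e; rewrite ek => e; xlra.
Qed.

Lemma turning_diff f g z a b : f 0 = g 0 -> f 1 = g 1 -> turning f z a -> turning g z b ->
  exists n : int, a - b = n%:~R.
Proof.
move=> e0 e1 [th _ [h1 ->]] [th' _ [h1' ->]].
have K t : I t -> f t = g t -> exists n : int, th t = th' t + n%:~R.
  move=> It e; have H1 := h1 t It; rewrite e in H1.
  exact: sdir_cis (sdir_trans (sdir_sym H1) (h1' t It)).
have [n ->] := K 1 (I1 R) e1; have [k ->] := K 0 (I0 R) e0.
by exists (n - k); rewrite intrB; ring.
Qed.

Lemma turning_exists f z : continuous f -> (forall t, I t -> f t <> z) -> exists a, turning f z a.
Proof.
move=> cf fz; have [|t t01|th cth H] := @lift_path R (fun t => f t - z); first by cont.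
  by rewrite subr_eq0; apply/eqP; apply: fz; rewrite IE.
by exists (th 1 - th 0), th => //; split => // t; rewrite IE; exact: H.
Qed.

Lemma turning_eq f z a b : turning f z a -> turning f z b -> a = b.
Proof.
move=> h1 h2; case: h1 => th1 c1 [k1 ->]; case: h2 => th2 c2 [k2 ->].
have : th1 0 - th2 0 = th1 1 - th2 1.
  apply: (@integer_valued_const R (fun t => th1 t - th2 t)); first by cont.
  move=> t t01; have It : I t by rewrite IE.
  have [k ->] := sdir_cis (sdir_trans (sdir_sym (k1 t It)) (k2 t It)).
  by exists k; ring.
by move=> e; xlra.
Qed.

Lemma winds_moving_center g p q n : continuous g -> g 0 = g 1 -> joined (~` (g @` I)) p q ->
  winds (fun t => g t - p) n -> winds (fun t => g t - q) n.
Proof.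
move=> cg g01 [f [cf Uf <- <-]] W.
apply: (@winds_homotopy R (fun z : P => g z.1 - f z.2)) => //; first by cont.
  move=> t s t01 s01 /=; rewrite subr_eq0; apply/eqP => e.
  by apply: (Uf s); exists t; rewrite ?IE.
by move=> s _ /=; rewrite g01.
Qed.

Lemma winds_far g N z : continuous g -> g 0 = g 1 -> (forall t, I t -> `|g t| <= N) ->
  4 * N < `|z| -> winds (fun t => g t - z) 0.
Proof.
move=> cg g01 gN zN.
have N0 : 0 <= N by apply: le_trans (gN 0 (I0 R)).
have z0 : - z != 0 by rewrite oppr_eq0 -normr_gt0; apply: le_lt_trans zN; rewrite mulr_ge0.
apply: (@winds_segment R (fun=> - z)); [by cont | by cont | by [] | by rewrite g01 | | exact: winds_cst].
move=> t s t01 s01; apply/eqP => e.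
have : s *: g t = z.
  have -> : s *: g t = (1 - s) *: - z + s *: (g t - z) + z.
    by apply: pair_eq; rewrite /= /GRing.scale /=; ring.
  by rewrite e add0r.
move=> e'; move: zN; rewrite -e' normrZ => h.
have It : I t by rewrite IE.
have := gN t It; case/andP: s01 => s0 s1; rewrite ger0_norm // in h.
have := normr_ge0 (g t); move: `|g t| h => x h x0 xN.
have : s * x <= x by rewrite ler_piMl.
by xlra.
Qed.


Lemma path_bounded f : continuous f -> exists2 N, 0 < N & forall t, I t -> `|f t| <= N.
Proof.
move=> cf; have kf : compact (f @` I).
  by apply: continuous_compact (@I_compact R); exact: continuous_subspaceT.
have [N N0 H] := compact_bounded_by kf.
by exists N => // t It; apply: H; exists t.
Qed.

Lemma compact_fiber (f : R -> P) (m c : R) : continuous f ->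
  compact [set t | [/\ I t, (f t).1 = m & (f t).2 <= c]].
Proof.
move=> cf; apply: (@subclosed_compact _ _ I) => [||t []//]; last exact: I_compact.
apply/(@closed_epsP R R) => t H; split.
- have cI : closed I by apply: (@compact_closedP R R); exact: I_compact.
  by apply/(iffLR (@closed_epsP R R I) cI) => d d0; have [y [Iy _ _] ty] := H d d0; exists y.
- apply/eqP; rewrite -subr_eq0 -normr_le0 leNgt; apply/negP => p.
  have c1 : continuous (fun t => (f t).1 - m) by cont.
  have [d d0 Hd] := (iffLR (@ct_epsP R R R _ _) (c1 t)) _ p; have [y [_ e _] ty] := H d d0.
  by have := Hd y ty; rewrite e subrr subr0 ltxx.
rewrite leNgt; apply/negP => p; rewrite -subr_gt0 in p.
have c1 : continuous (fun t => (f t).2) by cont.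
have [d d0 Hd] := (iffLR (@ct_epsP R R R _ _) (c1 t)) _ p; have [y [_ _ e] ty] := H d d0.
have := Hd y ty; rewrite ltr_norml => /andP[_ h]; move: e h.
by move: ((f t).2) ((f y).2) => u v *; xlra.
Qed.

(* Maehara's argument: the lowest point of f on the vertical line below the top point lies
   outside the loop formed by g and a detour u below everything. *)
Lemma maehara_core f g a b tl : continuous f -> continuous g ->
  f 0 = a -> g 0 = a -> f 1 = b -> g 1 = b ->
  (forall s t, I s -> I t -> f s = f t -> s = t) ->
  (forall s t, I s -> I t -> f s = g t -> f s = a \/ f s = b) ->
  (forall t, I t -> a.1 <= (f t).1 <= b.1) -> (forall t, I t -> a.1 <= (g t).1 <= b.1) ->
  a.1 < b.1 -> I tl -> (f tl).1 = (a.1 + b.1) / 2 ->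
  (forall t, I t -> (g t).1 = (a.1 + b.1) / 2 -> (g t).2 <= (f tl).2) ->
  exists z al be, [/\ forall t, I t -> f t <> z /\ g t <> z, turning f z al, turning g z be &
    al = be - 1].
Proof.
move=> cf cg f0 g0 f1 g1 fi fg fx gx ab Itl; set m := (a.1 + b.1) / 2 => ftl gtl.
have am : a.1 < m by rewrite /m; xlra.
have mb : m < b.1 by rewrite /m; xlra.
clearbody m.
have [tm [Itm ftm _] Hm] : exists2 tm, [/\ I tm, (f tm).1 = m & (f tm).2 <= (f tl).2] &
    forall t, I t -> (f t).1 = m -> (f tm).2 <= (f t).2.
  have [||t] := @compact_EVT_min _ R (fun t => (f t).2) _ _ (@compact_fiber f m (f tl).2 cf).
  - by exists tl.
  - by apply: continuous_subspaceT; cont.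
  rewrite inE => -[It e h] Ht; exists t => // s Is fs.
  have [h'|h'] := leP (f s).2 (f tl).2; first by apply: Ht; rewrite inE.
  exact: le_trans h (ltW h').
have [N Nf] : exists N, forall t, I t -> `|f t| <= N /\ `|g t| <= N.
  have [N1 _ H1] := path_bounded cf; have [N2 _ H2] := path_bounded cg.
  by exists (Num.max N1 N2) => t It; rewrite !le_max H1 // H2 // orbT.
have N0 : 0 <= N by apply: le_trans (Nf 0 (I0 R)).1.
pose H := N + 1.
have low (h : R -> P) t : `|h t| <= N -> - H < (h t).2.
  by rewrite prod_normE ge_max !ler_norml /H => /andP[_ /andP[h1 _]]; xlra.
have lowf t (It : I t) : - H < (f t).2 := low f t (Nf t It).1.
have lowg t (It : I t) : - H < (g t).2 := low g t (Nf t It).2.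
(* The region of the detour: within the strip between [a] and [b] it contains only these two points
   and what lies below all of [f] and [g]. *)
pose W := [set w : P | [\/ w = a \/ w = b, w.1 < a.1, b.1 < w.1 | w.2 < - H]].
have [u [cu Wu u0 u1]] : joined W a b.
  apply: (@joined_trans _ _ _ (a.1 - 1, a.2)).
    apply: joined_segment => t /andP[t0 t1].
    have [->|tn] := eqVneq t 0; first by rewrite scale0r addr0; constructor 1; left.
    have tp : 0 < t by rewrite lt_neqAle eq_sym tn.
    by constructor 2; rewrite /= /GRing.scale /=; xlra.
  apply: (@joined_trans _ _ _ (a.1 - 1, - H - 1)).
    by apply: joined_segment => t _; constructor 2; rewrite /= /GRing.scale /=; xlra.
  apply: (@joined_trans _ _ _ (b.1 + 1, - H - 1)).
    by apply: joined_segment => t _; constructor 4; rewrite /= /GRing.scale /=; xlra.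
  apply: (@joined_trans _ _ _ (b.1 + 1, b.2)).
    by apply: joined_segment => t _; constructor 3; rewrite /= /GRing.scale /=; xlra.
  apply: joined_sym; apply: joined_segment => t /andP[t0 t1].
  have [->|tn] := eqVneq t 0; first by rewrite scale0r addr0; constructor 1; right.
  have tp : 0 < t by rewrite lt_neqAle eq_sym tn.
  by constructor 3; rewrite /= /GRing.scale /=; xlra.
have fab t : I t -> (f t).1 = m -> f t <> a /\ f t <> b.
  by move=> _ e; split => e'; move: am mb; rewrite -e e' ltxx.
have linew (w : P) : w.1 = m -> - H <= w.2 -> ~ W w.
  move=> e h [[e'|e']|h'|h'|h'].
  - by move: am; rewrite -e e' ltxx.
  - by move: mb; rewrite -e e' ltxx.
  - by move: am; rewrite -e => k; have := lt_trans k h'; rewrite ltxx.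
  - by move: mb; rewrite -e => k; have := lt_trans k h'; rewrite ltxx.
  - by have := le_lt_trans h h'; rewrite ltxx.
pose X := g @` I `|` u @` I.
have nX (w : P) : (forall t, I t -> g t <> w) -> ~ W w -> ~ X w.
  by move=> h1 h2 [[t It e]|[t It e]]; [exact: h1 t It e | apply: h2; rewrite -e].
have XE : loop g u @` I = X by rewrite loop_image // g1 u1.
have closed_loop : loop g u 0 = loop g u 1 by apply: loop_closed; rewrite ?g0 ?g1.
have cl : continuous (loop g u) by exact: loop_cont.
have [M M0 HM] := path_bounded cl.
(* The lowest point of [f] is outside of the loop: follow [f] to its point [f tl], above which the
   line meets neither [g] nor the detour, and go up. *)
have [y far yM] : exists2 y, joined (~` X) (f tm) y & 4 * M < `|y|.
  have strip t : I t -> (f t).1 = m -> 0 < t < 1.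
    rewrite IE => /andP[t0 t1] e; rewrite !lt_neqAle t0 t1 !andbT; apply/andP; split; apply/eqP => e'.
      by move: e; rewrite -e' f0 => e; move: am; rewrite e ltxx.
    by move: e; rewrite e' f1 => e; move: mb; rewrite e ltxx.
  have open01 r : 0 < r < 1 -> (~` X) (f r).
    move=> r01; have Ir : I r by rewrite IE; xlra.
    have fr : f r <> a /\ f r <> b.
      split=> e; have : r = 0 \/ r = 1; try by case=> h; move: r01; rewrite h ltxx ?andbF.
        by left; apply: fi => //; [exact: I0 | rewrite e f0].
      by right; apply: fi => //; [exact: I1 | rewrite e f1].
    apply: nX.
      by move=> t It e; case: fr => h1 h2; case: (fg r t Ir It (esym e)).
    have := fx r Ir; have := lowf r Ir; move=> l1 /andP[l2 l3] [[h|h]|h|h|h]; try by case: fr.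
    - by have := lt_le_trans h l2; rewrite ltxx.
    - by have := lt_le_trans h l3; rewrite ltxx.
    - by have := lt_trans h l1; rewrite ltxx.
  exists (m, Num.max (f tl).2 (4 * M + 1)); last first.
    apply: (@lt_le_trans _ _ (4 * M + 1)); first by rewrite ltrDl.
    rewrite prod_normE le_max /=; apply/orP; right.
    by apply: (le_trans _ (ler_norm _)); rewrite le_max lexx orbT.
  apply: (@joined_trans _ _ _ (f tl)).
    have Pm := strip tm Itm ftm; have Pl := strip tl Itl ftl.
    have [h|/ltW h] := leP tm tl.
      by apply: joined_subpath => // r rr; apply: open01; xlra.
    by apply: joined_sym; apply: joined_subpath => // r rr; apply: open01; xlra.
  apply: joined_segment => t /andP[t0 t1]; set Y := Num.max _ _.
  have YM : (f tl).2 <= Y by rewrite le_max lexx.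
  have e1 : (f tl + t *: ((m, Y) - f tl)).1 = m by rewrite /= /GRing.scale /= ftl subrr mulr0 addr0.
  have e2 : (f tl).2 <= (f tl + t *: ((m, Y) - f tl)).2.
    by rewrite /= /GRing.scale /= lerDl mulr_ge0 // subr_ge0.
  move: (f tl + _) e1 e2 => w w1 w2; apply: nX; last first.
    by apply: linew => //; apply: le_trans w2; apply: ltW; exact: lowf.
  move=> s Is e; have e1 : (g s).1 = m by rewrite e.
  have gs := gtl s Is e1.
  have fgs : f tl = g s.
    apply: pair_eq; first by rewrite ftl e1.
    by apply/eqP; rewrite eq_le gs andbT e.
  have [h1 h2] := fab tl Itl ftl.
  by case: (fg tl s Itl Is fgs).
(* Seen from a point outside of the loop, [g] turns as much as the detour. The detour crosses the
   line only below [z], so the branch cut upwards gives its turning. *)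
have key z : z.1 = m -> - H <= z.2 -> (forall t, I t -> g t <> z) -> joined (~` X) z (f tm) ->
    turning g z (argdn (b - z) - argdn (a - z)).
  move=> z1 z2 gz zj.
  have W0 : winds (fun t => loop g u t - z) 0.
    apply: (@winds_moving_center _ y) => //.
      by rewrite XE; apply: joined_sym; exact: joined_trans zj far.
    by apply: (@winds_far _ M).
  have uz t : (u t - z).1 != 0 \/ (u t - z).2 < 0.
    have [e|n] := eqVneq (u t - z).1 0; last by left.
    right; move/eqP: e; rewrite subr_eq0 => /eqP e /=.
    case: (Wu t) => [[h|h]|h|h|h].
    - by move: am; rewrite -h e z1 ltxx.
    - by move: mb; rewrite -h e z1 ltxx.
    - by move: (lt_trans h am); rewrite e z1 ltxx.
    - by move: (lt_trans mb h); rewrite e z1 ltxx.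
    - by rewrite subr_lt0; exact: lt_le_trans h z2.
  have Tu : turning u z (argdn (b - z) - argdn (a - z)).
    rewrite -u0 -u1; apply: turning_fun => // t It; [exact: argdn_cont | exact: argdnP].
  have [c Tg] := turning_exists cg gz.
  have [n en] := turning_diff (etrans g0 (esym u0)) (etrans g1 (esym u1)) Tg Tu.
  have := winds_loop (etrans g1 (esym u1)) Tg Tu en => /winds_uniq /(_ W0) n0.
  by move/eqP: en; rewrite n0 mulr0z subr_eq0 => /eqP <-.
have bz (z : P) : z.1 = m -> 0 < (b - z).1 by move=> e; rewrite /= e subr_gt0.
have az (z : P) : z.1 = m -> (a - z).1 < 0 by move=> e; rewrite /= e subr_lt0.
(* For a path crossing the line only above [z], the branch cut downwards gives the turning. *)
have up (h : R -> P) z : continuous h -> h 0 = a -> h 1 = b -> z.1 = m ->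
    (forall t, I t -> (h t).1 = m -> z.2 < (h t).2) ->
    turning h z (argup (b - z) - argup (a - z)).
  move=> ch h0 h1 z1 hz; rewrite -h0 -h1.
  have hz' t : I t -> (h t - z).1 != 0 \/ 0 < (h t - z).2.
    move=> It; have [e|n] := eqVneq (h t - z).1 0; last by left.
    right; move/eqP: e; rewrite subr_eq0 => /eqP e /=; rewrite subr_gt0; apply: hz => //.
    by rewrite e z1.
  by apply: turning_fun => // t It; [apply: argup_cont; exact: hz' | apply: argupP; exact: hz'].
have gfm t : I t -> g t <> f tm.
  move=> It e; have [h1 h2] := fab tm Itm ftm.
  by case: (fg tm t Itm It (esym e)).
(* If [g] did not cross the line at or below the lowest point of [f], both branches would compute
   its turning around this point, with results differing by one. *)
have [[t0 [It0 gt0 h0]]|no] := pselect (exists t, [/\ I t, (g t).1 = m & (g t).2 <= (f tm).2]); last first.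
  have T1 := key (f tm) ftm (ltW (lowf tm Itm)) gfm (joined_refl (joined_in far).1).
  have T2 : turning g (f tm) (argup (b - f tm) - argup (a - f tm)).
    apply: up => // t It e; rewrite ltNge; apply/negP => h; apply: no; exists t; split => //.
  have := turning_eq T1 T2; rewrite arg_right ?bz // (@arg_left _ (a - f tm)) ?az //.
  by move: (argdn _) (argdn _) => x x' e; exfalso; xlra.
have [tp [Itp gtp gp] Hp] : exists2 tp, [/\ I tp, (g tp).1 = m & (g tp).2 <= (f tm).2] &
    forall t, I t -> (g t).1 = m -> (g t).2 <= (f tm).2 -> (g t).2 <= (g tp).2.
  have [||t] := @compact_EVT_max _ R (fun t => (g t).2) _ _ (@compact_fiber g m (f tm).2 cg).
  - by exists t0.
  - by apply: continuous_subspaceT; cont.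
  by rewrite inE => -[It e h] Ht; exists t => // s Is e1 e2; apply: Ht; rewrite inE.
have gp' : (g tp).2 < (f tm).2.
  rewrite lt_neqAle gp andbT; apply/eqP => e; apply: (gfm tp Itp).
  by apply: pair_eq => //; rewrite gtp ftm.
(* Midway between the lowest point of [f] on the line and the highest point of [g] below it: [f]
   crosses above [z], while [z] is still joined to the outside of the loop. *)
pose z : P := (m, ((g tp).2 + (f tm).2) / 2).
have z1 : z.1 = m by [].
have zp : (g tp).2 < z.2 by rewrite /z /=; xlra.
have zm : z.2 < (f tm).2 by rewrite /z /=; xlra.
clearbody z.
have gw (w : P) t : I t -> w.1 = m -> z.2 <= w.2 -> w.2 <= (f tm).2 -> g t <> w.
  move=> It e h1 h2 e'; have e1 : (g t).1 = m by rewrite e'.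
  have e2 : (g t).2 <= (f tm).2 by rewrite e'.
  have := Hp t It e1 e2; rewrite e' => /le_lt_trans /(_ zp) /lt_le_trans /(_ h1).
  by rewrite ltxx.
exists z, (argup (b - z) - argup (a - z)), (argdn (b - z) - argdn (a - z)); split.
- move=> t It; split; last by apply: gw => //; exact: ltW.
  move=> e; have e1 : (f t).1 = m by rewrite e.
  by have := Hm t It e1; rewrite e leNgt zm.
- apply: up => // t It e; exact: lt_le_trans zm (Hm t It e).
- apply: key => //.
  + by apply: ltW; apply: lt_trans zp; exact: lowg.
  + by move=> t It; apply: gw => //; exact: ltW.
  apply: joined_segment => t /andP[s0 s1].
  have e1 : (z + t *: (f tm - z)).1 = m by rewrite /= /GRing.scale /= ftm z1 subrr mulr0 addr0.
  have fz : 0 <= (f tm).2 - z.2 by rewrite subr_ge0 ltW.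
  have e2 : z.2 <= (z + t *: (f tm - z)).2 by rewrite /= /GRing.scale /= lerDl mulr_ge0.
  have e3 : (z + t *: (f tm - z)).2 <= (f tm).2.
    by rewrite /= /GRing.scale /= -lerBrDl ler_piMl.
  move: (z + _) e1 e2 e3 => w w1 w2 w3; apply: nX; first by move=> s Is; exact: gw.
  by apply: linew => //; apply: le_trans w2; apply: ltW; apply: lt_trans zp; exact: lowg.
by rewrite arg_right ?bz // (@arg_left _ (a - z)) ?az //; ring.
Qed.

(** Whichever path has the higher top point on the middle line plays the role of [f] in
    [maehara_core]; hence the undetermined sign. *)
Lemma maehara f g a b : continuous f -> continuous g ->
  f 0 = a -> g 0 = a -> f 1 = b -> g 1 = b ->
  (forall s t, I s -> I t -> f s = f t -> s = t) ->
  (forall s t, I s -> I t -> g s = g t -> s = t) ->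
  (forall s t, I s -> I t -> f s = g t -> f s = a \/ f s = b) ->
  (forall t, I t -> a.1 <= (f t).1 <= b.1) -> (forall t, I t -> a.1 <= (g t).1 <= b.1) ->
  a.1 < b.1 ->
  exists z al be, [/\ forall t, I t -> f t <> z /\ g t <> z, turning f z al, turning g z be &
    al - be = 1 \/ al - be = -1].
Proof.
move=> cf cg f0 g0 f1 g1 fi gi fg fx gx ab.
pose m := (a.1 + b.1) / 2.
have top (h : R -> P) : continuous h -> h 0 = a -> h 1 = b ->
    exists2 t, I t /\ (h t).1 = m & forall s, I s -> (h s).1 = m -> (h s).2 <= (h t).2.
  move=> ch h0 h1; have [N N0 HN] := path_bounded ch.
  have hN s : I s -> (h s).2 <= N.
    by move=> /HN; rewrite prod_normE ge_max => /andP[_]; apply: le_trans; exact: ler_norm.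
  have ch1 : continuous (fun t => (h t).1) by cont.
  have [|c cI hc] := @IVT R (fun t => (h t).1) 0 1 m ler01 (continuous_subspaceT ch1).
    by rewrite h0 h1 min_l ?max_r ?ltW // /m; xlra.
  have Ic : I c by rewrite IE; move: cI; rewrite in_itv.
  have [||t] := @compact_EVT_max _ R (fun t => (h t).2) _ _ (@compact_fiber h m N ch).
  - by exists c; split => //; exact: hN.
  - by apply: continuous_subspaceT; cont.
  rewrite inE => -[It e _] Ht; exists t => // s Is hs; apply: Ht; rewrite inE; split => //.
  exact: hN.
have [tf [Itf ftf] Hf] := top f cf f0 f1; have [tg [Itg gtg] Hg] := top g cg g0 g1.
have [h|/ltW h] := leP (g tg).2 (f tf).2.
  have [|z [al [be [av Tf Tg e]]]] := maehara_core cf cg f0 g0 f1 g1 fi fg fx gx ab Itf ftf.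
    by move=> t It e; apply: le_trans h; exact: Hg.
  by exists z, al, be; split => //; right; rewrite e; ring.
have gf s t : I s -> I t -> g s = f t -> g s = a \/ g s = b.
  by move=> Is It e; rewrite e; apply: (fg t s).
have [|z [al [be [av Tg Tf e]]]] := maehara_core cg cf g0 f0 g1 f1 gi gf gx fx ab Itg gtg.
  by move=> t It e; apply: le_trans h; exact: Hf.
exists z, be, al; split => //; last by left; rewrite e; ring.
by move=> t It; have [] := av t It.
Qed.

(** The complex power up to a positive factor: for negative exponents the inverse is replaced by the
    conjugate. *)
Definition zpow (a : P) (k : int) : P :=
  match k with Posz m => iter m (cmul a) (1, 0) | Negz m => iter m.+1 (cmul (cconj a)) (1, 0) end.

Lemma zpow_neq0 a k : a != 0 -> zpow a k != 0.
Proof.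
have e1 : ((1, 0) : P) != 0 by apply/eqP => /(congr1 fst) /= /eqP; rewrite oner_eq0.
have H (b : P) m : b != 0 -> iter m (cmul b) (1, 0) != 0.
  move=> b0; elim: m => // m IH /=.
  by rewrite -sqn_gt0 sqn_cmul mulr_gt0 // sqn_gt0.
move=> a0; case: k => m; first exact: H.
apply: H; apply: contraNN a0 => /eqP [/eqP h1 /eqP h2].
by apply/eqP; apply: pair_eq; apply/eqP => //; rewrite -oppr_eq0.
Qed.

Lemma zpow_cont (T : topologicalType) (f : T -> P) k x : continuous_at x f ->
  continuous_at x (fun y => zpow (f y) k).
Proof.
have H (g : T -> P) m : continuous_at x g -> continuous_at x (fun y => iter m (cmul (g y)) (1, 0)).
  move=> cg; elim: m => [|m IH] /=; first by cont.
  by rewrite /cmul; apply: ct_pair; [apply: ctD; [|apply: ctN]|apply: ctD]; apply: ctM;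
    (apply: ct_fst || apply: ct_snd); rewrite -/(cmul _ _); (exact: IH || exact: cg).
move=> cf; case: k => m; first exact: H.
by apply: H; rewrite /cconj; cont.
Qed.

Lemma winds_zpow g n k : winds g n -> winds (fun t => zpow (g t) k) (n * k).
Proof.
have H (h : R -> P) m n' : winds h n' -> winds (fun t => iter m (cmul (h t)) (1, 0)) (n' * m%:Z).
  move=> W; elim: m => [|m IH] /=.
    rewrite mulr0; apply: winds_cst; apply/eqP => /(congr1 fst) /= /eqP.
    by rewrite oner_eq0.
  by rewrite -add1n PoszD mulrDr mulr1; exact: winds_mul.
move=> W; case: k => m; first exact: H.
have -> : n * Negz m = - n * m.+1%:Z by rewrite NegzE mulrN mulNr.
exact: (H (fun t => cconj (g t)) m.+1 (- n) (winds_conj W)).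
Qed.

Definition outside X := [set z | ~ X z /\ forall N, exists2 y, joined (~` X) z y & N < `|y|].
Definition inside X := [set z | ~ X z /\ ~ outside X z].

Lemma ext_far X N z : 0 <= N -> (forall x, X x -> `|x| <= N) -> N < `|z| -> outside X z.
Proof.
move=> N0 XN zN; split; first by move/XN; rewrite leNgt zN.
move=> M; pose y : P := (Num.max N M + 1, 0).
have yE : `|y| = Num.max N M + 1.
  rewrite prod_normE /= normr0 max_l; last by rewrite normr_ge0.
  by rewrite ger0_norm // addr_ge0 // le_max N0.
have yN : N < `|y| by rewrite yE ltr_pwDr // le_max lexx.
exists y; last by rewrite yE ltr_pwDr // le_max lexx orbT.
apply: joined_sub (far_joined N0 zN yN).
by move=> w /= wN /XN; rewrite leNgt wN.
Qed.

Lemma ext_joined X x y : compact X -> outside X x -> outside X y -> joined (~` X) x y.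
Proof.
move=> kX [_ hx] [_ hy]; have [N N0 HN] := compact_bounded_by kX.
have [x' xx' x'N] := hx N; have [y' yy' y'N] := hy N.
apply: joined_trans xx' (joined_trans _ (joined_sym yy')).
apply: joined_sub (far_joined (ltW N0) x'N y'N).
by move=> w /= wN /HN; rewrite leNgt wN.
Qed.

Lemma joined_ext X x y : joined (~` X) x y -> outside X x -> outside X y.
Proof.
move=> xy [_ hx]; split; first exact: (joined_in xy).2.
by move=> N; have [z xz zN] := hx N; exists z => //; exact: joined_trans (joined_sym xy) xz.
Qed.

Lemma joined_int X x y : joined (~` X) x y -> inside X x -> inside X y.
Proof.
move=> xy [_ hx]; split; first exact: (joined_in xy).2.
by move=> ey; apply: hx; apply: joined_ext ey; exact: joined_sym.
Qed.

Lemma int_bounded X N z : 0 <= N -> (forall x, X x -> `|x| <= N) -> inside X z -> `|z| <= N.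
Proof.
move=> N0 XN [_ h]; rewrite leNgt; apply/negP => zN; apply: h.
exact: ext_far zN.
Qed.

Lemma ext_open X : closed X -> open (outside X).
Proof.
move=> cX; apply/open_epsP => x ex.
have /open_epsP/(_ x ex.1) [d d0 Hd] : open (~` X) by exact: closed_openC.
by exists d => // y xy; apply: joined_ext ex; exact: joined_ball Hd xy.
Qed.

Lemma int_open X : closed X -> open (inside X).
Proof.
move=> cX; apply/open_epsP => x ex.
have /open_epsP/(_ x ex.1) [d d0 Hd] : open (~` X) by exact: closed_openC.
by exists d => // y xy; apply: joined_int ex; exact: joined_ball Hd xy.
Qed.

Lemma closure_disjoint (U W : set P) x : open W -> (forall z, U z -> W z -> False) ->
  closure U x -> ~ W x.
Proof.
move=> oW D cU Wx; have [z [Uz Wz]] := cU W (open_nbhs_nbhs (conj oW Wx)).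
exact: D Uz Wz.
Qed.

Lemma closure_int X x : closed X -> closure (inside X) x -> inside X x \/ X x.
Proof.
move=> cX cx; have [Xx|nXx] := pselect (X x); first by right.
left; split => //; apply: closure_disjoint cx; first exact: ext_open.
by move=> z [].
Qed.

Lemma closure_ext X x : closed X -> closure (outside X) x -> outside X x \/ X x.
Proof.
move=> cX cx; have [Xx|nXx] := pselect (X x); first by right.
left; apply: contrapT => nx; have : inside X x by split.
by apply: closure_disjoint cx; [exact: int_open | move=> z ez []].
Qed.

End Jordan.

Section JordanTheorem.
Context (R : realType).
Notation P := (R * R)%type.
Notation I := (unit_interval R).
Implicit Types (X J A B : set P) (f g u L : R -> P).

Definition jloop J L := [/\ continuous L, L 0 = L 1, L @` I = J &
  forall s t, I s -> I t -> s < t -> L s = L t -> s = 0 /\ t = 1].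

Lemma loop_jloop f g a b : continuous f -> continuous g ->
  f 0 = a -> g 0 = a -> f 1 = b -> g 1 = b ->
  (forall s t, I s -> I t -> f s = f t -> s = t) ->
  (forall s t, I s -> I t -> g s = g t -> s = t) ->
  (forall s t, I s -> I t -> f s = g t -> f s = a \/ f s = b) ->
  jloop (f @` I `|` g @` I) (loop f g).
Proof.
move=> cf cg f0 g0 f1 g1 fi gi fg; split.
- exact: loop_cont.
- by apply: loop_closed; rewrite ?f0 ?f1.
- by apply: loop_image; rewrite f1.
have gg : (fun t => g (1 - t)) 0 = f 1 by rewrite /= subr0 f1.
move=> s t; rewrite !IE => s01 t01 st; rewrite /loop.
have [t2|t2] := leP t 2^-1.
  rewrite !catp_l //; last by xlra.
  by move=> /fi H; have : 2 * s = 2 * t by [apply: H; rewrite IE; xlra]; move=> e; exfalso; xlra.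
have [s2|s2] := leP s 2^-1; last first.
  rewrite !catp_r ?ltW // => /gi H.
  by have : 1 - (2 * s - 1) = 1 - (2 * t - 1) by [apply: H; rewrite IE; xlra]; move=> e; exfalso; xlra.
rewrite catp_l // catp_r ?(ltW t2) // => e.
have Is : I (2 * s) by rewrite IE; xlra.
have It : I (1 - (2 * t - 1)) by rewrite IE; xlra.
have [h|h] := fg _ _ Is It e.
  have k1 : 2 * s = 0 by apply: fi => //; [exact: I0 | rewrite h f0].
  have k2 : 1 - (2 * t - 1) = 0 by apply: gi => //; [exact: I0 | rewrite -e h g0].
  by split; xlra.
have k1 : 2 * s = 1 by apply: fi => //; [exact: I1 | rewrite h f1].
have k2 : 1 - (2 * t - 1) = 1 by apply: gi => //; [exact: I1 | rewrite -e h g1].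
by exfalso; xlra.
Qed.

Lemma jarcs_params J A B p q : jarcs J A B p q -> exists f g,
  [/\ continuous f, continuous g, f 0 = p /\ f 1 = q, g 0 = p /\ g 1 = q &
  [/\ forall s t, I s -> I t -> f s = f t -> s = t,
      forall s t, I s -> I t -> g s = g t -> s = t,
      forall s t, I s -> I t -> f s = g t -> f s = p \/ f s = q &
      A = f @` I /\ B = g @` I]].
Proof.
move=> [[f [cf fi fA fe]] [g [cg gi gB ge]] AB _]; exists f, g; split => //; split => //.
by move=> s t Is It e; apply: AB; split; [rewrite fA; exists s | rewrite e gB; exists t].
Qed.

Lemma jordan_loop J : jordan J -> exists2 L, jloop J L &
  exists z n, [/\ ~ J z, winds (fun t => L t - z) n & n = 1 \/ n = -1].
Proof.
move=> jJ; have kJ := jordan_compact jJ.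
have [A [B [p [q j]]]] := jJ.
have J0 : J !=set0 by case: j => aA _ _ ->; exists p; left; exact: arc_l aA.
have c1 : {within J, continuous (fun z : P => z.1)} by apply: continuous_subspaceT; cont.
have [a Ja Ha] := compact_EVT_min J0 kJ c1; have [b Jb Hb] := compact_EVT_max J0 kJ c1.
rewrite inE in Ja; rewrite inE in Jb.
have bd z : J z -> a.1 <= z.1 <= b.1 by move=> Jz; rewrite Ha ?Hb // inE.
(* The curve is not contained in a vertical line, where both of its arcs would pass through the
   midpoint of their ends. *)
have ab : a.1 < b.1.
  rewrite ltNge; apply/negP => ba.
  have cst z : J z -> z.1 = a.1.
    by move=> /bd /andP[h1 h2]; apply/eqP; rewrite eq_le h1 (le_trans h2).
  have [f [g [cf cg [f0 f1] [g0 g1] [fi gi fg [AE BE]]]]] := jarcs_params j.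
  case: (j) => aA aB _ JE.
  have Jf t : I t -> J (f t) by move=> It; rewrite JE; left; rewrite AE; exists t.
  have Jg t : I t -> J (g t) by move=> It; rewrite JE; right; rewrite BE; exists t.
  pose v := (p.2 + q.2) / 2.
  have mid (h : R -> P) : continuous h -> h 0 = p -> h 1 = q -> exists2 t, I t & (h t).2 = v.
    move=> ch h0 h1; have c2 : continuous (fun t => (h t).2) by cont.
    have [|t tI e] := @IVT R (fun t => (h t).2) 0 1 v ler01 (continuous_subspaceT c2).
      rewrite h0 h1 /v; have [k|k] := leP p.2 q.2.
        by apply/andP; split; xlra.
      by apply/andP; split; xlra.
    by exists t => //; rewrite IE; move: tI; rewrite in_itv.
  have [s Is es] := mid f cf f0 f1; have [t It et] := mid g cg g0 g1.
  have e : f s = g t by apply: pair_eq; rewrite ?es ?et // !cst //; [exact: Jg | exact: Jf].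
  have pq : p = q; last exact: (arc_neq aA).
  have p1 : p.1 = a.1 by rewrite -f0; apply: cst; apply: Jf; exact: I0.
  have q1 : q.1 = a.1 by rewrite -f1; apply: cst; apply: Jf; exact: I1.
  apply: pair_eq; first by rewrite p1 q1.
  by have [k|k] := fg s t Is It e; move: es; rewrite k /v; move: (p.2) (q.2) => x y *; xlra.
have nab : a <> b by move=> e; move: ab; rewrite e ltxx.
have [A' [B' j']] := jordan_split jJ Ja Jb nab.
have [f [g [cf cg [f0 f1] [g0 g1] [fi gi fg [AE BE]]]]] := jarcs_params j'.
case: (j') => _ _ _ JE.
have Jf t : I t -> J (f t) by move=> It; rewrite JE; left; rewrite AE; exists t.
have Jg t : I t -> J (g t) by move=> It; rewrite JE; right; rewrite BE; exists t.
have [||z [al [be [av Tf Tg d]]]] := maehara cf cg f0 g0 f1 g1 fi gi fg _ _ ab.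
- by move=> t It; apply: bd; exact: Jf.
- by move=> t It; apply: bd; exact: Jg.
exists (loop f g); first by rewrite JE AE BE; apply: loop_jloop f0 g0 f1 g1 _ _ _.
have [n en] : exists2 n : int, al - be = n%:~R & n = 1 \/ n = -1.
  by case: d => ->; [exists 1 => //; left | exists (-1) => //; right].
move=> hn; exists z, n; split => //.
  by rewrite JE AE BE => -[[t It e]|[t It e]]; have [h1 h2] := av t It; [apply: h1|apply: h2].
by apply: winds_loop Tf Tg en; rewrite f1 g1.
Qed.

(** Winding number zero makes the argument agree at both ends of the parameter interval, so it
    descends to the curve. *)
Lemma jloop_lift J L (F : P -> P) : jloop J L -> continuous F -> winds (fun t => F (L t)) 0 ->
  exists2 th : P -> R, continuous th & forall w, J w -> sdir (F w) (cis (th w)).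
Proof.
move=> [cL L01 LJ Li] cF [th cth [H1 H2]].
have [|e ce He] := @compact_factor R R P R I L th (@I_compact R) cL cth.
  move=> s t Is It e; have [st|ts|->//] := ltgtP s t.
    by have [-> ->] := Li s t Is It st e; rewrite H2 mulr0z addr0.
  by have [-> ->] := Li t s It Is ts (esym e); rewrite H2 mulr0z addr0.
rewrite LJ in ce.
have kJ : compact J by rewrite -LJ; apply: continuous_compact (@I_compact R); exact: continuous_subspaceT.
have [g cg Hg] := compact_extend kJ ce.
exists g => // w Jw; rewrite Hg //; move: Jw; rewrite -LJ => -[t It <-].
by rewrite He //; apply: H1; rewrite -IE.
Qed.

Lemma jloop_compact J L : jloop J L -> compact J.
Proof.
by move=> [cL _ <- _]; apply: continuous_compact (@I_compact R); exact: continuous_subspaceT.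
Qed.

Lemma jloop_winds J L z : jloop J L -> ~ J z -> exists n, winds (fun t => L t - z) n.
Proof.
move=> [cL L01 LJ _] nJz; apply: winds_exists; [by cont | | by rewrite L01].
move=> t t01; rewrite subr_eq0; apply/eqP => e; apply: nJz; rewrite -LJ -e.
by exists t; rewrite ?IE.
Qed.

Lemma winds_ext0 J L z : jloop J L -> outside J z -> winds (fun t => L t - z) 0.
Proof.
move=> [cL L01 LJ _] [nJz ez]; have [N N0 HN] := path_bounded cL.
have [y zy yN] := ez (4 * N).
apply: (@winds_moving_center _ L y) => //; last exact: (@winds_far _ L N).
by rewrite LJ; exact: joined_sym.
Qed.

(* Same winding around z and around a power of w - z0: if z were in another component, the
   argument lemma for the component of z would apply. *)
Lemma winds_int_joined J L z0 z n : jloop J L -> ~ J z0 -> winds (fun t => L t - z0) n ->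
  n = 1 \/ n = -1 -> inside J z -> joined (~` J) z0 z.
Proof.
move=> jL nJ0 W0 n1 iz; apply: contrapT => nj.
have kJ := jloop_compact jL; have cJ := compact_closedP kJ.
have [m Wz] := jloop_winds jL iz.1.
pose h (w : P) := zpow (w - z0) (n * m).
have ch : continuous h by move=> w; apply: zpow_cont; cont.
have h0 w : J w \/ joined (~` J) z w -> h w != 0.
  move=> H; apply: zpow_neq0; rewrite subr_eq0; apply/eqP => e.
  by case: H; rewrite e => // k; apply: nj; exact: joined_sym.
pose F (w : P) := cmul (w - z) (cconj (h w)).
have cF : continuous F by rewrite /F /cmul /cconj; cont.
have [|th cth Hth] := jloop_lift jL cF.
  have -> : 0 = m - n * (n * m).
    by rewrite mulrA; case: n1 => ->; rewrite ?mulNr ?mulrN ?opprK !mul1r subrr.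
  by apply: winds_mul => //; apply: winds_conj; apply: winds_zpow.
have [N N0 HN] := compact_bounded_by kJ.
apply: (@component_bounded_no_lift R J z h th N) => //; first exact: iz.1.
  by move=> w zw; apply: int_bounded (ltW N0) HN _; exact: joined_int zw iz.
move=> w Jw; have := Hth w Jw => k.
apply: sdir_trans (sdir_cmul k (sdir_refl (h w))).
rewrite /F -cmulA [cmul (cconj _) _]cmulC cmul_conj cmulC.
have q0 : h w != 0 by apply: h0; left.
have s0 : sqn (h w) != 0 by rewrite sqn_eq0.
exists (sqn (h w))^-1; first by rewrite invr_gt0 sqn_gt0.
by apply: pair_eq => /=; rewrite /GRing.scale /=; field.
Qed.

Lemma jordan_int_joined J x y : jordan J -> inside J x -> inside J y -> joined (~` J) x y.
Proof.
move=> jJ ix iy; have [L jL [z [n [nJz W n1]]]] := jordan_loop jJ.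
have K := winds_int_joined jL nJz W n1.
exact: joined_trans (joined_sym (K x ix)) (K y iy).
Qed.

Lemma jordan_int_nonempty J : jordan J -> exists z, inside J z.
Proof.
move=> jJ; have [L jL [z [n [nJz W n1]]]] := jordan_loop jJ.
exists z; split => // ez; have := winds_uniq W (winds_ext0 jL ez).
by case: n1 => ->.
Qed.

(* The turning number of one parametrization is a multiple of that of any other. *)
Lemma jloop_winds_int J L z n : jordan J -> jloop J L -> inside J z ->
  winds (fun t => L t - z) n -> n = 1 \/ n = -1.
Proof.
move=> jJ jL iz W; have [L0 jL0 [z0 [m [nJ0 W0 m1]]]] := jordan_loop jJ.
have j0z := winds_int_joined jL0 nJ0 W0 m1 iz.
have {}W0 : winds (fun t => L0 t - z) m.
  by case: jL0 => cL L01 LJ _; apply: (@winds_moving_center _ L0 z0) => //; rewrite LJ.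
have kJ := jloop_compact jL; case: (jL) => cL L01 LJ Li.
(* [E] inverts the parametrization [L], with values in the unit circle. *)
have [E cE HE] : exists2 E : P -> P, continuous E & forall t, I t -> E (L t) = cis t.
  have [|e ce He] := @compact_factor R R P P I L (@cis R) (@I_compact R) cL (@cis_cont R).
    move=> s t Is It e; have [st|ts|->//] := ltgtP s t.
      by have [-> ->] := Li s t Is It st e; rewrite cis0 cis1.
    by have [-> ->] := Li t s It Is ts (esym e); rewrite cis0 cis1.
  rewrite LJ in ce.
  have ce1 : {within J, continuous (fun z => (e z).1)} by move=> w; apply: ct_fst; exact: ce.
  have ce2 : {within J, continuous (fun z => (e z).2)} by move=> w; apply: ct_snd; exact: ce.
  have [e1 c1 H1] := compact_extend kJ ce1; have [e2 c2 H2] := compact_extend kJ ce2.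
  exists (fun z => (e1 z, e2 z)); first by cont.
  move=> t It; have Jt : J (L t) by rewrite -LJ; exists t.
  by rewrite H1 // H2 // -He //; case: (e _).
have E0 w : J w -> E w != 0 by rewrite -LJ => -[t It <-]; rewrite HE // cis_neq0.
(* Along [L], [w - z] turns as much as the [n]-th power of [E], so their quotient has an argument on
   the curve. Composing with [L0] then gives [m = k * n]. *)
pose F (w : P) := cmul (w - z) (cconj (zpow (E w) n)).
have cF : continuous F.
  have cz : continuous (fun w => zpow (E w) n) by move=> w; apply: zpow_cont; exact: cE.
  by rewrite /F /cmul /cconj; cont.
have WE : winds (fun t => E (L t)) 1.
  by apply: winds_ext (winds_cis R 1) => t t01; rewrite mul1r HE // IE.
have [|th cth Hth] := jloop_lift jL cF.
  have -> : 0 = n - 1 * n by rewrite mul1r subrr.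
  by apply: winds_mul => //; apply: winds_conj; apply: winds_zpow.
case: (jL0) => cL0 L001 L0J L0i.
have J0 t : I t -> J (L0 t) by move=> It; rewrite -L0J; exists t.
have [k Wk] : exists k, winds (fun t => E (L0 t)) k.
  apply: winds_exists; [by cont | by move=> t t01; apply: E0; apply: J0; rewrite IE | by rewrite L001].
have : winds (fun t => L0 t - z) (0 + k * n).
  have W1 : winds (fun t => cis (th (L0 t))) 0.
    exists (fun t => th (L0 t)); first by cont.
    by split; [move=> t _; exact: sdir_refl | rewrite L001 mulr0z addr0].
  apply: winds_sdir (winds_mul W1 (winds_zpow n Wk)) => t t01.
  have Jt := J0 t; rewrite IE in Jt.
  have h0 : zpow (E (L0 t)) n != 0 by apply: zpow_neq0; apply: E0; exact: Jt.
  apply: sdir_trans (sdir_cmul (Hth _ (Jt t01)) (sdir_refl _)).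
  rewrite /F -cmulA [cmul (cconj _) _]cmulC cmul_conj cmulC; set h := zpow _ _ in h0 *.
  have s0 : sqn h != 0 by rewrite sqn_eq0.
  exists (sqn h)^-1; first by rewrite invr_gt0 sqn_gt0.
  by apply: pair_eq => /=; rewrite /GRing.scale /=; field.
move/(winds_uniq W0); rewrite add0r => e.
have /eqP : absz (k * n) = 1%N by rewrite -e; case: m1 => ->.
by rewrite abszM muln_eq1 => /andP[_ /eqP]; clear; lia.
Qed.

(* Otherwise the component would also be a component of the complement of an arc. *)
Lemma jordan_frontier J x d : jordan J -> J x -> 0 < d ->
  (exists2 y, inside J y & `|x - y| < d) /\ (exists2 y, outside J y & `|x - y| < d).
Proof.
move=> jJ Jx d0; have kJ := jordan_compact jJ; have cJ := compact_closedP kJ.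
have [A0 [B0 [p [q j]]]] := jJ.
have [y Jy xy] : exists2 y, J y & x <> y.
  case: j => aA _ _ JE; have pq := arc_neq aA.
  have Jp : J p by rewrite JE; left; exact: arc_l aA.
  have Jq : J q by rewrite JE; left; exact: arc_r aA.
  by have [e|/eqP e] := eqVneq x p; [exists q => //; rewrite e | exists p].
have [A [B [aA aB AB JE]]] := jordan_split jJ Jx Jy xy.
have [A' [a [aA' A'A nA'x HA]]] := arc_trim aA d0.
have [B' [b [aB' B'B nB'x HB]]] := arc_trim aB d0.
have aK : arc (A' `|` B') a b.
  apply: arc_cat aA' (arc_sym aB') _ => z [Az Bz].
  by have [zx|//] := AB z (conj (A'A z Az) (B'B z Bz)); case: nA'x; rewrite -zx.
have KJ : A' `|` B' `<=` J by rewrite JE => z [/A'A|/B'B]; [left|right].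
have near z : J z -> ~ (A' `|` B') z -> `|x - z| < d.
  rewrite JE => -[Az|Bz] nK.
    by have [h|//] := HA z Az; case: nK; left.
  by have [h|//] := HB z Bz; case: nK; right.
have [z iz] := jordan_int_nonempty jJ.
have [e ee] : exists e, outside J e.
  have [N N0 HN] := compact_bounded_by kJ.
  exists (N + 1, 0); apply: (ext_far (ltW N0) HN).
  by rewrite prod_normE lt_max /= ger0_norm ?ltrDl ?ltr01 // addr_ge0 // ltW.
have ze : joined (~` (A' `|` B')) z e.
  by apply: arc_not_separating aK _ _ => /KJ; [exact: iz.1 | exact: ee.1].
(* A set whose frontier lies in the curve and which avoids the [d]-ball around [x] has its frontier
   in the trimmed arc, which does not separate [z] from [e]. *)
have main (U : set P) : open U -> (forall v : P, closure U v -> U v \/ J v) ->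
    (forall y, U y -> ~ `|x - y| < d) -> forall z e, joined (~` (A' `|` B')) z e -> U z -> U e.
  move=> oU cU nU z' e'; apply: joined_cross => // v cu.
  have [Uu|Ju] := cU v cu; first by left.
  right; apply: contrapT => nK; have xu := near v Ju nK.
  have p0 : 0 < d - `|x - v| by rewrite subr_gt0.
  have [w [Uw uw]] := cu _ (nbhsx_ballx v _ p0).
  apply: (nU w Uw); have -> : x - w = (x - v) + (v - w) by rewrite addrA subrK.
  rewrite (le_lt_trans (ler_normD _ _)) //; move: uw; rewrite -ball_normE /= => uw.
  by move: `|x - v| `|v - w| uw => s t *; xlra.
split; apply: contrapT => H.
  have : inside J e; last by move=> [_ []].
  apply: (main (inside J)) ze iz; first exact: int_open.
    by move=> v; exact: closure_int.
  by move=> w iw xw; apply: H; exists w.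
have : outside J z; last by case: iz.
apply: (main (outside J)) (joined_sym ze) ee; first exact: ext_open.
  by move=> v; exact: closure_ext.
by move=> w iw xw; apply: H; exists w.
Qed.

End JordanTheorem.

(** * Arcs in path-connected sets *)

Section RunningMax.
Context (R : realType) (V : normedModType R).
Variable (f : R -> V).
Hypothesis cf : continuous f.
Notation I := (unit_interval R).

(** With [Num.max r t] as upper end the value is [0] for [t <= r]. *)
Definition rmax (r t : R) : R :=
  sup [set `|f u - f r| | u in [set u | r <= u <= Num.max r t]].

Let bounded_on a b : exists2 N, 0 < N & forall u, a <= u <= b -> `|f u| <= N.
Proof.
have kf : compact (f @` `[a, b]).
  by apply: continuous_compact (@segment_compact _ _ _); exact: continuous_subspaceT.
have [N N0 H] := compact_bounded_by kf.
by exists N => // u uab; apply: H; exists u => //=; rewrite in_itv.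
Qed.

Let S r t := [set `|f u - f r| | u in [set u | r <= u <= Num.max r t]].

Let S_sup r t : has_sup (S r t).
Proof.
split; first by exists `|f r - f r|, r => //=; rewrite lexx le_max lexx.
have [N N0 H] := bounded_on r (Num.max r t).
exists (N + `|f r|) => x [u ur <-]; rewrite (le_trans (ler_normB _ _)) // lerD2r.
exact: H.
Qed.

Lemma rmax_ub r t u : r <= u -> u <= t -> `|f u - f r| <= rmax r t.
Proof.
move=> ru ut; apply: (sup_upper_bound (S_sup r t)); exists u => //=.
by rewrite ru le_max ut orbT.
Qed.

Lemma rmax_le r t c : 0 <= c -> (forall u, r <= u -> u <= t -> `|f u - f r| <= c) -> rmax r t <= c.
Proof.
move=> c0 H; apply: ge_sup; first exact: (S_sup r t).1.
move=> x [u /andP[ru]]; rewrite le_max => /orP[ur|ut] <-; last exact: H.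
have -> : u = r by apply/eqP; rewrite eq_le ur ru.
by rewrite subrr normr0.
Qed.

Lemma rmax_ge0 r t : 0 <= rmax r t.
Proof.
apply: (@le_trans _ _ `|f r - f r|); first exact: normr_ge0.
by apply: (sup_upper_bound (S_sup r t)); exists r => //=; rewrite lexx le_max lexx.
Qed.

Lemma rmax_homo r s t : s <= t -> rmax r s <= rmax r t.
Proof.
move=> st; apply: rmax_le; first exact: rmax_ge0.
by move=> u ru us; apply: rmax_ub => //; exact: le_trans st.
Qed.

Lemma rmax_incr r s t c : s <= t -> 0 <= c -> (forall u, s <= u <= t -> `|f u - f s| <= c) ->
  rmax r t <= rmax r s + 2 * c.
Proof.
move=> st c0 H; apply: rmax_le; first by apply: addr_ge0; [exact: rmax_ge0 | rewrite mulr_ge0].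
move=> u ru ut; have [us|/ltW su] := leP u s.
  by apply: (le_trans (rmax_ub ru us)); rewrite lerDl mulr_ge0.
have e : f u - f r = (f s - f r) + (f u - f s) by rewrite [RHS]addrC subrKA.
rewrite e (le_trans (ler_normD _ _)) //.
have h : `|f u - f s| <= c by apply: H; rewrite su.
have [rs|/ltW sr] := leP r s.
  by have := rmax_ub rs (lexx s); move: `|f s - f r| `|f u - f s| (rmax r s) h => x y z *; xlra.
have : `|f r - f s| <= c by apply: H; rewrite sr (le_trans ru).
by rewrite distrC; have := rmax_ge0 r s; move: `|f s - f r| `|f u - f s| (rmax r s) h => x y z *; xlra.
Qed.

End RunningMax.

Section Reparametrization.
Context (R : realType).

Lemma within_comp (T U W : topologicalType) (K : set U) (g : U -> W) (c : T -> U) :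
  {within K, continuous g} -> continuous c -> (forall t, K (c t)) -> continuous (fun t => g (c t)).
Proof.
move=> /subspace_continuousP cg cc Kc t; have H := cg (c t) (Kc t).
apply: cvg_comp H => A; rewrite /within /= => nA.
have nA' : nbhs (c t) [set x | K x -> A x] := nA.
have : nbhs t (c @^-1` [set x | K x -> A x]) := cc t _ nA'.
apply: filterS => s /= H; exact: (H (Kc s)).
Qed.

Notation I := (unit_interval R).

(* A path which is constant between any two parameters with the same value is, up to a
   monotone change of parameter, injective.  The new parameter is a weighted sum, over the
   rationals r, of the running maxima of the distance to f r. *)
Lemma reparam_injective (V : normedModType R) (f : R -> V) : continuous f -> f 0 <> f 1 ->
  (forall s t u, s <= u <= t -> I s -> I t -> f s = f t -> f u = f s) ->
  exists A, arc A (f 0) (f 1) /\ A `<=` f @` I.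
Proof.
move=> cf f01 fmon.
pose q (n : nat) : R := ratr (odflt 0 (unpickle n : option rat)).
have qdense s t : s < t -> exists n, s < q n < t.
  move=> /rat_in_itvoo [r]; rewrite in_itv /= => h.
  by exists (pickle r); rewrite /q pickleK.
(* Truncated at [1], the running maxima can be summed with weights [2^-(n+1)]; the remainder after
   [N] terms is at most [2^-N]. *)
pose m n t := Num.min (rmax f (q n) t) 1.
have m01 n t : 0 <= m n t <= 1 by rewrite /m le_min rmax_ge0 // ler01 ge_min lexx orbT.
have mh n s t : s <= t -> m n s <= m n t.
  by move=> st; rewrite /m le_min !ge_min rmax_homo //= lexx orbT.
pose w n : R := 2^-1 ^+ n.+1.
have w0 n : 0 < w n by rewrite exprn_gt0.
pose S N t := \sum_(n < N) w n * m n t.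
have SS N t : S N.+1 t = S N t + w N * m N t by rewrite /S big_ord_recr.
have tail N k t : S (N + k)%N t <= S N t + 2^-1 ^+ N.
  suff : S (N + k)%N t <= S N t + (2^-1 ^+ N - 2^-1 ^+ (N + k)).
    by move/le_trans; apply; rewrite lerD2l gerBl exprn_ge0.
  elim: k => [|k IH]; first by rewrite addn0 subrr addr0.
  rewrite addnS SS.
  have : w (N + k)%N * m (N + k)%N t <= w (N + k)%N by rewrite ler_piMr ?(ltW (w0 _)) //; case/andP: (m01 (N + k)%N t).
  rewrite /w [2^-1 ^+ (N + k).+1]exprS; move: IH; move: (2^-1 ^+ (N + k)) (S (N + k)%N t) => a b IH h.
  by xlra.
have SN N N' t : (N <= N')%N -> S N t <= S N' t.
  move=> /subnKC <-; elim: (N' - N)%N => [|k IH]; first by rewrite addn0.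
  rewrite addnS SS; apply: (le_trans IH).
  by rewrite lerDl mulr_ge0 ?(ltW (w0 _)) //; case/andP: (m01 (N + k)%N t).
have sup_S t : has_sup [set S N t | N in [set: nat]].
  split; first by exists (S 0%N t), 0%N.
  by exists (S 0%N t + 2^-1 ^+ 0) => x [N _ <-]; have := tail 0%N N t.
pose phi t := sup [set S N t | N in [set: nat]].
have phi_ub N t : S N t <= phi t by apply: (sup_upper_bound (sup_S t)); exists N.
have phi_le N t : phi t <= S N t + 2^-1 ^+ N.
  apply: ge_sup; first exact: (sup_S t).1.
  move=> x [N' _ <-]; have [h|/ltnW h] := leqP N N'; first by rewrite -(subnKC h) tail.
  by apply: (le_trans (SN _ _ t h)); rewrite lerDl exprn_ge0.
have phi_homo s t : s <= t -> phi s <= phi t.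
  move=> st; apply: ge_sup; first exact: (sup_S s).1.
  move=> x [N _ <-]; apply: le_trans (phi_ub N t).
  by apply: ler_sum => n _; rewrite ler_wpM2l ?(ltW (w0 _)) // mh.
have phi_strict n s t : s <= t -> m n s < m n t -> phi s < phi t.
  move=> st mst; pose c := w n * (m n t - m n s).
  have c0 : 0 < c by rewrite mulr_gt0 // subr_gt0.
  have step N : (n < N)%N -> S N s + c <= S N t.
    move=> nN; rewrite /S (bigD1 (Ordinal nN)) //= [leRHS](bigD1 (Ordinal nN)) //=.
    have : \sum_(i < N | i != Ordinal nN) w i * m i s <= \sum_(i < N | i != Ordinal nN) w i * m i t.
      by apply: ler_sum => i _; rewrite ler_wpM2l ?(ltW (w0 _)) // mh.
    move: (\sum_(i < N | _) _) (\sum_(i < N | _) _) => a b ab.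
    by rewrite /c mulrBr; xlra.
  suff : phi s + c <= phi t by move=> h; apply: lt_le_trans h; rewrite ltrDl.
  rewrite -lerBrDr; apply: ge_sup; first exact: (sup_S s).1.
  move=> x [N _ <-]; rewrite lerBrDr.
  apply: (le_trans _ (phi_ub (maxn N n.+1) t)).
  have := step (maxn N n.+1); rewrite leq_max ltnSn orbT => /(_ isT) h.
  by apply: le_trans h; rewrite lerD2r SN // leq_maxl.
have cphi : continuous phi.
  move=> t; apply/(@ct_epsP R R R) => e e0.
  have [N HN] : exists N, 2^-1 ^+ N < e / 4.
    have e4 : 0 < e / 4 by rewrite divr_gt0.
    have := @cvg_geometric R 1 2^-1; rewrite ger0_norm // invf_lt1 // ltr1n => /(_ isT) /cvgrPdist_lt.
    move=> /(_ _ e4) [N _ HN]; exists N; have := HN N (leqnn N).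
    by rewrite /= mul1r sub0r normrN ger0_norm // exprn_ge0.
  pose d2 := e / 8.
  have d20 : 0 < d2 by rewrite divr_gt0.
  have [d d0 Hd] := (iffLR (ct_epsP _ _) (cf t)) d2 d20.
  have osc s u : `|t - s| < d -> `|t - u| < d -> `|f u - f s| <= 2 * d2.
    move=> ts tu; have -> : f u - f s = (f t - f s) - (f t - f u) by rewrite opprB [RHS]addrC subrKA.
    rewrite (le_trans (ler_normB _ _)) //; have := Hd _ ts; have := Hd _ tu.
    by move: `|f t - f s| `|f t - f u| => a b *; xlra.
  have minc n s u : s <= u -> (forall v, s <= v <= u -> `|t - v| < d) -> m n u <= m n s + e / 2.
    move=> su H; have := @rmax_incr R V f cf (q n) s u (2 * d2) su.
    have c0 : 0 <= 2 * d2 by rewrite mulr_ge0 // ltW.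
    move=> /(_ c0) K; have {K} : rmax f (q n) u <= rmax f (q n) s + 2 * (2 * d2).
      by apply: K => v vv; apply: osc; apply: H => //; rewrite lexx su.
    have -> : 2 * (2 * d2) = e / 2 by rewrite /d2; field.
    rewrite /m; move: (rmax _ _ _) (rmax _ _ _) => a b ab.
    have [h|h] := leP a 1; first by rewrite ge_min ab.
    by rewrite ge_min; apply/orP; right; rewrite lerDl divr_ge0 // ltW.
  have Sinc s u : s <= u -> (forall v, s <= v <= u -> `|t - v| < d) -> S N u <= S N s + e / 2.
    move=> su H; apply: (@le_trans _ _ (\sum_(n < N) (w n * m n s + w n * (e / 2)))).
      apply: ler_sum => n _; rewrite -mulrDr ler_wpM2l ?(ltW (w0 _)) //; exact: minc.
    rewrite big_split /= lerD2l -mulr_suml ler_piMl ?divr_ge0 ?(ltW e0) //.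
    suff : \sum_(i < N) w i = 1 - 2^-1 ^+ N by move=> ->; rewrite gerBl exprn_ge0.
    elim: (N) => [|k IH]; first by rewrite big_ord0 expr0 subrr.
    by rewrite big_ord_recr /= IH /w exprS; move: (2^-1 ^+ k) => a; field.
  exists d => // s ts.
  have near v a b : `|t - a| < d -> `|t - b| < d -> a <= v <= b -> `|t - v| < d.
    by rewrite !ltr_norml => /andP[h1 h2] /andP[h3 h4] /andP[h5 h6]; apply/andP; split; xlra.
  have tt : `|t - t| < d by rewrite subrr normr0.
  have [st|/ltW st] := leP s t.
    have := Sinc s t st (fun v => near v s t ts tt); have := phi_ub N s; have := phi_le N t.
    have ph := phi_homo s t st; rewrite ger0_norm ?subr_ge0 //.
    by move: ph; move: (phi s) (phi t) (S N s) (S N t) (2^-1 ^+ N) HN => *; xlra.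
  have := Sinc t s st (fun v => near v t s tt ts); have := phi_ub N t; have := phi_le N s.
  have ph := phi_homo t s st; rewrite ler0_norm ?subr_le0 // opprB.
  by move: ph; move: (phi s) (phi t) (S N s) (S N t) (2^-1 ^+ N) HN => *; xlra.
have phi_eq s t : s <= t -> I s -> I t -> f s = f t -> phi s = phi t.
  move=> st Is It e.
  suff mE n : m n s = m n t by rewrite /phi; congr sup; apply/seteqP; split => x [N _ <-]; exists N => //; apply: eq_bigr => n _; rewrite mE.
  apply/eqP; rewrite eq_le mh //= /m.
  have : rmax f (q n) t <= rmax f (q n) s + 2 * 0.
    by apply: rmax_incr => // u su; rewrite (fmon s t u) // subrr normr0.
  by rewrite mulr0 addr0 => h; rewrite le_min !ge_min h lexx orbT.
have phi_neq s t : s < t -> f s <> f t -> phi s < phi t.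
  (* A rational slightly to the right of [s] has a value close to [f s], hence different from [f t].
     The running maximum starting there vanishes at [s] and is positive at [t]. *)
  move=> st fst; have [r [/andP[sr rt] frt]] : exists n, s < q n < t /\ f (q n) <> f t.
    apply: contrapT => no; apply: fst; apply/eqP; rewrite -subr_eq0 -normr_le0 leNgt; apply/negP => p.
    have [d d0 Hd] := (iffLR (ct_epsP _ _) (cf s)) _ p.
    have [n /andP[sn nt]] : exists n, s < q n < Num.min t (s + d).
      by apply: qdense; rewrite lt_min st ltrDl.
    move: nt; rewrite lt_min => /andP[nt nd].
    have : `|s - q n| < d by rewrite distrC gtr0_norm ?subr_gt0 // ltrBlDl.
    move/Hd; have -> : f (q n) = f t; last by rewrite ltxx.
    by apply: contrapT => k; apply: no; exists n; rewrite sn nt.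
  apply: (phi_strict r _ _ (ltW st)); rewrite /m.
  have h1 : rmax f (q r) s <= 0.
    by apply: rmax_le => // u ru us; have := lt_le_trans sr (le_trans ru us); rewrite ltxx.
  have h2 : 0 < rmax f (q r) t.
    apply: lt_le_trans (rmax_ub cf (ltW rt) (lexx t)).
    by rewrite normr_gt0 subr_eq0; apply/eqP => e; apply: frt.
  by apply: (@le_lt_trans _ _ 0); [rewrite ge_min h1 | rewrite lt_min h2 ltr01].
have I0' := @I0 R; have I1' := @I1 R.
have p01 : phi 0 < phi 1 by apply: phi_neq => //; exact: ltr01.
(* By the two preceding facts [phi] identifies exactly the parameters with equal values, so [f]
   factors through it injectively. *)
have [|g cg Hg] := @compact_factor R R R V I phi f (@I_compact R) cphi cf.
  move=> s t Is It e; apply: contrapT => n; have [st|ts|st] := ltgtP s t.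
  - by have := phi_neq s t st n; rewrite e ltxx.
  - by have := phi_neq t s ts (fun e => n (esym e)); rewrite e ltxx.
  - by apply: n; rewrite st.
have onto y : phi 0 <= y <= phi 1 -> exists2 t, I t & phi t = y.
  move=> y01; have [|t tI e] := @IVT R phi 0 1 y ler01 (continuous_subspaceT cphi).
    by rewrite min_l ?max_r ?(ltW p01).
  by exists t => //; rewrite IE; move: tI; rewrite in_itv.
pose G (y : R) := g (clamp (phi 0) (phi 1) y).
have cG : continuous G.
  apply: (within_comp cg); first exact: clamp_cont.
  by move=> y; have [t It <-] := onto _ (clamp_itv y (ltW p01)); exists t.
have GE y t : I t -> phi t = y -> phi 0 <= y <= phi 1 -> G y = f t.
  by move=> It e y01; rewrite /G clamp_id // -e Hg.
have G0 : G (phi 0) = f 0 by apply: GE => //; rewrite lexx ltW.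
have G1 : G (phi 1) = f 1 by apply: GE => //; rewrite lexx ltW.
exists (G @` `[phi 0, phi 1]); split.
  rewrite -G0 -G1; apply: arc_param => // y z y01 z01.
  have [s Is es] := onto y y01; have [t It et] := onto z z01.
  rewrite (GE y s) // (GE z t) // => e.
  have [st|ts|st] := ltgtP s t; last by rewrite -es -et st.
    by rewrite -es -et; apply: phi_eq => //; exact: ltW.
  by rewrite -es -et; apply/esym; apply: phi_eq => //; exact: ltW.
move=> x [y]; rewrite /= in_itv /= => y01 <-; have [t It et] := onto y y01.
by rewrite (GE y t) //; exists t.
Qed.


Lemma compact_gap (U : set R) a b : open U -> compact [set t | a <= t <= b /\ ~ U t].
Proof.
move=> oU; have -> : [set t | a <= t <= b /\ ~ U t] = `[a, b] `&` ~` U.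
  by apply/seteqP; split => t /=; rewrite in_itv.
by apply: compact_closedI; [exact: segment_compact | exact: open_closedC].
Qed.

Lemma gap_max (U : set R) a b : open U -> a <= b -> ~ U a ->
  exists x, [/\ a <= x <= b, ~ U x & forall t, x < t <= b -> U t].
Proof.
move=> oU ab Ua; have kK := @compact_gap U a b oU.
have [||x] := @compact_EVT_max R R (fun t => t) _ _ kK.
- by exists a; rewrite /= lexx ab.
- by apply: continuous_subspaceT; cont.
rewrite inE => -[xab nUx] Hx; exists x; split => // t /andP[xt tb]; apply: contrapT => nUt.
suff : t <= x by rewrite leNgt xt.
by apply: Hx; rewrite inE; split => //; case/andP: xab => ax _; rewrite tb (le_trans ax (ltW xt)).
Qed.

Lemma gap_min (U : set R) a b : open U -> a <= b -> ~ U b ->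
  exists x, [/\ a <= x <= b, ~ U x & forall t, a <= t < x -> U t].
Proof.
move=> oU ab Ub; have kK := @compact_gap U a b oU.
have [||x] := @compact_EVT_min R R (fun t => t) _ _ kK.
- by exists b; rewrite /= lexx ab.
- by apply: continuous_subspaceT; cont.
rewrite inE => -[xab nUx] Hx; exists x; split => // t /andP[xt tb]; apply: contrapT => nUt.
suff : x <= t by rewrite leNgt tb.
by apply: Hx; rewrite inE; split => //; case/andP: xab => _ ax; rewrite xt (le_trans (ltW tb) ax).
Qed.

Lemma clamp_lip (t s : R) : `|clamp 0 1 t - clamp 0 1 s| <= `|t - s|.
Proof.
have H (a b : R) : a <= b -> `|clamp 0 1 a - clamp 0 1 b| <= `|a - b|.
  move=> ab; rewrite [leRHS]ler0_norm ?subr_le0 // opprB ler_norml.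
  have [a0|a0] := leP a 0; have [b0|b0] := leP b 0; rewrite ?(clamp_le _ a0) ?(clamp_le _ b0) ?ler01 //; try by apply/andP; split; xlra.
    have [b1|b1] := leP b 1; first by rewrite (@clamp_id _ 0 1 b) ?(ltW b0) //; apply/andP; split; xlra.
    by rewrite (clamp_ge _ (ltW b1)) ?ler01 //; apply/andP; split; xlra.
  have [a1|a1] := leP a 1; have [b1|b1] := leP b 1; rewrite ?(clamp_ge _ (ltW a1)) ?(clamp_ge _ (ltW b1)) ?ler01 ?(@clamp_id _ 0 1 a) ?(@clamp_id _ 0 1 b) ?(ltW a0) ?(ltW b0) //; apply/andP; split; xlra.
have [h|/ltW h] := leP t s; first exact: H.
by rewrite distrC [leRHS]distrC; exact: H.
Qed.

(** * Erasing the loops of a path *)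

Section LoopErasure.
Context (V : normedModType R) (f : R -> V).
Hypothesis cf : continuous f.

(* Erasing the intervals of U from [0, 1] only removes loops of f. *)
Definition erasable (U : set R) := [/\ open U, forall t, U t -> 0 < t < 1 &
  forall x y : R, x < y -> 0 <= x -> y <= 1 -> ~ U x -> ~ U y -> (forall t, x < t < y -> U t) -> f x = f y].

(** In a chain, a compact part of a gap of the union lies in a single member. The ends of the gap of
    this member around it are close to [x] and [y] and have equal values, so the claim follows by
    continuity. *)
Lemma erasable_bigcup (F : set (set R)) : F `<=` erasable -> total_on F subset ->
  erasable (\bigcup_(X in F) X).
Proof.
move=> FE tF; split.
- by apply: bigcup_open => X /FE [].
- by move=> t [X /FE [_ h _]]; exact: h.
move=> x y xy x0 y1 nx ny xyU.
pose z := (x + y) / 2.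
have xz : x < z by rewrite /z; xlra.
have zy : z < y by rewrite /z; xlra.
pose Q : set R := [set t | exists2 X, F X & forall w, Num.min t z <= w <= Num.max t z -> X w].
have Qall t : x < t < y -> Q t.
  move=> txy; apply: (@joined_ind R R [set w | x < w < y] Q z).
  - move=> u /= uxy; have [X FX Xu] := xyU u uxy.
    have [oX _ _] := FE X FX; have [d d0 Hd] := (iffLR (open_epsP X) oX) u Xu.
    exists d => // v vxy uv.
    have K a b : `|u - a| < d -> `|u - b| < d -> Q a -> Q b.
      move=> ua ub [Y FY HY].
      have [Z [FZ XZ YZ]] : exists Z, [/\ F Z, X `<=` Z & Y `<=` Z].
        by have [h|h] := tF X Y FX FY; [exists Y; split => // | exists X; split => //].
      exists Z => // w wb.
      have [wa|wa] := boolP (Num.min a z <= w <= Num.max a z); first exact/YZ/HY.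
      apply: XZ; apply: Hd; move: ua ub wb wa; rewrite !ltr_norml !ge_min !le_max negb_and !negb_or -!ltNge.
      move=> /andP[h1 h2] /andP[h3 h4] /andP[/orP[h5|h5] /orP[h6|h6]] /orP[/andP[h7 h8]|/andP[h7 h8]]; clear -h1 h2 h3 h4 h5 h6 h7 h8; apply/andP; split; lra.
    have uu : `|u - u| < d by rewrite subrr normr0.
    by split; apply: K.
  - apply: joined_segment => s /andP[s0 s1] /=; rewrite /GRing.scale /=.
    case/andP: txy => h1 h2; have h3 : 0 <= 1 - s by rewrite subr_ge0.
    have -> : z + s * (t - z) = (1 - s) * z + s * t by ring.
    have k1 : (1 - s) * x <= (1 - s) * z by rewrite ler_wpM2l // ltW.
    have k2 : s * x <= s * t by rewrite ler_wpM2l // ltW.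
    have k3 : (1 - s) * z <= (1 - s) * y by rewrite ler_wpM2l // ltW.
    have k4 : s * t <= s * y by rewrite ler_wpM2l // ltW.
    have [e|sn] := eqVneq s 0; first by rewrite e subr0 !mul1r !mul0r addr0 xz zy.
    have sp : 0 < s by rewrite lt_neqAle eq_sym sn.
    have k5 : s * x < s * t by rewrite ltr_pM2l.
    have k6 : s * t < s * y by rewrite ltr_pM2l.
    by apply/andP; split; xlra.
  have [X FX Xz] := xyU z (introT andP (conj xz zy)).
  by exists X => // w; rewrite minxx maxxx => wz; have -> : w = z by apply/eqP; rewrite eq_le andbC.
apply/eqP; rewrite -subr_eq0 -normr_le0; apply/ler_addgt0Pr => e e0; rewrite add0r.
have e2 : 0 < e / 2 by rewrite divr_gt0.
have [d1 d10 H1] := (iffLR (ct_epsP _ _) (@cf x)) _ e2.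
have [d2 d20 H2] := (iffLR (ct_epsP _ _) (@cf y)) _ e2.
pose t1 := x + Num.min (d1 / 2) ((z - x) / 2); pose t2 := y - Num.min (d2 / 2) ((y - z) / 2).
have [m1 m1' m1''] : [/\ 0 < t1 - x, t1 - x < d1 & t1 < z].
  have : 0 < Num.min (d1 / 2) ((z - x) / 2) by rewrite lt_min !divr_gt0 // subr_gt0.
  have : Num.min (d1 / 2) ((z - x) / 2) <= d1 / 2 by rewrite ge_min lexx.
  have : Num.min (d1 / 2) ((z - x) / 2) <= (z - x) / 2 by rewrite ge_min lexx orbT.
  by rewrite /t1; move: (Num.min _ _) => m *; split; xlra.
have [m2 m2' m2''] : [/\ 0 < y - t2, y - t2 < d2 & z < t2].
  have : 0 < Num.min (d2 / 2) ((y - z) / 2) by rewrite lt_min !divr_gt0 // subr_gt0.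
  have : Num.min (d2 / 2) ((y - z) / 2) <= d2 / 2 by rewrite ge_min lexx.
  have : Num.min (d2 / 2) ((y - z) / 2) <= (y - z) / 2 by rewrite ge_min lexx orbT.
  by rewrite /t2; move: (Num.min _ _) => m *; split; xlra.
clearbody t1 t2 z.
have [X1 F1 HX1] : Q t1 by apply: Qall; xlra.
have [X2 F2 HX2] : Q t2 by apply: Qall; xlra.
have [X [FX X1X X2X]] : exists Z, [/\ F Z, X1 `<=` Z & X2 `<=` Z].
  by have [h|h] := tF X1 X2 F1 F2; [exists X2; split => // | exists X1; split => //].
have [oX X01 gX] := FE X FX.
have nXx : ~ X x by move=> h; apply: nx; exists X.
have nXy : ~ X y by move=> h; apply: ny; exists X.
have mid w : t1 <= w <= t2 -> X w.
  move=> /andP[h1 h2]; have [h|h] := leP w z.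
    by apply: X1X; apply: HX1; rewrite ge_min h1 le_max h orbT.
  by apply: X2X; apply: HX2; rewrite ge_min (ltW h) orbT le_max h2.
have [|x' [/andP[x1 x2] nx' Hx']] := @gap_max X x t1 oX _ nXx; first by xlra.
have [|y' [/andP[y1' y2] ny' Hy']] := @gap_min X t2 y oX _ nXy; first by xlra.
have xt1 : x' < t1.
  rewrite lt_neqAle x2 andbT; apply/eqP => e'; apply: nx'; apply: mid; rewrite e' lexx /=; xlra.
have yt2 : t2 < y'.
  rewrite lt_neqAle y1' andbT; apply/eqP => e'; apply: ny'; apply: mid; rewrite -e' lexx andbT; xlra.
have fxy : f x' = f y'.
  apply: gX => //; try by xlra.
  move=> t /andP[h1 h2]; have [k1|k1] := leP t t1; first by apply: Hx'; rewrite h1.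
  have [k2|k2] := leP t2 t; first by apply: Hy'; rewrite k2.
  by apply: mid; rewrite (ltW k1) ltW.
have -> : f x - f y = (f x - f x') - (f y - f y') by rewrite fxy opprB addrA subrK.
rewrite (le_trans (ler_normB _ _)) // [leRHS](splitr e) lerD // ltW //.
  by apply: H1; rewrite distrC ger0_norm; xlra.
by apply: H2; rewrite ger0_norm; xlra.
Qed.

(** For a maximal erased set [U], a loop between two remaining parameters is erased entirely.
    Halting [f] during the erased intervals then gives a path that is constant between equal
    values. *)
Theorem path_to_arc : f 0 <> f 1 -> exists A, arc A (f 0) (f 1) /\ A `<=` f @` I.
Proof.
move=> f01; have [U [[oU U01 gU] mU]] := Zorn_bigcup erasable_bigcup.
have nU0 : ~ U 0 by move/U01; rewrite ltxx.
have nU1 : ~ U 1 by move/U01; rewrite ltxx andbF.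
have loopU s t : s < t -> 0 <= s -> t <= 1 -> ~ U s -> ~ U t -> f s = f t -> forall u, s < u < t -> U u.
  move=> st s0 t1 nUs nUt fst.
  pose U' := U `|` [set u | s < u < t].
  have E : erasable U'.
    split.
    - apply: openU => //; have -> : [set u : R | s < u < t] = `]s, t[%classic by apply/seteqP; split => u; rewrite /= in_itv.
      exact: interval_open.
    - by move=> u [/U01//|/= h]; xlra.
    move=> x y xy x0 y1 nx ny H.
    have [ov|nov] := boolP ((x < t) && (s < y)).
      have nx' : ~~ (s < x < t) by apply/negP => h; apply: nx; right.
      have ny' : ~~ (s < y < t) by apply/negP => h; apply: ny; right.
      case/andP: ov => xt sy.
      have xs : x <= s by move: nx'; rewrite xt andbT -leNgt.
      have ty : t <= y by move: ny'; rewrite sy /= -leNgt.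
      have xs' : x = s.
        apply/eqP; rewrite eq_le xs /= leNgt; apply/negP => h.
        have [//|/=] : U' s by apply: H; rewrite h.
        by rewrite ltxx.
      have ty' : t = y.
        apply/eqP; rewrite eq_le ty /= leNgt; apply/negP => h.
        have [//|/=] : U' t by apply: H; rewrite h andbT xs'.
        by rewrite ltxx andbF.
      by rewrite xs' -ty'.
    apply: gU => //; [by move=> h; apply: nx; left | by move=> h; apply: ny; left |].
    move=> u uxy; have [//|/= ust] := H u uxy; move/negP: nov; case.
    by apply/andP; split; xlra.
  move=> u su; apply: contrapT => nUu; apply: (mU U') E; split; first by move=> v; left.
  by move=> /(_ u) K; apply: nUu; apply: K; right.
(* [alpha t] is the last remaining parameter up to [t]. *)
have alphaP t : exists a, 0 <= t <= 1 -> [/\ 0 <= a <= t, ~ U a & forall s, a < s <= t -> U s].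
  have [/andP[t0 t1]|n] := boolP (0 <= t <= 1); last by exists 0.
  by have [a Ha] := gap_max oU t0 nU0; exists a.
have [alpha Ha] := choice alphaP.
pose g t := f (alpha (clamp 0 1 t)).
have gE t : ~ U t -> 0 <= t <= 1 -> g t = f t.
  move=> nUt t01; rewrite /g clamp_id //; congr f.
  have [/andP[h1 h2] h3 h4] := Ha t t01; apply/eqP; rewrite eq_le h2 leNgt; apply/negP => h.
  by apply: nUt; apply: h4; rewrite h lexx.
have g0 : g 0 = f 0 by apply: gE => //; exact: itv0.
have g1 : g 1 = f 1 by apply: gE => //; exact: itv1.
have ahomo s t : 0 <= s -> s <= t -> t <= 1 -> alpha s <= alpha t.
  move=> s0 st t1; have [|/andP[h1 h2] h3 h4] := Ha s; first by rewrite s0 (le_trans st).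
  have [|/andP[k1 k2] k3 k4] := Ha t; first by rewrite t1 (le_trans s0).
  rewrite leNgt; apply/negP => h; apply: h3; apply: k4; rewrite h; exact: le_trans st.
(* Since [f] takes equal values at the ends of an erased interval, an increment of [f] along [alpha]
   is an increment of [f] between two parameters of [[s, t]]; this gives the continuity of [g]. *)
have gap s t : 0 <= s -> s <= t -> t <= 1 ->
    exists u v, [/\ s <= u <= t, s <= v <= t & f (alpha s) - f (alpha t) = f u - f v].
  move=> s0 st t1; have [|/andP[h1 h2] h3 h4] := Ha s; first by rewrite s0 (le_trans st).
  have [|/andP[k1 k2] k3 k4] := Ha t; first by rewrite t1 (le_trans s0).
  have [h|h] := leP (alpha t) s.
    exists s, s; rewrite !lexx st; split => //; rewrite subrr; apply/eqP; rewrite subr_eq0; apply/eqP.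
    congr f; apply/eqP; rewrite eq_le ahomo //= leNgt; apply/negP => h'.
    by apply: k3; apply: h4; rewrite h' h.
  have [u [/andP[u1 u2] nUu Hu]] := gap_min oU (ltW h) k3.
  exists u, (alpha t); rewrite u1 (le_trans u2 k2) k2 (ltW h); split => //; congr (_ - _).
  have [e|e] := eqVneq (alpha s) u; first by rewrite e.
  have su : alpha s < u by rewrite lt_neqAle e (le_trans h2).
  apply: gU => //; [exact: le_trans (le_trans u2 k2) t1 |].
  move=> w /andP[w1 w2]; have [ws|sw] := leP w s; first by apply: h4; rewrite w1.
  by apply: Hu; rewrite (ltW sw).
have cg : continuous g.
  move=> t; apply/ct_epsP => e e0; have e2 : 0 < e / 2 by rewrite divr_gt0.
  have [d d0 Hd] := (iffLR (ct_epsP _ _) (@cf (clamp 0 1 t))) _ e2.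
  exists d => // s ts; have := clamp_lip t s.
  have /andP[t0 t1] := clamp_itv t (@ler01 R); have /andP[s0 s1] := clamp_itv s (@ler01 R).
  rewrite /g; move: (clamp 0 1 t) (clamp 0 1 s) t0 t1 s0 s1 Hd => a b a0 a1 b0 b1 Hd /le_lt_trans /(_ ts) ab.
  have [u [v [uu vv ->]]] : exists u v, [/\ `|a - u| < d, `|a - v| < d & f (alpha a) - f (alpha b) = f u - f v].
    have near w : Num.min a b <= w <= Num.max a b -> `|a - w| < d.
      move=> wb; move: ab; rewrite !ltr_norml => /andP[h1 h2]; move: wb.
      by rewrite ge_min le_max => /andP[/orP[h3|h3] /orP[h4|h4]]; apply/andP; split; xlra.
    have [h|/ltW h] := leP a b.
      have [u [v [uu vv E]]] := gap a b a0 h b1; exists u, v; split => //; apply: near.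
        by case/andP: uu => k1 k2; rewrite ge_min k1 le_max k2 orbT.
      by case/andP: vv => k1 k2; rewrite ge_min k1 le_max k2 orbT.
    have [u [v [uu vv E]]] := gap b a b0 h a1; exists v, u; split.
    - by apply: near; case/andP: vv => k1 k2; rewrite ge_min k1 le_max k2 orbT.
    - by apply: near; case/andP: uu => k1 k2; rewrite ge_min k1 le_max k2 orbT.
    by rewrite -opprB E opprB.
  have -> : f u - f v = (f a - f v) - (f a - f u) by rewrite opprB [RHS]addrC subrKA.
  rewrite (le_lt_trans (ler_normB _ _)) // [ltRHS](splitr e) ltrD //; exact: Hd.
have [||A [aA AE]] := reparam_injective cg.
- by rewrite g0 g1.
- move=> s t u /andP[su ut]; rewrite !IE => s01 t01.
  have u01 : 0 <= u <= 1 by xlra.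
  rewrite /g !clamp_id // => e.
  have [h|h] := leP (alpha t) (alpha s).
    have {h} : alpha u = alpha s; last by move->.
    by apply/eqP; rewrite eq_le; apply/andP; split; [apply: le_trans h|]; apply: ahomo; xlra.
  have [/andP[h1 h2] h3 h4] := Ha s s01; have [/andP[k1 k2] k3 k4] := Ha t t01.
  have [/andP[l1 l2] l3 l4] := Ha u u01.
  have K := loopU _ _ h h1 (le_trans k2 (proj2 (andP t01))) h3 k3 e.
  have a1 : alpha s <= alpha u by apply: ahomo; xlra.
  have a2 : alpha u <= alpha t by apply: ahomo; xlra.
  have [e1|n1] := eqVneq (alpha s) (alpha u); first by rewrite e1.
  have [e2|n2] := eqVneq (alpha u) (alpha t); first by rewrite e2 e.
  by case: l3; apply: K; rewrite !lt_neqAle n1 n2 a1 a2.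
exists A; rewrite -g0 -g1; split => // x /AE [t It <-].
exists (alpha (clamp 0 1 t)) => //.
have := Ha _ (clamp_itv t (@ler01 R)); have := clamp_itv t (@ler01 R); rewrite IE => /andP[c0 c1] [/andP[h1 h2] _ _].
by rewrite h1 (le_trans h2).
Qed.
End LoopErasure.

End Reparametrization.

(** * Crosscuts *)

Section Crosscuts.
Context (R : realType).
Notation P := (R * R)%type.
Notation I := (unit_interval R).
Implicit Types (J X : set P) (p q x y z : P).

Lemma joined_within (V : normedModType R) (U : set V) (x y : V) : joined U x y ->
  joined [set w | joined U x w] x y.
Proof.
move=> [f [cf Uf <- <-]]; apply: joined_path => // t /andP[t0 _].
exact: joined_subpath.
Qed.

Lemma joined_inside J x y : jordan J -> inside J x -> inside J y -> joined (inside J) x y.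
Proof.
move=> jJ ix iy; apply: joined_sub (joined_within (jordan_int_joined jJ ix iy)).
by move=> w /= h; exact: joined_int h ix.
Qed.

Lemma in_or_out X z : [\/ X z, inside X z | outside X z].
Proof.
have [|nX] := pselect (X z); first by constructor 1.
by have [|no] := pselect (outside X z); [constructor 3 | constructor 2].
Qed.

Lemma outside_not_inside X z : outside X z -> ~ inside X z.
Proof. by move=> h []. Qed.

(** From a point beyond all of the curve in the direction [v], the ray in this direction leads to
    infinity. *)
Lemma halfplane_inside J (H : P -> R) (v : P) z : compact J -> v != 0 ->
  (forall w t, H (w + t *: v) = H w + t) -> inside J z -> exists2 x, J x & H z <= H x.
Proof.
move=> kJ v0 HD [nJz noz]; apply: contrapT => n; apply: noz; split=> // N.
have lt x : J x -> H x < H z by move=> Jx; rewrite ltNge; apply/negP => h; apply: n; exists x.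
have vp : 0 < `|v| by rewrite normr_gt0.
pose t := (Num.max N 0 + `|z| + 1) / `|v|.
have t0 : 0 <= t by rewrite divr_ge0 // !addr_ge0 // le_max lexx orbT.
exists (z + t *: v).
  apply: joined_segment => s /andP[s0 s1] Jx; have := lt _ Jx.
  rewrite (_ : z + t *: v - z = t *: v); last by rewrite addrC addKr.
  have st : 0 <= s * t by rewrite mulr_ge0.
  by rewrite scalerA HD ltNge lerDl st.
have : `|t *: v| <= `|z + t *: v| + `|z| by rewrite -{1}(addrK z (t *: v)) [X in `|X - _|]addrC ler_normB.
rewrite normrZ ger0_norm // /t mulfVK ?gt_eqF //.
have : N <= Num.max N 0 by rewrite le_max lexx.
move=> h1 h2; xlra.
Qed.

Lemma arc_interior (V : normedModType R) (A : set V) (p q : V) : arc A p q ->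
  exists r, [/\ A r, r <> p & r <> q].
Proof.
move=> [f [cf fi fA [f0 f1]]]; have h : I 2^-1 by rewrite IE; apply/andP; split; xlra.
exists (f 2^-1); split; first by rewrite fA; exists 2^-1.
  by rewrite -f0 => /(fi _ _ h (I0 R)) e; xlra.
by rewrite -f1 => /(fi _ _ h (I1 R)) e; xlra.
Qed.

Definition crosscut J C p q := [/\ arc C p q, J p, J q & forall z, C z -> [\/ inside J z, z = p | z = q]].

Lemma crosscut_jarcs J A B C p q : jarcs J A B p q -> crosscut J C p q -> jarcs (A `|` C) A C p q.
Proof.
move=> [aA aB AB JE] [aC _ _ CJ]; split=> // z [Az /CJ []]; [|by left|by right].
by case; rewrite JE => n _; case: n; left.
Qed.

(** Paths outside of [J] miss [A] and [C], so the outside only grows. A point of [J] in the open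
    inside of the new curve would have outside points of [J] nearby. *)
Lemma crosscut_inside_sub J A B C p q : jarcs J A B p q -> crosscut J C p q ->
  inside (A `|` C) `<=` inside J `\` C.
Proof.
move=> jJ cC; have j1 := crosscut_jarcs jJ cC.
case: (jJ) (cC) => aA aB AB JE [aC Jp Jq CJ].
have jorJ : jordan J by exists A, B, p, q.
have jor1 : jordan (A `|` C) by exists A, C, p, q.
have oo z : outside J z -> outside (A `|` C) z.
  move=> oz; have sub w : outside J w -> ~ (A `|` C) w.
    move=> ow [Aw|/CJ [iw|e|e]]; first by case: ow; rewrite JE => n _; apply: n; left.
    - exact: outside_not_inside ow iw.
    - by move: ow; rewrite e => -[].
    - by move: ow; rewrite e => -[].
  split; first exact: sub.
  move=> N; have [nJ /(_ N) [y jy yN]] := oz; exists y => //.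
  by apply: joined_sub (joined_within jy) => w /= jw; apply: sub; exact: joined_ext jw oz.
move=> z iz; split; last by move=> Cz; case: iz => n _; apply: n; right.
have [Jz||] := in_or_out J z => //; last by move/oo/outside_not_inside.
have [d d0 Hd] := (iffLR (open_epsP _) (@int_open R _ (compact_closedP (jordan_compact jor1)))) z iz.
have [_ [y oy zy]] := jordan_frontier jorJ Jz d0.
by case: (outside_not_inside (oo _ oy)); exact: Hd.
Qed.

(** If the two insides met, the first would be contained in the second by connectedness; then an
    inner point of [A], a limit of the first, would be in the closure of the second. *)
Lemma crosscut_inside_disjoint J A B C p q z : jarcs J A B p q -> crosscut J C p q ->
  inside (A `|` C) z -> inside (B `|` C) z -> False.
Proof.
move=> jJ cC iz1 iz2; have j1 := crosscut_jarcs jJ cC.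
have s1 := crosscut_inside_sub jJ cC; have s2 := crosscut_inside_sub (jarcs_swap jJ) cC.
have jor1 : jordan (A `|` C) by exists A, C, p, q.
have jor2 : jordan (B `|` C) by exists B, C, p, q; exact: crosscut_jarcs (jarcs_swap jJ) cC.
case: (jJ) (cC) => aA aB AB JE [aC Jp Jq CJ].
have sub w : inside (A `|` C) w -> inside (B `|` C) w.
  move=> iw; apply: joined_int iz2; apply: joined_sub (joined_inside jor1 iz1 iw) => u iu.
  by have [[nJ _] nC] := s1 u iu; move=> [Bu|//]; apply: nJ; rewrite JE; right.
have [a [Aa ap aq]] := arc_interior aA.
have ca : closure (inside (B `|` C)) a.
  move=> W /nbhs_ballP [d d0 Hd].
  have [[y iy ay] _] := jordan_frontier jor1 (or_introl Aa : (A `|` C) a) d0.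
  by exists y; split; [exact: sub | apply: Hd; rewrite -ball_normE].
have [/s2 [[nJ _] _]|[Ba|/CJ [[nJ _]|//|//]]] := closure_int (compact_closedP (jordan_compact jor2)) ca.
- by apply: nJ; rewrite JE; left.
- by have [|] := AB a (conj Aa Ba).
by apply: nJ; rewrite JE; left.
Qed.

(** A point outside of both curves could be joined to infinity off their union by Janiszewski's
    theorem, as the two curves meet in the connected set [C]. *)
Lemma crosscut_cover J A B C p q z : jarcs J A B p q -> crosscut J C p q -> inside J z ->
  [\/ C z, inside (A `|` C) z | inside (B `|` C) z].
Proof.
move=> jJ cC iz; case: (jJ) (cC) => aA aB AB JE [aC Jp Jq CJ].
have jor1 : jordan (A `|` C) by exists A, C, p, q; exact: crosscut_jarcs jJ cC.
have jor2 : jordan (B `|` C) by exists B, C, p, q; exact: crosscut_jarcs (jarcs_swap jJ) cC.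
have [|nC] := pselect (C z); first by constructor 1.
have [[Az|//]||o1] := in_or_out (A `|` C) z; first by case: iz; rewrite JE => n _; case: n; left.
  by constructor 2.
have [[Bz|//]||o2] := in_or_out (B `|` C) z; first by case: iz; rewrite JE => n _; case: n; right.
  by constructor 3.
exfalso; apply: (outside_not_inside _ iz).
split; first by case: iz.
move=> N; have k1 := jordan_compact jor1; have k2 := jordan_compact jor2.
have [N1 N10 B1] := compact_bounded_by k1; have [N2 N20 B2] := compact_bounded_by k2.
pose M := Num.max N (Num.max N1 N2).
have [MN MN1 MN2] : [/\ N <= M, N1 <= M & N2 <= M] by rewrite /M !le_max !lexx !orbT.
have [y yM] : exists y : P, M < `|y|.
  have M0 : 0 < M by apply: lt_le_trans MN1.
  by exists ((M + 1), 0); rewrite prod_normE /= normr0 lt_max ger0_norm ?ltrDl //; xlra.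
exists y; last exact: le_lt_trans yM.
have o1y : outside (A `|` C) y by apply: ext_far B1 _; [exact: ltW | exact: le_lt_trans yM].
have o2y : outside (B `|` C) y by apply: ext_far B2 _; [exact: ltW | exact: le_lt_trans yM].
have K : joined (~` ((A `|` C) `|` (B `|` C))) z y.
  apply: rotlift_joined.
  - by apply: compactU.
  - by case=> [] => [h|h]; [case: o1|case: o2].
  - by case=> [] => [h|h]; [case: o1y|case: o2y].
  apply: janiszewski => //.
  - by case: o2y.
  - have e : (A `|` C) `&` (B `|` C) = C.
      apply/seteqP; split=> [w [[Aw|//] [Bw|//]]|w Cw]; last by split; right.
      by have [->|->] := AB w (conj Aw Bw); [exact: arc_l aC | exact: arc_r aC].
    by rewrite e => x x' Cx Cx'; exact: arc_joined aC Cx Cx'.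
  - by apply: joined_rotlift; [exact: compact_closedP | exact: ext_joined].
  - by apply: joined_rotlift; [exact: compact_closedP | exact: ext_joined].
apply: joined_sub K => w nw; rewrite JE => -[h|h]; apply: nw; [left|right]; by left.
Qed.

Lemma jordan_rest J r e : jordan J -> J r -> 0 < e -> exists B : set P,
  [/\ compact B, B `<=` J /\ B !=set0, ~ B r,
      forall x y, B x -> B y -> joined B x y & forall z, J z -> B z \/ `|r - z| < e].
Proof.
move=> jJ Jr e0.
have [q [A [B jab]]] : exists q A B, jarcs J A B r q.
  have [A [B [p' [q' j]]]] := jJ.
  have [pp'|npp'] := pselect (r = p').
    by exists q', A, B; rewrite pp'.
  have [A' [B' j']] := jarcs_move j Jr npp'; exists p', A', B'; exact: jarcs_sym.
have [aA aB AB JE] := jab.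
have [A' [p1 [aA' sA nA HA]]] := arc_trim aA e0.
have [B' [p2 [aB' sB nB HB]]] := arc_trim aB e0.
have qA := arc_r aA'; have qB := arc_r aB'.
exists (A' `|` B'); split.
- by apply: compactU; [exact: arc_compact aA' | exact: arc_compact aB'].
- by rewrite JE; split=> [z [/sA|/sB]|]; [left|right|exists q; left].
- by case.
- have toq z : (A' `|` B') z -> joined (A' `|` B') z q.
    move=> [h|h].
      by apply: joined_sub (arc_joined aA' h qA); left.
    by apply: joined_sub (arc_joined aB' h qB); right.
  by move=> z w hz hw; exact: joined_trans (toq _ hz) (joined_sym (toq _ hw)).
by rewrite JE => z [/HA|/HB] [h|h]; [left; left|right|left; right|right].
Qed.

(** Janiszewski's theorem for [J] and the union of [B] with the sphere [S] of radius [e]: the points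
    of [J] on the sphere belong to [B], so the intersection is the connected set [B]. *)
Lemma jordan_ulc J p e : jordan J -> J p -> 0 < e -> exists2 d, 0 < d &
  forall x y, inside J x -> inside J y -> `|p - x| < d -> `|p - y| < d ->
    joined [set z | inside J z /\ `|p - z| < e] x y.
Proof.
move=> jJ Jp e0; have [B [kB [BJ _] nBp jB HB]] := jordan_rest jJ Jp e0.
pose S := [set z : P | `|p - z| = e].
have kS : compact S.
  apply: (@compact_of_closed_bounded _ _ (`|p| + e)).
    apply: (@preimage_closed _ _ (fun z : P => `|p - z|) [set e]); first by move=> z _; cont.
    exact: closed_eq.
  by move=> z <-; rewrite -{1}(subKr p z) [leLHS](_ : _ = `|p - (p - z)|) // ler_normB.
have [d1 d10 Hd1] := (iffLR (open_epsP _) (closed_openC (compact_closedP kB))) p nBp.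
exists (Num.min d1 e); first by rewrite lt_min d10.
move=> x y ix iy xd yd.
have nball z : `|p - z| < Num.min d1 e -> ~ (S `|` B) z.
  by rewrite lt_min => /andP[h1 h2] [h|]; [move: h2; rewrite h ltxx | exact: Hd1].
have J1 : joined (~` (J `|` (S `|` B))) x y.
  have nx := nball x xd; have ny := nball y yd; have kJ := jordan_compact jJ.
  apply: rotlift_joined; first by apply: compactU => //; exact: compactU.
  - by case=> // h; case: ix.
  - by case=> // h; case: iy.
  apply: janiszewski => //; first exact: compactU.
  - have -> // : J `&` (S `|` B) = B.
    apply/seteqP; split=> [z [Jz [Sz|//]]|z Bz]; last by split; [exact: BJ | right].
    by have [//|] := HB z Jz; rewrite Sz ltxx.
  - apply: joined_rotlift; first exact: compact_closedP.
    exact: jordan_int_joined.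
  - apply: joined_rotlift; first by apply: compact_closedP; apply: compactU.
    have jp w : `|p - w| < Num.min d1 e -> joined (~` (S `|` B)) p w.
      by apply: joined_ball => z /nball.
    exact: joined_trans (joined_sym (jp x _)) (jp y _).
have := joined_within J1; apply: joined_sub => w /= jw; split.
  by apply: joined_int ix; apply: joined_sub jw => z nz Jz; apply: nz; left.
have [_ xe] : `|p - x| < d1 /\ `|p - x| < e by move: xd; rewrite lt_min => /andP[].
apply: (@joined_ind R _ (~` (J `|` (S `|` B))) [set z | `|p - z| < e] x w) => // u nu.
have ue : `|p - u| != e by apply/eqP => h; apply: nu; right; left.
have : 0 < `| `|p - u| - e| by rewrite normr_gt0 subr_eq0.
move=> h; exists (`| `|p - u| - e|) => // v _ uv /=.
have h1 : `|p - u| <= `|p - v| + `|u - v|.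
  by rewrite (_ : p - u = (p - v) - (u - v)) ?ler_normB // opprB addrA subrK.
have h2 : `|p - v| <= `|p - u| + `|u - v|.
  by rewrite (_ : p - v = (p - u) + (u - v)) ?ler_normD // addrA subrK.
move: uv; have [k|k|k] := ltgtP `|p - u| e.
- rewrite ltr0_norm ?subr_lt0 // opprB => uv; split=> _ //; xlra.
- rewrite gtr0_norm ?subr_gt0 // => uv; split=> h'; xlra.
- by move: ue; rewrite k eqxx.
Qed.

(** * Infinite concatenations of paths *)

Section InfinitePath.
Context (V : normedModType R) (W : set V) (p : V) (x : nat -> V) (U : nat -> set V).
Hypothesis jU : forall n, joined (U n) (x n) (x n.+1).
Hypothesis UW : forall n, U n `<=` W.
Hypothesis Up : forall e : R, 0 < e -> exists N, forall n (z : V), (N <= n)%N -> U n z -> `|p - z| < e.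

(** The first [n] paths, one per unit of time, followed by rest at [x n]. *)
Fixpoint stitch (c : nat -> R -> V) (n : nat) : R -> V := if n is m.+1
  then fun t => stitch c m t + (c m (clamp 0 1 (t - m%:R)) - x m) else fun=> x 0%N.

Lemma joined_limit : joined (W `|` [set p]) (x 0%N) p.
Proof.
have [c Hc] := choice jU.
have cc n : continuous (c n) by have [] := Hc n.
have cU n t : U n (c n t) by have [] := Hc n.
have c0 n : c n 0 = x n by have [] := Hc n.
have c1 n : c n 1 = x n.+1 by have [] := Hc n.
have cg n : continuous (stitch c n).
  by elim: n => [|n IH] /= t; [cont | apply: ctD; [exact: IH | cont]].
have g_stop n m t : t <= n%:R -> stitch c (n + m) t = stitch c n t.
  move=> tn; elim: m => [|m IH]; first by rewrite addn0.
  by rewrite addnS /= IH clamp_le ?c0 ?subrr ?addr0 // subr_le0 (le_trans tn) // ler_nat leq_addr.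
have g_val n t : n%:R <= t -> stitch c n t = x n.
  elim: n t => [//|n IH] t nt /=; rewrite IH; last by rewrite (le_trans _ nt) // ler_nat.
  have t1 : 1 <= t - n%:R by move: nt; rewrite -natr1 => nt; hlra.
  by rewrite clamp_ge // c1 addrC subrK.
have Nex (t : R) : exists n : nat, t <= n%:R.
  exists (Num.bound `|t|).
  by rewrite (le_trans (ler_norm t)) // ltW // archi_boundP.
have [N HN] := choice Nex.
pose G t := stitch c (N t) t.
have GE n t : t <= n%:R -> G t = stitch c n t.
  move=> tn; rewrite /G; have [h|/ltnW h] := leqP (N t) n.
    by rewrite -(subnKC h) g_stop.
  by rewrite -(subnKC h) g_stop.
have cG : continuous G.
  move=> t; apply/ct_epsP => e e0; have [d d0 Hd] := (iffLR (ct_epsP _ _) (cg (N t).+1 t)) e e0.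
  exists (Num.min d 1); first by rewrite lt_min d0 ltr01.
  move=> s; rewrite lt_min => /andP[ts1 ts2].
  have tN := HN t; rewrite (GE (N t).+1 t) 1?(GE (N t).+1 s); first exact: Hd.
    by move: ts2; rewrite ltr_norml -natr1 => /andP[*]; hlra.
  by rewrite -natr1; hlra.
have GU K t : K%:R <= t -> exists2 n, (K <= n)%N & U n (G t).
  move=> Kt; have [m Hm] : exists m : nat, t <= (K + m)%:R.
    by exists (N t); rewrite (le_trans (HN t)) // ler_nat leq_addl.
  elim: m Hm => [|m IH] Hm.
    exists K => //; rewrite addn0 in Hm; rewrite (GE _ _ Hm) g_val // -c0; exact: cU.
  have [h|/ltW h] := leP t (K + m)%:R; first exact: IH.
  exists (K + m)%N; first exact: leq_addr.
  by rewrite (GE _ _ Hm) addnS /= g_val // addrC subrK; exact: cU.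
(* Infinite time is compressed to [s = 0], the time at parameter [s] being [s^-1 - 1]. *)
pose f s := if s <= 0 then p else G (Num.max 0 (s^-1 - 1)).
apply: joined_sym; exists f; split.
- move=> s; apply/ct_epsP => e e0; have [s0|s0|s0] := ltgtP s 0.
  + exists (- s); first by rewrite oppr_gt0.
    move=> t; rewrite ltr_norml => /andP[h1 h2].
    by rewrite /f (ltW s0) ifT ?subrr ?normr0 //; hlra.
  + have cGi : continuous_at s (fun s => G (Num.max 0 (s^-1 - 1))).
      by apply: ct_comp => //; cont; rewrite gt_eqF.
    have [d d0 Hd] := (iffLR (ct_epsP _ _) cGi) e e0.
    exists (Num.min d s); first by rewrite lt_min d0.
    move=> t; rewrite lt_min => /andP[h1]; rewrite ltr_norml => /andP[h2 h3].
    rewrite /f leNgt s0 /= leNgt (_ : 0 < t) /=; last by hlra.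
    exact: Hd.
  + have [K HK] := Up e0; exists (K.+1%:R^-1); first by rewrite invr_gt0.
    move=> t; rewrite /f s0 lexx sub0r normrN => tK.
    have [t0|t0] := leP t 0; first by rewrite subrr normr0.
    rewrite ger0_norm ?(ltW t0) // in tK.
    have [|n Kn Un] := GU K (Num.max 0 (t^-1 - 1)); last exact: HK Un.
    rewrite le_max; apply/orP; right; rewrite lerBrDr natr1 -[leLHS]invrK lef_pV2 ?posrE ?invr_gt0 ?ltW //.
- move=> t; rewrite /f; case: ifP => _; first by right.
  have [|n _ Un] := GU 0%N (Num.max 0 (t^-1 - 1)); first by rewrite le_max lexx.
  by left; exact: UW Un.
- by rewrite /f lexx.
by rewrite /f leNgt ltr01 /= invr1 subrr maxxx (GE 0%N).
Qed.
End InfinitePath.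

(** Uniform local connectedness joins the consecutive points of a sequence tending to [p] by paths
    inside the curve that shrink to [p]. *)
Lemma jordan_accessible J p : jordan J -> J p ->
  exists2 x, inside J x & joined (inside J `|` [set p]) x p.
Proof.
move=> jJ Jp.
have ulc n : exists d : R, 0 < d /\ forall x y, inside J x -> inside J y -> `|p - x| < d -> `|p - y| < d ->
    joined [set z | inside J z /\ `|p - z| < n.+1%:R^-1] x y.
  by have [|d d0 Hd] := @jordan_ulc J p (n.+1%:R^-1) jJ Jp; [rewrite invr_gt0 | exists d].
have [d Hd] := choice ulc.
(* Close enough to [p] to be joined by short paths to both neighbours in the sequence; for [n = 0]
   the second bound repeats the first. *)
have xex n : exists x, inside J x /\ `|p - x| < Num.min (d n) (d n.-1).
  have [|[x ix px] _] := jordan_frontier jJ Jp (_ : 0 < Num.min (d n) (d n.-1)); last by exists x.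
  by rewrite lt_min !(Hd _).1.
have [x Hx] := choice xex.
exists (x 0%N); first exact: (Hx _).1.
apply: (@joined_limit _ (inside J) p x (fun n => [set z | inside J z /\ `|p - z| < n.+1%:R^-1])).
- move=> n; have [_ K] := Hd n; apply: K; [exact: (Hx _).1 | exact: (Hx _).1 | |].
    by have [_] := Hx n; rewrite lt_min => /andP[].
  by have [_] := Hx n.+1; rewrite lt_min => /andP[].
- by move=> n z [].
move=> e e0; exists (Num.bound e^-1) => n z Nn [_ /lt_trans]; apply.
rewrite -[ltRHS]invrK ltf_pV2 ?posrE ?invr_gt0 //.
have e1 : 0 <= e^-1 by rewrite invr_ge0 ltW.
by rewrite (lt_trans (archi_boundP e1)) // ltr_nat ltnS.
Qed.

(** Both ends are accessible from the inside, and the resulting path contains an arc. *)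
Lemma crosscut_exists J p q : jordan J -> J p -> J q -> p <> q -> exists C, crosscut J C p q.
Proof.
move=> jJ Jp Jq pq; have [x ix jx] := jordan_accessible jJ Jp.
have [y iy jy] := jordan_accessible jJ Jq.
pose W z := [\/ inside J z, z = p | z = q].
have [f [cf Wf f0 f1]] : joined W p q.
  apply: joined_trans (joined_sub _ (joined_sym jx)) _; first by move=> z [|->]; [constructor 1 | constructor 2].
  apply: joined_trans (joined_sub _ (joined_inside jJ ix iy)) (joined_sub _ jy); first by constructor 1.
  by move=> z [|->]; [constructor 1 | constructor 3].
have [|A [aA AI]] := path_to_arc cf; first by rewrite f0 f1.
by exists A; split => //; [rewrite -f0 -f1|move=> z /AI [t _ <-]; exact: Wf].
Qed.

End Crosscuts.

(** * Chords on a line *)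

Section SeparatingChords.
Context (R : realType).
Notation P := (R * R)%type.
Notation I := (unit_interval R).
Implicit Types (J K X : set P) (p q x y z : P).

Lemma within_epsP (V W : normedModType R) (X : set V) (f : V -> W) :
  (forall z : V, X z -> forall e : R, 0 < e -> exists2 d : R, 0 < d &
    forall w : V, X w -> `|z - w| < d -> `|f z - f w| < e) -> {within X, continuous f}.
Proof.
move=> Hf; apply/subspace_continuousP => z Xz; apply/cvgrPdist_lt => e e0.
have [d d0 Hd] := Hf z Xz e e0; rewrite /prop_near1 /within /=.
by apply/nbhs_ballP; exists d => // w; rewrite -ball_normE => zw Xw; exact: Hd.
Qed.

Lemma jordan_joined (V : normedModType R) (J : set V) (p q : V) : jordan J -> J p -> J q -> joined J p q.
Proof.
move=> [A [B [a [b [aA aB AB ->]]]]].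
have K (z : V) : (A `|` B) z -> joined (A `|` B) a z.
  move=> [h|h].
    by apply: joined_sub (arc_joined aA (arc_l aA) h); left.
  by apply: joined_sub (arc_joined aB (arc_l aB) h); right.
by move=> /K h1 /K; exact: joined_trans (joined_sym h1).
Qed.

Lemma arg_diff_int p q (g : P) (s t : R) : g != q -> sdir (g - p) (cmul (cis s) (g - q)) ->
  sdir (g - p) (cmul (cis t) (g - q)) -> exists n : int, s - t = n%:~R.
Proof.
move=> gq h1 h2; have [n ->] : exists n : int, s = t + n%:~R; last by exists n; ring.
apply: sdir_cis; apply: (@sdir_cancel _ (g - q)); first by rewrite subr_eq0.
by rewrite ![cmul (g - q) _]cmulC; exact: sdir_trans (sdir_sym h1) h2.
Qed.

Lemma lift_diff_const X p q (th1 th2 : P -> R) x y : ~ X q -> continuous th1 -> continuous th2 ->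
  (forall z, X z -> sdir (z - p) (cmul (cis (th1 z)) (z - q))) ->
  (forall z, X z -> sdir (z - p) (cmul (cis (th2 z)) (z - q))) ->
  joined X x y -> th1 x - th2 x = th1 y - th2 y.
Proof.
move=> nq c1 c2 H1 H2 [f [cf Uf <- <-]].
apply: (@integer_valued_const R (fun t => th1 (f t) - th2 (f t))); first by cont.
move=> t _; apply: (@arg_diff_int p q (f t)); [|exact: H1|exact: H2].
by apply/eqP => e; apply: nq; rewrite -e.
Qed.

Lemma int_close_eq (m n : int) : `|m%:~R - n%:~R| < 1 :> R -> m = n.
Proof.
rewrite -intrB -intr_norm ltrz1 => h; lia.
Qed.

(** Near [r], the part of the curve at distance [e / 2] or more from [r] lies in a connected set
    [B0] that misses both points, hence in only one of the two arcs; the other arc is small. *)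
Lemma small_arcs J e : jordan J -> 0 < e -> exists2 d, 0 < d & forall p q, J p -> J q ->
  p <> q -> `|p - q| < d -> exists A B, jarcs J A B p q /\ forall z, A z -> `|p - z| < e.
Proof.
move=> jJ e0; pose Q (d : R) p := forall q, J q -> p <> q -> `|p - q| < d ->
  exists A B, jarcs J A B p q /\ forall z, A z -> `|p - z| < e.
have [|||d d0 Hd] := @compact_unif R _ J Q; [exact: jordan_compact | | |by exists d => // p q Jp; exact: Hd].
  by move=> d d' p dd' H q Jq pq /lt_le_trans /(_ dd'); exact: H.
move=> r Jr; have e2 : 0 < e / 2 by rewrite divr_gt0.
have [B0 [kB [BJ [b0 Bb0]] nBr jB HB]] := jordan_rest jJ Jr e2.
have [d d0 Hd] := (iffLR (open_epsP _) (closed_openC (compact_closedP kB))) r nBr.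
have m0 : 0 < Num.min d e by rewrite lt_min d0.
exists (Num.min d e / 2); first by rewrite divr_gt0.
move=> p rp Jp q Jq pq pqd.
have [md me] : Num.min d e <= d /\ Num.min d e <= e by rewrite !ge_min !lexx orbT.
have nBp : ~ B0 p by apply: Hd; xlra.
have nBq : ~ B0 q.
  apply: Hd; rewrite (_ : r - q = (r - p) + (p - q)); last by rewrite addrA subrK.
  rewrite (le_lt_trans (ler_normD _ _)) //; xlra.
have [A [B [jab Bb]]] : exists A B, jarcs J A B p q /\ B b0.
  have [A [B j]] := jordan_split jJ Jp Jq pq; have [_ _ _ JE] := j.
  have : (A `|` B) b0 by rewrite -JE; exact: BJ.
  by move=> [h|h]; [exists B, A; split => //; exact: jarcs_swap | exists A, B].
exists A, B; split => // z Az; have [aA aB AB JE] := jab.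
have cA := compact_closedP (arc_compact aA); have cB := compact_closedP (arc_compact aB).
have BB w : B0 w -> B w.
  move=> Bw; apply: (joined_ind _ (jB _ _ Bb0 Bw) Bb) => u Bu.
  have [Buu|nBu] := pselect (B u).
    have nAu : ~ A u by move=> Au; have [h|h] := AB u (conj Au Buu); [apply: nBp|apply: nBq]; rewrite -h.
    have [d' d'0 Hd'] := (iffLR (open_epsP _) (closed_openC cA)) u nAu.
    by exists d' => // v /BJ; rewrite JE => -[Av /Hd'//|Bv _]; split.
  have [d' d'0 Hd'] := (iffLR (open_epsP _) (closed_openC cB)) u nBu.
  by exists d' => // v _ /Hd'.
have nBz : ~ B0 z.
  by move=> Bz; have [h|h] := AB z (conj Az (BB z Bz)); [apply: nBp|apply: nBq]; rewrite -h.
have Jz : J z by rewrite JE; left.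
have [//|rz] := HB z Jz.
rewrite (_ : p - z = (r - z) - (r - p)); last by rewrite opprB [RHS]addrC addrA subrK.
rewrite (le_lt_trans (ler_normB _ _)) //; xlra.
Qed.

Lemma count_ltn (I0 : eqType) (a b : pred I0) s : (forall i, a i -> b i) ->
  (exists2 i, i \in s & b i && ~~ a i) -> (count a s < count b s)%N.
Proof.
move=> ab [i + /andP[bi nai]]; elim: s => // k s IH; rewrite inE /= => /orP[/eqP<-|/IH h].
  by rewrite bi (negbTE nai) add0n add1n ltnS; exact: sub_count.
by rewrite -addnS leq_add //; case: (boolP (a k)) => [/ab->|].
Qed.

Section Coordinates.
Variables (H T : P -> R) (mk : R -> R -> P) (v : P).
(** Abstract coordinates let a single argument cover both horizontal and vertical lines: [H] is the
    level, [T] the position on a level, [mk] the point with given coordinates, and [v] the direction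
    in which the level grows. *)
Definition coordinates := [/\ continuous H, continuous T, v != 0,
  forall (w : P) (t : R), H (w + t *: v) = H w + t &
  [/\ forall z, mk (H z) (T z) = z, forall a b, H (mk a b) = a, forall a b, T (mk a b) = b,
      forall a b b', `|mk a b - mk a b'| = `|b - b'| & forall z, `|T z| <= `|z| /\ forall w, `|H z - H w| <= `|z - w|]].
Hypothesis C : coordinates.

Let cH : continuous H. Proof. by case: C. Qed.
Let cT : continuous T. Proof. by case: C. Qed.
Let v0 : v != 0. Proof. by case: C. Qed.
Let HD : forall (w : P) (t : R), H (w + t *: v) = H w + t. Proof. by case: C. Qed.
Let mkK z : mk (H z) (T z) = z. Proof. by case: C => _ _ _ _ []. Qed.
Let Hmk a b : H (mk a b) = a. Proof. by case: C => _ _ _ _ []. Qed.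
Let Tmk a b : T (mk a b) = b. Proof. by case: C => _ _ _ _ []. Qed.
Let mkd a b b' : `|mk a b - mk a b'| = `|b - b'|. Proof. by case: C => _ _ _ _ []. Qed.
Let Tle z : `|T z| <= `|z|. Proof. by case: C => _ _ _ _ [_ _ _ _ /(_ z) []]. Qed.
Let Hlip z w : `|H z - H w| <= `|z - w|. Proof. by case: C => _ _ _ _ [_ _ _ _ /(_ z) []]. Qed.
Let cmk a : continuous (mk a).
Proof. by move=> t; apply/ct_epsP => e e0; exists e => // s; rewrite mkd. Qed.

Definition chord J c a b := [/\ a < b, J (mk c a), J (mk c b) & forall t, a < t < b -> inside J (mk c t)].

Lemma mk_arc c a b : a < b -> arc (mk c @` `[a, b]) (mk c a) (mk c b).
Proof.
move=> ab; apply: arc_param => //.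
by move=> s t _ _ /(congr1 T); rewrite !Tmk.
Qed.

Lemma chord_crosscut J c a b : chord J c a b -> crosscut J (mk c @` `[a, b]) (mk c a) (mk c b).
Proof.
move=> [ab Ja Jb ins]; split => //; first exact: mk_arc.
move=> z [t]; rewrite /= in_itv /= => /andP[at_ tb] <-.
have [->|na] := eqVneq t a; first by constructor 2.
have [->|nb] := eqVneq t b; first by constructor 3.
by constructor 1; apply: ins; rewrite !lt_neqAle at_ tb eq_sym na nb.
Qed.

Lemma chord_through J c t : jordan J -> inside J (mk c t) -> exists a b, [/\ a < t, t < b & chord J c a b].
Proof.
move=> jJ it; have kJ := jordan_compact jJ; have clJ := compact_closedP kJ.
have [N N0 HN] := compact_bounded_by kJ.
have out s : N < `|s| -> outside J (mk c s).
  move=> h; apply: ext_far HN _; first exact: ltW.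
  by rewrite (lt_le_trans h) // -{1}(Tmk c s) Tle.
have oU : open [set s | ~ J (mk c s)].
  apply: (@open_comp _ _ (mk c) (~` J)); first by move=> s _; exact: cmk.
  exact: closed_openC.
have tN : `|t| <= N by rewrite leNgt; apply/negP => /out /outside_not_inside.
have /andP[tN1 tN2] : - N <= t <= N by rewrite -ler_norml.
have no s u : s <= u -> (forall w, s <= w <= u -> ~ J (mk c w)) -> joined (~` J) (mk c s) (mk c u).
  by move=> su Hw; apply: joined_subpath => // ?; exact: cmk.
have [a [at_ Ja Ha]] : exists a, [/\ a < t, J (mk c a) & forall s, a < s <= t -> ~ J (mk c s)].
  have [s [st Js]] : exists s, s <= t /\ J (mk c s).
    apply: contrapT => n; have oo : outside J (mk c (- N - 1)).
      by apply: out; rewrite ltr0_norm; hlra.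
    apply: (outside_not_inside _ it); apply: joined_ext oo; apply: no; first by hlra.
    by move=> w /andP[_ wt] Jw; apply: n; exists w.
  have [|a [/andP[sa at_] nJa Ha]] := gap_max oU st; first by move=> /(_ Js).
  have Ja : J (mk c a) by apply: contrapT.
  exists a; split => //; rewrite lt_neqAle at_ andbT; apply/eqP => e.
  by case: it => + _; apply; rewrite -e.
have [b [tb Jb Hb]] : exists b, [/\ t < b, J (mk c b) & forall s, t <= s < b -> ~ J (mk c s)].
  have [s [st Js]] : exists s, t <= s /\ J (mk c s).
    apply: contrapT => n; have oo : outside J (mk c (N + 1)).
      by apply: out; rewrite gtr0_norm; hlra.
    apply: (outside_not_inside _ it); apply: joined_ext oo; apply: joined_sym; apply: no; first by hlra.
    by move=> w /andP[tw _] Jw; apply: n; exists w.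
  have [|b [/andP[tb bs] nJb Hb]] := gap_min oU st; first by move=> /(_ Js).
  have Jb : J (mk c b) by apply: contrapT.
  exists b; split => //; rewrite lt_neqAle tb andbT; apply/eqP => e.
  by case: it => + _; apply; rewrite e.
exists a, b; split => //; split => //; first exact: lt_trans tb.
move=> s /andP[as_ sb]; have [h|/ltW h] := leP s t.
  apply: joined_int it; apply: joined_sym; apply: no => // w /andP[sw wt]; apply: Ha.
  by rewrite wt (lt_le_trans as_).
by apply: joined_int it; apply: no => // w /andP[tw ws]; apply: Hb; rewrite tw (le_lt_trans ws).
Qed.

Lemma joined_level U x y c : joined U x y -> H x < c -> c < H y -> exists2 z, joined U x z & H z = c.
Proof.
move=> [f [cf Uf <- <-]] xc cy.
have cHf : continuous (fun t => H (f t)) by move=> t; apply: (@ct_comp _ _ _ H f) => //; exact: cH.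
have [|t] := @IVT R (fun t => H (f t)) 0 1 c ler01 (continuous_subspaceT cHf).
  by rewrite min_l ?max_r ?(ltW (lt_trans xc cy)) // !ltW.
rewrite in_itv /= => /andP[t0 _] <-; exists (f t) => //.
exact: joined_subpath.
Qed.

(* By Eilenberg's criterion: if no chord separated x from y, then the change across each chord of
   the difference between an argument along J and one along the line would vanish, and the two
   arguments could be merged into one along J and all its chords. *)
Lemma separating_chord J c x y : jordan J -> inside J x -> inside J y -> H x < c -> c < H y ->
  exists a b, chord J c a b /\ ~ joined (~` (J `|` mk c @` `[a, b])) x y.
Proof.
move=> jJ ix iy xc cy; apply: contrapT => n.
have kJ := jordan_compact jJ; have clJ := compact_closedP kJ.
have [[nJx _] [nJy _]] := (ix, iy).
have [thJ cJ HJ] : rotlift J x y by apply: joined_rotlift => //; exact: jordan_int_joined.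
have [N N0 HN] := compact_bounded_by kJ.
have onY z s : H z != c -> z <> mk c s by move=> zc e; move: zc; rewrite e Hmk eqxx.
have [thY cY HY] : rotlift (mk c @` `[- N, N]) x y.
  apply: (@arc_rotlift R _ (mk c (- N)) (mk c N)); first by apply: mk_arc; hlra.
    by move=> [s _] /esym; apply: onY; rewrite lt_eqF.
  by move=> [s _] /esym; apply: onY; rewrite gt_eqF.
have YN t : J (mk c t) \/ inside J (mk c t) -> (mk c @` `[- N, N]) (mk c t).
  move=> h; exists t => //; rewrite /= in_itv /= -ler_norml -(Tmk c t) (le_trans (Tle _)) //.
  by case: h => [/HN//|/(int_bounded (ltW N0) HN)].
(* The difference of the argument along [J] and the one along the line, an integer wherever both are
   defined. *)
pose m t := thJ (mk c t) - thY (mk c t).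
have mZ t : J (mk c t) -> exists k : int, m t = k%:~R.
  move=> Jt; apply: (@arg_diff_int x y (mk c t)); [|exact: HJ|by apply: HY; apply: YN; left].
  by apply/eqP => e; apply: nJy; rewrite -e.
have mchord a b : chord J c a b -> m a = m b.
  move=> ch; have [ab Ja Jb ins] := ch.
  have nC z : H z != c -> ~ (mk c @` `[a, b]) z by move=> zc [s _] /esym; exact: onY.
  have [nCx nCy] : ~ (mk c @` `[a, b]) x /\ ~ (mk c @` `[a, b]) y.
    by split; apply: nC; rewrite ?(lt_eqF xc) ?(gt_eqF cy).
  have J1 : joined (~` (J `|` mk c @` `[a, b])) x y.
    by apply: contrapT => h; apply: n; exists a, b.
  have [|th cth Hth] := joined_rotlift _ J1.
    by apply: compact_closedP; apply: compactU => //; exact: (arc_compact (mk_arc c ab)).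
  have e1 : thJ (mk c a) - th (mk c a) = thJ (mk c b) - th (mk c b).
    by apply: (lift_diff_const nJy cJ cth HJ _ (jordan_joined jJ Ja Jb)) => z Jz; apply: Hth; left.
  have aC := mk_arc c ab.
  have e2 : thY (mk c a) - th (mk c a) = thY (mk c b) - th (mk c b).
    apply: (lift_diff_const nCy cY cth _ _ (arc_joined aC (arc_l aC) (arc_r aC))).
      move=> z [s]; rewrite /= in_itv /= => /andP[as_ sb] <-; apply: HY; apply: YN.
      have [->|na] := eqVneq s a; first by left.
      have [->|nb] := eqVneq s b; first by left.
      by right; apply: ins; rewrite !lt_neqAle as_ sb eq_sym na nb.
    by move=> z Cz; apply: Hth; right.
  by rewrite /m; move: e1 e2; set u := thJ _; set u' := thJ _; set w := thY _; set w' := thY _; move=> e1 e2; hlra.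
have [al Hal] : exists al : R -> R, forall t, inside J (mk c t) -> exists b, [/\ al t < t, t < b & chord J c (al t) b].
  have h t : exists a, inside J (mk c t) -> exists b, [/\ a < t, t < b & chord J c a b].
    have [it|nit] := pselect (inside J (mk c t)); last by exists 0.
    by have [a [b ?]] := chord_through jJ it; exists a; exists b.
  by have [al ?] := choice h; exists al.
(* On a chord, the argument along the line is shifted by the value of [m] at the left end, which is
   also the value at the right end. *)
pose th z := if `[<J z>] then thJ z else thY z + m (al (T z)).
pose K := J `|` [set z | inside J z /\ H z = c].
have thE1 z : J z -> th z = thJ z by move=> Jz; rewrite /th asboolT.
have thE2 z : inside J z -> th z = thY z + m (al (T z)) by move=> [nJz _]; rewrite /th asboolF.
have Kin z : K z -> J z \/ inside J z by case=> [|[]]; [left|right].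
have kK : compact K.
  apply: (@compact_of_closed_bounded _ _ N); last first.
    by move=> z /Kin [/HN//|/(int_bounded (ltW N0) HN)].
  have -> : K = ~` (outside J) `&` [set z | J z \/ H z = c].
    apply/seteqP; split=> [z [Jz|[iz zc]]|z [noz [Jz|zc]]].
    - by split; [case | left].
    - by split; [move/outside_not_inside | right].
    - by left.
    have [Jz|iz|//] := in_or_out J z; [by left | by right].
  apply: closedI; first by apply: open_closedC; exact: ext_open.
  apply: closedU => //; apply: (@preimage_closed _ _ H [set c]); last exact: closed_eq.
  by move=> z _; exact: cH.
have wth : {within K, continuous th}.
  apply: within_epsP => z Kz e e0.
  have [iz|niz] := pselect (inside J z).
    have zc : H z = c by case: Kz => [Jz|[]//]; case: iz.
    have ez : z = mk c (T z) by rewrite -zc mkK.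
    have [d1 d10 H1] := (iffLR (open_epsP _) (@int_open R _ clJ)) z iz.
    have [d2 d20 H2] := (iffLR (ct_epsP _ _) (cY z)) e e0.
    have [|b [ab1 ab2 [ab Ja Jb ins]]] := Hal (T z); first by rewrite -ez.
    have [d3 d30 H3] : exists2 d : R, 0 < d & forall w, `|z - w| < d -> al (T z) < T w < b.
      have e3 : 0 < Num.min (T z - al (T z)) (b - T z) by rewrite lt_min !subr_gt0 ab1.
      have [d d0 Hd] := (iffLR (ct_epsP _ _) (@cT z)) _ e3.
      by exists d => // w /Hd; rewrite lt_min !ltr_norml => /andP[/andP[h1 h2] /andP[h3 h4]]; apply/andP; split; hlra.
    exists (Num.min d1 (Num.min d2 d3)); first by rewrite !lt_min d10 d20.
    move=> w Kw; rewrite !lt_min => /and3P[w1 w2 w3].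
    have iw := H1 w w1; rewrite !thE2 //.
    have wc : H w = c by case: Kw => [Jw|[]//]; case: iw.
    have -> : al (T w) = al (T z).
      have [|b' [ab1' ab2' [ab' Ja' Jb' ins']]] := Hal (T w); first by rewrite -wc mkK.
      have /andP[h1 h2] := H3 w w3.
      have [h|h|//] := ltgtP (al (T w)) (al (T z)).
        by have [] := ins' (al (T z)); rewrite ?h ?(lt_trans h1) // => + _; case.
      by have [] := ins (al (T w)); rewrite ?h ?(lt_trans ab1') // => + _; case.
    by rewrite opprD addrACA subrr addr0; exact: H2.
  have Jz : J z by case/Kin: Kz.
  have e1 : 0 < Num.min e 2^-1 by rewrite lt_min e0 invr_gt0 ltr0n.
  have [d1 d10 H1] := (iffLR (ct_epsP _ _) (cJ z)) _ e1.
  have [zc|zc] := eqVneq (H z) c; last first.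
    have e2 : 0 < `|H z - c| by rewrite normr_gt0 subr_eq0.
    have [d2 d20 H2] := (iffLR (ct_epsP _ _) (@cH z)) _ e2.
    exists (Num.min d1 d2); first by rewrite lt_min d10.
    move=> w Kw; rewrite lt_min => /andP[w1 /H2 w2].
    have Jw : J w by case: Kw => [//|[_ wc]]; move: w2; rewrite wc ltxx.
    by rewrite !thE1 //; have := H1 w w1; rewrite lt_min => /andP[].
  have ez : z = mk c (T z) by rewrite -zc mkK.
  have [d2 d20 H2] := (iffLR (ct_epsP _ _) (cY z)) _ e1.
  have d0 : 0 < Num.min d1 d2 by rewrite lt_min d10.
  have [d3 d30 H3] := (iffLR (ct_epsP _ _) (@cT z)) _ d0.
  exists (Num.min d1 (Num.min d2 d3)); first by rewrite !lt_min d10 d20.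
  move=> w Kw; rewrite !lt_min => /and3P[w1 w2 w3].
  case: (Kw) => [Jw|[iw wc]].
    by rewrite !thE1 //; have := H1 w w1; rewrite lt_min => /andP[].
  rewrite thE1 // thE2 //.
  have [|b [ab1 ab2 ch]] := Hal (T w); first by rewrite -wc mkK.
  have [ab Ja Jb ins] := ch.
  (* A chord through a point close to [z] has an end close to [z], and there the integer [m] must
     take the same value as at [z]. *)
  suff -> : m (al (T w)) = m (T z).
    have -> : thJ z - (thY w + m (T z)) = thY z - thY w by rewrite /m -ez; ring.
    by have := H2 w w2; rewrite lt_min => /andP[].
  have [t' [Jt' <- tt']] : exists t', [/\ J (mk c t'), m t' = m (al (T w)) & `|T z - t'| < Num.min d1 d2].
    have := H3 w w3; rewrite ltr_norml => /andP[h1 h2].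
    have [h|h] := leP (T z) (al (T w)).
      by exists (al (T w)); split => //; rewrite ler0_norm ?subr_le0 //; hlra.
    have h' : b <= T z.
      rewrite leNgt; apply/negP => h'; have [] := ins (T z); rewrite ?h ?h' // => + _.
      by rewrite -ez; case.
    exists b; split => //; first exact/esym/mchord.
    by rewrite ger0_norm ?subr_ge0 //; hlra.
  have [k ek] := mZ t' Jt'; have [l el] : exists k : int, m (T z) = k%:~R by apply: mZ; rewrite -ez.
  rewrite ek el; congr (_%:~R); apply: int_close_eq; rewrite -ek -el /m -ez.
  have zt : `|z - mk c t'| < Num.min d1 d2 by rewrite {1}ez mkd.
  move: zt; rewrite lt_min => /andP[/H1 + /H2]; rewrite !lt_min => /andP[_ k1] /andP[_ k2].
  have -> : thJ (mk c t') - thY (mk c t') - (thJ z - thY z) = (thY z - thY (mk c t')) - (thJ z - thJ (mk c t')) by ring.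
  rewrite (le_lt_trans (ler_normB _ _)) //; hlra.
have [g cg Hg] := compact_extend kK wth.
have nK z : inside J z -> H z != c -> ~ K z by move=> iz zc [Jz|[_ e]]; [case: iz | rewrite e eqxx in zc].
have J1 : joined (~` K) x y.
  apply: rotlift_joined => //; [by apply: nK => //; rewrite lt_eqF | by apply: nK => //; rewrite gt_eqF |].
  exists g => // z Kz; rewrite Hg //; case: (Kz) => [Jz|[iz zc]]; first by rewrite thE1 //; exact: HJ.
  have ez : z = mk c (T z) by rewrite -zc mkK.
  have [|b [ab1 ab2 ch]] := Hal (T z); first by rewrite -ez.
  have [k ek] : exists k : int, m (al (T z)) = k%:~R by apply: mZ; case: ch.
  by rewrite thE2 // ek cisDz; apply: HY; rewrite ez; apply: YN; right; rewrite -ez.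
(* The path crosses the level [c] inside [J], which is a point of [K]. *)
have [z jz zc] := joined_level J1 xc cy.
have [_ nKz] := joined_in jz; apply: nKz; right; split => //.
by apply: joined_int ix; apply: joined_sub jz => w nw Jw; apply: nw; left.
Qed.

(** This makes the cutting finite: a chord separating a point well below the level from one well
    above it has length at least [d]. *)
Definition short_chords_ok J c e d := forall a b x y, chord J c a b -> b - a < d ->
  inside J x -> inside J y -> H x < c - e -> c + e < H y -> joined (~` (J `|` mk c @` `[a, b])) x y.

Lemma inside_below J z : compact J -> inside J z -> exists2 x, J x & H z <= H x.
Proof. by move=> kJ; apply: halfplane_inside kJ v0 _. Qed.

Lemma inside_above J z : compact J -> inside J z -> exists2 x, J x & H x <= H z.
Proof.
move=> kJ iz; have [||x Jx h] := @halfplane_inside R J (fun w => - H w) (- v) z kJ _ _ iz.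
- by rewrite oppr_eq0.
- by move=> w t; rewrite scalerN -scaleNr HD opprD opprK.
by exists x; rewrite // -lerN2.
Qed.

(** A short chord and the small arc that it cuts off stay within [e] of the level, so both points
    lie in the other part. *)
Lemma short_chords_exist J c e : jordan J -> 0 < e -> exists2 d, 0 < d & short_chords_ok J c e d.
Proof.
move=> jJ e0; have [d d0 Hd] := small_arcs jJ e0; exists d => // a b x y ch abd ix iy xc cy.
have [ab Ja Jb _] := ch; have cC := chord_crosscut ch; have [aC _ _ _] := cC.
have [|A [B [jab HA]]] := Hd _ _ Ja Jb (arc_neq aC); first by rewrite mkd distrC gtr0_norm ?subr_gt0.
have HAC z : (A `|` mk c @` `[a, b]) z -> c - e < H z < c + e.
  move=> [/HA h|[t _ <-]]; last by rewrite Hmk; apply/andP; split; hlra.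
  have := le_lt_trans (Hlip (mk c a) z) h; rewrite Hmk ltr_norml => /andP[h1 h2].
  by apply/andP; split; hlra.
have kAC : compact (A `|` mk c @` `[a, b]).
  by case: jab => aA _ _ _; apply: compactU; [exact: arc_compact aA | exact: arc_compact aC].
have nC z : H z != c -> ~ (mk c @` `[a, b]) z by move=> zc [s _] e'; move: zc; rewrite -e' Hmk eqxx.
have jB : jordan (B `|` mk c @` `[a, b]).
  by exists B, (mk c @` `[a, b]), (mk c a), (mk c b); exact: crosscut_jarcs (jarcs_swap jab) cC.
have ix' : inside (B `|` mk c @` `[a, b]) x.
  have [/nC|iAC|//] := crosscut_cover jab cC ix; first by rewrite lt_eqF => [/(_ isT)//|]; hlra.
  by have [z /HAC /andP[h1 _] h2] := inside_above kAC iAC; hlra.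
have iy' : inside (B `|` mk c @` `[a, b]) y.
  have [/nC|iAC|//] := crosscut_cover jab cC iy; first by rewrite gt_eqF => [/(_ isT)//|]; hlra.
  by have [z /HAC /andP[_ h1] h2] := inside_below kAC iAC; hlra.
apply: joined_sub (joined_inside jB ix' iy') => z /(crosscut_inside_sub (jarcs_swap jab) cC) [[nJ _] nCz].
by case.
Qed.

(** A chord of the part is also a chord of [J]. By Janiszewski's theorem, two points separated
    neither by the part nor by [J] with the new chord are not separated by the union, because the
    two sets meet in the arc [A]. *)
Lemma short_chords_inherit J A B c e d a0 b0 : chord J c a0 b0 ->
  jarcs J A B (mk c a0) (mk c b0) -> short_chords_ok J c e d ->
  short_chords_ok (A `|` mk c @` `[a0, b0]) c e d.
Proof.
move=> ch0 jab ok a b x y ch abd ix iy xc cy; set C0 := mk c @` `[a0, b0].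
have cC := chord_crosscut ch0; have j1 := crosscut_jarcs jab cC.
have [ab Ka Kb ins] := ch; have [ab0 Ja0 Jb0 ins0] := ch0.
have [aA aB AB JE] := jab; have sub := crosscut_inside_sub jab cC.
have jor : jordan (A `|` C0) by exists A, C0, (mk c a0), (mk c b0).
have C0A z : C0 z -> J z -> A z.
  by case: cC => _ _ _ /(_ z) h /h [[]//|->|->] _; [exact: arc_l aA | exact: arc_r aA].
have CK t : C0 (mk c t) = (a0 <= t <= b0) :> Prop.
  apply/propext; split=> [[s]|h]; last by exists t => //=; rewrite in_itv.
  by rewrite /= in_itv /= => h /(congr1 T); rewrite !Tmk => <-.
have nC0 t : a < t < b -> ~ (a0 <= t <= b0) by move=> /ins /sub [_ h] h'; apply: h; rewrite -/C0 CK.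
have end_ok t : (t = a \/ t = b) -> (A `|` C0) (mk c t) -> J (mk c t).
  move=> tab [At|]; first by rewrite JE; left.
  rewrite CK => /andP[h1 h2]; have [->//|na] := eqVneq t a0; have [->//|nb] := eqVneq t b0.
  have l1 : a0 < t by rewrite lt_neqAle eq_sym na.
  have l2 : t < b0 by rewrite lt_neqAle nb.
  case: tab => e'.
    pose s := (t + Num.min b b0) / 2; have : t < Num.min b b0 by rewrite lt_min l2 e' ab.
    have : Num.min b b0 <= b by rewrite ge_min lexx.
    have : Num.min b b0 <= b0 by rewrite ge_min lexx orbT.
    move=> k1 k2 k3; case: (@nC0 s); rewrite /s; apply/andP; split; hlra.
  pose s := (t + Num.max a a0) / 2; have : Num.max a a0 < t by rewrite gt_max l1 e' ab.
  have : a <= Num.max a a0 by rewrite le_max lexx.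
  have : a0 <= Num.max a a0 by rewrite le_max lexx orbT.
  move=> k1 k2 k3; case: (@nC0 s); rewrite /s; apply/andP; split; hlra.
have Ja : J (mk c a) by apply: end_ok => //; left.
have Jb : J (mk c b) by apply: end_ok => //; right.
have chJ : chord J c a b by split => // t /ins /sub [].
have [ixJ _] := sub x ix; have [iyJ _] := sub y iy.
have J1 := ok a b x y chJ abd ixJ iyJ xc cy.
have [nx ny] := joined_in J1; set C1 := mk c @` `[a, b] in nx ny J1 *.
have kC1 := arc_compact (mk_arc c ab); have kA := arc_compact aA; have kK := jordan_compact jor.
have kJ : compact J by rewrite JE; apply: compactU => //; exact: arc_compact aB.
have J2 : joined (~` ((A `|` C0) `|` (J `|` C1))) x y.
  apply: rotlift_joined.
  - by apply: compactU => //; exact: compactU.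
  - by case=> //; case: ix.
  - by case=> //; case: iy.
  apply: janiszewski => //; first exact: compactU.
  - have -> : (A `|` C0) `&` (J `|` C1) = A.
      apply/seteqP; split=> [z [[//|Cz] [Jz|C1z]]|z Az]; last 1 first.
      + by split; left; rewrite // JE; left.
      + exact: C0A.
      case: C1z Cz => t; rewrite /= in_itv /= => /andP[h1 h2] <- Cz; apply: C0A => //.
      have [->//|na] := eqVneq t a; have [->//|nb] := eqVneq t b.
      have tab : a < t < b by rewrite !lt_neqAle h1 h2 eq_sym na nb.
      by case: (nC0 t tab); rewrite -CK.
    by move=> z w; exact: arc_joined aA.
  - by apply: joined_rotlift; [exact: compact_closedP | exact: jordan_int_joined].
  - by apply: joined_rotlift => //; apply: compact_closedP; exact: compactU.
apply: joined_sub J2 => z nz [h|h]; apply: nz; first by left.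
by right; right.
Qed.

(** Induction on the number of points of a fixed grid on the level [c] that lie inside the curve.
    Outside of the base cases there is a separating chord. It is at least [d] long, so it contains a
    grid point, which is then inside neither part. *)
Theorem level_induction (Phi : set P -> Prop) J c e : jordan J -> 0 < e ->
  (forall K, jordan K -> inside K `<=` inside J ->
    (forall z, inside K z -> c - e <= H z) \/ (forall z, inside K z -> H z <= c + e) -> Phi K) ->
  (forall K a b, jordan K -> inside K `<=` inside J -> chord K c a b ->
    (forall A B, jarcs K A B (mk c a) (mk c b) -> Phi (A `|` mk c @` `[a, b])) -> Phi K) -> Phi J.
Proof.
move=> jJ e0 base step; have [d d0 Hd] := short_chords_exist c jJ e0.
have [N N0 HN] := compact_bounded_by (jordan_compact jJ).
(* With spacing [d / 2], every chord of length at least [d] has a grid point in its interior. *)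
pose grid (i : nat) : R := - N + i%:R * (d / 2).
have gridS i : grid i.+1 = grid i + d / 2 by rewrite /grid -natr1; ring.
have d2 : 0 < d / 2 by rewrite divr_gt0.
have big r : exists i, r < grid i.
  exists (Num.bound `|(r + N) / (d / 2)|).
  rewrite /grid addrC ltrBrDr -ltr_pdivrMr //; apply: le_lt_trans (archi_boundP (normr_ge0 _)).
  exact: ler_norm.
have [M HM] := big N.
have mono i j : (i <= j)%N -> grid i <= grid j by move=> ij; rewrite lerD2l ler_wpM2r ?ler_nat // ltW.
pose mu K := count (fun i => `[<inside K (mk c (grid i))>]) (iota 0 M).
suff K n : forall K, (mu K < n)%N -> jordan K -> inside K `<=` inside J -> short_chords_ok K c e d -> Phi K.
  by apply: (K (mu J).+1).
elim: n => // n IH K Kn jK KJ ok.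
have [[x [y [ix iy xc cy]]]|nxy] := pselect (exists x y, [/\ inside K x, inside K y, H x < c - e & c + e < H y]); last first.
  apply: base => //; have [[x [ix xc]]|nx] := pselect (exists x, inside K x /\ H x < c - e).
    by right=> z iz; rewrite leNgt; apply/negP => h; apply: nxy; exists x, z.
  by left=> z iz; rewrite leNgt; apply/negP => h; apply: nx; exists z.
have [||a [b [ch nj]]] := separating_chord jK ix iy (c := c); [hlra | hlra |].
have abd : d <= b - a by rewrite leNgt; apply/negP => h; apply: nj; exact: ok.
have [ab Ka Kb ins] := ch.
have bd t : a < t < b -> `|t| <= N.
  move=> /ins /KJ /(int_bounded (ltW N0) HN); apply: le_trans; rewrite -{1}(Tmk c t); exact: Tle.
have [aN bN] : - N <= a /\ b <= N.
  split; apply/ler_addgt0Pr => r r0.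
    have : `|a + Num.min r ((b - a) / 2)| <= N.
      have k1 : 0 < Num.min r ((b - a) / 2) by rewrite lt_min r0 divr_gt0 // subr_gt0.
      have k2 : Num.min r ((b - a) / 2) <= (b - a) / 2 by rewrite ge_min lexx orbT.
      by apply: bd; apply/andP; split; hlra.
    have : Num.min r ((b - a) / 2) <= r by rewrite ge_min lexx.
    by rewrite ler_norml => k1 /andP[k2 k3]; hlra.
  have : `|b - Num.min r ((b - a) / 2)| <= N.
    have k1 : 0 < Num.min r ((b - a) / 2) by rewrite lt_min r0 divr_gt0 // subr_gt0.
    have k2 : Num.min r ((b - a) / 2) <= (b - a) / 2 by rewrite ge_min lexx orbT.
    by apply: bd; apply/andP; split; hlra.
  have : Num.min r ((b - a) / 2) <= r by rewrite ge_min lexx.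
  by rewrite ler_norml => k1 /andP[k2 k3]; hlra.
have [i iM gi] : exists2 i, (i < M)%N & a < grid i < b.
  have [i ai imin] := ex_minnP (big a).
  have ib : grid i < b.
    case: i ai imin => [|i] ai imin; first by rewrite /grid mul0r addr0 in ai *; hlra.
    have : grid i <= a by rewrite leNgt; apply/negP => /imin; rewrite ltnn.
    by rewrite gridS => ?; hlra.
  exists i; last by rewrite ai.
  rewrite ltnNge; apply/negP => /mono h; hlra.
apply: (step K a b) => // A B jab; have cC := chord_crosscut ch.
have sub := crosscut_inside_sub jab cC.
apply: IH.
- rewrite -ltnS; apply: leq_ltn_trans Kn; apply: count_ltn.
    by move=> k /asboolP /sub [h _]; apply/asboolP.
  exists i; first by rewrite mem_iota.
  apply/andP; split; first by apply/asboolP; exact: ins.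
  by apply/asboolPn => /sub [_]; apply; exists (grid i) => //=; rewrite in_itv /=; case/andP: gi => *; rewrite !ltW.
- by exists A, (mk c @` `[a, b]), (mk c a), (mk c b); exact: crosscut_jarcs jab cC.
- by move=> z /sub [/KJ].
exact: short_chords_inherit jab ok.
Qed.

End Coordinates.

Lemma coordinates_fst : coordinates (@fst R R) (@snd R R) (fun a b => (a, b)) (1, 0).
Proof.
split; [by move=> z; exact: cvg_fst | by move=> z; exact: cvg_snd | by apply/eqP => -[/eqP]; rewrite oner_eq0 | |].
  by move=> w t /=; rewrite /GRing.scale /= mulr1.
split => //; first by case.
  by move=> a b b'; rewrite prod_normE /= subrr normr0 max_r.
by move=> z; rewrite prod_normE /= le_max lexx orbT; split => // w; rewrite prod_normE /= le_max lexx.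
Qed.

Lemma coordinates_snd : coordinates (@snd R R) (@fst R R) (fun a b => (b, a)) (0, 1).
Proof.
split; [by move=> z; exact: cvg_snd | by move=> z; exact: cvg_fst | by apply/eqP => -[/eqP]; rewrite oner_eq0 | |].
  by move=> w t /=; rewrite /GRing.scale /= mulr1.
split => //; first by case.
  by move=> a b b'; rewrite prod_normE /= subrr normr0 max_l.
by move=> z; rewrite prod_normE /= le_max lexx; split => // w; rewrite prod_normE /= le_max lexx orbT.
Qed.

End SeparatingChords.

(** * The Schoenflies theorem *)

Section Schoenflies.
Context (R : realType).
Notation P := (R * R)%type.
Notation P2 := (P * P)%type.
Notation I := (unit_interval R).

Definition hull (X : set P) := X `|` inside X.

Definition injective_on (V W : Type) (A : set V) (f : V -> W) := forall x y, A x -> A y -> f x = f y -> x = y.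

Lemma arc_image (V W : normedModType R) (f : V -> W) (A : set V) p q : continuous f ->
  injective_on A f -> arc A p q -> arc (f @` A) (f p) (f q).
Proof.
move=> cf fi [u [cu ui AE [<- <-]]]; rewrite AE in fi *; exists (fun t => f (u t)); split => //.
- by move=> t; apply: (@ct_comp _ _ _ f u) => //; exact: cf.
- by move=> s t Is It /fi e; apply: ui => //; apply: e; [exists s | exists t].
by apply/seteqP; split=> [_ [_ [t It <-] <-]|_ [t It <-]]; [exists t | exists (u t) => //; exists t].
Qed.

Lemma jarcs_image (V W : normedModType R) (f : V -> W) (J A B : set V) p q : continuous f ->
  injective_on J f -> jarcs J A B p q -> jarcs (f @` J) (f @` A) (f @` B) (f p) (f q).
Proof.
move=> cf fi [aA aB AB JE]; have AJ : A `<=` J by rewrite JE => z; left.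
have BJ : B `<=` J by rewrite JE => z; right.
split.
- by apply: arc_image => // x y /AJ Jx /AJ Jy; exact: fi.
- by apply: arc_image => // x y /BJ Jx /BJ Jy; exact: fi.
- move=> _ [[x Ax <-] [y By e]]; have {}e := fi _ _ (BJ _ By) (AJ _ Ax) e.
  by rewrite e in By; have [->|->] := AB x (conj Ax By); [left|right].
by rewrite JE image_setU.
Qed.

Lemma jordan_image (V W : normedModType R) (f : V -> W) (J : set V) : continuous f ->
  injective_on J f -> jordan J -> jordan (f @` J).
Proof.
by move=> cf fi [A [B [p [q j]]]]; exists (f @` A), (f @` B), (f p), (f q); exact: jarcs_image.
Qed.

Lemma crosscut_hull_sub (J A B C : set P) p q : jarcs J A B p q -> crosscut J C p q ->
  hull (A `|` C) `<=` hull J.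
Proof.
move=> jJ cC; have [_ _ _ JE] := jJ; have [_ Jp Jq CJ] := cC.
move=> z [[Az|/CJ [|->|->]]|/(crosscut_inside_sub jJ cC) []]; by [left; rewrite JE; left|right|left].
Qed.

Lemma crosscut_hull_cover (J A B C : set P) p q z : jarcs J A B p q -> crosscut J C p q ->
  hull J z -> hull (A `|` C) z \/ hull (B `|` C) z.
Proof.
move=> jJ cC; have [_ _ _ JE] := jJ; rewrite {1}/hull {1}JE => -[[Az|Bz]|/(crosscut_cover jJ cC) [Cz|iz|iz]].
- by left; left; left.
- by right; left; left.
- by left; left; right.
- by left; right.
- by right; right.
Qed.

Lemma crosscut_hull_meet (J A B C : set P) p q z : jarcs J A B p q -> crosscut J C p q ->
  hull (A `|` C) z -> hull (B `|` C) z -> C z.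
Proof.
move=> jJ cC; have [aA aB AB JE] := jJ; have [aC _ _ _] := cC.
have s1 := crosscut_inside_sub jJ cC; have s2 := crosscut_inside_sub (jarcs_swap jJ) cC.
move=> [[Az|//]|i1] [[Bz|//]|i2].
- by have [->|->] := AB z (conj Az Bz); [exact: arc_l aC | exact: arc_r aC].
- by have [[nJ _] _] := s2 z i2; case: nJ; rewrite JE; left.
- by have [[nJ _] _] := s1 z i1; case: nJ; rewrite JE; right.
by case: (crosscut_inside_disjoint jJ cC i1 i2).
Qed.

Lemma crosscut_hull_rim (J A B C : set P) p q z : jarcs J A B p q -> crosscut J C p q ->
  hull (A `|` C) z -> J z -> A z.
Proof.
move=> jJ cC [[//|Cz]|/(crosscut_inside_sub jJ cC) [[//]]] Jz.
have [aA _ _ _] := jJ.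
by have [_ _ _ /(_ z Cz) [[]//|->|->]] := cC; [exact: arc_l aA|exact: arc_r aA].
Qed.

Definition side (b : bool) (w : P2) : P := if b then w.1 else w.2.

Lemma side_cont b : continuous (side b).
Proof. by case: b => w; [exact: cvg_fst | exact: cvg_snd]. Qed.

(* A cell is the graph of a homeomorphism between two Jordan curves. *)
Definition cell (G : set P2) := jordan G /\ forall b, injective_on G (side b).

Definition plate b (G : set P2) := hull (side b @` G).

(** Simultaneous cuts: [C] is the graph of a homeomorphism between a crosscut on each side. *)
Definition cellsplit (G A B C : set P2) p q := [/\ jarcs G A B p q, arc C p q,
  forall b, crosscut (side b @` G) (side b @` C) (side b p) (side b q) &
  forall b, injective_on C (side b)].

Lemma cellsplit_swap G A B C p q : cellsplit G A B C p q -> cellsplit G B A C p q.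
Proof. by move=> [/jarcs_swap]. Qed.

Lemma cell_jarcs G A B p q b : cell G -> jarcs G A B p q ->
  jarcs (side b @` G) (side b @` A) (side b @` B) (side b p) (side b q).
Proof. by move=> [_ fi]; apply: jarcs_image => //; exact: side_cont. Qed.

Lemma cellsplit_cell G A B C p q : cell G -> cellsplit G A B C p q -> cell (A `|` C).
Proof.
move=> cG [jG aC cC Ci]; have [_ Gi] := cG; have [aA aB AB GE] := jG.
have AG : A `<=` G by rewrite GE => z; left.
have Cp := arc_l aC; have Cq := arc_r aC; have Ap := arc_l aA; have Aq := arc_r aA.
have K b a c : A a -> C c -> side b a = side b c -> a = c /\ (c = p \/ c = q).
  move=> Aa Cc e; have [_ _ _ H] := cC b.
  have [|[+ _]|e'|e'] := H (side b c); [by exists c | by case; exists a => //; exact: AG | |].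
    have <- := Ci b _ _ Cc Cp e'; split; last by left.
    by rewrite (Ci b _ _ Cc Cp e'); apply: (Gi b); rewrite ?e //; exact: AG.
  have <- := Ci b _ _ Cc Cq e'; split; last by right.
  by rewrite (Ci b _ _ Cc Cq e'); apply: (Gi b); rewrite ?e //; exact: AG.
split; first by exists A, C, p, q; split => // z [Az Cz]; exact: (K true z z Az Cz erefl).2.
move=> b x y [Ax|Cx] [Ay|Cy] e.
- exact: (Gi b _ _ (AG _ Ax) (AG _ Ay)).
- exact: (K b x y Ax Cy e).1.
- exact/esym/(K b y x Ay Cx (esym e)).1.
exact: Ci e.
Qed.

(** Plates overlap only in rim points that have a common partner on the other side; this makes the
    limit of the refinements single valued. *)
Definition meet_on_rim (G D : set P2) := forall b z, plate b G z -> plate b D z -> (side b @` (G `&` D)) z.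

Lemma meet_on_rim_sym G D : meet_on_rim G D -> meet_on_rim D G.
Proof. by move=> m b z h1 h2; rewrite setIC; exact: m. Qed.

Lemma cellsplit_sub G A B C p q b : cell G -> cellsplit G A B C p q ->
  plate b (A `|` C) `<=` plate b G.
Proof.
move=> cG [jG aC cC Ci]; rewrite /plate image_setU.
exact: (crosscut_hull_sub (cell_jarcs b cG jG) (cC b)).
Qed.

Lemma cellsplit_meet G A B C p q : cell G -> cellsplit G A B C p q ->
  meet_on_rim (A `|` C) (B `|` C).
Proof.
move=> cG [jG aC cC Ci] b z; rewrite /plate !image_setU => h1 h2.
have [w Cw <-] := crosscut_hull_meet (cell_jarcs b cG jG) (cC b) h1 h2.
by exists w => //; split; right.
Qed.

Lemma cellsplit_meet_other G A B C p q D : cell G -> cellsplit G A B C p q ->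
  meet_on_rim G D -> meet_on_rim (A `|` C) D.
Proof.
move=> cG s m b z h1 h2; have [w [Gw Dw] e] := m b z (cellsplit_sub cG s h1) h2.
have [jG aC cC Ci] := s; have [aA _ _ GE] := jG; have [_ Gi] := cG.
move: h1; rewrite /plate image_setU => h1.
have [|a Aa e'] := crosscut_hull_rim (cell_jarcs b cG jG) (cC b) h1; first by exists w.
exists a => //; split; first by left.
by rewrite (Gi b a w) //; [rewrite GE; left | rewrite e e'].
Qed.

Inductive splitted : set P2 -> seq (set P2) -> Prop :=
| splitted_leaf G : splitted G [:: G]
| splitted_node G A B C p q l1 l2 : cellsplit G A B C p q ->
    splitted (A `|` C) l1 -> splitted (B `|` C) l2 -> splitted G (l1 ++ l2).

Lemma splitted_cell G l D : cell G -> splitted G l -> D \in l -> cell D.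
Proof.
move=> cG s; elim: s cG D => {G l} [G|G A B C p q l1 l2 s s1 IH1 s2 IH2] cG D.
  by rewrite inE => /eqP->.
by rewrite mem_cat => /orP[/IH1|/IH2]; apply; [exact: cellsplit_cell s | exact: cellsplit_cell (cellsplit_swap s)].
Qed.

Lemma splitted_sub G l D b : cell G -> splitted G l -> D \in l -> plate b D `<=` plate b G.
Proof.
move=> cG s; elim: s cG D => {G l} [G|G A B C p q l1 l2 s s1 IH1 s2 IH2] cG D.
  by rewrite inE => /eqP->.
have s' := cellsplit_swap s.
rewrite mem_cat => /orP[/IH1|/IH2] H; apply: subset_trans (H _) _.
- exact: cellsplit_cell s.
- exact: cellsplit_sub s.
- exact: cellsplit_cell s'.
exact: cellsplit_sub s'.
Qed.

Lemma splitted_cover G l b z : cell G -> splitted G l -> plate b G z ->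
  exists2 D, D \in l & plate b D z.
Proof.
move=> cG s; elim: s cG z => {G l} [G|G A B C p q l1 l2 s s1 IH1 s2 IH2] cG z.
  by exists G; rewrite ?mem_head.
have [jG aC cC Ci] := s; have s' := cellsplit_swap s.
move/(crosscut_hull_cover (cell_jarcs b cG jG) (cC b)); rewrite -!image_setU => -[/IH1|/IH2] H.
  by have [|D Dl Dz] := H; [exact: cellsplit_cell s | exists D; rewrite // mem_cat Dl].
by have [|D Dl Dz] := H; [exact: cellsplit_cell s' | exists D; rewrite // mem_cat Dl orbT].
Qed.

Lemma splitted_rim G l w : splitted G l -> G w -> exists2 D, D \in l & D w.
Proof.
move=> s; elim: s => {G l} [G|G A B C p q l1 l2 s s1 IH1 s2 IH2].
  by exists G; rewrite ?mem_head.
have [[_ _ _ ->] _ _ _] := s => -[Aw|Bw].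
  by have [|D Dl Dw] := IH1; [left | exists D; rewrite // mem_cat Dl].
by have [|D Dl Dw] := IH2; [left | exists D; rewrite // mem_cat Dl orbT].
Qed.

Lemma splitted_meet_other G l D E : cell G -> splitted G l -> meet_on_rim G D -> E \in l -> meet_on_rim E D.
Proof.
move=> cG s; elim: s cG E => {G l} [G|G A B C p q l1 l2 s s1 IH1 s2 IH2] cG E m.
  by rewrite inE => /eqP->.
have s' := cellsplit_swap s.
rewrite mem_cat => /orP[/IH1|/IH2]; apply.
- exact: cellsplit_cell s.
- exact: cellsplit_meet_other s _.
- exact: cellsplit_cell s'.
exact: cellsplit_meet_other s' _.
Qed.

Lemma splitted_meet G l D E : cell G -> splitted G l -> D \in l -> E \in l -> D = E \/ meet_on_rim D E.
Proof.
move=> cG s; elim: s cG D E => {G l} [G|G A B C p q l1 l2 s s1 IH1 s2 IH2] cG D E.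
  by rewrite inE => /eqP->; rewrite inE => /eqP->; left.
have s' := cellsplit_swap s.
have c1 := cellsplit_cell cG s; have c2 := cellsplit_cell cG s'.
have K D1 D2 : D1 \in l1 -> D2 \in l2 -> meet_on_rim D1 D2.
  move=> h1 h2; apply: splitted_meet_other c1 s1 _ h1; apply: meet_on_rim_sym.
  by apply: splitted_meet_other c2 s2 _ h2; apply: meet_on_rim_sym; exact: cellsplit_meet s.
rewrite !mem_cat => /orP[h1|h1] /orP[h2|h2].
- exact: IH1.
- by right; exact: K.
- by right; apply: meet_on_rim_sym; exact: K.
exact: IH2.
Qed.

Lemma splitted_trans G l (Q : set P2 -> Prop) : cell G -> splitted G l ->
  (forall D, cell D -> D \in l -> exists2 l', splitted D l' & forall E, E \in l' -> Q E) ->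
  exists2 l', splitted G l' & forall E, E \in l' -> Q E /\
    exists2 D, D \in l & forall b, plate b E `<=` plate b D.
Proof.
move=> cG s; elim: s cG => {G l} [G|G A B C p q l1 l2 s s1 IH1 s2 IH2] cG H.
  have [||l' sl' Hl'] := H G => //; first by rewrite mem_head.
  exists l' => // E El'; split; first exact: Hl'.
  by exists G; rewrite ?mem_head // => b; exact: splitted_sub El'.
have s' := cellsplit_swap s.
have [||l1' sl1 H1] := IH1; first exact: cellsplit_cell s.
  by move=> D cD Dl; apply: H; rewrite // mem_cat Dl.
have [||l2' sl2 H2] := IH2; first exact: cellsplit_cell s'.
  by move=> D cD Dl; apply: H; rewrite // mem_cat Dl orbT.
exists (l1' ++ l2'); first exact: splitted_node s sl1 sl2.
move=> E; rewrite mem_cat => /orP[/H1|/H2] [QE [D Dl DE]]; split=> //; exists D => //.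
  by rewrite mem_cat Dl.
by rewrite mem_cat Dl orbT.
Qed.

(** Any crosscut of the other side between the corresponding points will do; the size of the plates
    on that side is reduced when it is cut in its turn. *)
Lemma cell_split_exists G C b p q : cell G -> G p -> G q ->
  crosscut (side b @` G) C (side b p) (side b q) ->
  exists A B C', cellsplit G A B C' p q /\ side b @` C' = C.
Proof.
move=> cG Gp Gq cC; have [jG Gi] := cG; have [aC _ _ CJ] := cC.
have pq : p <> q by move=> e; apply: (arc_neq aC); rewrite e.
have [A [B jab]] := jordan_split jG Gp Gq pq.
have [||||C1 cC1] := @crosscut_exists R (side (~~ b) @` G) (side (~~ b) p) (side (~~ b) q).
- by apply: jordan_image => //; exact: side_cont.
- by exists p.
- by exists q.
- by move=> /(Gi _ _ _ Gp Gq).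
have [aC1 _ _ CJ1] := cC1.
have [f [cf fi fC [f0 f1]]] := aC; have [g [cg gi gC [g0 g1]]] := aC1.
pose h t : P2 := if b then (f t, g t) else (g t, f t).
have hb t : side b (h t) = f t by rewrite /h /side; case: (b).
have hnb t : side (~~ b) (h t) = g t by rewrite /h /side; case: (b).
have ch : continuous h by rewrite /h; case: (b) => t; apply: ct_pair; [exact: cf|exact: cg|exact: cg|exact: cf].
have eqside (w w' : P2) : side b w = side b w' -> side (~~ b) w = side (~~ b) w' -> w = w'.
  by case: w w' => w1 w2 [w1' w2']; rewrite /side; case: (b) => /= -> ->.
have h0 : h 0 = p by apply: eqside; rewrite ?hb ?hnb.
have h1 : h 1 = q by apply: eqside; rewrite ?hb ?hnb.
have ib : injective_on (h @` I) (side b).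
  by move=> _ _ [s Is <-] [t It <-]; rewrite !hb => /(fi _ _ Is It) ->.
have inb : injective_on (h @` I) (side (~~ b)).
  by move=> _ _ [s Is <-] [t It <-]; rewrite !hnb => /(gi _ _ Is It) ->.
have eb : side b @` (h @` I) = C.
  by rewrite fC; apply/seteqP; split=> [_ [_ [t It <-] <-]|_ [t It <-]]; [exists t; rewrite ?hb | exists (h t); rewrite ?hb //; exists t].
have enb : side (~~ b) @` (h @` I) = C1.
  by rewrite gC; apply/seteqP; split=> [_ [_ [t It <-] <-]|_ [t It <-]]; [exists t; rewrite ?hnb | exists (h t); rewrite ?hnb //; exists t].
have dec b' : b' = b \/ b' = ~~ b by move: (b) b' => -[] []; by [left|right].
exists A, B, (h @` I); split => //; split => //.
- by exists h; split => // s t Is It /(congr1 (side b)); rewrite !hb; exact: fi.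
- by move=> b'; have [->|->] := dec b'; rewrite ?eb ?enb.
by move=> b'; have [->|->] := dec b'.
Qed.

(** * Refining cells on one side *)

Section Refinement.
Variables (H T : P -> R) (mk : R -> R -> P) (v : P).
Hypothesis C : coordinates H T mk v.
Variable b : bool.

Let Hlip z w : `|H z - H w| <= `|z - w|. Proof. by case: C => _ _ _ _ [_ _ _ _ /(_ z) []]. Qed.

Lemma hull_limit J (a c : R) : jordan J -> (forall z, inside J z -> a <= H z <= c) ->
  forall z, hull J z -> a <= H z <= c.
Proof.
move=> jJ K z [Jz|/K//]; apply/andP; split; apply/ler_addgt0Pr => e e0.
  have [[y /K /andP[ay _] zy] _] := jordan_frontier jJ Jz e0.
  by have := le_lt_trans (Hlip z y) zy; rewrite ltr_norml => /andP[k1 k2]; hlra.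
have [[y /K /andP[_ ay] zy] _] := jordan_frontier jJ Jz e0.
by have := le_lt_trans (Hlip z y) zy; rewrite ltr_norml => /andP[k1 k2]; hlra.
Qed.

Definition ranged w G := exists a, forall z, plate b G z -> a <= H z <= a + w.

(** [level_induction] at the middle level on the side [b], each chord being accompanied by some
    crosscut on the other side. *)
Lemma range_halve G a w e : cell G -> 0 < e -> (forall z, plate b G z -> a <= H z <= a + w) ->
  exists2 l, splitted G l & forall D, D \in l -> ranged (w / 2 + e) D.
Proof.
move=> cG e0; have jG : jordan (side b @` G).
  by apply: jordan_image; [exact: side_cont | exact: cG.2 | exact: cG.1].
pose c := a + w / 2; move E : (side b @` G) => K; rewrite /plate {1}E => HK.
have jK : jordan K by rewrite -E.
(* The statement quantifies over all cells with side [K], because the induction sees only one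
   side. *)
pose Phi K := forall G, cell G -> side b @` G = K -> (forall z, inside K z -> a <= H z <= a + w) ->
  exists2 l, splitted G l & forall D, D \in l -> ranged (w / 2 + e) D.
suff : Phi K by apply => // z iz; apply: HK; right.
apply: (level_induction C (c := c) (e := e) jK e0).
  move=> K1 jK1 _ K1H G1 cG1 E1 HK1; exists [:: G1]; first exact: splitted_leaf.
  move=> D; rewrite inE => /eqP->; case: K1H => K1H.
    exists (a + w / 2 - e); rewrite /plate E1; apply: hull_limit => // z iz.
    have /andP[h1 h2] := HK1 z iz; have := K1H z iz; rewrite /c => h3; apply/andP; split; hlra.
  exists a; rewrite /plate E1; apply: hull_limit => // z iz.
  have /andP[h1 h2] := HK1 z iz; have := K1H z iz; rewrite /c => h3; apply/andP; split; hlra.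
move=> K1 r s jK1 _ ch IH G1 cG1 E1 HK1.
have [rs Kr Ks ins] := ch; have cC := chord_crosscut C ch.
have [p Gp ep] : exists2 p, G1 p & side b p = mk c r by move: Kr; rewrite -E1 => -[p]; exists p.
have [q Gq eq] : exists2 q, G1 q & side b q = mk c s by move: Ks; rewrite -E1 => -[q]; exists q.
rewrite -E1 -ep -eq in cC.
have [A [B [C' [sp eC]]]] := cell_split_exists cG1 Gp Gq cC.
have [jG1 aC' cC' Ci'] := sp; have jb := cell_jarcs b cG1 jG1; rewrite E1 ep eq in jb.
rewrite E1 ep eq in cC.
have K1' : forall z, inside (side b @` A `|` mk c @` `[r, s]) z -> a <= H z <= a + w.
  by move=> z /(crosscut_inside_sub jb cC) [/HK1].
have K2' : forall z, inside (side b @` B `|` mk c @` `[r, s]) z -> a <= H z <= a + w.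
  by move=> z /(crosscut_inside_sub (jarcs_swap jb) cC) [/HK1].
have [|l1 s1 H1] := IH _ _ jb (A `|` C') (cellsplit_cell cG1 sp) _ K1'.
  by rewrite image_setU eC.
have [|l2 s2 H2] := IH _ _ (jarcs_swap jb) (B `|` C') (cellsplit_cell cG1 (cellsplit_swap sp)) _ K2'.
  by rewrite image_setU eC.
exists (l1 ++ l2); first exact: splitted_node sp s1 s2.
by move=> D; rewrite mem_cat => /orP[/H1|/H2].
Qed.

Lemma range_refine G e : cell G -> 0 < e -> exists2 l, splitted G l & forall D, D \in l -> ranged e D.
Proof.
move=> cG e0.
have jG : jordan (side b @` G).
  by apply: jordan_image; [exact: side_cont | exact: cG.2 | exact: cG.1].
(* Halving with tolerance [e / 8] reduces an excess of [n + 1] quarters of [e] to at most [n] of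
   them. *)
have K n : forall G, cell G -> ranged (e + n%:R * (e / 4)) G ->
    exists2 l, splitted G l & forall D, D \in l -> ranged e D.
  elim: n => [|n IH] G1 cG1 [a Ha].
    exists [:: G1]; first exact: splitted_leaf.
    by move=> D; rewrite inE => /eqP->; exists a; rewrite mul0r addr0 in Ha.
  have [|l s Hl] := @range_halve G1 a _ (e / 8) cG1 _ Ha; first by rewrite divr_gt0.
  have [|l' s' Hl'] := @splitted_trans G1 l (ranged e) cG1 s.
    move=> D cD /Hl [a' Ha']; apply: IH => //; exists a' => z /Ha' /andP[-> h] /=.
    have : 0 <= n%:R * (e / 4) by rewrite mulr_ge0 // divr_ge0 // ltW.
    have E : n.+1%:R * (e / 4) = n%:R * (e / 4) + e / 4 by rewrite -natr1 mulrDl mul1r.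
    by rewrite E in h; move: (n%:R * _) h => x h ?; hlra.
  by exists l' => // D /Hl' [].
have [N N0 HN] := compact_bounded_by (jordan_compact jG).
have NH z : plate b G z -> `|H z - H 0| <= N.
  move=> Gz; rewrite (le_trans (Hlip _ _)) // subr0.
  by case: Gz => [/HN//|/(int_bounded (ltW N0) HN)].
pose n := Num.bound (2 * N / (e / 4)); apply: (K n) => //.
have e4 : 0 < e / 4 by rewrite divr_gt0.
have k : 2 * N / (e / 4) <= n%:R.
  by apply/ltW/archi_boundP; rewrite divr_ge0 ?mulr_ge0 // ltW.
rewrite ler_pdivrMr // in k.
exists (H 0 - N) => z /NH; rewrite ler_norml => /andP[h1 h2]; move: k; move: (n%:R * _) => x k.
by apply/andP; split; hlra.
Qed.
End Refinement.

Definition mesh (e : R) G := forall b z w, plate b G z -> plate b G w -> `|z - w| <= e.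

(** Both coordinates on both sides are refined in turn; later cuts keep the earlier bounds, since
    plates only shrink. *)
Lemma cell_refine G e : cell G -> 0 < e -> exists2 l, splitted G l & forall D, D \in l -> mesh e D.
Proof.
move=> cG e0.
have step b (H T : P -> R) mk v (Q : set P2 -> Prop) l : coordinates H T mk v ->
    (forall D E, Q D -> (forall b, plate b E `<=` plate b D) -> Q E) ->
    splitted G l -> (forall D, D \in l -> Q D) ->
    exists2 l', splitted G l' & forall D, D \in l' -> Q D /\ ranged H b e D.
  move=> C Qm s HQ; have [|l' s' Hl'] := @splitted_trans G l (ranged H b e) cG s.
    by move=> D cD _; exact: range_refine C b D e cD e0.
  by exists l' => // D /Hl' [rD [E /HQ QE DE]]; split => //; exact: Qm QE DE.
have rm (H : P -> R) b D E : ranged H b e D -> (forall b, plate b E `<=` plate b D) -> ranged H b e E.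
  by move=> [a Ha] DE; exists a => z /DE; exact: Ha.
have [|||l1 s1 H1] := step true _ _ _ _ (fun=> True) [:: G] (coordinates_fst R) => //.
  exact: splitted_leaf.
have [||l2 s2 H2] := step true _ _ _ _ (ranged fst true e) l1 (coordinates_snd R) _ s1.
- by move=> D E; exact: rm.
- by move=> D /H1 [].
have [||l3 s3 H3] := step false _ _ _ _ (fun D => ranged fst true e D /\ ranged snd true e D) l2 (coordinates_fst R) _ s2.
- by move=> D E [h1 h2] DE; split; [exact: rm h1 DE | exact: rm h2 DE].
- by move=> D /H2.
have [||l4 s4 H4] := step false _ _ _ _ (fun D => (ranged fst true e D /\ ranged snd true e D) /\ ranged fst false e D) l3 (coordinates_snd R) _ s3.
- by move=> D E [[h1 h2] h3] DE; split; [split|]; [exact: rm h1 DE | exact: rm h2 DE | exact: rm h3 DE].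
- by move=> D /H3.
exists l4 => // D /H4 [[[r1 r2] r3] r4] b z w.
have K : ranged fst b e D /\ ranged snd b e D by case: b.
case: K => [[a1 K1] [a2 K2]] Dz Dw; rewrite prod_normE /= ge_max !ler_norml.
have /andP[h1 h2] := K1 z Dz; have /andP[h3 h4] := K1 w Dw.
have /andP[h5 h6] := K2 z Dz; have /andP[h7 h8] := K2 w Dw.
by apply/andP; split; apply/andP; split; xlra.
Qed.

Lemma plate_compact b G : cell G -> compact (plate b G).
Proof.
move=> [jG Gi]; have j : jordan (side b @` G).
  by apply: jordan_image => //; exact: side_cont.
have k := jordan_compact j; have [N N0 HN] := compact_bounded_by k.
apply: (@compact_of_closed_bounded _ _ N).
  have -> : plate b G = ~` (outside (side b @` G)).
    apply/seteqP; split=> [z [Jz [//]|iz /outside_not_inside//]|z nz].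
    by have [h|h|//] := in_or_out (side b @` G) z; [left|right].
  by apply: open_closedC; apply: ext_open; exact: compact_closedP.
by move=> z [/HN//|/(int_bounded (ltW N0) HN)].
Qed.

Lemma plate_nonempty b G : cell G -> plate b G !=set0.
Proof.
by move=> [[A [B [p [q [aA _ _ ->]]]]] _]; exists (side b p); left; exists p => //; left; exact: arc_l aA.
Qed.

(** * The limit of the refinements *)

Section Limit.
Variables (G : set P2) (L : nat -> seq (set P2)).
Hypothesis cG : cell G.
Hypothesis sL : forall n, splitted G (L n).
Hypothesis mL : forall n D, D \in L n -> mesh (n.+1%:R^-1) D.
Hypothesis refL : forall n D, D \in L n.+1 -> exists2 E, E \in L n & forall b, plate b D `<=` plate b E.

Definition linked b n z w := exists D, [/\ D \in L n, plate b D z & plate (~~ b) D w].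

(** Two cells of the same stage whose plates share a point coincide or share a rim point, and the
    partner of this rim point is within one mesh of both [w] and [w']. *)
Lemma linked_close b n z w w' D E : D \in L n -> E \in L n -> plate b D z -> plate b E z ->
  plate (~~ b) D w -> plate (~~ b) E w' -> `|w - w'| <= 2 / n.+1%:R.
Proof.
move=> Dn En Dz Ez Dw Ew; have [DE|m] := splitted_meet cG (sL n) Dn En.
  rewrite -DE in Ew; apply: le_trans (mL Dn Dw Ew) _.
  by rewrite ler_peMl ?invr_ge0 // ler1n.
have [x [Dx Ex] _] := m b z Dz Ez.
have h1 : `|w - side (~~ b) x| <= n.+1%:R^-1 by apply: mL Dn _ _ _ Dw _; left; exists x.
have h2 : `|w' - side (~~ b) x| <= n.+1%:R^-1 by apply: mL En _ _ _ Ew _; left; exists x.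
rewrite (_ : w - w' = (w - side (~~ b) x) - (w' - side (~~ b) x)); last by rewrite opprB addrA subrK.
rewrite (le_trans (ler_normB _ _)) // (_ : 2 / _ = n.+1%:R^-1 + n.+1%:R^-1) ?lerD //.
by rewrite mulrDl mul1r.
Qed.

Lemma linked_mono b n z w : linked b n.+1 z w -> linked b n z w.
Proof. by move=> [D [Dn Dz Dw]]; have [E En DE] := refL Dn; exists E; split => //; exact: DE. Qed.

Lemma linked_mono_le b n m z w : (n <= m)%N -> linked b m z w -> linked b n z w.
Proof.
move=> nm; rewrite -(subnKC nm); elim: (m - n)%N => [|k IH]; first by rewrite addn0.
by rewrite addnS => /linked_mono.
Qed.

Lemma linked_closed b n z : closed [set w | linked b n z w].
Proof.
have : forall D, D \in L n -> cell D by move=> D; exact: splitted_cell cG (sL n).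
rewrite /linked; elim: (L n) => [|D l IH] cl.
  have -> : [set w | exists D, [/\ D \in [::], plate b D z & plate (~~ b) D w]] = set0.
    by apply/seteqP; split=> // w [D []].
  exact: closed0.
have -> : [set w | exists E, [/\ E \in D :: l, plate b E z & plate (~~ b) E w]] =
    [set w | plate b D z /\ plate (~~ b) D w] `|` [set w | exists E, [/\ E \in l, plate b E z & plate (~~ b) E w]].
  apply/seteqP; split=> [w [E []]|w [[Dz Dw]|[E [El Ez Ew]]]].
  - by rewrite inE => /orP[/eqP-> ? ?|El Ez Ew]; [left|right; exists E].
  - by exists D; rewrite mem_head.
  - by exists E; rewrite inE El orbT.
apply: closedU; last by apply: IH => E El; apply: cl; rewrite inE El orbT.
have [Dz|nDz] := pselect (plate b D z).
  have -> : [set w | plate b D z /\ plate (~~ b) D w] = plate (~~ b) D by apply/seteqP; split=> w // [].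
  by apply: compact_closedP; apply: plate_compact; apply: cl; rewrite mem_head.
have -> : [set w | plate b D z /\ plate (~~ b) D w] = set0 by apply/seteqP; split=> w // [].
exact: closed0.
Qed.

(** The partners of [z] at the successive stages form decreasing closed sets, so a cluster point
    belongs to all of them. *)
Lemma linked_exists b z : plate b G z -> exists w, plate (~~ b) G w /\ forall n, linked b n z w.
Proof.
move=> Gz; have ex n : exists w, linked b n z w.
  have [D Dn Dz] := splitted_cover cG (sL n) Gz.
  have [w Dw] := @plate_nonempty (~~ b) D (splitted_cell cG (sL n) Dn).
  by exists w, D.
have [w Hw] := choice ex.
have sub n x : linked b n z x -> plate (~~ b) G x.
  by move=> [D [Dn _ Dx]]; exact: splitted_sub cG (sL n) Dn _ Dx.
have [|x [Gx cx]] := @plate_compact (~~ b) G cG (w @ \oo) _.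
  by exists 0%N => // n _; exact: sub (Hw n).
exists x; split => // n; apply: (@linked_closed b n z); move=> B nB.
apply: cx nB; exists n => // m /= nm; exact: linked_mono_le nm (Hw m).
Qed.

Lemma eps_small (e : R) : 0 < e -> exists n : nat, 2 / n.+1%:R < e.
Proof.
move=> e0; exists (Num.bound (2 / e)); have h : 0 <= 2 / e by rewrite divr_ge0 // ltW.
rewrite ltr_pdivrMr // mulrC -ltr_pdivrMr //.
by rewrite (lt_trans (archi_boundP h)) // ltr_nat.
Qed.

Lemma linked_uniq b z w w' : (forall n, linked b n z w) -> (forall n, linked b n z w') -> w = w'.
Proof.
move=> H H'; apply/eqP; rewrite -subr_eq0 -normr_le0; apply/ler_addgt0Pr => e e0; rewrite add0r.
have [n ne] := eps_small e0; have [D [Dn Dz Dw]] := H n; have [E [En Ez Ew]] := H' n.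
exact: le_trans (linked_close Dn En Dz Ez Dw Ew) (ltW ne).
Qed.

Lemma linked_sym b n z w : linked b n z w -> linked (~~ b) n w z.
Proof. by move=> [D [Dn Dz Dw]]; exists D; rewrite negbK. Qed.

Lemma avoid_closed (l : seq (set P2)) b z : (forall D, D \in l -> cell D) ->
  exists2 d, 0 < d & forall w D, D \in l -> `|z - w| < d -> plate b D w -> plate b D z.
Proof.
elim: l => [|D l IH] cl; first by exists 1.
have [|d d0 Hd] := IH; first by move=> E El; apply: cl; rewrite inE El orbT.
have [Dz|nDz] := pselect (plate b D z).
  exists d => // w E; rewrite inE => /orP[/eqP-> //|El]; exact: Hd El.
have cD : closed (plate b D) by apply: compact_closedP; apply: plate_compact; apply: cl; rewrite mem_head.
have [d' d'0 Hd'] := (iffLR (open_epsP _) (closed_openC cD)) z nDz.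
exists (Num.min d d'); first by rewrite lt_min d0.
move=> w E; rewrite inE lt_min => /orP[/eqP->|El] /andP[h1 h2] Ew; last exact: Hd El h1 Ew.
by case: (Hd' w h2).
Qed.

Lemma limit_map b : exists f : P -> P, [/\ {within plate b G, continuous f},
  forall z, plate b G z -> plate (~~ b) G (f z) /\ forall n, linked b n z (f z) &
  forall w, G w -> f (side b w) = side (~~ b) w].
Proof.
have ex z : exists w, plate b G z -> plate (~~ b) G w /\ forall n, linked b n z w.
  have [Gz|nGz] := pselect (plate b G z); last by exists 0.
  by have [w Hw] := linked_exists Gz; exists w.
have [f Hf] := choice ex; exists f; split => //; last first.
  move=> w Gw; have Gz : plate b G (side b w) by left; exists w.
  apply: (@linked_uniq b (side b w)); first exact: (Hf _ Gz).2.
  move=> n; have [D Dn Dw] := splitted_rim (sL n) Gw.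
  by exists D; split => //; left; exists w.
apply: within_epsP => z Gz e e0; have [n ne] := eps_small e0.
have [d d0 Hd] := @avoid_closed (L n) b z (fun D => @splitted_cell G (L n) D cG (sL n)).
exists d => // w Gw zw; apply: le_lt_trans ne.
have [D [Dn Dz Dfz]] := (Hf z Gz).2 n; have [E [En Ew Efw]] := (Hf w Gw).2 n.
exact: linked_close Dn En Dz (Hd w E En zw Ew) Dfz Efw.
Qed.

Lemma limit_homeo : exists f : P -> P, homeo_on (plate true G) (plate false G) f /\
  forall w, G w -> f w.1 = w.2.
Proof.
have [f [cf Hf fG]] := limit_map true; have [g [cg Hg gG]] := limit_map false.
have gf z : plate true G z -> g (f z) = z.
  move=> Gz; have [Gfz l1] := Hf z Gz; have [_ l2] := Hg _ Gfz.
  by apply: (linked_uniq l2) => n; apply: (@linked_sym true).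
have fg z : plate false G z -> f (g z) = z.
  move=> Gz; have [Ggz l1] := Hg z Gz; have [_ l2] := Hf _ Ggz.
  by apply: (linked_uniq l2) => n; apply: (@linked_sym false).
exists f; split; last by move=> w /fG.
exists g; split => //; apply/seteqP; split=> [_ [z /Hf [h _] <-]//|z Gz].
by exists (g z); [have [] := Hg z Gz | exact: fg].
Qed.
End Limit.

(** Extension form of the Schoenflies theorem for the homeomorphism with graph [G]: simultaneous
    subdivisions of both hulls, with meshes tending to [0], determine the extension in the limit. *)
Theorem schoenflies G : cell G -> exists f : P -> P,
  homeo_on (hull (fst @` G)) (hull (snd @` G)) f /\ forall w, G w -> f w.1 = w.2.
Proof.
move=> cG.
have next (nl : nat * seq (set P2)) : exists l, splitted G nl.2 -> [/\ splitted G l,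
    forall D, D \in l -> mesh (nl.1.+1%:R^-1) D &
    forall D, D \in l -> exists2 E, E \in nl.2 & forall b, plate b D `<=` plate b E].
  have [s|ns] := pselect (splitted G nl.2); last by exists [::].
  have [|l sl Hl] := @splitted_trans G nl.2 (mesh (nl.1.+1%:R^-1)) cG s.
    by move=> D cD _; apply: cell_refine; rewrite ?invr_gt0.
  by exists l => _; split => // D /Hl [].
have [F HF] := choice next.
pose L := fix L n := if n is m.+1 then F (n, L m) else F (0%N, [:: G]).
have sL n : splitted G (L n).
  by elim: n => [|n IH] /=; [have [] := HF (0%N, [:: G]) (splitted_leaf G) | have [] := HF (n.+1, L n) IH].
have mL n D : D \in L n -> mesh (n.+1%:R^-1) D.
  case: n => [|n] /=; first by have [_ H _] := HF (0%N, [:: G]) (splitted_leaf G); exact: H.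
  by have [_ H _] := HF (n.+1, L n) (sL n); exact: H.
have rL n D : D \in L n.+1 -> exists2 E, E \in L n & forall b, plate b D `<=` plate b E.
  by have [_ _ H] := HF (n.+1, L n) (sL n); exact: H.
exact: limit_homeo cG sL mL rL.
Qed.

End Schoenflies.

(** * Simple closed curves on the torus *)

Section TorusCurves.
Context (R : realType).
Notation P := (R * R)%type.
Notation P2 := (P * P)%type.
Notation I := (unit_interval R).
Implicit Types (e k : int * int) (C : set P2) (l : R -> P).

Lemma within_comp_within (T U W : topologicalType) (B : set T) (K : set U) (g : U -> W) (c : T -> U) :
  {within K, continuous g} -> continuous c -> (forall t, B t -> K (c t)) ->
  {within B, continuous (fun t => g (c t))}.
Proof.
move=> /subspace_continuousP cg cc BK; apply/subspace_continuousP => t Bt.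
have H := cg (c t) (BK t Bt); move=> A nA; have := H A nA; rewrite /= /within /= => nA'.
have : nbhs t (c @^-1` [set x | K x -> A (g x)]) := cc t _ nA'.
apply: filterS => s /= h Bs; exact: h (BK s Bs).
Qed.

Definition cover (z : P) : P2 := (cis z.1, cis z.2).
Definition zv k : P := (k.1%:~R, k.2%:~R).

Lemma cover_cont : continuous cover.
Proof. by move=> z; rewrite /cover /cis; cont. Qed.

Lemma zvD k k' : zv (k + k') = zv k + zv k'.
Proof. by apply: pair_eq; rewrite /= intrD. Qed.

Lemma zvN k : zv (- k) = - zv k.
Proof. by apply: pair_eq; rewrite /= intrN. Qed.

Lemma zv_inj : injective zv.
Proof. by move=> [a b] [a' b'] [/intr_inj-> /intr_inj->]. Qed.

Lemma coverD z k : cover (z + zv k) = cover z.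
Proof. by rewrite /cover /= !cisDz. Qed.

Lemma cover_eq z w : cover z = cover w -> exists k, z = w + zv k.
Proof.
move=> h; have [m em] := @cis_eq R z.1 w.1 (congr1 fst h).
have [n en] := @cis_eq R z.2 w.2 (congr1 snd h).
by exists (m, n); apply: pair_eq.
Qed.

Lemma circle_cis t : circle R (cis t).
Proof. exact: (@sqn_cis R t). Qed.

Lemma cover_bV z : bV R (cover z).
Proof. by split; exact: circle_cis. Qed.

Lemma circle_neq0 (u : P) : circle R u -> u != 0.
Proof. by rewrite -sqn_gt0 /circle /= /sqn => ->. Qed.

Lemma circle_sdir (u w : P) : circle R u -> circle R w -> sdir u w -> u = w.
Proof.
move=> cu cw [r r0 e]; have : sqn u = r ^+ 2 * sqn w by rewrite e sqnZ.
rewrite /sqn cu cw mulr1 => /esym/eqP; rewrite sqrf_eq1 => /orP[/eqP r1|/eqP r1].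
  by rewrite e r1 scale1r.
by rewrite r1 oppr_gt0 ltr10 in r0.
Qed.

Lemma int_part (t : R) : exists n : int, 0 <= t - n%:~R < 1.
Proof.
exists (Num.floor t); rewrite subr_ge0 Num.Theory.ge_floor /= ltrBlDr addrC.
by have := Num.Theory.lt_succ_floor t; rewrite intrD.
Qed.

Lemma circle_param (u : P) : circle R u -> exists2 t, I t & u = cis t.
Proof.
move=> cu; have [t ut] := sdir_cis_exists (circle_neq0 cu).
have [n /andP[n0 n1]] := int_part t; exists (t - n%:~R); first by rewrite IE n0 ltW.
by rewrite -intrN cisDz; apply: circle_sdir ut => //; exact: circle_cis.
Qed.

Lemma cover_lift (g : P -> P2) N : 0 <= N -> continuous g -> (forall z, bV R (g z)) ->
  exists2 w : P -> P, continuous w & forall z, `|z| <= N -> cover (w z) = g z.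
Proof.
move=> N0 cg gV.
have [||th1 c1 H1] := @lift_square R (fun z => (g z).1) N N0; first by cont.
  by move=> z _; apply: circle_neq0; case: (gV z).
have [||th2 c2 H2] := @lift_square R (fun z => (g z).2) N N0; first by cont.
  by move=> z _; apply: circle_neq0; case: (gV z).
exists (fun z => (th1 z, th2 z)); first by cont.
move=> z zN; have [g1 g2] := gV z; apply/esym; rewrite /cover /= [LHS]surjective_pairing.
by congr (_, _); apply: circle_sdir => //; [exact: circle_cis | exact: H1 | exact: circle_cis | exact: H2].
Qed.

Lemma lattice_const (w : R -> P) a b : a <= b -> continuous w ->
  (forall t, a <= t <= b -> exists k, w t = zv k) -> w a = w b.
Proof.
move=> ab cw Hw; pose u t := w (a + t * (b - a)).
have cu : continuous u by rewrite /u; cont.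
have Hu t : 0 <= t <= 1 -> exists k, u t = zv k.
  move=> /andP[t0 t1]; apply: Hw; have ab0 : 0 <= b - a by rewrite subr_ge0.
  have h1 : 0 <= t * (b - a) by rewrite mulr_ge0.
  have h2 : t * (b - a) <= b - a by rewrite ler_piMl.
  by apply/andP; split; xlra.
have -> : w a = u 0 by rewrite /u mul0r addr0.
have -> : w b = u 1 by rewrite /u mul1r addrC subrK.
apply: pair_eq.
  apply: (@integer_valued_const R (fun t => (u t).1)); first by cont.
  by move=> t /Hu [k ->]; exists k.1.
apply: (@integer_valued_const R (fun t => (u t).2)); first by cont.
by move=> t /Hu [k ->]; exists k.2.
Qed.

(** The additional variable [tau] allows isotopies to be extended, not only single curves. *)
Lemma quasi_periodic (G : P -> P) (e : P) : continuous G -> (forall tau : R, G (tau, 1) = G (tau, 0) + e) ->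
  exists L : P -> P, [/\ continuous L, forall tau u : R, L (tau, u + 1) = L (tau, u) + e &
    forall tau u : R, 0 <= u <= 1 -> L (tau, u) = G (tau, u)].
Proof.
move=> cG Ge.
(* A formula without case distinction that agrees with the extension [L] for second coordinates
   between [n - 1] and [n + 1], and so proves its continuity at the integers. *)
pose Psi (n : int) (z : P) := G (z.1, clamp 0 1 (z.2 - n%:~R)) +
  (G (z.1, clamp 0 1 (z.2 - n%:~R + 1)) - G (z.1, 1)) + n%:~R *: e.
have cPsi n : continuous (Psi n) by rewrite /Psi; cont.
pose fl (t : R) : int := Num.floor t.
have flP t : 0 <= t - (fl t)%:~R < 1.
  rewrite /fl subr_ge0 Num.Theory.ge_floor /= ltrBlDr addrC.
  by have := Num.Theory.lt_succ_floor t; rewrite intrD.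
have flU t (n : int) : 0 <= t - n%:~R < 1 -> fl t = n.
  by move=> h; apply: Num.Theory.floor_def; rewrite intrD; apply/andP; split; xlra.
pose L (z : P) := G (z.1, z.2 - (fl z.2)%:~R) + (fl z.2)%:~R *: e.
have LPsi n (z : P) : -1 < z.2 - n%:~R < 1 -> L z = Psi n z.
  move=> /andP[h1 h2]; rewrite /L /Psi; have [h|h] := leP 0 (z.2 - n%:~R).
    rewrite (flU _ n) ?h // clamp_id ?h ?ltW // clamp_ge //; first by rewrite subrr addr0.
    by xlra.
  rewrite (flU _ (n - 1)); last by rewrite intrB; apply/andP; split; xlra.
  rewrite clamp_le ?ltW // clamp_id; last by apply/andP; split; xlra.
  rewrite intrB opprB addrA [z.2 + 1 - _]addrAC Ge scalerBl scale1r.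
  set X := G _; set Y := G _; set Z := _ *: e.
  by clearbody X Y Z; apply: pair_eq; rewrite /=; ring.
exists L; split.
- move=> z; apply/ct_epsP => r r0; have /andP[h1 h2] := flP z.2.
  have [d d0 Hd] := (iffLR (ct_epsP _ _) (cPsi (fl z.2) z)) r r0.
  pose m := 1 - (z.2 - (fl z.2)%:~R); have m0 : 0 < m by rewrite subr_gt0.
  exists (Num.min d (Num.min m 1)); first by rewrite !lt_min d0 m0 /=.
  move=> w; rewrite !lt_min => /and3P[w1 w2 w3].
  have zw : `|z.2 - w.2| <= `|z - w| by rewrite prod_normE /= le_max lexx orbT.
  have := le_lt_trans zw w2; have := le_lt_trans zw w3; rewrite !ltr_norml /m => /andP[k1 k2] /andP[k3 k4].
  by rewrite !(LPsi (fl z.2)) //; [exact: Hd | apply/andP; split; xlra | apply/andP; split; xlra].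
- move=> tau u; rewrite /L /=; have /andP[h1 h2] := flP u.
  have -> : fl (u + 1) = fl u + 1 by apply: flU; rewrite intrD; apply/andP; split; xlra.
  by rewrite intrD opprD addrACA subrr addr0 scalerDl scale1r addrA.
move=> tau u /andP[u0 u1]; rewrite /L /=; have [u1'|u1'] := ltP u 1.
  by rewrite (flU u 0) ?subr0 ?u0 // scale0r addr0.
have -> : u = 1 by apply/eqP; rewrite eq_le u1.
by rewrite (flU 1 1) subrr ?lexx ?ltr01 // scale1r -Ge.
Qed.

(* The periodic extension to the line of a lift of a simple closed curve of class e. *)
Definition simple_lift e l := [/\ continuous l, forall t, l (t + 1) = l t + zv e &
  forall s t, cover (l s) = cover (l t) -> exists n : int, s = t + n%:~R].

Definition trace l : set P2 := (fun t => cover (l t)) @` I.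

Definition curve C e := exists2 l, simple_lift e l & trace l = C.

Lemma simple_lift_int e l t (n : int) : simple_lift e l -> l (t + n%:~R) = l t + n%:~R *: zv e.
Proof.
move=> [_ le _]; have N s (m : nat) : l (s + m%:R) = l s + m%:R *: zv e.
  elim: m => [|m IH]; first by rewrite scale0r !addr0.
  by rewrite -natr1 addrA le IH scalerDl scale1r addrA.
case: n => m; first exact: N.
have := N (t + (Negz m)%:~R) m.+1; rewrite NegzE mulrNz addrNK => ->.
by rewrite scaleNr addrK.
Qed.

Lemma cover_lift_int e l t (n : int) : simple_lift e l -> cover (l (t + n%:~R)) = cover (l t).
Proof.
move=> /simple_lift_int ->; have -> : n%:~R *: zv e = zv (n * e.1, n * e.2) by apply: pair_eq; rewrite /= intrM.
exact: coverD.
Qed.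

Lemma trace_all e l t : simple_lift e l -> trace l (cover (l t)).
Proof.
move=> sl; have [n /andP[n0 n1]] := int_part t; exists (t - n%:~R); first by rewrite IE n0 ltW.
by rewrite -intrN (cover_lift_int _ _ sl).
Qed.

(** On the torus, the curve is an embedded circle, so a path in it has a continuous parameter [phi].
    The difference between [w] and [l] at this parameter is a lattice vector, hence constant. *)
Lemma path_in_curve e l w : simple_lift e l -> continuous w ->
  (forall y, I y -> trace l (cover (w y))) ->
  exists (phi : R -> R) k, continuous phi /\ forall y, I y -> w y = l (phi y) + zv k.
Proof.
move=> sl cw Hw; have [cl le li] := sl.
pose f t := cover (l t); have cf : continuous f by move=> t; apply: (@ct_comp _ _ _ cover l); [exact: cover_cont | exact: cl].
have [|psi cpsi Hpsi] := @compact_factor R _ _ _ I f (@cis R) (@I_compact R) cf (@cis_cont R).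
  by move=> s t _ _ /li [n ->]; rewrite cisDz.
pose G (y : R) := psi (cover (w (clamp 0 1 y))).
have Ic (y : R) : I (clamp 0 1 y) by rewrite IE; exact: clamp_itv.
have cG : continuous G.
  apply: (within_comp cpsi) => [|y]; last exact: Hw.
  by move=> y; apply: (@ct_comp _ _ _ cover); [exact: cover_cont | cont].
have GE y : I y -> exists t, cover (w y) = cover (l t) /\ G y = cis t.
  by move=> Iy; have [t It e'] := Hw y Iy; exists t; rewrite /G clamp_id // -e' Hpsi.
have [|phi cphi Hphi] := @lift_path R G cG.
  by move=> t /GE [s [_ ->]]; exact: cis_neq0.
have K y : I y -> exists k, w y - l (phi y) = zv k.
  move=> Iy; have [t [e1 e2]] := GE y Iy; have := Hphi y Iy; rewrite e2 => /sdir_cis [n en].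
  have : cover (w y) = cover (l (phi y)) by rewrite e1 en (cover_lift_int _ _ sl).
  by move/cover_eq => [k ->]; exists k; rewrite addrC addKr.
have [k ek] := K 0 (I0 R); exists phi, k; split => // y Iy; move: (Iy); rewrite IE => /andP[y0 y1].
have : w 0 - l (phi 0) = w y - l (phi y).
  apply: (@lattice_const (fun y => w y - l (phi y)) 0 y y0); first by cont.
  by move=> t /andP[t0 ty]; apply: K; rewrite IE t0 (le_trans ty).
by rewrite ek => ->; rewrite addrC subrK.
Qed.

(** Followed along [l], one period of [l'] changes the parameter by an integer. *)
Lemma curve_class_multiple C e e' : curve C e -> curve C e' -> exists n : int, e' = (n * e.1, n * e.2).
Proof.
move=> [l sl lC] [l' sl' lC']; have [cl' le' _] := sl'.
have [|phi [k [cphi H]]] := path_in_curve sl cl'.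
  by move=> y Iy; rewrite lC -lC'; exact: trace_all sl'.
have := le' 0; rewrite add0r (H 1 (I1 R)) (H 0 (I0 R)) addrAC => /addIr h.
have [n en] : exists n : int, phi 1 = phi 0 + n%:~R.
  by case: sl => _ _; apply; rewrite h coverD.
move: h; rewrite en (simple_lift_int _ _ sl) => /addrI h; exists n; apply: zv_inj.
by rewrite -h; apply: pair_eq; rewrite /= intrM.
Qed.

Lemma curve_class_uniq C e e' : curve C e -> curve C e' -> e' = e \/ e' = - e.
Proof.
move=> ce ce'; have [n en] := curve_class_multiple ce ce'; have [m em] := curve_class_multiple ce' ce.
have K (x : int) : x != 0 -> x = m * (n * x) -> n = 1 \/ n = -1.
  move=> x0 h; have h1 : 1 * x = (m * n) * x by rewrite mul1r -mulrA.
  have /(congr1 absz) := mulIf x0 h1; rewrite abszM => /esym/eqP; rewrite muln_eq1 => /andP[_ /eqP n1].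
  by lia.
have fin : n = 1 \/ n = -1 -> e' = e \/ e' = - e.
  by rewrite en => -[->|->]; [left|right]; case: (e) => a b /=; rewrite ?mul1r ?mulN1r.
have [e1|n1] := eqVneq e.1 0; last first.
  by apply: fin; apply: K n1 _; rewrite {1}em en.
have [e2|n2] := eqVneq e.2 0; last first.
  by apply: fin; apply: K n2 _; rewrite {1}em en.
by left; rewrite en [RHS]surjective_pairing e1 e2 !mulr0.
Qed.

(** The isotopy lifts to the plane as a whole, and the vector between the two ends of the lifted
    circle is a lattice vector depending continuously on time. *)
Lemma isotopic_curves C C' : isotopic_circles R (bV R) C C' -> exists e, curve C e /\ curve C' e.
Proof.
move=> [H [cH emb H0 H1]].
pose g (z : P) := H (clamp 0 1 z.1, cis z.2).
have Ic (y : R) : I (clamp 0 1 y) by rewrite IE; exact: clamp_itv.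
have cg : continuous g.
  apply: (within_comp cH) => [|z]; first by rewrite /cis; cont.
  by split; [exact: Ic | exact: circle_cis].
have gV z : bV R (g z).
  by have [_ sub] := emb _ (Ic z.1); apply: sub; exists (cis z.2) => //; exact: circle_cis.
have [w cw Hw] := cover_lift ler01 cg gV.
have nrm (t u : R) : I t -> I u -> `|(t, u)| <= 1.
  by rewrite !IE => /andP[t0 t1] /andP[u0 u1]; rewrite prod_normE /= ge_max !ger0_norm // t1.
have K t : I t -> exists k, w (t, 1) - w (t, 0) = zv k.
  move=> It; have : cover (w (t, 1)) = cover (w (t, 0)).
    rewrite (Hw _ (nrm _ _ It (I1 R))) (Hw _ (nrm _ _ It (I0 R))).
    by change (H (clamp 0 1 t, cis 1) = H (clamp 0 1 t, cis 0)); rewrite cis1 cis0.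
  by move=> /cover_eq [k ->]; exists k; rewrite addrC addKr.
have [e ee] := K 0 (I0 R).
have Ke t : I t -> w (t, 1) = w (t, 0) + zv e.
  move=> It; move: (It); rewrite IE => /andP[t0 t1].
  have : w (0, 1) - w (0, 0) = w (t, 1) - w (t, 0).
    apply: (@lattice_const (fun t => w (t, 1) - w (t, 0)) 0 t t0); first by cont.
    by move=> s /andP[s0 st]; apply: K; rewrite IE s0 (le_trans st).
  by rewrite ee => ->; rewrite addrC subrK.
have [||L [cL Le LG]] := @quasi_periodic (fun z => w (clamp 0 1 z.1, clamp 0 1 z.2)) (zv e).
- by cont.
- by move=> tau /=; rewrite (@clamp_id _ 0 1 1) ?lexx ?ler01 // (@clamp_id _ 0 1 0) ?lexx ?ler01 // Ke.
have ext (f : R -> P) t : (forall u, f (u + 1) = f u + zv e) -> exists n : int, 0 <= t - n%:~R <= 1 /\ cover (f t) = cover (f (t - n%:~R)).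
  move=> fe; have [n /andP[n0 n1]] := int_part t; exists n; split; first by rewrite n0 ltW.
  have N s (m : nat) : cover (f (s + m%:R)) = cover (f s).
    elim: m => [|m IH]; first by rewrite addr0.
    by rewrite -natr1 addrA fe coverD.
  case: n {n0 n1} => m; first by rewrite -{1}(subrK m%:R t) N.
  by rewrite NegzE mulrNz opprK N.
have cov t s : I t -> cover (L (t, s)) = H (t, cis s).
  move=> It; have [n [In ->]] := ext (fun s => L (t, s)) s (Le t).
  rewrite LG // [X in w X]/= (clamp_id It) (clamp_id In) Hw ?nrm //.
  change (H (clamp 0 1 t, cis (s - n%:~R)) = H (t, cis s)).
  by rewrite (clamp_id It) -intrN cisDz.
have sl t : I t -> simple_lift e (fun s => L (t, s)).
  move=> It; split; [by cont | exact: Le |].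
  move=> s s'; rewrite !cov // => h; apply: cis_eq.
  have [[g' [_ _ _ gK]] _] := emb t It.
  by rewrite -(gK _ (circle_cis s)) h gK //; exact: circle_cis.
have tr t : I t -> trace (fun s => L (t, s)) = (fun x => H (t, x)) @` circle R.
  move=> It; apply/seteqP; split=> [_ [s Is <-]|_ [x /circle_param [s Is ->] <-]].
    by rewrite cov //; exists (cis s) => //; exact: circle_cis.
  by exists s; rewrite // cov.
exists e; split; [exists (fun s => L (0, s))|exists (fun s => L (1, s))].
- by apply: sl; exact: I0.
- by rewrite tr //; exact: I0.
- by apply: sl; exact: I1.
by rewrite tr //; exact: I1.
Qed.

Lemma slope_curve_trace (v : int * int) : trace (fun t => t *: zv (v.2, v.1)) = @slope_curve R v.
Proof.
apply/seteqP; split=> [_ [t It <-]|_ [t It <-]]; exists t => //; rewrite /cover /cis /= /GRing.scale /=.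
  by congr ((_, _), (_, _)); congr (_ _); ring.
by congr ((_, _), (_, _)); congr (_ _); ring.
Qed.

Lemma slope_curve_class (v : int * int) : coprimez v.1 v.2 -> curve (@slope_curve R v) (v.2, v.1).
Proof.
move=> cv; exists (fun t => t *: zv (v.2, v.1)); first split.
- by cont.
- by move=> t; rewrite scalerDl scale1r.
- move=> s t /cover_eq [k ek].
  have [[a b] ab] := coprimezP _ _ cv; rewrite /= in ab.
  pose x := s - t; have [e1 e2] : x * v.2%:~R = k.1%:~R /\ x * v.1%:~R = k.2%:~R.
    have h1 : s * v.2%:~R = t * v.2%:~R + k.1%:~R := congr1 fst ek.
    have h2 : s * v.1%:~R = t * v.1%:~R + k.2%:~R := congr1 snd ek.
    by rewrite /x !mulrBl h1 h2; split; ring.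
  exists (a * k.2 + b * k.1); rewrite intrD !intrM -e1 -e2.
  have -> : a%:~R * (x * v.1%:~R) + b%:~R * (x * v.2%:~R) = x * (a * v.1 + b * v.2)%:~R.
    by rewrite intrD !intrM; ring.
  by rewrite ab mulr1 /x addrC subrK.
exact: slope_curve_trace.
Qed.

Lemma slope_class C v e : has_slope C v -> curve C e -> (v.2, v.1) = e \/ (v.2, v.1) = - e.
Proof.
move=> [cv /isotopic_curves [e0 [c0 c1]]] ce.
have h1 := curve_class_uniq ce c0; have h2 := curve_class_uniq c1 (slope_curve_class cv).
by case: h1 h2 => -> [] ->; rewrite ?opprK; [left|right|right|left].
Qed.

(** Isotopy on the level of periodic lines, where composing isotopies and applying linear maps is
    easier than on the torus. *)
Definition liso e l l' := exists L : P -> P, [/\ continuous L,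
  forall tau, I tau -> simple_lift e (fun s => L (tau, s)),
  forall s, L (0, s) = l s & forall s, L (1, s) = l' s].

Lemma liso_trans e l1 l2 l3 : liso e l1 l2 -> liso e l2 l3 -> liso e l1 l3.
Proof.
move=> [L [cL sL L0 L1]] [M [cM sM M0 M1]].
pose N (z : P) := L (Num.min (2 * z.1) 1, z.2) + M (Num.max (2 * z.1 - 1) 0, z.2) - L (1, z.2).
have NL tau s : tau <= 2^-1 -> N (tau, s) = L (2 * tau, s).
  move=> h; rewrite /N /= min_l; last by xlra.
  by rewrite max_r ?M0 ?L1 ?addrK //; xlra.
have NM tau s : 2^-1 <= tau -> N (tau, s) = M (2 * tau - 1, s).
  move=> h; rewrite /N /= min_r; last by xlra.
  by rewrite max_l 1?addrC ?addKr //; xlra.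
exists N; split.
- by rewrite /N; cont.
- move=> tau; rewrite IE => /andP[t0 t1]; have [h|h] := leP tau 2^-1.
    rewrite (_ : (fun s => N (tau, s)) = fun s => L (2 * tau, s)); last by apply/funext => s; rewrite NL.
    by apply: sL; rewrite IE; apply/andP; split; xlra.
  rewrite (_ : (fun s => N (tau, s)) = fun s => M (2 * tau - 1, s)); last by apply/funext => s; rewrite NM ?ltW.
  by apply: sM; rewrite IE; apply/andP; split; xlra.
- by move=> s; rewrite NL ?mulr0 ?L0 // invr_ge0.
move=> s; rewrite NM; last by xlra.
by rewrite mulr1 (_ : 2 - 1 = 1) ?M1 //; xlra.
Qed.

Lemma liso_refl e l : simple_lift e l -> liso e l l.
Proof.
move=> sl; exists (fun z => l z.2); split => //; case: sl => cl _ _.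
by move=> z; apply: (@ct_comp _ _ _ l snd); [exact: cl | exact: cvg_snd].
Qed.

Lemma liso_isotopic e l l' : liso e l l' -> isotopic_circles R (bV R) (trace l) (trace l').
Proof.
move=> [L [cL sL L0 L1]].
pose f (z : P) := (z.1, cis z.2); pose h (z : P) := cover (L z).
have cf : continuous f by rewrite /f /cis; cont.
have ch : continuous h by move=> z; apply: (@ct_comp _ _ _ cover L); [exact: cover_cont | exact: cL].
have kK : compact (I `*` I) by apply: compact_setX; exact: I_compact.
have [|H cH HH] := @compact_factor R _ _ _ (I `*` I) f h kK cf ch.
  move=> [s1 s2] [t1 t2] [/= Is1 Is2] [/= It1 It2] [e1 e2 e3].
  have [n ->] : exists n : int, s2 = t2 + n%:~R by apply: cis_eq; apply: pair_eq.
  by rewrite /h e1 (cover_lift_int _ _ (sL _ It1)).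
have fK : f @` (I `*` I) = I `*` circle R.
  apply/seteqP; split=> [_ [[a b] [/= Ia Ib] <-]|[a b] [/= Ia /circle_param [s Is ->]]].
    by split => //=; exact: circle_cis.
  by exists (a, s).
rewrite fK in cH.
have HE t s : I t -> I s -> H (t, cis s) = cover (L (t, s)) by move=> It Is; apply: (HH (t, s)).
have im t : I t -> (fun x => H (t, x)) @` circle R = trace (fun s => L (t, s)).
  move=> It; apply/seteqP; split=> [_ [x /circle_param [s Is ->] <-]|_ [s Is <-]].
    by exists s => //; rewrite HE.
  by exists (cis s); [exact: circle_cis | exact: HE].
exists H; split => //.
- move=> t It; split; last by rewrite im // => _ [s _ <-]; exact: cover_bV.
  have ct : continuous (fun s => cover (L (t, s))).
    by move=> s; apply: (@ct_comp _ _ _ cover); [exact: cover_cont | cont].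
  have [|g cg Hg] := @compact_factor R _ _ _ I (fun s => cover (L (t, s))) (@cis R) (@I_compact R) ct (@cis_cont R).
    by move=> s s' _ _; have [_ _ li] := sL t It; move=> /li [n ->]; rewrite cisDz.
  exists g; split => //.
  + by apply: (@within_comp_within _ _ _ _ _ H (fun x : P => (t, x)) cH) => [|x cx]; [cont | split].
  + by rewrite im.
  + by move=> _ /circle_param [s Is ->]; rewrite HE // Hg.
- by rewrite (im _ (I0 R)) (_ : (fun s => L (0, s)) = l) //; apply/funext.
by rewrite (im _ (I1 R)) (_ : (fun s => L (1, s)) = l') //; apply/funext.
Qed.

End TorusCurves.

(** * Isotopies across discs *)

Section DiscMoves.
Context (R : realType).
Notation P := (R * R)%type.
Notation P2 := (P * P)%type.
Notation I := (unit_interval R).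
Implicit Types (e k : int * int) (l : R -> P) (X Y J : set P).

(** If the insides met, that of [X] would be contained in that of [Y] by connectedness; a point of
    [X] off [Y] would then be a limit of points inside [Y]. *)
Lemma jordan_hulls X Y z : jordan X -> jordan Y -> (forall w, X w -> ~ inside Y w) ->
  (forall w, Y w -> ~ inside X w) -> (exists2 w, X w & ~ Y w) -> hull X z -> hull Y z -> X z /\ Y z.
Proof.
move=> jX jY XY YX [x Xx nYx] [Xz|iX] [Yz|iY] //; [by case: (XY z Xz) | by case: (YX z Yz) |].
have sub w : inside X w -> inside Y w.
  move=> iw; apply: joined_int iY; apply: joined_sub (joined_inside jX iX iw) => u iu Yu.
  exact: YX Yu iu.
have cx : closure (inside Y) x.
  move=> W /nbhs_ballP [d d0 Hd]; have [[y iy xy] _] := jordan_frontier jX Xx d0.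
  by exists y; split; [exact: sub | apply: Hd; rewrite -ball_normE].
by have [/(XY _ Xx)|/nYx] := closure_int (compact_closedP (jordan_compact jY)) cx.
Qed.

Definition shift (c : P) X : set P := [set z | X (z - c)].

Lemma joined_shift (c : P) X x y : joined X x y -> joined (shift c X) (x + c) (y + c).
Proof.
move=> [f [cf Xf <- <-]]; exists (fun t => f t + c); split => //; first by cont.
by move=> t; rewrite /shift /= addrK.
Qed.

Lemma outside_shift (c : P) X z : outside X z -> outside (shift c X) (z + c).
Proof.
move=> [nXz H]; split; first by rewrite /shift /= addrK.
move=> N; have [y jy yN] := H (N + `|c|); exists (y + c); last first.
  have : `|y| <= `|y + c| + `|c| by rewrite -{1}(addrK c y) ler_normB.
  by move=> h; xlra.
by apply: joined_sub (joined_shift c jy) => w.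
Qed.

Lemma inside_shift (c : P) X z : inside (shift c X) z <-> inside X (z - c).
Proof.
have K (c' : P) Y w : inside (shift c' Y) w -> inside Y (w - c').
  move=> [nY no]; split => // o; apply: no; rewrite -(subrK c' w).
  exact: outside_shift.
split; first exact: K.
move=> i; have := K (- c) (shift c X) (z - c); rewrite opprK subrK; apply.
by congr (inside _ _): i; apply/seteqP; split=> w; rewrite /shift /= opprK addrK.
Qed.

Lemma jordan_shift (c : P) J : jordan J -> jordan (shift c J).
Proof.
move=> jJ; have -> : shift c J = (fun z => z + c) @` J.
  by apply/seteqP; split=> [z Jz|_ [z Jz <-]]; [exists (z - c); rewrite ?subrK | rewrite /shift /= addrK].
by apply: jordan_image => //; [cont | move=> x y _ _ /addIr].
Qed.

(** After [n] periods the line has moved by [n] times the nonzero class, so it leads to infinity;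
    [b] chooses the direction of travel. *)
Lemma lift_escapes e l X k u (b : bool) : zv R e != 0 -> simple_lift e l ->
  (forall x, 0 <= x -> ~ X (l (u + (-1) ^+ b * x) + zv R k)) -> outside X (l u + zv R k).
Proof.
move=> e0 sl H; have [cl _ _] := sl.
split; first by have := H 0 (lexx 0); rewrite mulr0 addr0.
move=> N; have e0' : 0 < `|zv R e| by rewrite normr_gt0.
pose c := l u + zv R k; pose n := Num.bound ((Num.max N 0 + `|c|) / `|zv R e|).
have nP : (Num.max N 0 + `|c|) / `|zv R e| < n%:R.
  by apply: archi_boundP; rewrite divr_ge0 // addr_ge0 // le_max lexx orbT.
rewrite ltr_pdivrMr // in nP.
exists (l (u + (-1) ^+ b * n%:R) + zv R k).
  have -> : l u = l (u + (-1) ^+ b * 0) by rewrite mulr0 addr0.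
  have cf : continuous (fun x : R => l (u + (-1) ^+ b * x) + zv R k) by cont.
  apply: (@joined_subpath R _ _ (fun x : R => l (u + (-1) ^+ b * x) + zv R k) 0 n%:R) => //.
  by move=> x /andP[x0 _]; exact: H.
have -> : (-1) ^+ b * n%:R = ((-1) ^+ b * n%:Z)%:~R :> R by rewrite intrM; case: (b).
rewrite (simple_lift_int _ _ sl) addrAC -/c.
have : `|((-1) ^+ b * n%:Z)%:~R *: zv R e| <= `|c + ((-1) ^+ b * n%:Z)%:~R *: zv R e| + `|c|.
  by set w := _ *: _; rewrite -{1}(addKr c w) addrC (le_trans (ler_normB _ _)).
rewrite normrZ -intr_norm normrM normrX normrN1 expr1n mul1r.
have : N <= Num.max N 0 by rewrite le_max lexx.
rewrite (_ : `|n%:Z|%:~R = n%:R :> R) //; move: nP; move: (n%:R * _) => y *; xlra.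
Qed.

Section DiscEmbedding.
(** [C] and the part of [l] between [s] and [t] bound a disc in the plane. The last two hypotheses
    say that [C] projects injectively to the torus and meets the curve there only in its ends; they
    force the disc to embed as well. *)
Variables (e : int * int) (l : R -> P) (s t : R) (C : set P).
Hypothesis e0 : zv R e != 0.
Hypothesis sl : simple_lift e l.
Hypothesis st : s < t < s + 1.
Hypothesis aC : arc C (l s) (l t).
Hypothesis Cl : forall z u k, C z -> z = l u + zv R k -> z = l s \/ z = l t.
Hypothesis CC : forall z w k, C z -> C w -> z = w + zv R k -> k = 0.

Let A := l @` `[s, t].
Let J := A `|` C.

Lemma lift_inj u w k : l u = l w + zv R k -> exists n : int, u = w + n%:~R /\ zv R k = n%:~R *: zv R e.
Proof.
move=> h; have [_ _ li] := sl; have [n en] := li u w ltac:(by rewrite h coverD).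
by exists n; split => //; move: h; rewrite en (simple_lift_int _ _ sl) => /addrI ->.
Qed.

Lemma lift_inj0 u w : l u = l w -> u = w.
Proof.
move=> h; have [|n [-> /esym/eqP]] := @lift_inj u w 0; first by rewrite addr0.
by rewrite scaler_eq0 (negbTE e0) orbF => /eqP->; rewrite addr0.
Qed.

Lemma int_small (n : int) : -1 < (n%:~R : R) < 1 -> n = 0.
Proof. move=> /andP[h1 h2]; have k1 : n < 1 by rewrite -(ltr_int R).
have k2 : -1 < n by rewrite -(ltr_int R).
by clear -k1 k2; lia. Qed.

Lemma disc_jarcs : jarcs J A C (l s) (l t).
Proof.
have [cl _ _] := sl; case/andP: st => s_t _; split => //.
  by apply: arc_param => // u w _ _; exact: lift_inj0.
by move=> z [[u _ <-] Cz]; apply: (Cl (u := u) (k := 0) Cz); rewrite addr0.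
Qed.

Let jJ : jordan J. Proof. by exists A, C, (l s), (l t); exact: disc_jarcs. Qed.

Lemma disc_rim u k : J (l u + zv R k) -> exists w (n : int), [/\ s <= w <= t, u = w + n%:~R & l u + zv R k = l w].
Proof.
have K w : s <= w <= t -> l u + zv R k = l w -> exists w (n : int), [/\ s <= w <= t, u = w + n%:~R & l u + zv R k = l w].
  move=> w01 h; have [|n [un en]] := @lift_inj u w (- k); first by rewrite -h zvN addrK.
  by exists w, n.
case/andP: st => s_t _.
move=> [[w w01 h]|Cz]; first by apply: (K w) => //; move: w01; rewrite /= in_itv.
by have [h|h] := Cl Cz erefl; [apply: (K s) | apply: (K t)]; rewrite // ?lexx ltW.
Qed.

(** A translate of [l] by a vector not parallel to [e] misses the rim and escapes to infinity. The
    other translates are [l] itself, whose parts before [s] and after [t] escape. *)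
Lemma disc_outside u k : ~ inside J (l u + zv R k).
Proof.
move=> ins; have nin : ~ outside J (l u + zv R k) by case: ins.
have [[n en]|nn] := pselect (exists n : int, zv R k = n%:~R *: zv R e); last first.
  apply: nin; apply: (@lift_escapes e l J k u false) => // x _ /disc_rim [w [n [_ _ h]]].
  by apply: nn; have [n' [_ h']] := lift_inj (esym h); exists n'.
have E : l u + zv R k = l (u + n%:~R) + zv R 0 by rewrite (simple_lift_int _ _ sl) en addr0.
rewrite E in nin ins; move: (u + n%:~R) nin ins => u' nin ins.
have [h|h] := ltP u' s.
  apply: nin; apply: (@lift_escapes e l J 0 u' true) => // x x0 /disc_rim [w [m [/andP[w1 _] _]]].
  by rewrite addr0 expr1 mulN1r => /lift_inj0 hh; hlra.
have [h'|h'] := ltP t u'.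
  apply: nin; apply: (@lift_escapes e l J 0 u' false) => // x x0 /disc_rim [w [m [/andP[_ w2] _]]].
  by rewrite addr0 expr0 mul1r => /lift_inj0 hh; hlra.
by case: ins => nJ _; apply: nJ; left; exists u'; rewrite ?addr0 //= in_itv /= h.
Qed.

Lemma disc_shift_rim k z : k != 0 -> J z -> ~ J (z + zv R k).
Proof.
move=> k0; have Al z' u n : A z' -> z' + zv R n = l u -> s <= u <= t -> n = 0.
  move=> [w]; rewrite /= in_itv /= => /andP[w1 w2] <- h /andP[u1 u2]; have [m [uw en]] := lift_inj (esym h).
  have m0 : m = 0 by case/andP: st => h1 h2; apply: int_small; apply/andP; split; hlra.
  by apply: (@zv_inj R); rewrite en m0 scale0r.
case/andP: (st) => s_t st1; have ss : s <= s <= t by rewrite lexx ltW.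
have tt : s <= t <= t by rewrite lexx ltW.
move=> [Az|Cz] [[w]|Cw].
- by rewrite /= in_itv /= => w01 h; move/eqP: k0; apply; exact: Al Az (esym h) w01.
- move/eqP: k0; apply; have [u _ zu] := Az.
  by have [h|h] := Cl (u := u) (k := k) Cw ltac:(by rewrite zu); [apply: Al Az h ss|apply: Al Az h tt].
- rewrite /= in_itv /= => w01 h.
  have h' : z = l w + zv R (- k) by rewrite h zvN addrK.
  have AE x : s <= x <= t -> A (l x) by move=> x01; exists x; rewrite //= in_itv.
  move/eqP: k0; apply; have [hz|hz] := Cl Cz h'.
    by apply: (Al (l s) w k) => //; [exact: AE | rewrite -hz].
  by apply: (Al (l t) w k) => //; [exact: AE | rewrite -hz].
by move/eqP: k0; apply; exact: (CC Cw Cz erefl).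
Qed.

(* Distinct lattice translates of J are disjoint and none lies inside another, because each contains
   points of a translate of the line l, which escapes to infinity outside J. *)
Lemma disc_embeds z w k : hull J z -> hull J w -> z = w + zv R k -> k = 0.
Proof.
move=> hz hw zw; have [//|k0] := eqVneq k 0; exfalso.
have out k' y : k' != 0 -> J y -> ~ inside J (y + zv R k').
  move=> k'0 Jy ins; apply: (@disc_outside s k').
  have Js : J (l s) by left; exists s => //=; rewrite in_itv /= lexx; case/andP: st => /ltW.
  apply: joined_int ins; apply: joined_sub (joined_shift (zv R k') (jordan_joined jJ Jy Js)).
  by move=> x; rewrite /shift /= => Jx Jx'; apply: (disc_shift_rim k'0 Jx); rewrite subrK.
have nout x : shift (zv R k) J x -> ~ inside J x.
  by move=> Jx; rewrite -(subrK (zv R k) x); exact: out.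
have nout' x : J x -> ~ inside (shift (zv R k) J) x.
  by move=> Jx /inside_shift; rewrite -zvN; apply: out; rewrite ?oppr_eq0.
have Js : J (l s) by left; exists s => //=; rewrite in_itv /= lexx; case/andP: st => /ltW.
have [||Jz] := jordan_hulls jJ (jordan_shift (zv R k) jJ) nout' nout _ hz.
- exists (l s) => //; rewrite /shift /= -zvN; apply: disc_shift_rim => //.
  by rewrite oppr_eq0.
- have sw : z - zv R k = w by rewrite zw addrK.
  by case: hw => [Jw|iw]; [left; rewrite /shift /= sw | right; apply/inside_shift; rewrite sw].
by rewrite /shift /= zw addrK => Jw; apply: (disc_shift_rim k0 Jw); rewrite -zw.
Qed.

End DiscEmbedding.

(** A path to infinity off [X] cannot leave the bounded set [U]. *)
Lemma cross_inside (U X : set P) N z : open U -> (forall w, U w -> `|w| <= N) ->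
  (forall w, closure U w -> U w \/ X w) -> U z -> hull X z.
Proof.
move=> oU UN cU Uz; have [Xz|nX] := pselect (X z); first by left.
right; split => // -[_ /(_ N) [y jy yN]].
by have := UN y (joined_cross oU cU jy Uz); rewrite leNgt yN.
Qed.

Lemma sqn_cont : continuous (@sqn R).
Proof. by rewrite /sqn => z; cont. Qed.

Lemma sqn_norm (z : P) : sqn z <= 1 -> `|z| <= 1.
Proof.
rewrite /sqn => h; have h1 : z.1 ^+ 2 <= 1 by have := sqr_ge0 z.2; move=> h'; xlra.
have h2 : z.2 ^+ 2 <= 1 by have := sqr_ge0 z.1; move=> h'; xlra.
have K (x : R) : x ^+ 2 <= 1 -> `|x| <= 1.
  by move=> hx; rewrite -(@ler_pXn2r _ 2) ?nnegrE // expr1n real_normK ?num_real.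
by rewrite prod_normE ge_max /= !K.
Qed.

Lemma hull_circle : hull (circle R) = disk R.
Proof.
apply/seteqP; split=> [z [|iz]|z dz].
- by rewrite /circle /disk /= => ->.
- rewrite /disk /=; apply/negPn/negP; rewrite -ltNge => h.
  have kc : compact (circle R).
    apply: (@compact_of_closed_bounded _ _ 1).
      apply: (@preimage_closed _ _ (@sqn R) [set 1]); first by move=> w _; exact: sqn_cont.
      exact: closed_eq.
    by move=> w cw; apply: sqn_norm; rewrite [sqn w](cw : _ = 1).
  apply: (outside_not_inside _ iz); split=> [cz|N].
    by move: h; rewrite (cz : _ = 1) ltxx.
  have z0 : 0 < `|z|.
    rewrite normr_gt0; apply/eqP => z0; move: h; rewrite z0 /= expr0n /= addr0 ltNge.
    by rewrite ler01.
  pose r := (Num.max N 0) / `|z| + 1; have r0 : 0 <= (Num.max N 0) / `|z|.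
    by rewrite divr_ge0 // le_max lexx orbT.
  exists ((1 + r) *: z).
    apply: joined_segment => s /andP[s0 s1] cw.
    have : sqn (z + s *: ((1 + r) *: z - z)) = 1 := cw.
    rewrite (_ : z + s *: ((1 + r) *: z - z) = (1 + s * r) *: z); last by apply: pair_eq; rewrite /= /GRing.scale /=; ring.
    rewrite sqnZ => e; have : 1 < (1 + s * r) ^+ 2 * sqn z.
      apply: lt_le_trans h _; rewrite -[leLHS]mul1r ler_wpM2r ?sqn_ge0 //.
      have h1 : 0 <= s * r by rewrite mulr_ge0 // addr_ge0.
      by rewrite expr2 mulr_ege1 // lerDl.
    by rewrite e ltxx.
  rewrite normrZ ger0_norm; last by rewrite !addr_ge0.
  have : N <= Num.max N 0 by rewrite le_max lexx.
  have : r * `|z| = Num.max N 0 + `|z| by rewrite /r mulrDl mul1r divfK // gt_eqF.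
  have -> : (1 + r) * `|z| = `|z| + r * `|z| by rewrite mulrDl mul1r.
  by move=> -> ?; xlra.
have [h|h] := eqVneq (sqn z) 1; first by left.
have oU : open [set w : P | sqn w < 1].
  apply: (@open_comp _ _ (@sqn R) [set x | x < 1]); first by move=> w _; exact: sqn_cont.
  exact: open_lt.
apply: (@cross_inside [set w | sqn w < 1] (circle R) 1) => //.
- by move=> w /ltW; exact: sqn_norm.
- move=> w cw; have : sqn w <= 1.
    have cl : closed [set w : P | sqn w <= 1].
      apply: (@preimage_closed _ _ (@sqn R) [set x | x <= 1]); first by move=> w' _; exact: sqn_cont.
      exact: closed_le.
    by apply: cl; apply: closureS cw => x /ltW.
  by rewrite le_eqVlt => /orP[/eqP|]; [right | left].
by rewrite /= lt_neqAle h.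
Qed.

Lemma cis_half_inj (s t : R) : I s -> I t -> cis (s / 2) = cis (t / 2) -> s = t.
Proof.
rewrite !IE => /andP[s0 s1] /andP[t0 t1] /cis_eq [n en].
have n0 : n = 0 by apply: int_small; apply/andP; split; xlra.
by rewrite n0 addr0 in en; xlra.
Qed.

Lemma cis_half_cross (s t : R) : I s -> I t -> cis (s / 2) = cis (- (t / 2)) -> s = 0 /\ t = 0 \/ s = 1 /\ t = 1.
Proof.
rewrite !IE => /andP[s0 s1] /andP[t0 t1] /cis_eq [n en].
have : n = 0 \/ n = 1.
  have k1 : n < 2 by rewrite -(ltr_int R) /=; xlra.
  have k2 : -1 < n by rewrite -(ltr_int R) /=; xlra.
  by clear -k1 k2; lia.
by case=> en'; rewrite en' /= in en; [left|right]; split; xlra.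
Qed.

(** The Schoenflies theorem for the unit circle, whose upper half corresponds to [f] and whose lower
    half to [g]. *)
Lemma jordan_disk J A B p q (f g : R -> P) : jarcs J A B p q -> continuous f -> continuous g ->
  injective_on I f -> injective_on I g -> A = f @` I -> B = g @` I ->
  f 0 = p /\ f 1 = q -> g 0 = p /\ g 1 = q ->
  exists phi : P -> P, [/\ homeo_on (disk R) (hull J) phi,
    forall x, I x -> phi (cis (x / 2)) = f x & forall x, I x -> phi (cis (- (x / 2))) = g x].
Proof.
move=> [_ _ AB JE] cf cg fi gi fA gB [f0 f1] [g0 g1].
pose u (x : R) : P2 := (cis (x / 2), f x); pose v (x : R) : P2 := (cis (- (x / 2)), g x).
have cu : continuous u by rewrite /u; cont.
have cv : continuous v by rewrite /v; cont.
pose G := (u @` I) `|` (v @` I).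
have uv0 : u 0 = v 0 by rewrite /u /v mul0r oppr0 f0 g0.
have uv1 : u 1 = v 1.
  by rewrite /u /v f1 g1 cisN mul1r cis_half /cconj /= oppr0.
have fg x y : I x -> I y -> f x = g y -> x = 0 /\ y = 0 \/ x = 1 /\ y = 1.
  move=> Ix Iy e; have [|e'|e'] := AB (f x).
  - by split; [rewrite fA; exists x | rewrite gB e; exists y].
  - by left; split; [apply: fi; rewrite ?f0 //; exact: I0 | apply: gi; rewrite ?g0 -?e //; exact: I0].
  by right; split; [apply: fi; rewrite ?f1 //; exact: I1 | apply: gi; rewrite ?g1 -?e //; exact: I1].
have Gi b : injective_on G (side b).
  have uu x y : I x -> I y -> side b (u x) = side b (u y) -> u x = u y.
    by move=> Ix Iy; case: (b) => /= e; rewrite ?(cis_half_inj Ix Iy e) ?(fi _ _ Ix Iy e).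
  have vv x y : I x -> I y -> side b (v x) = side b (v y) -> v x = v y.
    move=> Ix Iy; case: (b) => /= e; last by rewrite (gi _ _ Ix Iy e).
    by rewrite (cis_half_inj Ix Iy) // -(opprK (x / 2)) -(opprK (y / 2)) cisN e -cisN.
  have w x y : I x -> I y -> side b (u x) = side b (v y) -> u x = v y.
    move=> Ix Iy; case: (b) => /= e.
      by have [[-> ->]|[-> ->]] := cis_half_cross Ix Iy e.
    by have [[-> ->]|[-> ->]] := fg _ _ Ix Iy e.
  move=> _ _ [[x Ix <-]|[x Ix <-]] [[y Iy <-]|[y Iy <-]]; [exact: uu | exact: w | | exact: vv].
  by move/esym/w => ->.
have cG : cell G.
  split => //; exists (u @` I), (v @` I), (u 0), (u 1); split => //.
  - exists u; split => // s t Is It /(congr1 snd) /=; exact: fi.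
  - exists v; split => //.
    by move=> s t Is It /(congr1 snd) /=; exact: gi.
  move=> _ [[x Ix <-] [y Iy e]].
  by have [[-> _]|[-> _]] := fg _ _ Ix Iy (esym (congr1 snd e)); [left|right].
have [phi [hphi Hphi]] := schoenflies cG.
have e1 : fst @` G = circle R.
  apply/seteqP; split=> [_ [w [[x _ <-]|[x _ <-]] <-]|z /circle_param [t It ->]]; [exact: circle_cis | exact: circle_cis |].
  move: It; rewrite IE => /andP[t0 t1]; have [h|h] := leP t 2^-1.
    exists (u (2 * t)); last by rewrite /u /= mulrC mulKf.
    by left; exists (2 * t) => //; rewrite IE; apply/andP; split; xlra.
  exists (v (2 - 2 * t)).
    by right; exists (2 - 2 * t) => //; rewrite IE; apply/andP; split; xlra.
  rewrite /v /=; have -> : - ((2 - 2 * t) / 2) = t + (-1)%:~R by rewrite intrN; xlra.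
  by rewrite cisDz.
have e2 : snd @` G = J.
  rewrite JE fA gB /G image_setU; congr (_ `|` _).
    by apply/seteqP; split=> [_ [_ [x Ix <-] <-]|_ [x Ix <-]]; [exists x | exists (u x) => //; exists x].
  by apply/seteqP; split=> [_ [_ [x Ix <-] <-]|_ [x Ix <-]]; [exists x | exists (v x) => //; exists x].
rewrite e1 e2 hull_circle in hphi; exists phi; split => // x Ix.
  by have := Hphi (u x); apply; left; exists x.
by have := Hphi (v x); apply; right; exists x.
Qed.

Lemma simple_lift_shift e l (c : R) : simple_lift e l -> simple_lift e (fun u => l (u + c)).
Proof.
move=> [cl le li]; split; first by cont.
  by move=> t; rewrite addrAC le.
by move=> s t /li [n en]; exists n; move: en; rewrite addrAC => /addIr.
Qed.

Lemma quasi_periodic_eq (f g : R -> P) (e : P) : (forall u, f (u + 1) = f u + e) ->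
  (forall u, g (u + 1) = g u + e) -> (forall u, 0 <= u <= 1 -> f u = g u) -> forall u, f u = g u.
Proof.
move=> fe ge fg u; have [n /andP[n0 n1]] := int_part u.
have N (h : R -> P) s (m : nat) : (forall u, h (u + 1) = h u + e) -> h (s + m%:R) = h s + m%:R *: e.
  move=> he; elim: m => [|m IH]; first by rewrite scale0r !addr0.
  by rewrite -natr1 addrA he IH scalerDl scale1r addrA.
have fg' := fg (u - n%:~R) ltac:(by rewrite n0 ltW).
case: n n0 n1 fg' => m n0 n1 fg'; first by rewrite -(subrK m%:R u) !N // fg'.
move: fg'; rewrite NegzE mulrNz opprK !N // => /addIr; exact.
Qed.

(** The disc embeds in the torus by [disc_embeds], and the rest of the curve does not enter it, so
    the curve remains simple while its arc is pushed through. *)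
Lemma disc_move0 e l t (C : set P) : zv R e != 0 -> simple_lift e l -> 0 < t < 1 -> arc C (l 0) (l t) ->
  (forall z u k, C z -> z = l u + zv R k -> z = l 0 \/ z = l t) ->
  (forall z w k, C z -> C w -> z = w + zv R k -> k = 0) ->
  exists l', [/\ simple_lift e l', liso e l l', forall u, t <= u <= 1 -> l' u = l u & l' @` `[0, t] = C].
Proof.
move=> e0 sl t01 aC Cl CC; have [cl le li] := sl.
have st : 0 < t < 0 + 1 by rewrite add0r.
case/andP: (t01) => t0 t1.
have ja := disc_jarcs e0 sl st aC Cl.
have [g [cg gi gC [g0 g1]]] := aC.
pose f (x : R) := l (t * x).
have cf : continuous f by rewrite /f; cont.
have fi : injective_on I f.
  by move=> x y _ _ /(lift_inj0 e0 sl) /(mulfI (negbT (gt_eqF t0))).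
have fA : l @` `[0, t] = f @` I.
  apply/seteqP; split=> [_ [x + <-]|_ [x + <-]]; rewrite ?IE /= ?in_itv /= => /andP[x0 x1].
    exists (x / t); last by rewrite /f mulrC divfK ?gt_eqF.
    by rewrite IE divr_ge0 ?(ltW t0) //= ler_pdivrMr // mul1r.
  by exists (t * x) => //; rewrite /= in_itv /= mulr_ge0 ?(ltW t0) //= ler_piMr // ltW.
have [||phi [hphi Hf Hg]] := jordan_disk ja cf cg fi gi fA gC.
- by rewrite /f mulr0 mulr1.
- by [].
have [psi [cphi cpsi phiD psiK]] := hphi.
have phi_inj z w : disk R z -> disk R w -> phi z = phi w -> z = w.
  by move=> dz dw h; rewrite -(psiK z dz) h psiK.
have phi_hull z : disk R z -> hull (l @` `[0, t] `|` C) (phi z) by move=> dz; rewrite -phiD; exists z.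
(* Flattening the upper half circle by the factor [1 - 2 * tau] moves it to the lower half circle
   with fixed ends. *)
pose pt (tau x : R) : P := ((cis (x / 2)).1, (1 - 2 * tau) * (cis (x / 2)).2).
have ptD tau x : 0 <= tau <= 1 -> disk R (pt tau x).
  move=> /andP[a0 a1]; rewrite /disk /pt /= exprMn.
  have h : sqn (cis (x / 2)) = 1 := sqn_cis _; rewrite /sqn in h.
  have h2 : (1 - 2 * tau) ^+ 2 <= 1.
    rewrite (_ : (1 - 2 * tau) ^+ 2 = 1 - 4 * (tau * (1 - tau))); last by ring.
    have : 0 <= tau * (1 - tau) by rewrite mulr_ge0 // subr_ge0.
    by move=> h'; xlra.
  by rewrite -[leRHS]h /= lerD2l ler_piMl // sqr_ge0.
pose part (z : P) := phi (pt (clamp 0 1 z.1) (clamp 0 1 (z.2 / t))).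
have cpart : continuous part.
  apply: (within_comp cphi); first by rewrite /pt /cis; cont.
  by move=> z; apply: ptD; exact: clamp_itv.
have pt0 tau : pt tau 0 = (1, 0) by rewrite /pt mul0r cis0 /= mulr0.
have pt1 tau : pt tau 1 = (-1, 0) by rewrite /pt mul1r cis_half /= mulr0.
have phi0 : phi (1, 0) = l 0 by have := Hf 0 (I0 R); rewrite mul0r cis0 /f mulr0.
have phi1 : phi (-1, 0) = l t by have := Hf 1 (I1 R); rewrite mul1r cis_half /f mulr1.
have part_r tau u : t <= u -> part (tau, u) = l t.
  by move=> tu; rewrite /part /= (@clamp_ge _ 0 1 (u / t)) ?ler01 ?ler_pdivlMr ?mul1r // pt1.
have part_l tau : part (tau, 0) = l 0.
  by rewrite /part /= mul0r (@clamp_le _ 0 1 0) ?ler01 ?lexx // pt0.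
(* [part] rests at [l t] from the parameter [t] on, so the sum runs through the moving arc and then
   along [l]. *)
pose G (z : P) := part z + l (clamp t 1 z.2) - l t.
have cG : continuous G by rewrite /G; cont.
have Gl tau u : u <= t -> G (tau, u) = part (tau, u).
  by move=> ut; rewrite /G /= (clamp_le (ltW t1) ut) addrK.
have Gr tau u : t <= u -> u <= 1 -> G (tau, u) = l u.
  by move=> tu u1; rewrite /G part_r //= clamp_id ?tu // addrC addKr.
have l1 : l 1 = l 0 + zv R e by rewrite -le add0r.
have [|L [cL Le LG]] := quasi_periodic cG (e := zv R e).
  by move=> tau; rewrite Gr ?(ltW t1) // Gl ?(ltW t0) // part_l.
have ext e' (s u : R) (h : R -> P) : (forall u, h (u + 1) = h u + zv R e') -> exists n : int, 0 <= u - n%:~R < 1 /\ cover (h u) = cover (h (u - n%:~R)).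
  move=> he; have [n n01] := int_part u; exists n; split => //.
  have N s' (m : nat) : cover (h (s' + m%:R)) = cover (h s').
    elim: m => [|m IH]; first by rewrite addr0.
    by rewrite -natr1 addrA he coverD.
  case: n {n01} => m; first by rewrite -{1}(subrK m%:R u) N.
  by rewrite NegzE mulrNz opprK N.
have core tau u u' : I tau -> 0 <= u < 1 -> 0 <= u' < 1 -> u <= t -> cover (G (tau, u)) = cover (G (tau, u')) -> u = u'.
  move=> It; have tau01 : clamp 0 1 tau = tau by rewrite clamp_id.
  have dD x : disk R (pt (clamp 0 1 tau) x) by apply: ptD; exact: clamp_itv.
  move=> /andP[u0 u1] /andP[u'0 u'1] ut; rewrite Gl //.
  have xI v : 0 <= v -> v <= t -> clamp 0 1 (v / t) = v / t /\ I (v / t).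
    move=> v0 vt; have h : 0 <= v / t <= 1 by rewrite divr_ge0 ?(ltW t0) //= ler_pdivrMr // mul1r.
    by rewrite clamp_id // IE.
  have [u't|tu'] := leP u' t.
    rewrite Gl // => /cover_eq [k hk].
    have k0 := disc_embeds e0 sl st aC Cl CC (phi_hull _ (dD _)) (phi_hull _ (dD _)) hk.
    move: hk; rewrite k0 addr0 => /phi_inj h; have {}h := h (dD _) (dD _).
    have [e1 i1] := xI u u0 ut; have [e2 i2] := xI u' u'0 u't.
    move: h; rewrite /= e1 e2 => /(congr1 fst) /= h.
    have : u / t = u' / t.
      move: i1 i2; rewrite !IE => /andP[a0 a1] /andP[b0 b1].
      have bd (y : R) : 0 <= y -> y <= 1 -> 2 * pi * (y / 2) \in `[0, pi].
        move=> y0 y1; rewrite in_itv /= (_ : 2 * pi * (y / 2) = pi * y); last by field.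
        by rewrite mulr_ge0 ?pi_ge0 //= ler_piMr // pi_ge0.
      have h' := cos_inj (bd _ a0 a1) (bd _ b0 b1) h.
      have p0 : 2 * pi != 0 :> R by rewrite mulf_neq0 // gt_eqF // pi_gt0.
      by have := mulfI p0 h' => h''; xlra.
    by move=> /(mulIf (invr_neq0 (negbT (gt_eqF t0)))).
  (* A translate of a point of [l] in the disc lies on the rim, so up to an integer its parameter is
     in [[0, t]]; this excludes the remaining parameters. *)
  rewrite Gr ?ltW // => /cover_eq [k hk].
  have Jz := phi_hull _ (dD (clamp 0 1 (u / t))); have hk' : part (tau, u) = l u' + zv R k := hk.
  rewrite -/(part (tau, u)) in Jz.
  have := Jz; rewrite hk' => -[|ins]; last by case: (disc_outside e0 sl st Cl ins).
  move=> /(disc_rim sl st Cl) [w [n [/andP[w0 wt] uw hw]]].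
  have n0 : n = 0 \/ n = 1.
    have k1 : n < 2 by rewrite -(ltr_int R) /=; xlra.
    have k2 : -1 < n by rewrite -(ltr_int R) /=; xlra.
    by clear -k1 k2; lia.
  case: n0 => en; rewrite en /= in uw; last by xlra.
  by xlra.
have lL0 s : L (0, s) = l s.
  apply: (@quasi_periodic_eq (fun s => L (0, s)) l (zv R e)) => // u u01; rewrite LG //.
  case/andP: u01 => u0 u1; have [ut|tu] := leP u t; last by rewrite Gr // ltW.
  rewrite Gl // /part /= (@clamp_le _ 0 1 0) ?lexx ?ler01 // /pt mulr0 subr0 mul1r -surjective_pairing.
  rewrite clamp_id; last by rewrite divr_ge0 ?(ltW t0) //= ler_pdivrMr // mul1r.
  rewrite Hf; last by rewrite IE divr_ge0 ?(ltW t0) //= ler_pdivrMr // mul1r.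
  by rewrite /f mulrC divfK // gt_eqF.
have sL tau : I tau -> simple_lift e (fun s => L (tau, s)).
  move=> It; split; [by cont | exact: Le |] => s s'.
  have [n [n01 ->]] := ext e 0 s (fun s => L (tau, s)) (Le tau).
  have [n' [n01' ->]] := ext e 0 s' (fun s => L (tau, s)) (Le tau).
  case/andP: (n01) => a0 a1; case/andP: (n01') => b0 b1.
  rewrite !LG ?a0 ?b0 ?ltW // => h.
  suff h' : s - n%:~R = s' - n'%:~R by exists (n - n'); rewrite intrB; xlra.
  have [ut|tu] := leP (s - n%:~R) t; first exact: core h.
  have [ut'|tu'] := leP (s' - n'%:~R) t; first by apply/esym; apply: core (esym h).
  move: h; rewrite !Gr ?ltW // => /li [m em].
  have m0 : m = 0 by apply: int_small; apply/andP; split; xlra.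
  by rewrite em m0 addr0.
exists (fun s => L (1, s)); split.
- exact: sL (I1 R).
- by exists L; split.
- by move=> u /andP[tu u1]; rewrite LG ?Gr // u1 (le_trans (ltW t0)).
have L1 x : I x -> L (1, t * x) = g x.
  rewrite IE => /andP[x0 x1]; have h1 : 0 <= t * x by rewrite mulr_ge0 // ltW.
  have h2 : t * x <= t by rewrite ler_piMr // ltW.
  rewrite LG; last by rewrite h1 (le_trans h2) // ltW.
  rewrite Gl // /part /= (@clamp_ge _ 0 1 1) ?lexx ?ler01 // [t * x]mulrC mulfK ?gt_eqF //.
  rewrite clamp_id ?x0 // -Hg ?IE ?x0 //; congr phi; rewrite cisN /pt /cconj.
  by congr (_, _); rewrite mulr1; ring.
rewrite gC; apply/seteqP; split=> [_ [x + <-]|_ [x Ix <-]].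
  rewrite /= in_itv /= => /andP[x0 xt]; exists (x / t).
    by rewrite IE divr_ge0 ?(ltW t0) //= ler_pdivrMr // mul1r.
  by rewrite -L1 ?IE ?divr_ge0 ?(ltW t0) //= ?ler_pdivrMr ?mul1r // mulrC divfK // gt_eqF.
exists (t * x); last exact: L1.
by move: Ix; rewrite IE /= in_itv /= => /andP[x0 x1]; rewrite mulr_ge0 ?(ltW t0) //= ler_piMr // ltW.
Qed.

(* Isotoping an arc of the curve across the disc that it cobounds with C. *)
Lemma disc_move e l s t (C : set P) : zv R e != 0 -> simple_lift e l -> s < t < s + 1 -> arc C (l s) (l t) ->
  (forall z u k, C z -> z = l u + zv R k -> z = l s \/ z = l t) ->
  (forall z w k, C z -> C w -> z = w + zv R k -> k = 0) ->
  exists l', [/\ simple_lift e l', liso e l l', forall u, t <= u <= s + 1 -> l' u = l u & l' @` `[s, t] = C].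
Proof.
move=> e0 sl /andP[s_t st1] aC Cl CC.
have [||||l' [sl' [L [cL sL L0 L1]] l'r l'C]] := @disc_move0 e (fun u => l (u + s)) (t - s) C e0 (simple_lift_shift s sl).
- by apply/andP; split; xlra.
- by rewrite add0r subrK.
- by move=> z u k Cz; rewrite add0r subrK => h; exact: Cl Cz h.
- exact: CC.
exists (fun u => l' (u - s)); split.
- exact: simple_lift_shift.
- exists (fun z => L (z.1, z.2 - s)); split.
  + by cont.
  + by move=> tau It; exact: (simple_lift_shift (- s) (sL tau It)).
  + by move=> u; rewrite L0 subrK.
  + by move=> u; rewrite L1.
- by move=> u /andP[tu us]; rewrite l'r ?subrK //; apply/andP; split; xlra.
rewrite -l'C; apply/seteqP; split=> [_ [u + <-]|_ [u + <-]]; rewrite /= in_itv /= => /andP[h1 h2].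
  by exists (u - s) => //; rewrite /= in_itv /=; apply/andP; split; xlra.
by exists (u + s); rewrite ?addrK //= in_itv /=; apply/andP; split; xlra.
Qed.

End DiscMoves.

(** * Isotopy to a linear curve *)

Section Straightening.
Context (R : realType).
Notation P := (R * R)%type.
Notation P2 := (P * P)%type.
Notation I := (unit_interval R).
Implicit Types (l : R -> P) (X J K : set P).

Definition e1 : int * int := (1, 0).

Lemma e1_neq0 : zv R e1 != 0.
Proof. by apply/eqP => /(congr1 fst) /= /eqP; rewrite oner_eq0. Qed.

(** A U-shaped arc below the ends of one period: it completes this period to the Jordan curve
    [frame], whose inside can be cut by chords. *)
Definition brim (a d m : R) : set P :=
  (pair a @` `[d, m]) `|` ((fun x => (x, d)) @` `[a, a + 1]) `|` (pair (a + 1) @` `[d, m]).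

Lemma brimP a d m (z : P) : brim a d m z <->
  (z.1 = a \/ z.1 = a + 1) /\ d <= z.2 <= m \/ z.2 = d /\ a <= z.1 <= a + 1.
Proof.
split.
  by move=> [[]|] [x + <-]; rewrite /= in_itv /= => h; [left; split => //; left | right | left; split => //; right].
case: z => x y /= [[[->|->] h]|[-> h]].
- by left; left; exists y.
- by right; exists y.
by left; right; exists x.
Qed.

Lemma brim_arc a d m : d < m -> arc (brim a d m) (a, m) (a + 1, m).
Proof.
move=> dm; have aa : a < a + 1 by rewrite ltrDl.
have V0 := arc_sym (mk_arc (coordinates_fst R) a dm).
have B := mk_arc (coordinates_snd R) d aa.
have V1 := mk_arc (coordinates_fst R) (a + 1) dm.
apply: arc_cat V1 _; first apply: arc_cat V0 B _.
- move=> z [[y + <-] [x + [ex ey]]]; rewrite /= !in_itv /= => _ _.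
  by rewrite /set1 /= -ey.
move=> z [[[y _ <-]|[x _ <-]] [y' _ [ex ey]]]; first by move: aa; rewrite ex ltxx.
by rewrite /set1 /= ex.
Qed.

Lemma lift1_int l u (n : int) : simple_lift e1 l -> l (u + n%:~R) = ((l u).1 + n%:~R, (l u).2).
Proof.
move=> sl; rewrite (simple_lift_int _ _ sl); apply: pair_eq; rewrite /= /GRing.scale /= ?mulr1 //.
by rewrite mulr0 addr0.
Qed.

Definition frame l d := l @` I `|` brim (l 0).1 d (l 0).2.

(** * One period of a curve closed by a brim *)

Section Frame.
Variables (l : R -> P) (d : R).
Hypothesis sl : simple_lift e1 l.
Hypothesis lmin : forall u, (l 0).2 <= (l u).2.
Hypothesis dl : d < (l 0).2.

Lemma lift1_one : l 1 = ((l 0).1 + 1, (l 0).2).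
Proof. by have := lift1_int 0 1 sl; rewrite add0r. Qed.

Lemma brim_lift u : brim (l 0).1 d (l 0).2 (l u) -> u = 0 \/ u = 1.
Proof.
have um := lmin u; have dl' := dl; move=> /brimP [[e /andP[_ h]]|[h _]]; last by exfalso; flra.
have h2 : (l u).2 = (l 0).2 by apply/eqP; rewrite eq_le h um.
case: e => h1; [left|right]; apply: (lift_inj0 e1_neq0 sl); first exact: pair_eq.
by rewrite lift1_one; exact: pair_eq.
Qed.

Lemma frame_jarcs : jarcs (frame l d) (l @` I) (brim (l 0).1 d (l 0).2) (l 0) (l 1).
Proof.
have [cl _ _] := sl; split => //.
- by apply: arc_param; rewrite ?ltr01 // => s t _ _; exact: (lift_inj0 e1_neq0 sl).
- by have := brim_arc (l 0).1 dl; rewrite -lift1_one -surjective_pairing.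
by move=> z [[u _ <-] /brim_lift [->|->]]; [left|right].
Qed.

Lemma frame_jordan : jordan (frame l d).
Proof. by exists (l @` I), (brim (l 0).1 d (l 0).2), (l 0), (l 1); exact: frame_jarcs. Qed.

Lemma frame_rim u : frame l d (l u) -> 0 <= u <= 1.
Proof.
move=> [[w Iw]|/brim_lift [->|->]]; rewrite ?lexx ?ler01 //.
by move=> /(lift_inj0 e1_neq0 sl) <-; rewrite -IE.
Qed.

(** Horizontal translates are the curve itself, whose other periods run off to infinity. Upward
    translates are disjoint from the curve and stay above the brim; a downward one could cross the
    brim, hence the sign condition. *)
Lemma frame_outside u (k : int * int) : 0 <= k.2 -> ~ inside (frame l d) (l u + zv R k).
Proof.
move=> k0 ins; have no : ~ outside (frame l d) (l u + zv R k) by case: ins.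
have [k2|k2] := eqVneq k.2 0.
  have E : l u + zv R k = l (u + k.1%:~R) + zv R 0.
    by rewrite (lift1_int _ _ sl) addr0; apply: pair_eq; rewrite /= ?k2 ?addr0.
  rewrite E in no ins; move: (u + k.1%:~R) no ins => w no ins.
  have [h|h] := ltP w 0.
    apply: no; apply: (@lift_escapes R e1 l _ 0 w true e1_neq0 sl) => x x0.
    by rewrite addr0 expr1 mulN1r => /frame_rim /andP[h1 h2]; flra.
  have [h'|h'] := ltP 1 w.
    apply: no; apply: (@lift_escapes R e1 l _ 0 w false e1_neq0 sl) => x x0.
    by rewrite addr0 expr0 mul1r => /frame_rim /andP[h1 h2]; flra.
  by case: ins => n _; apply: n; rewrite addr0; left; exists w => //; rewrite IE h.
have k1 : 1 <= k.2%:~R :> R by rewrite (ler_int R 1); clear -k0 k2; lia.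
have dl' := dl; apply: no; apply: (@lift_escapes R e1 l _ k u false e1_neq0 sl) => x x0.
have hx := lmin (u + (-1) ^+ false * x); move: (u + (-1) ^+ false * x) hx => w hw [[y Iy h]|].
  have [n [_ en]] := lift_inj sl h; have := congr1 snd en; rewrite /= /GRing.scale /= mulr0 => h'; flra.
by move=> /brimP /= [[_ /andP[_ h]]|[h _]]; flra.
Qed.

Lemma frame_height z M : (forall u, (l u).2 <= M) -> hull (frame l d) z -> d <= z.2 <= M.
Proof.
move=> lM; have K w : frame l d w -> d <= w.2 <= M.
  have m0 := lM 0; have dl' := dl.
  move=> [[u _ <-]|/brimP [[_ /andP[h1 h2]]|[-> _]]]; first by have := lmin u; have := lM u; move=> *; apply/andP; split; hlra.
    by apply/andP; split; hlra.
  by apply/andP; split; hlra.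
have kF := jordan_compact frame_jordan.
move=> [/K//|iz]; have [x /K /andP[_ h1] h2] := inside_below (coordinates_snd R) kF iz.
have [y /K /andP[h3 _] h4] := inside_above (coordinates_snd R) kF iz.
by rewrite (le_trans h3 h4) (le_trans h2 h1).
Qed.

Lemma frame_bottom (x : R) : ~ inside (frame l d) (x, d).
Proof.
move=> ins; have kF := jordan_compact frame_jordan.
have [r r0 Hr] := (iffLR (open_epsP _) (@int_open R _ (compact_closedP kF))) _ ins.
have i2 : inside (frame l d) (x, d - r / 2).
  by apply: Hr; rewrite prod_normE /= subrr normr0 opprB addrCA subrr addr0 max_r ?normr_ge0 // gtr0_norm; hlra.
have [y [[u _ <-]|/brimP [[_ /andP[h1 h2]]|[h1 _]]] /= h4] := inside_above (coordinates_snd R) kF i2; try by clear -h1 h4 r0; flra.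
by have := lmin u; have := dl; move=> *; flra.
Qed.

(** A point of a translated side of the brim is moved up vertically to the end of the side, which
    lies on a translate of the curve. *)
Lemma frame_translate_outside z (n : int) : n != 0 -> frame l d z -> ~ inside (frame l d) (z + zv R (n, 0)).
Proof.
move=> n0; have dl' := dl.
move=> [[w _ <-]|/brimP [[zj /andP[h1 h2]]|[h _]]]; first exact: frame_outside.
  have [N zN] : exists N : int, z + zv R (n, 0) = ((l 0).1 + N%:~R, z.2).
    by case: zj => h; [exists n|exists (n + 1)]; apply: pair_eq; rewrite /= ?h ?addr0 ?intrD // addrA addrAC.
  rewrite zN; have [N01|N01] := pselect (N = 0 \/ N = 1).
    move=> [nF _]; apply: nF; right; apply/brimP; left; rewrite h1 h2; split => //=.
    by case: N01 => ->; [left; rewrite addr0|right].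
  move=> ins; apply: (@frame_outside 0 (N, 0)) => //.
  have -> : l 0 + zv R (N, 0) = ((l 0).1 + N%:~R, (l 0).2) by apply: pair_eq; rewrite /= ?addr0.
  have [cl _ _] := sl; apply: joined_int ins.
  apply: (@joined_subpath R _ _ (fun y : R => ((l 0).1 + N%:~R, y)) z.2 (l 0).2) => //; first by cont.
  move=> y /andP[y1 y2] [[w Iw ew]|/brimP /= h].
    have wm : (l w).2 = (l 0).2 by apply/eqP; rewrite eq_le lmin andbT ew.
    have : l w = l (0 + N%:~R) by rewrite (lift1_int _ _ sl) ew; apply: pair_eq => //=; rewrite -wm ew.
    move=> /(lift_inj0 e1_neq0 sl); rewrite add0r => ewN; move: Iw; rewrite IE ewN => /andP[a0 a1].
    by apply: N01; rewrite (ler_int R 0) in a0; rewrite (ler_int R _ 1) in a1; clear -a0 a1; lia.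
  have /andP[a0 a1] : 0 <= (N%:~R : R) <= 1.
    by case: h => [[[h|h] _]|[_ /andP[h h']]]; apply/andP; split; hlra.
  by apply: N01; rewrite (ler_int R 0) in a0; rewrite (ler_int R _ 1) in a1; clear -a0 a1; lia.
rewrite (_ : z + zv R (n, 0) = (z.1 + n%:~R, d)); first exact: frame_bottom.
by apply: pair_eq; rewrite /= ?h ?addr0.
Qed.

(** By [jordan_hulls] horizontal translates meet only in their rims, and there only along a common
    vertical side. This yields injectivity on the torus in [strip_isotopy]. *)
Lemma frame_translate z (n : int) : 0 < n -> hull (frame l d) z -> hull (frame l d) (z - zv R (n, 0)) ->
  z.1 = (l 0).1 + 1 /\ d <= z.2 <= (l 0).2.
Proof.
move=> n0 hz hw; have dl' := dl; have jF := frame_jordan.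
have n1 : n != 0 by rewrite gt_eqF.
have n1R : 1 <= n%:~R :> R by rewrite (ler_int R 1); clear -n0; lia.
set F := frame l d in hz hw jF *.
have Fx : F ((l 0).1 + 1 / 2, d) by right; apply/brimP; right; split => //=; apply/andP; split; hlra.
have [w Fw|w Fw||||Fz Fzn] := @jordan_hulls R F (shift (zv R (n, 0)) F) z jF (jordan_shift (zv R (n, 0)) jF).
- move=> /inside_shift; rewrite -zvN (_ : - (n, 0) = (- n, 0)); last by apply/eqP; rewrite -pair_eqE /= oppr0 !eqxx.
  by apply: frame_translate_outside => //; rewrite oppr_eq0.
- by rewrite -(subrK (zv R (n, 0)) w); exact: frame_translate_outside.
- exists ((l 0).1 + 1 / 2, d) => //; rewrite /shift /= => -[[u _ e]|/brimP /= h].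
    by have := congr1 snd e; rewrite /= subr0 => h; have := lmin u; rewrite h => h'; flra.
  by case: h => [[[h|h] _]|[_ /andP[h h']]]; flra.
- exact: hz.
- by case: hw => [h|h]; [left | right; apply/inside_shift].
rewrite /shift /= in Fzn.
have fin : z = l 1 -> z.1 = (l 0).1 + 1 /\ d <= z.2 <= (l 0).2.
  by move=> ->; rewrite lift1_one /= lexx ltW.
have lz u : z = l u -> z - zv R (n, 0) = l (u + (- n)%:~R).
  by move=> ->; rewrite (lift1_int _ _ sl); apply: pair_eq; rewrite /= ?subr0 // intrN.
have lz' u : z - zv R (n, 0) = l u -> z = l (u + n%:~R).
  by rewrite (lift1_int _ _ sl) => <-; apply: pair_eq; rewrite /= ?subr0 // subrK.
case: Fz Fzn => [[u Iu eu]|bz] [[w Iw ew]|bw].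
- move: Iu Iw; rewrite !IE => /andP[u0 u1] /andP[w0 w1].
  have := lz u (esym eu); rewrite -ew => /(lift_inj0 e1_neq0 sl); rewrite intrN => h.
  by apply: fin; rewrite -eu; congr l; hlra.
- move: Iu; rewrite IE => /andP[u0 u1]; rewrite (lz u) // in bw.
  have := brim_lift bw; rewrite intrN => h; apply: fin; rewrite -eu; congr l.
  by case: h => h; hlra.
- move: Iw; rewrite IE => /andP[w0 w1]; rewrite (lz' w) // in bz *.
  have := brim_lift bz => h; rewrite -(lz' w) //; apply: fin; rewrite (lz' w) //; congr l.
  by case: h => h; hlra.
move: bz bw => /brimP bz /brimP /= bw; rewrite ?subr0 in bw.
have x1 : z.1 = (l 0).1 + 1.
  have z1 : z.1 <= (l 0).1 + 1 by case: bz => [[[h|h] _]|[_ /andP[h h']]]; hlra.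
  have w1 : (l 0).1 <= z.1 - n%:~R by case: bw => [[[h|h] _]|[_ /andP[h h']]]; hlra.
  by hlra.
split => //; case: bz => [[_ //]|[h _]]; rewrite h lexx /=; exact: ltW.
Qed.

End Frame.

(* One application lowers the maximal height of the curve: all of the curve lying well above the
   level M - 1/2 is cut off along finitely many chords of that level. *)
Lemma lower_once l M : simple_lift e1 l -> (forall u, (l 0).2 <= (l u).2) -> (forall u, (l u).2 <= M) ->
  (l 0).2 + 1 <= M -> exists l', [/\ simple_lift e1 l', liso e1 l l', l' 0 = l 0,
    forall u, (l 0).2 <= (l' u).2 & forall u, (l' u).2 <= M - 1 / 4].
Proof.
move=> sl lmin lM mM; set m := (l 0).2 in lmin mM *.
pose d := m - 1; have dm : d < m by rewrite /d; xlra.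
(* Downward translates of the curve stay below [M - 1], hence below the chords on the level [c]; the
   tolerance [1 / 4] leaves a curve below [M - 1 / 4]. *)
pose c := M - 1 / 2; have q0 : 0 < 1 / 4 :> R by rewrite divr_gt0.
(* The induction runs over frames of curves isotopic to [l]; after each cut only the part containing
   the brim is again such a frame. *)
pose Phi K := forall l1, simple_lift e1 l1 -> l1 0 = l 0 -> (forall u, m <= (l1 u).2) ->
  (forall u, (l1 u).2 <= M) -> liso e1 l l1 -> frame l1 d = K ->
  exists l', [/\ simple_lift e1 l', liso e1 l l', l' 0 = l 0,
    forall u, m <= (l' u).2 & forall u, (l' u).2 <= M - 1 / 4].
suff H : Phi (frame l d) by apply: (H l) => //; exact: (liso_refl sl).
apply: (level_induction (coordinates_snd R) (c := c) (e := 1 / 4) (frame_jordan sl lmin dm) q0).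
  move=> K jK _ KH l1 sl1 l10 l1m l1M iso EK; exists l1; split => // u.
  (* The inside comes close to the bottom of the brim, so it cannot lie entirely above the level. *)
  case: KH => KH.
    have Kz : K ((l 0).1 + 1 / 2, d).
      by rewrite -EK; right; apply/brimP; right; split => //=; rewrite l10; apply/andP; split; xlra.
    have [[y /KH h1 h2] _] := jordan_frontier jK Kz q0; exfalso.
    move: h2; rewrite prod_normE gt_max /= => /andP[_]; rewrite ltr_norml => /andP[h3 h4].
    by rewrite /c /d in h1 h3 h4; xlra.
  have [n /andP[n0 n1]] := int_part u.
  have -> : (l1 u).2 = (l1 (u - n%:~R)).2.
    by rewrite -{1}(subrK n%:~R u) (lift1_int _ _ sl1).
  have Kz : K (l1 (u - n%:~R)) by rewrite -EK; left; exists (u - n%:~R) => //; rewrite IE n0 ltW.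
  apply/ler_addgt0Pr => r r0; have [[y /KH h1 h2] _] := jordan_frontier jK Kz r0.
  move: h2; rewrite prod_normE gt_max /= => /andP[_]; rewrite ltr_norml => /andP[h3 h4].
  by rewrite /c in h1; xlra.
move=> K a b jK KJ ch IH l1 sl1 l10 l1m l1M iso EK.
have [ab Ka Kb ins] := ch; have [cl1 _ _] := sl1.
have lmin1 u : (l1 0).2 <= (l1 u).2 by rewrite l10; exact: l1m.
have dm1 : d < (l1 0).2 by rewrite l10.
have cm : m < c by rewrite /c; xlra.
have onl x : K (x, c) -> exists2 s, 0 < s < 1 & l1 s = (x, c).
  rewrite -EK => -[[s + e]|/brimP /= [[_ /andP[_]]|[h _]]]; last by rewrite /d in h; xlra.
    rewrite IE => /andP[s0 s1]; exists s => //; rewrite !lt_neqAle s0 s1 !andbT.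
    apply/andP; split; apply/eqP => es; have := congr1 snd e; rewrite /= -?es.
      by rewrite l10 -/m => h; xlra.
    by rewrite es (lift1_one sl1) l10 /= -/m => h; xlra.
  by rewrite l10 => h; have := lt_le_trans cm h; rewrite ltxx.
have [sa /andP[sa0 sa1] ea] := onl a Ka; have [sb /andP[sb0 sb1] eb] := onl b Kb.
set C := (fun x => (x, c)) @` `[a, b].
have cC := chord_crosscut (coordinates_snd R) ch; have [aC _ _ CK] := cC.
have insC z : C z -> [\/ inside K z, z = l1 sa | z = l1 sb].
  by move=> /CK [h|h|h]; [constructor 1 | constructor 2; rewrite ea | constructor 3; rewrite eb].
have Ch z : C z -> z.2 = c by move=> [x _ <-].
(* Translates with [0 <= k.2] do not enter the frame, and all others are too low to meet the
   chord. *)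
have Cl z u k : C z -> z = l1 u + zv R k -> z = l1 sa \/ z = l1 sb.
  move=> Cz ez; have [iz|->|->] := insC z Cz; [exfalso | by left | by right].
  have [k0|k0] := leP 0 k.2; first by apply: (frame_outside sl1 lmin1 dm1 (u := u) k0); rewrite EK -ez.
  have k1 : k.2%:~R <= -1 :> R by rewrite -[leRHS]/((-1)%:~R) ler_int; clear -k0; lia.
  by have := Ch z Cz; rewrite ez /= => h; have := l1M u; rewrite /c in h; xlra.
(* A chord meeting its own translate is at least one unit long, so [l1 (sa + 1)] would be its right
   end or lie inside the frame. *)
have CC0 z w k : C z -> C w -> z = w + zv R k -> 0 <= k.1 -> k = 0.
  move=> Cz Cw ez k1; have k2 : k.2 = 0.
    have := congr1 snd ez; rewrite /= (Ch z Cz) (Ch w Cw) => h.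
    by apply/eqP; rewrite -(intr_eq0 R); apply/eqP; xlra.
  have [e|kn] := eqVneq k.1 0; first by rewrite [k]surjective_pairing e k2.
  have k1' : 1 <= k.1%:~R :> R by rewrite (ler_int R 1); clear -k1 kn; lia.
  case: Cz ez => x + <- ez; case: Cw ez => y + <- ez; rewrite /= !in_itv /= => /andP[y1 y2] /andP[x1 x2].
  have exy : x = y + k.1%:~R := congr1 fst ez.
  have a1b : a + 1 <= b by xlra.
  have e1a : l1 (sa + 1) = (a + 1, c) by have := lift1_int sa 1 sl1; rewrite ea.
  have [h|h] := eqVneq (a + 1) b.
    exfalso; have := lift_inj0 e1_neq0 sl1 (etrans e1a (etrans (congr1 (fun r => (r, c)) h) (esym eb))) => h'.
    by clear -h' sa0 sb1; flra.
  exfalso; apply: (frame_outside sl1 lmin1 dm1 (u := sa + 1) (k := 0)) => //.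
  by rewrite EK addr0 e1a; apply: ins; rewrite ltrDl ltr01 lt_neqAle h.
have CC z w k : C z -> C w -> z = w + zv R k -> k = 0.
  move=> Cz Cw ez; have [k0|k0] := leP 0 k.1; first exact: CC0 Cz Cw ez k0.
  have h : - k = 0 by apply: (CC0 w z); rewrite //= ?oppr_ge0 ?(ltW k0) // zvN ez addrK.
  by rewrite -[k]opprK h oppr0.
have sab : sa <> sb by move=> h; have := ea; rewrite h eb => -[h']; move: ab; rewrite h' ltxx.
have main s t : 0 < s -> s < t -> t < 1 -> arc C (l1 s) (l1 t) ->
    (forall z u k, C z -> z = l1 u + zv R k -> z = l1 s \/ z = l1 t) ->
    (forall A B, jarcs K A B (l1 s) (l1 t) -> Phi (A `|` C)) ->
    exists l', [/\ simple_lift e1 l', liso e1 l l', l' 0 = l 0,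
      forall u, m <= (l' u).2 & forall u, (l' u).2 <= M - 1 / 4].
  move=> s0 st t1 aC' Cl' IH'.
  have s1 := lt_trans st t1; have t0 := lt_trans s0 st.
  have [|l2 [sl2 iso2 l2r l2C]] := disc_move e1_neq0 sl1 (s := s) (t := t) _ aC' Cl' CC.
    by rewrite st; xlra.
  have l2l u : 0 <= u <= s -> l2 u = l1 u.
    move=> /andP[u0 us]; have [_ p2 _] := sl2; have [_ p1 _] := sl1.
    by apply: (addIr (zv R e1)); rewrite -p2 -p1 l2r //; apply/andP; split; xlra.
  (* The rest of the frame, including the brim, when the arc from [s] to [t] is replaced by the
     chord. *)
  pose A := (l1 @` `[0, s] `|` brim (l1 0).1 d (l1 0).2) `|` l1 @` `[t, 1].
  have l1i : forall x y, l1 x = l1 y -> x = y by move=> x y; exact: (lift_inj0 e1_neq0 sl1).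
  have jA : jarcs K A (l1 @` `[s, t]) (l1 s) (l1 t).
    have ar x y : x < y -> arc (l1 @` `[x, y]) (l1 x) (l1 y).
      by move=> xy; apply: arc_param => // ? ? _ _; exact: l1i.
    split; last 1 first.
    - rewrite -EK /frame; apply/seteqP; split=> [z [[u Iu <-]|h]|z [[[[u + <-]|h]|[u + <-]]|[u + <-]]].
      + move: Iu; rewrite IE => /andP[u0 u1]; have [us|su] := leP u s.
          by left; left; left; exists u => //=; rewrite in_itv /= u0.
        have [ut|tu] := leP u t; first by right; exists u => //=; rewrite in_itv /= ltW.
        by left; right; exists u => //=; rewrite in_itv /= ltW.
      + by left; left; right.
      + by rewrite /= in_itv /= => /andP[u0 us]; left; exists u => //; rewrite IE u0; xlra.
      + by right.
      + by rewrite /= in_itv /= => /andP[u0 us]; left; exists u => //; rewrite IE us andbT; xlra.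
      by rewrite /= in_itv /= => /andP[u0 us]; left; exists u => //; rewrite IE; apply/andP; split; xlra.
    - apply: arc_cat (arc_sym (ar t 1 t1)) _; first apply: arc_cat (arc_sym (ar 0 s s0)) _ _.
      + by have [] := frame_jarcs sl1 lmin1 dm1.
      + move=> z [[u + <-] /(brim_lift sl1 lmin1 dm1) [->|h]] //; rewrite h /= in_itv /= => /andP[_ h']; exfalso; flra.
      move=> z [[[u + <-]|h] [w + e]]; rewrite /= !in_itv /= => /andP[h1 h2].
        by move=> /andP[h3 h4]; have := l1i _ _ e => e'; exfalso; clear -h2 h3 e' st; flra.
      rewrite -e in h *; have [h'|->] := brim_lift sl1 lmin1 dm1 h; first by exfalso; flra.
      by [].
    - exact: ar.
    move=> z [[[[u + <-]|h]|[u + <-]] [w + e]]; rewrite /= !in_itv /=.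
    - move=> /andP[h1 h2] /andP[h3 h4]; have hw := l1i _ _ e; left; congr l1; xlra.
    - move=> /andP[h3 h4]; rewrite -e in h; have [h'|h'] := brim_lift sl1 lmin1 dm1 h; exfalso; flra.
    move=> /andP[h1 h2] /andP[h3 h4]; have hw := l1i _ _ e; right; congr l1; xlra.
  have l2C' u : s <= u <= t -> (l2 u).2 = c.
    by move=> h; apply: Ch; rewrite -l2C; exists u => //=; rewrite in_itv.
  have l2h u : m <= (l2 u).2 <= M.
    have [n /andP[n0 n1]] := int_part u.
    have -> : (l2 u).2 = (l2 (u - n%:~R)).2 by rewrite -{1}(subrK n%:~R u) (lift1_int _ _ sl2).
    move: (u - n%:~R) n0 n1 => w w0 w1; have [ws|sw] := leP w s; first by rewrite l2l ?w0 // l1m l1M.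
    have [wt|tw] := leP w t; last by rewrite l2r ?l1m ?l1M //; apply/andP; split; xlra.
    by rewrite l2C' ?(ltW sw) //; rewrite /c; apply/andP; split; xlra.
  apply: (IH' _ _ jA l2) => //.
  - by rewrite l2l ?lexx ?(ltW s0).
  - by move=> u; case/andP: (l2h u).
  - by move=> u; case/andP: (l2h u).
  - exact: liso_trans iso iso2.
  rewrite /frame l2l ?lexx ?(ltW s0) // /A -l2C; apply/seteqP; split=> [z [[u Iu <-]|h]|z [[[[u + <-]|h]|[u + <-]]|[u + <-]]].
  - move: Iu; rewrite IE => /andP[u0 u1]; have [us|su] := leP u s.
      by left; left; left; exists u; rewrite ?l2l ?u0 //= in_itv /= u0.
    have [ut|tu] := leP u t; first by right; exists u => //=; rewrite in_itv /= ltW.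
    left; right; exists u; last by rewrite l2r //; apply/andP; split; xlra.
    by rewrite /= in_itv /= ltW.
  - by left; left; right.
  - by rewrite /= in_itv /= => /andP[u0 us]; left; exists u; rewrite ?l2l ?u0 // IE u0; xlra.
  - by right.
  - rewrite /= in_itv /= => /andP[u0 us]; left; exists u; last by rewrite l2r //; apply/andP; split; xlra.
    by rewrite IE us andbT; xlra.
  by rewrite /= in_itv /= => /andP[u0 us]; left; exists u => //; rewrite IE; apply/andP; split; xlra.
have [h|h|//] := ltgtP sa sb.
  by apply: (main sa sb) => //; [rewrite ea eb | move=> A B; rewrite ea eb; exact: IH].
apply: (main sb sa) => //.
- by rewrite ea eb; exact: arc_sym.
- by move=> z u k Cz /(Cl _ _ _ Cz) [->|->]; [right|left].
by move=> A B; rewrite ea eb => /jarcs_sym; exact: IH.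
Qed.

Lemma lower_below_one l M (n : nat) : simple_lift e1 l -> (forall u, (l 0).2 <= (l u).2) ->
  (forall u, (l u).2 <= M) -> M <= (l 0).2 + 1 + n%:R / 4 ->
  exists l', [/\ simple_lift e1 l', liso e1 l l', l' 0 = l 0,
    forall u, (l 0).2 <= (l' u).2 & exists2 M', M' < (l 0).2 + 1 & forall u, (l' u).2 <= M'].
Proof.
elim: n l M => [|n IH] l M sl lmin lM h.
all: have [hM|hM] := ltP M ((l 0).2 + 1); first by exists l; split => //; [exact: liso_refl | exists M].
all: have [l' [sl' iso l'0 l'm l'M]] := lower_once sl lmin lM hM.
  by exists l'; split => //; exists (M - 1 / 4) => //; rewrite mul0r addr0 in h; xlra.
have [|||l2 [sl2 iso2 l20 l2m [M' h1 h2]]] := IH l' (M - 1 / 4) sl'.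
- by move=> u; rewrite l'0.
- exact: l'M.
- by rewrite l'0; rewrite -natr1 in h; xlra.
exists l2; rewrite -l'0; split => //; first exact: liso_trans iso iso2.
by exists M'.
Qed.

(** The strip between the curve and a horizontal line just below it, taken modulo the period, embeds
    in the torus; the curve is slid through it down to the line. *)
Lemma strip_isotopy l M : simple_lift e1 l -> (forall u, (l 0).2 <= (l u).2) -> (forall u, (l u).2 <= M) ->
  M < (l 0).2 + 1 -> exists d, liso e1 l (fun u => ((l 0).1 + u, d)).
Proof.
move=> sl lmin lM Mm; have [cl le li] := sl.
set x0 := (l 0).1; set m := (l 0).2 in lmin Mm *.
(* The midpoint of [M - 1] and [m], so that the strip from [d] to [M] has height less than one. *)
pose d := (m + M - 1) / 2; have m0 := lM 0; rewrite -/m in m0.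
have dm : d < m by rewrite /d; xlra.
have Md : M < d + 1 by rewrite /d; xlra.
pose aff (z : P) : P := (x0 + z.1, d + z.2 * (m - d)).
have caff : continuous aff by rewrite /aff; cont.
have md0 : m - d != 0 by rewrite subr_eq0 gt_eqF.
have affi z w : aff z = aff w -> z = w.
  by move=> [/addrI h1 /addrI /(mulIf md0) h2]; exact: pair_eq.
have aff0 : aff (0, 1) = l 0 by apply: pair_eq; rewrite /= ?addr0 // mul1r addrC subrK.
have aff1 : aff (1, 1) = l 1 by rewrite (lift1_one sl); apply: pair_eq; rewrite /= // mul1r addrC subrK.
have affb z : brim 0 0 1 z -> brim x0 d m (aff z).
  have k0 : 0 < m - d by rewrite subr_gt0.
  move=> /brimP h; apply/brimP; case: h => [[z1 /andP[z2 z3]]|[z2 z1]]; [left|right]; split.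
  - by case: z1 => /= ->; [left; rewrite addr0 | right; rewrite add0r].
  - rewrite /= lerDl mulr_ge0 //=; last exact: ltW.
    by have : z.2 * (m - d) <= m - d by [rewrite ler_piMl // ltW]; move=> h; xlra.
  - by rewrite /= z2 mul0r addr0.
  by rewrite add0r in z1; case/andP: z1 => h1 h2 /=; apply/andP; split; xlra.
have affb' z : brim x0 d m z -> exists2 w, brim 0 0 1 w & aff w = z.
  have k0 : 0 < m - d by rewrite subr_gt0.
  move=> /brimP h; exists (z.1 - x0, (z.2 - d) / (m - d)); last first.
    by apply: pair_eq; rewrite /= ?divfK // addrC subrK.
  apply/brimP; case: h => [[z1 /andP[z2 z3]]|[z2 z1]]; [left|right]; split => /=.
  - by case: z1 => ->; [left; rewrite subrr | right; rewrite addrC addKr add0r].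
  - by rewrite divr_ge0 ?subr_ge0 ?(ltW dm) //= ler_pdivrMr // mul1r lerB.
  - by rewrite z2 subrr mul0r.
  by case/andP: z1 => h1 h2; apply/andP; split; xlra.
(* Boundary values for the Schoenflies theorem: the top of the unit square goes to the curve, the
   other three sides go affinely to the brim. *)
pose u (x : R) : P2 := ((x, 1), l x); pose v (z : P) : P2 := (z, aff z).
have cu : continuous u by rewrite /u; cont.
have cv : continuous v by rewrite /v; cont.
pose G := (u @` I) `|` (v @` brim 0 0 1).
have bl x : brim x0 d m (l x) -> x = 0 \/ x = 1 by exact: (brim_lift sl lmin dm).
have ends x : x = 0 \/ x = 1 -> u x = v (x, 1) by rewrite /u /v => -[->|->]; rewrite ?aff0 ?aff1.
have uv b x z : I x -> brim 0 0 1 z -> side b (u x) = side b (v z) -> (x = 0 \/ x = 1) /\ u x = v z.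
  move=> Ix bz; case: b => /= h.
    have x01 : x = 0 \/ x = 1.
      move: bz; rewrite -h => /brimP /= [[h' _]|[h' _]]; first by rewrite add0r in h'.
      by exfalso; flra.
    by split => //; rewrite ends // h.
  have x01 : x = 0 \/ x = 1 by apply: bl; rewrite h; exact: affb.
  split => //; rewrite ends //; congr v; apply: affi; rewrite -h.
  by case: x01 => ->; rewrite ?aff0 ?aff1.
have Gi b : injective_on G (side b).
  move=> _ _ [[x Ix <-]|[z bz <-]] [[y Iy <-]|[w bw <-]].
  - by case: (b) => /= h; [case: h => ->|rewrite (lift_inj0 e1_neq0 sl h)].
  - by move=> h; case: (uv b x w).
  - by move=> h; case: (uv b y z).
  by case: (b) => /= h; [rewrite h | rewrite (affi _ _ h)].
have cG : cell G.
  split => //; exists (u @` I), (v @` brim 0 0 1), (u 0), (u 1); split => //.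
  - by apply: arc_param; rewrite ?ltr01 // => s t _ _ /(congr1 snd) /=; exact: (lift_inj0 e1_neq0 sl).
  - have -> : u 0 = v (0, 1) by apply: ends; left.
    have -> : u 1 = v (1, 1) by apply: ends; right.
    apply: arc_image => //; first by move=> ? ? _ _ /(congr1 fst).
    by have H := brim_arc 0 (@ltr01 R); rewrite add0r in H.
  by move=> _ [[x Ix <-] [z bz h]]; have [[->|->] _] := uv true x z Ix bz (congr1 fst (esym h)); [left|right].
have [f [[g [cf cg fim gK]] fG]] := schoenflies cG.
have e2 : snd @` G = frame l d.
  apply/seteqP; split=> [_ [_ [[x Ix <-]|[z bz <-]] <-]|z [[x Ix <-]|/affb' [w bw <-]]].
  - by left; exists x.
  - by right; exact: affb.
  - by exists (u x) => //; left; exists x.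
  by exists (v w) => //; right; exists w.
have bx z : 0 <= z.1 <= 1 -> 0 <= z.2 <= 1 -> (z.1 = 0 \/ z.1 = 1) \/ (z.2 = 0 \/ z.2 = 1) -> (fst @` G) z.
  move=> z1 z2 h; have [h1|n1] := eqVneq z.2 1.
    by exists (u z.1); [left; exists z.1; rewrite ?IE | rewrite /u /= -h1 -surjective_pairing].
  exists (v z) => //; right; exists z => //; apply/brimP; rewrite add0r; case: h => [h|[h|h]].
  - by left.
  - by right.
  by rewrite h eqxx in n1.
have sqh z : 0 <= z.1 <= 1 -> 0 <= z.2 <= 1 -> hull (fst @` G) z.
  move=> z1 z2; have [b|nb] := pselect ((z.1 = 0 \/ z.1 = 1) \/ (z.2 = 0 \/ z.2 = 1)); first by left; exact: bx.
  pose U := [set w : P | (0 < w.1 < 1) && (0 < w.2 < 1)].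
  have oU : open U.
    have -> : U = fst @^-1` `]0, 1[%classic `&` snd @^-1` `]0, 1[%classic.
      by apply/seteqP; split=> w; rewrite /U /= !in_itv /= => /andP.
    apply: openI.
      by apply: open_comp; [move=> x _; exact: cvg_fst | exact: interval_open].
    by apply: open_comp; [move=> x _; exact: cvg_snd | exact: interval_open].
  apply: (@cross_inside R U _ 1) => //.
  - move=> w /andP[/andP[a1 a2] /andP[a3 a4]]; rewrite prod_normE ge_max /= !ler_norml.
    by apply/andP; split; apply/andP; split; xlra.
  - move=> w cw; have [w1 w2] : 0 <= w.1 <= 1 /\ 0 <= w.2 <= 1.
      have cl' : closed (fst @^-1` `[0, 1]%classic `&` snd @^-1` `[0, 1]%classic : set P).
        apply: closedI.
          by apply: preimage_closed; [move=> x _; exact: cvg_fst | exact: interval_closed].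
        by apply: preimage_closed; [move=> x _; exact: cvg_snd | exact: interval_closed].
      have : (fst @^-1` `[0, 1]%classic `&` snd @^-1` `[0, 1]%classic) w.
        apply: cl'; apply: closureS cw => x /andP[/andP[a1 a2] /andP[a3 a4]].
        by split; rewrite /= in_itv /= !ltW.
      by move=> [] /=; rewrite !in_itv.
    have [b|nb'] := pselect ((w.1 = 0 \/ w.1 = 1) \/ (w.2 = 0 \/ w.2 = 1)); first by right; exact: bx.
    left; case/andP: w1 => a1 a2; case/andP: w2 => a3 a4; rewrite /U /= !lt_neqAle a1 a2 a3 a4 !andbT.
    by apply/andP; split; apply/andP; split; apply/eqP => h; apply: nb'; rewrite -?h; auto.
  case/andP: z1 => a1 a2; case/andP: z2 => a3 a4; rewrite /U /= !lt_neqAle a1 a2 a3 a4 !andbT.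
  by apply/andP; split; apply/andP; split; apply/eqP => h; apply: nb; rewrite -?h; auto.
have fi z w : hull (fst @` G) z -> hull (fst @` G) w -> f z = f w -> z = w.
  by move=> hz hw h; rewrite -(gK z hz) h gK.
have fh z : hull (fst @` G) z -> hull (frame l d) (f z) by move=> hz; rewrite -e2 -fim; exists z.
have fu x : 0 <= x <= 1 -> f (x, 1) = l x by move=> x01; apply: (fG (u x)); left; exists x; rewrite ?IE.
have fv z : brim 0 0 1 z -> f z = aff z by move=> bz; apply: (fG (v z)); right; exists z.
(* Time runs down the square, so the isotopy consists of the images of its horizontal segments. *)
pose sq (z : P) : P := (clamp 0 1 z.2, 1 - clamp 0 1 z.1).
have cI (t : R) : 0 <= clamp 0 1 t <= 1 by exact: clamp_itv.
have sqH z : hull (fst @` G) (sq z).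
  by apply: sqh => /=; [exact: cI | have /andP[h1 h2] := cI z.1; apply/andP; split; xlra].
pose G0 z := f (sq z).
have cG0 : continuous G0 by apply: (within_comp cf); [rewrite /sq; cont | exact: sqH].
have sq0 tau : G0 (tau, 0) = aff (0, 1 - clamp 0 1 tau).
  rewrite /G0 /sq /= (@clamp_id _ 0 1 0) ?lexx ?ler01 // fv //; apply/brimP; left; split; first by left.
  by have /andP[h1 h2] := cI tau => /=; apply/andP; split; xlra.
have sq1 tau : G0 (tau, 1) = aff (1, 1 - clamp 0 1 tau).
  rewrite /G0 /sq /= (@clamp_id _ 0 1 1) ?lexx ?ler01 // fv //; apply/brimP; left; split; first by right; rewrite add0r.
  by have /andP[h1 h2] := cI tau => /=; apply/andP; split; xlra.
have [|L [cL Le LG]] := quasi_periodic cG0 (e := zv R e1).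
  by move=> tau; rewrite sq0 sq1 /aff; apply: pair_eq; rewrite /= ?addr0.
(* Vertical translates are excluded by the height. Horizontal ones meet only along the right side by
   [frame_translate], which corresponds to the parameter [1]. *)
have key tau w w' (k : int * int) : 0 <= w < 1 -> 0 <= w' < 1 -> 0 <= k.1 -> G0 (tau, w) = G0 (tau, w') + zv R k -> w = w'.
  move=> /andP[a0 a1] /andP[b0 b1] k1 h.
  have /andP[h1 h2] := frame_height sl lmin dm lM (fh _ (sqH (tau, w))).
  have /andP[h3 h4] := frame_height sl lmin dm lM (fh _ (sqH (tau, w'))).
  have e2' : k.2 = 0.
    have := congr1 snd h; rewrite /= -/(G0 (tau, w)) -/(G0 (tau, w')) in h1 h2 h3 h4 * => h'.
    by apply: (@int_small R); apply/andP; split; xlra.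
  have [k10|k10] := eqVneq k.1 0.
    have kz : k = 0 by rewrite [k]surjective_pairing k10 e2'.
    rewrite kz addr0 in h; have := fi _ _ (sqH _) (sqH _) h => /(congr1 fst) /=.
    by rewrite !clamp_id ?a0 ?b0 ?ltW.
  have kp : 0 < k.1 by rewrite lt_neqAle eq_sym k10.
  have kE : k = (k.1, 0) by rewrite {1}[k]surjective_pairing e2'.
  have [|x1 x2] := frame_translate sl lmin dm kp (fh _ (sqH (tau, w))).
    by rewrite -/(G0 (tau, w)) h -kE addrK; exact: fh (sqH _).
  rewrite -/(G0 (tau, w)) -/x0 -/m in x1 x2.
  have bb : brim x0 d m (G0 (tau, w)) by apply/brimP; left; split => //; right.
  have [y by_ ey] := affb' _ bb.
  have y1 : y.1 = 1 by have := congr1 fst ey; rewrite /= x1 => /addrI.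
  have yH : hull (fst @` G) y.
    have [h' h''] : 0 <= y.1 <= 1 /\ 0 <= y.2 <= 1.
      by move: by_ => /brimP [[_ h']|[h' _]]; rewrite y1 lexx ler01; split => //; rewrite h' lexx ler01.
    exact: sqh.
  have := fi _ _ (sqH _) yH (etrans (esym ey) (esym (fv _ by_)) : f (sq (tau, w)) = f y).
  by move=> /(congr1 fst) /=; rewrite y1 clamp_id ?a0 ?ltW // => h'; exfalso; flra.
have sL tau : simple_lift e1 (fun s => L (tau, s)).
  split; [by cont | exact: Le |] => s s'.
  have [n /andP[n0 n1]] := int_part s; have [n' /andP[n0' n1']] := int_part s'.
  have red r (q : int) : L (tau, r) = L (tau, r - q%:~R) + zv R (q, 0).
    have N r' (j : nat) : L (tau, r' + j%:R) = L (tau, r') + j%:R *: zv R e1.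
      elim: j => [|j IH]; first by rewrite scale0r !addr0.
      by rewrite -natr1 addrA Le IH scalerDl scale1r addrA.
    have sz (q' : int) : zv R (q', 0) = q'%:~R *: zv R e1 by apply: pair_eq; rewrite /= /GRing.scale /= ?mulr1 ?mulr0.
    rewrite sz; case: q => j; first by rewrite -N subrK.
    by rewrite NegzE mulrNz opprK N scaleNr addrK.
  move=> /cover_eq [k hk]; suff h : s - n%:~R = s' - n'%:~R by exists (n - n'); rewrite intrB; xlra.
  have hk' : G0 (tau, s - n%:~R) = G0 (tau, s' - n'%:~R) + zv R ((n', 0) + k - (n, 0)).
    move: hk; rewrite (red s n) (red s' n') !LG ?n0 ?n0' ?ltW // => hk.
    by apply: (addIr (zv R (n, 0))); rewrite hk !zvD zvN -[RHS]addrA subrK addrA.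
  have [p|p] := leP 0 ((n', 0) + k - (n, 0)).1; first by apply: key hk'; rewrite ?n0 ?n0'.
  apply/esym; apply: (key tau _ _ (- ((n', 0) + k - (n, 0)))); rewrite ?n0 ?n0' ?oppr_ge0 ?(ltW p) //.
  by rewrite zvN hk' addrK.
have L0 s : L (0, s) = l s.
  apply: (@quasi_periodic_eq R (fun s => L (0, s)) l (zv R e1)) => // w w01; rewrite LG //.
  by rewrite /G0 /sq /= (@clamp_id _ 0 1 0) ?lexx ?ler01 // subr0 clamp_id // fu.
have L1 s : L (1, s) = (x0 + s, d).
  apply: (@quasi_periodic_eq R (fun s => L (1, s)) (fun s => (x0 + s, d)) (zv R e1)) => // [w|w w01].
    by apply: pair_eq; rewrite /= ?addr0 // addrA.
  rewrite LG // /G0 /sq /= (@clamp_id _ 0 1 1) ?lexx ?ler01 // subrr clamp_id // fv.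
    by rewrite /aff /= mul0r addr0.
  by apply/brimP; right; rewrite add0r.
by exists d, L; split.
Qed.

Lemma trace_shift e l c : simple_lift e l -> trace (fun u => l (u + c)) = trace l.
Proof.
move=> sl; apply/seteqP; split=> [_ [t _ <-]|_ [t _ <-]]; first exact: trace_all sl.
by rewrite -{1}(subrK c t); exact: (trace_all (t - c) (simple_lift_shift c sl)).
Qed.

(** Starting at a lowest point, as [lower_below_one] requires, changes the parametrization but not
    the trace. Translations move the final horizontal line to height [0]. *)
Lemma straighten1 l : simple_lift e1 l -> exists2 l0, trace l0 = trace l & liso e1 l0 (fun u => (u, 0)).
Proof.
move=> sl; have [cl le li] := sl.
have ch : {within `[0, 1], continuous (fun u => (l u).2)} by apply: continuous_subspaceT; cont.
have [c _ Hc] := EVT_min (@ler01 R) ch; have [c' _ Hc'] := EVT_max (@ler01 R) ch.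
have per u : exists2 t, t \in `[0, 1] & (l u).2 = (l t).2.
  have [n /andP[n0 n1]] := int_part u; exists (u - n%:~R); first by rewrite in_itv /= n0 ltW.
  by rewrite -{1}(subrK n%:~R u) (lift1_int _ _ sl).
have sl0 := simple_lift_shift c sl; pose l0 u := l (u + c).
have lmin u : (l0 0).2 <= (l0 u).2 by rewrite /l0 add0r; have [t tI ->] := per (u + c); exact: Hc.
have lM u : (l0 u).2 <= (l c').2 by rewrite /l0; have [t tI ->] := per (u + c); exact: Hc'.
have [|||l2 [sl2 iso2 l20 l2m [M' h1 h2]]] := @lower_below_one l0 (l c').2 (Num.bound (((l c').2 - (l0 0).2) * 4)) sl0.
- exact: lmin.
- exact: lM.
- have h : 0 <= ((l c').2 - (l0 0).2) * 4 by rewrite mulr_ge0 // subr_ge0.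
  by have := archi_boundP h => h'; xlra.
have hmin u : (l2 0).2 <= (l2 u).2 by rewrite l20.
rewrite -l20 in h1; have [d iso3] := strip_isotopy sl2 hmin h2 h1.
exists l0; first exact: trace_shift sl.
apply: liso_trans (liso_trans iso2 iso3) _.
set x0 := (l2 0).1; exists (fun z => ((1 - z.1) * x0 + z.2, (1 - z.1) * d)); split.
- by cont.
- move=> tau _; split; first by cont.
    by move=> t; apply: pair_eq; rewrite /= ?addr0 // addrA.
  move=> s t /cover_eq [k /(congr1 fst) /= h]; exists k.1; xlra.
- by move=> s; rewrite /= subr0 !mul1r.
by move=> s; rewrite /= subrr !mul0r add0r.
Qed.

Theorem curve_isotopic (C : set P2) (e : int * int) : coprimez e.1 e.2 -> curve C e ->
  isotopic_circles R (bV R) C (slope_curve (e.2, e.1)).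
Proof.
move=> ce [l sl <-]; have [[a b] ab] := coprimezP _ _ ce; rewrite /= in ab.
have abR : a%:~R * e.1%:~R + b%:~R * e.2%:~R = 1 :> R by rewrite -!intrM -intrD ab.
(* Mutually inverse unimodular maps obtained from a Bezout relation; [M] sends [e1] to [e]. *)
pose M (z : P) : P := (z.1 * e.1%:~R - z.2 * b%:~R, z.1 * e.2%:~R + z.2 * a%:~R).
pose N (z : P) : P := (a%:~R * z.1 + b%:~R * z.2, e.1%:~R * z.2 - e.2%:~R * z.1).
have ids (A B X Y x y : R) : A * X + B * Y = 1 ->
    [/\ (A * x + B * y) * X - (X * y - Y * x) * B = x, (A * x + B * y) * Y + (X * y - Y * x) * A = y,
        A * (x * X - y * B) + B * (x * Y + y * A) = x & X * (x * Y + y * A) - Y * (x * X - y * B) = y].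
  by move=> h; split; rewrite -[RHS]mul1r -h; ring.
have cM : continuous M by rewrite /M; cont.
have cN : continuous N by rewrite /N; cont.
have MN z : M (N z) = z by have [h1 h2 _ _] := ids _ _ _ _ z.1 z.2 abR; exact: pair_eq.
have MD z w : M (z + w) = M z + M w by apply: pair_eq; rewrite /=; ring.
have ND z w : N (z + w) = N z + N w by apply: pair_eq; rewrite /=; ring.
have Mz k : exists k', M (zv R k) = zv R k'.
  by exists (k.1 * e.1 - k.2 * b, k.1 * e.2 + k.2 * a); apply: pair_eq; rewrite /= ?intrD ?intrN ?intrM.
have Nz k : exists k', N (zv R k) = zv R k'.
  by exists (a * k.1 + b * k.2, e.1 * k.2 - e.2 * k.1); apply: pair_eq; rewrite /= ?intrD ?intrN ?intrM.
have NM z : N (M z) = z by have [_ _ h1 h2] := ids _ _ _ _ z.1 z.2 abR; exact: pair_eq.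
have Ne : N (zv R e) = zv R e1 by apply: pair_eq; rewrite /= ?abR // mulrC subrr.
have Me : M (zv R e1) = zv R e by rewrite -Ne MN.
have lin (F F' : P -> P) f f' h : continuous F -> (forall z w, F (z + w) = F z + F w) ->
    (forall z w, F' (z + w) = F' z + F' w) -> (forall z, F' (F z) = z) ->
    (forall k, exists k', F' (zv R k) = zv R k') -> F (zv R f) = zv R f' -> simple_lift f h -> simple_lift f' (fun s => F (h s)).
  move=> cF FD FD' FK Fz ff [chh hf hi]; split.
  - by move=> s; apply: (@ct_comp _ _ _ F h); [exact: cF | exact: chh].
  - by move=> t; rewrite hf FD ff.
  move=> s t /cover_eq [k ek]; apply: hi; have := congr1 F' ek; rewrite FD' !FK => ->.
  by have [k' ->] := Fz k; rewrite coverD.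
have [l0 tr0 [L [cL sL L0 L1]]] := straighten1 (lin N M e e1 l cN ND MD MN Mz Ne sl).
have tM h : trace (fun s => M (h s)) = (fun z => cover (M z)) @` (h @` I).
  by apply/seteqP; split=> [_ [t It <-]|_ [_ [t It <-] <-]]; [exists (h t) => //; exists t | exists t].
have <- : trace (fun s => M (l0 s)) = trace l.
  have K h h' : trace h `<=` trace h' -> trace (fun s => M (h s)) `<=` trace (fun s => M (h' s)).
    move=> hh _ [t It <-]; have [|t' It' e'] := hh (cover (h t)); first by exists t.
    exists t' => //; have [k ->] := cover_eq e'; rewrite MD; have [k' ->] := Mz k; exact: coverD.
  have E : trace l = trace (fun s => M (N (l s))) by congr trace; apply/funext => s; rewrite MN.
  by rewrite E; apply/seteqP; split; apply: K; rewrite tr0.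
rewrite -slope_curve_trace /= -surjective_pairing.
apply: (@liso_isotopic R e); exists (fun z => M (L z)); split.
- by move=> z; apply: (@ct_comp _ _ _ M L); [exact: cM | exact: cL].
- by move=> tau It; exact: (lin M N e1 e _ cM MD ND NM Nz Me (sL tau It)).
- by move=> s; rewrite L0.
by move=> s; rewrite L1; apply: pair_eq; rewrite /= /GRing.scale /= !mul0r ?subr0 ?addr0.
Qed.

End Straightening.

(** * Intersections and classes *)

Section Classes.
Context (R : realType).
Notation P := (R * R)%type.
Notation P2 := (P * P)%type.
Notation I := (unit_interval R).
Implicit Types (e k c : int * int) (l f g B : R -> P).

Definition det e k : int := e.1 * k.2 - e.2 * k.1.

Lemma periodic_reduce (B : R -> P) (c : P) s : (forall u, B (u + 1) = B u + c) ->
  exists n : int, 0 <= s - n%:~R < 1 /\ B s = B (s - n%:~R) + n%:~R *: c.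
Proof.
move=> Bc; have [n n01] := int_part s; exists n; split => //.
have N u (m : nat) : B (u + m%:R) = B u + m%:R *: c.
  elim: m => [|m IH]; first by rewrite scale0r !addr0.
  by rewrite -natr1 addrA Bc IH scalerDl scale1r addrA.
case: n {n01} => m; first by rewrite -{1}(subrK m%:R s) N.
by rewrite NegzE mulrNz opprK N scaleNr addrK.
Qed.

Lemma periodic_path f g (c : P) : continuous f -> continuous g -> f 1 = g 0 -> g 1 = f 0 + c ->
  exists B : R -> P, [/\ continuous B, forall u, B (u + 1) = B u + c &
    forall u, I u -> B u = catp f g (f 1) u].
Proof.
move=> cf cg fg gf; have cc := catp_cont (r := f 1) cf cg.
have [c0 c1] := @catp_ends R _ f g (f 1) erefl (esym fg).
have [||L [cL Le LG]] := @quasi_periodic R (fun z => catp f g (f 1) z.2) c.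
- by move=> z; apply: (@ct_comp _ _ _ (catp f g (f 1)) snd); [exact: cc | exact: cvg_snd].
- by move=> tau /=; rewrite c0 c1.
exists (fun u => L (0, u)); split; first by cont.
  exact: Le.
by move=> u; rewrite IE => u01; rewrite LG.
Qed.

Lemma catp_half f g r u : f 1 = r -> g 0 = r -> I u ->
  exists2 t, I t & (u = t / 2 /\ catp f g r u = f t) \/ (u = (1 + t) / 2 /\ catp f g r u = g t).
Proof.
move=> fr gr; rewrite IE => /andP[u0 u1]; have [h|h] := leP u 2^-1.
  exists (2 * u); first by rewrite IE; apply/andP; split; xlra.
  by left; rewrite catp_l //; split => //; xlra.
exists (2 * u - 1); first by rewrite IE; apply/andP; split; xlra.
by right; rewrite catp_r ?ltW //; split => //; xlra.
Qed.

Definition cover_inj f := forall s t, I s -> I t -> cover (f s) = cover (f t) -> s = t.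

Lemma catp_cover_inj f g r : f 1 = r -> g 0 = r -> cover_inj f -> cover_inj g ->
  (forall s t, I s -> I t -> cover (f s) = cover (g t) -> s = 1 /\ t = 0) -> cover_inj (catp f g r).
Proof.
move=> fr gr fi gi fg s t Is It.
have [s' Is' [[es ->]|[es ->]]] := catp_half fr gr Is; have [t' It' [[et ->]|[et ->]]] := catp_half fr gr It => h.
- by rewrite es et (fi _ _ Is' It' h).
- by have [h1 h2] := fg _ _ Is' It' h; rewrite es et h1 h2 addr0.
- by have [h1 h2] := fg _ _ It' Is' (esym h); rewrite es et h1 h2 addr0.
by rewrite es et (gi _ _ Is' It' h).
Qed.

Lemma closed_curve f g c : continuous f -> continuous g -> f 1 = g 0 -> g 1 = f 0 + zv R c ->
  cover_inj f -> cover_inj g ->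
  (forall s t, I s -> I t -> cover (f s) = cover (g t) -> s = 1 /\ t = 0 \/ s = 0 /\ t = 1) ->
  exists l, simple_lift c l /\ trace l = (fun t => cover (f t)) @` I `|` (fun t => cover (g t)) @` I.
Proof.
move=> cf cg fg gf fi gi cross; have [B [cB Bc BE]] := periodic_path cf cg fg gf.
have half u : I u -> u < 1 -> exists2 t, I t & (u = t / 2 /\ B u = f t) \/ ((u = (1 + t) / 2 /\ t < 1) /\ B u = g t).
  move=> Iu u1; have [t It h] := catp_half (f := f) (g := g) erefl (esym fg) Iu; exists t => //.
  by rewrite BE //; case: h => [[h1 h2]|[h1 h2]]; [left|right; split => //; split => //; xlra].
exists B; split; last first.
  apply/seteqP; split=> [_ [u Iu <-]|_ [[t It <-]|[t It <-]]].
  - by rewrite /= BE //; have [t It [[_ ->]|[_ ->]]] := catp_half (f := f) (g := g) erefl (esym fg) Iu; [left|right]; exists t.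
  - have Iu : I (t / 2) by move: It; rewrite !IE => /andP[t0 t1]; apply/andP; split; xlra.
    exists (t / 2) => //; rewrite /= BE // catp_l //; first by rewrite mulrC divfK.
    by move: It; rewrite IE => /andP[t0 t1]; xlra.
  have Iu : I ((1 + t) / 2) by move: It; rewrite !IE => /andP[t0 t1]; apply/andP; split; xlra.
  exists ((1 + t) / 2) => //; rewrite /= BE // catp_r //; last by move: It; rewrite IE => /andP[t0 t1]; xlra.
  by rewrite mulrC divfK // addrC addKr.
split => //.
have zc (n : int) : n%:~R *: zv R c = zv R (n * c.1, n * c.2) by apply: pair_eq; rewrite /= intrM.
move=> s t; have [n [/andP[n0 n1] ->]] := periodic_reduce s Bc; have [m [/andP[m0 m1] ->]] := periodic_reduce t Bc.
rewrite !zc !coverD => h.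
suff e : s - n%:~R = t - m%:~R by exists (n - m); rewrite intrB; xlra.
have Is : I (s - n%:~R) by rewrite IE n0 ltW.
have It : I (t - m%:~R) by rewrite IE m0 ltW.
move: h; have [s' Is' [[es ->]|[[es s1] ->]]] := half _ Is n1; have [t' It' [[et ->]|[[et t1] ->]]] := half _ It m1 => h.
- by rewrite es et (fi _ _ Is' It' h).
- have [[h1 h2]|[h1 h2]] := cross _ _ Is' It' h; first by rewrite es et h1 h2 addr0.
  by rewrite h2 ltxx in t1.
- have [[h1 h2]|[h1 h2]] := cross _ _ It' Is' (esym h); first by rewrite es et h1 h2 addr0.
  by rewrite h2 ltxx in s1.
by rewrite es et (gi _ _ Is' It' h).
Qed.

Lemma periodic_bounded (b : R -> P) : continuous b -> (forall u, b (u + 1) = b u) ->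
  exists2 N, 0 < N & forall u, `|b u| <= N.
Proof.
move=> cb bp; have [N N0 HN] := path_bounded cb; exists N => // u.
have [|n [/andP[n0 n1] ->]] := @periodic_reduce b 0 u; first by move=> v; rewrite addr0.
by rewrite scaler0 addr0; apply: HN; rewrite IE n0 ltW.
Qed.

Lemma cramer0 (a b c d x y : R) : a * d - b * c != 0 ->
  x * d - y * c = 0 -> x * b - y * a = 0 -> x = 0 /\ y = 0.
Proof.
move=> D0 h1 h2; split; apply: (mulIf D0); rewrite mul0r.
  have -> : x * (a * d - b * c) = a * (x * d - y * c) - c * (x * b - y * a) by ring.
  by rewrite h1 h2 !mulr0 subr0.
have -> : y * (a * d - b * c) = b * (x * d - y * c) - d * (x * b - y * a) by ring.
by rewrite h1 h2 !mulr0 subr0.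
Qed.

(* In the basis of the two classes, (s, t) |-> B s - l t is at bounded distance from the identity
   of the plane, hence onto. *)
Lemma curves_meet B l (kappa e : int * int) : continuous B -> continuous l ->
  (forall u, B (u + 1) = B u + zv R kappa) -> (forall u, l (u + 1) = l u + zv R e) ->
  det kappa e != 0 -> exists s t, B s = l t.
Proof.
move=> cB cl Bk le; rewrite -(intr_eq0 R) /det; set D : R := _%:~R => D0; apply: contrapT => n.
have DE : D = kappa.1%:~R * e.2%:~R - kappa.2%:~R * e.1%:~R by rewrite /D intrD intrN !intrM.
(* The coordinates of [B s - l t] in the basis [kappa], [e], the second with reversed sign, so that
   [Psi] stays at bounded distance from the identity. *)
pose Psi (z : P) : P := let w := B z.1 - l z.2 in
  ((w.1 * e.2%:~R - w.2 * e.1%:~R) / D, (w.1 * kappa.2%:~R - w.2 * kappa.1%:~R) / D).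
have cPsi : continuous Psi by rewrite /Psi /=; cont.
have Psi0 z : Psi z != 0.
  apply/eqP => h; apply: n; exists z.1, z.2.
  have h1 := congr1 fst h; have h2 := congr1 snd h; rewrite /Psi /= in h1 h2.
  move/eqP: h1; rewrite mulf_eq0 invr_eq0 (negbTE D0) orbF => /eqP h1.
  move/eqP: h2; rewrite mulf_eq0 invr_eq0 (negbTE D0) orbF => /eqP h2.
  move: h1 h2; set x := (B z.1).1 - (l z.2).1; set y := (B z.1).2 - (l z.2).2; move=> h1 h2.
  have [x0 y0] : x = 0 /\ y = 0 by apply: cramer0 h1 h2; rewrite -DE.
  by apply: pair_eq; apply/eqP; rewrite -subr_eq0; apply/eqP.
pose b (z : P) := Psi z - z.
have [||N1 N10 HN1] := @periodic_bounded (fun s => B s - s *: zv R kappa).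
- by cont.
- by move=> u; rewrite Bk scalerDl scale1r opprD addrACA subrr addr0.
have [||N2 N20 HN2] := @periodic_bounded (fun s => l s - s *: zv R e).
- by cont.
- by move=> u; rewrite le scalerDl scale1r opprD addrACA subrr addr0.
pose A : R := `|e.2%:~R| + `|e.1%:~R| + `|kappa.2%:~R| + `|kappa.1%:~R|.
pose N := (N1 + N2) * A / `|D|.
have bN z : `|Psi z - z| <= N.
  set w := (B z.1 - z.1 *: zv R kappa) - (l z.2 - z.2 *: zv R e).
  have wN : `|w| <= N1 + N2 by rewrite (le_trans (ler_normB _ _)) // lerD.
  have [w1 w2] : `|w.1| <= N1 + N2 /\ `|w.2| <= N1 + N2.
    by move: wN; rewrite prod_normE ge_max => /andP[].
  have -> : Psi z - z = ((w.1 * e.2%:~R - w.2 * e.1%:~R) / D, (w.1 * kappa.2%:~R - w.2 * kappa.1%:~R) / D).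
    apply: pair_eq; rewrite /Psi /w /= /GRing.scale /=; apply: (mulIf D0); rewrite mulrBl !divfK // DE; ring.
  have n12 : 0 <= N1 + N2 by rewrite addr_ge0 // ltW.
  have K x y : `|w.1 * x - w.2 * y| <= (N1 + N2) * (`|x| + `|y|).
    by rewrite (le_trans (ler_normB _ _)) // !normrM mulrDr lerD // ler_wpM2r.
  rewrite prod_normE ge_max /= !normrM !normfV /N !ler_wpM2r ?invr_ge0 //.
    by rewrite (le_trans (K _ _)) // ler_wpM2l // /A -addrA lerDr addr_ge0.
  by rewrite (le_trans (K _ _)) // ler_wpM2l // /A -addrA lerDl addr_ge0.
have N0 : 0 <= N by rewrite (le_trans _ (bN 0)).
(* On the circle of this radius the sup norm is at least [N + 1], which exceeds the distance of
   [Psi] from the identity. *)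
pose r : R := 2 * N + 2.
have r0 : 0 < r by rewrite /r; xlra.
have [|th cth Hth] := @lift_square R Psi r (ltW r0) cPsi; first by move=> z _; exact: Psi0.
pose f t : P := r *: cis t; pose g t := Psi (f t).
have cf : continuous f by rewrite /f /cis; cont.
have cg : continuous g by move=> t; apply: (@ct_comp _ _ _ Psi f); [exact: cPsi | exact: cf].
have f01 : f 0 = f 1 by rewrite /f cis0 cis1.
have fr t : `|f t| <= r.
  rewrite /f normrZ gtr0_norm // ler_piMr ?(ltW r0) //; apply: sqn_norm.
  by rewrite sqn_cis.
have fl t : N < `|f t|.
  rewrite /f normrZ gtr0_norm //; have := sup_ge_half (sqn_cis t) => h.
  by apply: (@lt_le_trans _ _ (r * 2^-1)); [rewrite /r; xlra | rewrite ler_wpM2l // ltW].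
have W0 : winds g 0.
  exists (fun t => th (f t)).
    by move=> t; apply: (@ct_comp _ _ _ th f); [exact: cth | exact: cf].
  by split; [move=> t _; exact: Hth | rewrite f01 addr0].
have W1 : winds g 1.
  apply: (@winds_segment R f g) => //; first by rewrite /g f01.
    move=> t s _ /andP[s0 s1]; rewrite -normr_gt0.
    rewrite (_ : _ + _ = f t + s *: (g t - f t)); last by rewrite scalerBl scale1r scalerBr addrAC addrA.
    have h : `|s *: (g t - f t)| <= N.
      by rewrite normrZ ger0_norm // (le_trans (ler_piMl _ s1)) // bN.
    have : `|f t| <= `|f t + s *: (g t - f t)| + `|s *: (g t - f t)|.
      by rewrite -{1}(addrK (s *: (g t - f t)) (f t)) ler_normB.
    by have := fl t => *; xlra.
  apply: (winds_sdir _ (winds_cis R 1)) => t _; exists r => //; rewrite mul1r //.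
by have := winds_uniq W0 W1.
Qed.

Lemma jloop_jordan (J : set P) (L : R -> P) : jloop J L -> jordan J.
Proof.
move=> [cL L01 LJ Li].
have inj a b s t : 0 <= a -> b <= 1 -> b - a < 1 -> a <= s <= b -> a <= t <= b -> L s = L t -> s = t.
  move=> a0 b1 ab /andP[s1 s2] /andP[t1 t2] h.
  have K x y : 0 <= x -> y <= 1 -> x < y -> y - x < 1 -> L x <> L y.
    move=> x0 y1 xy xy1 e; have [||h0 h1] := Li x y _ _ xy e.
    - by rewrite IE x0; xlra.
    - by rewrite IE y1 andbT; xlra.
    by xlra.
  have [st|ts|//] := ltgtP s t; [case: (K s t) | case: (K t s)]; rewrite ?h //; xlra.
exists (L @` `[0, 2^-1]), (L @` `[2^-1, 1]), (L 0), (L 2^-1); split.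
- by apply: arc_param; rewrite ?invr_gt0 ?ltr0n // => s t; apply: inj; xlra.
- by apply: arc_sym; rewrite L01; apply: arc_param => //; [xlra | move=> s t; apply: inj; xlra].
- move=> z [[s + <-] [t + e]]; rewrite /= !in_itv /= => /andP[s0 s1] /andP[t0 t1].
  have [st|st] := eqVneq s t; first by right; congr L; rewrite st in s1; xlra.
  have [|||h0 h1] := Li s t _ _ _ (esym e); [by rewrite IE; apply/andP; split; xlra | by rewrite IE; apply/andP; split; xlra | by rewrite lt_neqAle st; xlra | ].
  by left; rewrite h0.
rewrite -LJ; apply/seteqP; split=> [_ [t + <-]|_ [[t + <-]|[t + <-]]]; rewrite ?IE /= ?in_itv /= => /andP[t0 t1].
- by have [h|h] := leP t 2^-1; [left|right]; exists t => //=; rewrite in_itv /=; apply/andP; split => //; exact: ltW.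
- by exists t => //; rewrite IE t0; xlra.
by exists t => //; rewrite IE t1 andbT; xlra.
Qed.

(* The exponential map wraps the cylinder R^2 / <e> onto the punctured plane; a Jordan curve winds
   at most once around the origin. *)
Lemma primitive_class l e (m : int) : coprimez e.1 e.2 -> simple_lift (m * e.1, m * e.2) l -> [\/ m = 0, m = 1 | m = -1].
Proof.
move=> ce [cl le li]; have [[a b] ab] := coprimezP _ _ ce; rewrite /= in ab.
have abR : a%:~R * e.1%:~R + b%:~R * e.2%:~R = 1 :> R by rewrite -!intrM -intrD ab.
(* Coordinates in a basis of the lattice beginning with [e]: on [e], [p1] is [1] and [p2] is [0], so
   [p1] becomes the angle on the cylinder and [p2] its height. *)
pose p1 (z : P) : R := a%:~R * z.1 + b%:~R * z.2.
pose p2 (z : P) : R := e.1%:~R * z.2 - e.2%:~R * z.1.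
pose L t : P := expR (p2 (l t)) *: cis (p1 (l t)).
have cp1 : continuous (fun t => p1 (l t)) by rewrite /p1; cont.
have cp2 : continuous (fun t => p2 (l t)) by rewrite /p2; cont.
have cexp : continuous (fun t => expR (p2 (l t))).
  by move=> t; apply: (@ct_comp _ _ _ (@expR R)); [exact: continuous_expR | exact: cp2].
have cL : continuous L.
  by move=> t; apply: ctZ; [exact: cexp | rewrite /cis; cont; exact: cp1].
have lm : l 1 = l 0 + zv R (m * e.1, m * e.2) by rewrite -le add0r.
have p1m : p1 (l 1) = p1 (l 0) + m%:~R.
  rewrite lm /p1 /= !intrM (_ : _ + _ = a%:~R * (l 0).1 + b%:~R * (l 0).2 + m%:~R * (a%:~R * e.1%:~R + b%:~R * e.2%:~R)); last by ring.
  by rewrite abR mulr1.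
have p2m : p2 (l 1) = p2 (l 0) by rewrite lm /p2 /= !intrM; ring.
have jL : jloop (L @` I) L.
  split => //; first by rewrite /L p1m p2m cisDz.
  move=> s t; rewrite !IE => /andP[s0 s1] /andP[t0 t1] st h.
  have e2 : p2 (l s) = p2 (l t).
    have : sqn (L s) = sqn (L t) by rewrite h.
    rewrite !sqnZ !sqn_cis !mulr1 => /eqP; rewrite eqrXn2 ?expR_ge0 // => /eqP.
    exact: expR_inj.
  have e1 : cis (p1 (l s)) = cis (p1 (l t)).
    by move: h; rewrite /L e2 => /(scalerI (lt0r_neq0 (expR_gt0 _))).
  have [n en] := cis_eq e1.
  have [n' en'] : exists n' : int, s = t + n'%:~R.
    apply: li; rewrite -(coverD (l t) (n * e.1, n * e.2)); congr cover.
    have K (z : P) : z = (p1 z * e.1%:~R - p2 z * b%:~R, p1 z * e.2%:~R + p2 z * a%:~R).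
      have id (A B' X Y x y : R) : A * X + B' * Y = 1 ->
        x = (A * x + B' * y) * X - (X * y - Y * x) * B' /\ y = (A * x + B' * y) * Y + (X * y - Y * x) * A.
        by move=> h'; split; rewrite -[LHS]mul1r -h'; ring.
      by have [h1 h2] := id _ _ _ _ z.1 z.2 abR; apply: pair_eq.
    rewrite (K (l s)) (K (l t)) en e2; apply: pair_eq; rewrite /= intrM; ring.
  have k1 : -2 < n' by rewrite -(ltr_int R) /=; xlra.
  have k2 : n' < 0 by rewrite -(ltr_int R) /=; xlra.
  have n1 : n' = -1 by clear -k1 k2; lia.
  by rewrite n1 in en'; split; xlra.
have L0 z : (L @` I) z -> z != 0.
  by move=> [t _ <-]; rewrite -sqn_gt0 sqnZ sqn_cis mulr1 exprn_gt0 // expR_gt0.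
have n0 : ~ (L @` I) 0 by move/L0; rewrite eqxx.
have W : winds (fun t => L t - 0) m.
  exists (fun t => p1 (l t)) => //; split => // t _; rewrite subr0; exists (expR (p2 (l t))) => //.
  exact: expR_gt0.
have [//|i0|o0] := in_or_out (L @` I) 0.
  by have [->|->] := jloop_winds_int (jloop_jordan jL) jL i0 W; [constructor 2 | constructor 3].
by constructor 1; exact: winds_uniq W (winds_ext0 jL o0).
Qed.

End Classes.

(** * Band sums *)

Section Band.
Context (R : realType).
Notation P := (R * R)%type.
Notation P2 := (P * P)%type.
Notation I := (unit_interval R).

Lemma I2 : I 2^-1.
Proof. by rewrite IE; apply/andP; split; xlra. Qed.

Lemma no_int (n : int) (x y : R) : x = y + n%:~R -> y < x < y + 1 -> False.
Proof.
move=> h /andP[h1 h2]; have n0 : n = 0 by apply: (@int_small R); apply/andP; split; xlra.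
by rewrite n0 addr0 in h; xlra.
Qed.

Lemma no_int' (n : int) (x y : R) : x = y + n%:~R -> y - 1 < x < y -> False.
Proof.
by move=> h /andP[h1 h2]; apply: (@no_int (- n) y x); rewrite ?intrN ?h ?addrK //; apply/andP; split; xlra.
Qed.

Lemma near_int (n : int) (x y : R) : x = y + n%:~R -> y - 1 < x < y + 1 -> x = y.
Proof.
move=> h /andP[h1 h2]; have n0 : n = 0 by apply: (@int_small R); apply/andP; split; xlra.
by rewrite h n0 addr0.
Qed.

Lemma frac_zero (x d : R) (n : int) : `|x| <= 1 -> -1 < d < 1 -> d != 0 -> x * d = n%:~R -> x = 0.
Proof.
rewrite -ltr_norml => x1 d1 d0 h; have n0 : n = 0.
  apply: (@int_small R); rewrite -ltr_norml -h normrM (le_lt_trans _ d1) // ler_piMl //.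
by move/eqP: h; rewrite n0 mulf_eq0 (negbTE d0) orbF => /eqP.
Qed.

Lemma zvZ (n : int) (k : int * int) : zv R (n * k.1, n * k.2) = n%:~R *: zv R k.
Proof. by apply: pair_eq; rewrite /= intrM. Qed.

Lemma coprime_zv (e : int * int) : coprimez e.1 e.2 -> zv R e != 0.
Proof.
move=> ce; apply/eqP => /(congr1 (fun z : P => z)); rewrite -(_ : zv R 0 = 0) // => /zv_inj e0.
by move: ce; rewrite e0.
Qed.

(** The lifted band: its end [0] lies on [l], with position [a], and its end [1] on the translate by
    [kap], with position [b]. The last hypothesis places the second end in the gap that the first
    one leaves in a period. *)
Variables (e kap : int * int) (l : R -> P) (w : P -> P) (a b : R -> R).
Hypothesis ce : coprimez e.1 e.2.
Hypothesis sl : simple_lift e l.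
Hypothesis cw : continuous w.
Hypothesis Binj : forall z z', square R z -> square R z' -> cover (w z) = cover (w z') -> z = z'.
Hypothesis Btr : forall z, square R z -> trace l (cover (w z)) -> z.1 = 0 \/ z.1 = 1.
Hypothesis aw : forall y, I y -> w (0, y) = l (a y).
Hypothesis bw : forall y, I y -> w (1, y) = l (b y) + zv R kap.
Hypothesis amono : forall y y', I y -> I y' -> y < y' -> a y < a y'.
Hypothesis bab : forall y, I y -> a 1 < b y < a 0 + 1.

Let cl : continuous l. Proof. by case: sl. Qed.

Lemma lift_eq u u' : cover (l u) = cover (l u') -> exists n : int, u = u' + n%:~R.
Proof. by case: sl => _ _; apply. Qed.

Lemma rung y v u : I y -> I v -> cover (l u) = cover (w (v, y)) ->
  exists n : int, v = 0 /\ u = a y + n%:~R \/ v = 1 /\ u = b y + n%:~R.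
Proof.
move=> Iy Iv h; have [||v0|v1] := @Btr (v, y); first by [].
- by rewrite -h; exact: trace_all sl.
- by move: h; rewrite /= in v0 *; rewrite v0 (aw Iy) => /lift_eq [n ->]; exists n; left.
by move: h; rewrite /= in v1 *; rewrite v1 (bw Iy) coverD => /lift_eq [n ->]; exists n; right.
Qed.

Lemma band_sides : [/\ a 0 < a 1, a 1 < b 0 < a 0 + 1 & a 1 < b 1 < a 0 + 1].
Proof. by split; [exact: (amono (I0 R) (I1 R) ltr01) | exact: bab (I0 R) | exact: bab (I1 R)]. Qed.

Lemma row_cover_inj y : I y -> cover_inj (fun u => w (u, y)).
Proof. by move=> Iy s t Is It h; have [] := @Binj (s, y) (t, y) (conj Is Iy) (conj It Iy) h. Qed.

Lemma row_cont y : continuous (fun u => w (u, y)).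
Proof. by move=> u; apply: (@ct_comp _ _ _ w); [exact: cw | cont]. Qed.

Lemma segment_cover_inj (x y : R) k : -1 < y - x < 1 -> y != x ->
  cover_inj (fun u => l (x + u * (y - x)) + zv R k).
Proof.
move=> h yx s t; rewrite !IE => /andP[s0 s1] /andP[t0 t1]; rewrite !coverD => /lift_eq [n en].
apply/eqP; rewrite -subr_eq0; apply/eqP; apply: (@frac_zero _ (y - x) n) => //.
- by rewrite ler_norml; apply/andP; split; hlra.
- by rewrite subr_eq0.
by rewrite mulrBl; hlra.
Qed.

Lemma segment_cont (x y : R) k : continuous (fun u : R => l (x + u * (y - x)) + zv R k).
Proof. by cont. Qed.

Lemma bezout_det : exists z : int * int, det e z = 1.
Proof.
have [[p q] pq] := coprimezP _ _ ce; exists (- q, p); rewrite /det /= -pq /=; ring.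
Qed.

Lemma det_zv (N : int) (k : int * int) : zv R k = N%:~R *: zv R e -> det e k = 0.
Proof.
move=> h; have -> : k = (N * e.1, N * e.2).
  by apply: (@zv_inj R); rewrite h; apply: pair_eq; rewrite /= intrM.
by rewrite /det /=; ring.
Qed.

Lemma det_multiple k : det e k = 0 -> exists m : int, k = (m * e.1, m * e.2).
Proof.
have [[p q] pq] := coprimezP _ _ ce; rewrite /= in pq.
rewrite /det => /eqP; rewrite subr_eq0 => /eqP h; exists (p * k.1 + q * k.2).
have h1 : (p * k.1 + q * k.2) * e.1 = k.1.
  by rewrite mulrDl -mulrA -(mulrA q) (mulrC k.2) h -[RHS]mul1r -pq; ring.
have h2 : (p * k.1 + q * k.2) * e.2 = k.2.
  by rewrite mulrDl -mulrA -(mulrA q) (mulrC k.1) -h -[RHS]mul1r -pq; ring.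
by rewrite h1 h2; case: k {h h1 h2}.
Qed.

(* Otherwise a translate of [l] by a vector of determinant 1 would miss the closed curve made
   of the lower edge of the band and of an arc of [l]. *)
Lemma band_det_small : `|det e kap| <= 1.
Proof.
rewrite leNgt; apply/negP => j1; have [z0 dz] := bezout_det.
have [cf cg] := (@row_cont 0, @segment_cont (b 0) (a 0) kap).
have fg : w (1, 0) = l (b 0 + 0 * (a 0 - b 0)) + zv R kap by rewrite (bw (I0 R)) mul0r addr0.
have gf : l (b 0 + 1 * (a 0 - b 0)) + zv R kap = w (0, 0) + zv R kap by rewrite (aw (I0 R)) mul1r (addrC (b 0)) subrK.
have [B [cB Bk BE]] := periodic_path cf cg fg gf.
pose l' u := l u + zv R z0.
have cl' : continuous l' by rewrite /l'; cont.
have l'e u : l' (u + 1) = l' u + zv R e by rewrite /l'; case: sl => _ -> _; rewrite addrAC.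
have dk : det kap e != 0.
  by apply/eqP; move: j1; rewrite /det -opprB normrN; clear => h1 h2; move: h1; rewrite (mulrC e.2) (mulrC e.1) h2.
have [s [t st]] := curves_meet cB cl' Bk l'e dk.
(* Taking determinants with [e] would give [1 = N * det e kap]. *)
have K v (N : int) : l' t = l v + N%:~R *: zv R kap -> False.
  have -> : N%:~R *: zv R kap = zv R (N * kap.1, N * kap.2) by apply: pair_eq; rewrite /= intrM.
  move=> h; have [|M [_ /det_zv]] := @lift_inj R e l sl t v ((N * kap.1, N * kap.2) - z0).
    by rewrite zvD zvN addrA -h /l' addrK.
  move=> h0; have : N * det e kap = 1 by rewrite -dz -[LHS]subr0 -h0 /det /=; ring.
  move=> h1; move: j1; have := congr1 absz h1; rewrite abszM => /eqP; rewrite muln_eq1 => /andP[_ /eqP].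
  by move: (det e kap) => j; clear; lia.
have [n [/andP[n0 n1] en]] := periodic_reduce s Bk.
rewrite st in en.
have In : I (s - n%:~R) by rewrite IE n0 ltW.
have [t' It' [[_ h]|[_ h]]] := @catp_half R (fun u => w (u, 0)) (fun u => l (b 0 + u * (a 0 - b 0)) + zv R kap) _ _ erefl (esym fg) In; rewrite (BE _ In) h in en.
  have [|N [[v0 _]|[v1 _]]] := @rung 0 t' t (I0 R) It'.
  - by rewrite -(coverD (l t) z0) -/(l' t) en -zvZ coverD.
  - by rewrite v0 (aw (I0 R)) in en; exact: K en.
  apply: (@K (b 0) (n + 1)); rewrite en v1 (bw (I0 R)) intrD scalerDl scale1r.
  by rewrite -addrA (addrC (zv R kap)).
apply: (@K (b 0 + t' * (a 0 - b 0)) (n + 1)); rewrite en intrD scalerDl scale1r.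
by rewrite -addrA (addrC (zv R kap)).
Qed.

(** The core of the band, closed by the arc of [l] from its end [b 2^-1] to [a 2^-1 + n], is a
    simple closed curve of class [m + n] times [e], and [primitive_class] applies. *)
Lemma core_closed (n : int) : let d := a 2^-1 + n%:~R - b 2^-1 in -1 < d < 1 ->
  forall m, kap = (m * e.1, m * e.2) -> [\/ m + n = 0, m + n = 1 | m + n = -1].
Proof.
move=> d d1 m km.
have A := bab I2; have B := @amono 2^-1 1 I2 (I1 R) ltac:(hlra); have C := @amono 0 2^-1 (I0 R) I2 ltac:(hlra).
have d0 : d != 0.
  apply/eqP => h; apply: (@no_int n (b 2^-1) (a 2^-1)); first by rewrite /d in h; hlra.
  by apply/andP; split; hlra.
have d2 : -1 < b 2^-1 + d - b 2^-1 < 1 by rewrite addrAC subrr add0r.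
have [||||s t Is It h|l0 [sl0 _]] := @closed_curve R _ _ ((m + n) * e.1, (m + n) * e.2) (@row_cont 2^-1) (@segment_cont (b 2^-1) (b 2^-1 + d) kap).
- by rewrite (bw I2) mul0r addr0.
- rewrite mul1r [_ + (_ - _)]addrC subrK [b _ + d]addrC /d subrK (simple_lift_int _ _ sl) (aw I2) -addrA; congr (_ + _).
  by rewrite km !zvZ -scalerDl -intrD addrC.
- exact: row_cover_inj I2.
- by apply: segment_cover_inj => //; rewrite -subr_eq0 addrAC subrr add0r.
- rewrite coverD in h; have [N [[-> en]|[-> en]]] := rung I2 Is (esym h).
    right; split => //; apply/eqP; rewrite -subr_eq0; apply/eqP.
    apply: (@frac_zero _ d (N - n)) => //; first by move: It; rewrite IE => /andP[t0 t1]; rewrite ler_norml; apply/andP; split; hlra.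
    by rewrite mulrBl mul1r intrB; rewrite /d in en *; hlra.
  left; split => //; apply: (@frac_zero _ d N) => //; first by move: It; rewrite IE => /andP[t0 t1]; rewrite ler_norml; apply/andP; split; hlra.
  by hlra.
exact: (primitive_class ce sl0).
Qed.

(** The disc bounded in the plane by [g] and an arc of [l] is mapped injectively to the torus, and
    its boundary becomes [beta] together with a subarc of the curve. *)
Lemma disc_trivial (s t : R) (g : R -> P) F beta : s < t < s + 1 -> continuous g -> injective_on I g -> g 0 = l s -> g 1 = l t ->
  (forall z u k, (g @` I) z -> z = l u + zv R k -> z = l s \/ z = l t) ->
  (forall z z' k, (g @` I) z -> (g @` I) z' -> z = z' + zv R k -> k = 0) ->
  F `&` bV R = trace l -> beta = (fun u => cover (g u)) @` I -> trivial_band R (bV R) F beta.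
Proof.
move=> st cg gi g0 g1 Cl CC Fl be; have e0 := coprime_zv ce.
have aC : arc (g @` I) (l s) (l t) by exists g.
have jJ := disc_jarcs e0 sl st aC Cl; have DE := disc_embeds e0 sl st aC Cl CC.
have [s_t ts1] := andP st; pose f (u : R) := l (s + u * (t - s)).
have cf : continuous f by rewrite /f; cont.
have fi : injective_on I f.
  move=> u v _ _ /(lift_inj0 e0 sl) /addrI; apply: mulIf; rewrite subr_eq0 gt_eqF //.
have AE : l @` `[s, t] = f @` I.
  apply/seteqP; split=> [_ [u + <-]|_ [u + <-]]; rewrite ?IE /= ?in_itv /= => /andP[u0 u1].
    have ts : t - s != 0 by rewrite subr_eq0 gt_eqF.
    exists ((u - s) / (t - s)); last by rewrite /f divfK // addrC subrK.
    by rewrite IE divr_ge0 ?ler_pdivrMr ?mul1r ?subr_gt0 // ?subr_ge0 ?lerB // ltW.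
  by exists (s + u * (t - s)) => //=; rewrite in_itv /=; apply/andP; split; nra.
have f0 : f 0 = l s by rewrite /f mul0r addr0.
have f1 : f 1 = l t by rewrite /f mul1r addrC subrK.
have [phi [[psi [cphi cpsi im K]] pf pg]] := jordan_disk jJ cf cg fi gi AE erefl (conj f0 f1) (conj g0 g1).
(* The radial retraction onto the disk; it extends the parametrization of the disc continuously to
   the plane. *)
pose rho (z : P) : P := (Num.max 1 (Num.sqrt (sqn z)))^-1 *: z.
have m0 (z : P) : 0 < Num.max 1 (Num.sqrt (sqn z)) by rewrite lt_max ltr01.
have crho : continuous rho.
  move=> z; apply: ctZ; last exact: ct_id.
  by apply: ctV; [rewrite gt_eqF | apply: ct_max; [exact: ct_cst | apply: ct_sqrt; exact: sqn_cont]].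
have dE (z : P) : disk R z = (sqn z <= 1) by [].
have s0 (z : P) : 0 <= sqn z by rewrite /sqn addr_ge0 // sqr_ge0.
have rhoD z : disk R (rho z).
  rewrite dE sqnZ exprVn mulrC ler_pdivrMr ?exprn_gt0 // mul1r -{1}(sqr_sqrtr (s0 z)).
  by rewrite ler_pXn2r ?nnegrE ?sqrtr_ge0 ?(ltW (m0 z)) // le_max lexx orbT.
have rhoid z : disk R z -> rho z = z.
  rewrite dE => h; rewrite /rho (max_idPl _) ?invr1 ?scale1r //.
  by rewrite -sqrtr1 ler_sqrt.
pose F0 z := cover (phi (rho z)).
have cF0 : continuous F0.
  have cq : continuous (fun z => phi (rho z)) by apply: (within_comp cphi).
  by move=> z; apply: (@ct_comp _ _ _ (@cover R) (fun z => phi (rho z))); [exact: cover_cont | exact: cq].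
have F0i z z' : disk R z -> disk R z' -> F0 z = F0 z' -> z = z'.
  move=> dz dz'; rewrite /F0 !rhoid // => /cover_eq [k ek].
  have hz x : disk R x -> hull (l @` `[s, t] `|` g @` I) (phi x) by move=> dx; rewrite -im; exists x.
  have k0 := DE _ _ _ (hz _ dz) (hz _ dz') ek.
  by rewrite k0 addr0 in ek; rewrite -(K _ dz) -(K _ dz') ek.
have kD : compact (disk R).
  apply: (@compact_of_closed_bounded _ _ 1); last by move=> z; exact: sqn_norm.
  rewrite (_ : disk R = @sqn R @^-1` [set x | x <= 1]) //.
  by apply: preimage_closed => [z _|]; [exact: sqn_cont | exact: closed_le].
have FD : F0 @` disk R = @cover R @` hull (l @` `[s, t] `|` g @` I).
  rewrite -im; apply/seteqP; split=> [_ [z dz <-]|_ [_ [z dz <-] <-]].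
    by exists (phi z); [exists z | rewrite /F0 rhoid].
  by exists z => //; rewrite /F0 rhoid.
exists (@cover R @` (l @` `[s, t])); split.
- by move=> _ [_ [u _ <-] <-]; rewrite Fl; exact: trace_all sl.
- rewrite AE; exists (fun u => cover (f u)); have ci : continuous (fun u : R => u) by cont.
  have cF : continuous (fun u => cover (f u)) by move=> u; apply: (@ct_comp _ _ _ (@cover R) f); [exact: cover_cont | exact: cf].
  have [|h ch hE] := @compact_factor R _ _ _ I (fun u => cover (f u)) (fun u => u) (@I_compact R) cF ci.
    move=> u v Iu Iv /cover_eq [k ek]; apply: fi => //.
    have hz x : I x -> hull (l @` `[s, t] `|` g @` I) (f x) by move=> Ix; left; left; rewrite AE; exists x.
    by rewrite ek (DE _ _ _ (hz _ Iu) (hz _ Iv) ek) addr0.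
  exists h; split => //; first exact: continuous_subspaceT.
    by rewrite image_comp.
  by rewrite image_comp.
have ci : continuous (fun z : P => z) by cont.
have [h ch hE] := @compact_factor R _ _ _ (disk R) F0 (fun z => z) kD cF0 ci F0i.
exists (F0 @` disk R), F0; split.
- by move=> _ [z _ <-]; exact: cover_bV.
- by exists h; split => //; exact: continuous_subspaceT.
rewrite be; have cd u : disk R (cis u) by rewrite dE sqn_cis.
apply/seteqP; split=> [_ [z /circle_param [u Iu ->] <-]|_ [[u Iu <-]|[_ [u + <-] <-]]].
- rewrite /F0 rhoid //; have := Iu; rewrite IE => /andP[u0 u1]; have [h2|h2] := leP u 2^-1.
    right; exists (f (2 * u)); last by rewrite -(pf (2 * u)) ?(mulrC 2) ?mulfK // IE; apply/andP; split; hlra.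
    by rewrite AE; exists (2 * u) => //; rewrite IE; apply/andP; split; hlra.
  have I2u : I (2 - 2 * u) by rewrite IE; apply/andP; split; hlra.
  left; exists (2 - 2 * u) => //; rewrite -(pg _ I2u); congr (cover (phi _)).
  by rewrite -(cisDz u (-1)); congr cis; rewrite intrN; field.
- by exists (cis (- (u / 2))); [exact: circle_cis | rewrite /F0 rhoid // pg].
move=> us; have : (f @` I) (l u) by rewrite -AE; exists u.
by move=> [v Iv <-]; exists (cis (v / 2)); [exact: circle_cis | rewrite /F0 rhoid // pf].
Qed.

Lemma band_det_neq0 F beta : F `&` bV R = trace l -> (fun z => cover (w z)) @` (I `*` [set 2^-1]) = beta ->
  ~ trivial_band R (bV R) F beta -> det e kap != 0.
Proof.
move=> Fl be nt; apply/eqP => dk; apply: nt; have [m km] := det_multiple dk.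
have A := bab I2; have B := @amono 2^-1 1 I2 (I1 R) ltac:(hlra); have C := @amono 0 2^-1 (I0 R) I2 ltac:(hlra).
(* [core_closed] applies to both arcs of the curve between the ends of the core, with [n = 0] and
   with [n = 1]. *)
have m01 : m = 0 \/ m = -1.
  have h0 : [\/ m + 0 = 0, m + 0 = 1 | m + 0 = -1] by apply: core_closed => //; apply/andP; split; hlra.
  have h1 : [\/ m + 1 = 0, m + 1 = 1 | m + 1 = -1] by apply: core_closed => //; apply/andP; split; hlra.
  by clear -h0 h1; case: h0 h1 => h []; lia.
pose f u := w (u, 2^-1); have cf : continuous f := @row_cont 2^-1.
have f0 : f 0 = l (a 2^-1) by rewrite /f aw //; exact: I2.
have f1 : f 1 = l (b 2^-1 + m%:~R) by rewrite /f bw ?km ?zvZ ?(simple_lift_int _ _ sl) //; exact: I2.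
have fi u v k : I u -> I v -> f u = f v + zv R k -> u = v.
  by move=> Iu Iv h; apply: (row_cover_inj I2) => //; rewrite -(coverD (w (v, _)) k) -h.
have fC u v k : I u -> f u = l v + zv R k -> u = 0 \/ u = 1.
  by move=> Iu h; have [|n [[-> _]|[-> _]]] := @rung 2^-1 u v I2 Iu; [rewrite -(coverD (l v) k) -h | left | right].
have bE : beta = (fun u => cover (f u)) @` I.
  by rewrite -be; apply/seteqP; split=> [_ [[u v] [/= Iu ->] <-]|_ [u Iu <-]]; [exists u | exists (u, 2^-1)].
have CC u v k : I u -> I v -> f u = f v + zv R k -> k = 0.
  move=> Iu Iv h; have uv := fi _ _ _ Iu Iv h; move: h; rewrite uv -{1}(addr0 (f v)) => /addrI.
  by rewrite -(_ : zv R 0 = 0) // => /zv_inj.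
case: m01 => m0; rewrite m0 ?intrN ?addr0 in f1.
  apply: (@disc_trivial (a 2^-1) (b 2^-1) f) => //.
  - by apply/andP; split; hlra.
  - by move=> u v Iu Iv h; apply: (@fi _ _ 0) => //; rewrite addr0.
  - by move=> _ u k [v Iv <-] /(fC _ _ _ Iv) [] ->; [left|right].
  - by move=> _ _ k [u Iu <-] [v Iv <-]; exact: CC.
have IN u : I u -> I (1 - u) by rewrite !IE => /andP[? ?]; apply/andP; split; hlra.
apply: (@disc_trivial (b 2^-1 - 1) (a 2^-1) (fun u => f (1 - u))) => //.
- by apply/andP; split; hlra.
- by cont.
- move=> u v Iu Iv h; have : 1 - u = 1 - v by apply: (@fi _ _ 0); rewrite ?addr0 //; exact: IN.
  by move=> ?; hlra.
- by rewrite subr0.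
- by rewrite subrr.
- by move=> _ u k [v Iv <-] /(fC _ _ _ (IN _ Iv)) [] ->; [right|left].
- by move=> _ _ k [u Iu <-] [v Iv <-]; apply: CC; exact: IN.
rewrite bE; apply/seteqP; split=> [_ [u Iu <-]|_ [u Iu <-]].
  by exists (1 - u); [exact: IN | rewrite opprB addrC subrK].
by exists (1 - u) => //; exact: IN.
Qed.

Lemma periodic_points (f g B : R -> P) k : (forall u, B (u + 1) = B u + zv R k) -> f 1 = g 0 ->
  (forall u, I u -> B u = catp f g (f 1) u) ->
  forall s, exists2 t, I t & cover (B s) = cover (f t) \/ cover (B s) = cover (g t).
Proof.
move=> Bk fg BE s; have [n [/andP[n0 n1] en]] := periodic_reduce s Bk.
have In : I (s - n%:~R) by rewrite IE n0 ltW.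
rewrite en -zvZ coverD (BE _ In).
by have [t It [[_ ->]|[_ ->]]] := catp_half (erefl (f 1)) (esym fg) In; exists t; [|left| |right].
Qed.

Lemma band_orientation : (forall y y', I y -> I y' -> y < y' -> b y' < b y) -> det e kap != 0 -> False.
Proof.
move=> bdecr dk; have [A B C] := band_sides; have D := bdecr _ _ (I0 R) (I1 R) ltr01.
have c1 := @segment_cont (a 1) (b 1) 0; have c2 := @segment_cont (b 0) (a 0 + 1) 0.
have cg1 : continuous (fun u : R => w (1 - u, 1) + zv R (- kap)).
  by move=> u; apply: ctD; [apply: (@ct_comp _ _ _ w); [exact: cw | cont] | exact: ct_cst].
have cg2 : continuous (fun u : R => w (u, 0) + zv R e).
  by move=> u; apply: ctD; [apply: (@ct_comp _ _ _ w); [exact: cw | cont] | exact: ct_cst].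
have fg1 : l (a 1 + 1 * (b 1 - a 1)) + zv R 0 = w (1 - 0, 1) + zv R (- kap).
  by rewrite subr0 (bw (I1 R)) zvN addrK mul1r (addrC (a 1)) subrK addr0.
have gf1 : w (1 - 1, 1) + zv R (- kap) = (l (a 1 + 0 * (b 1 - a 1)) + zv R 0) + zv R (- kap).
  by rewrite subrr (aw (I1 R)) mul0r !addr0.
have fg2 : l (b 0 + 1 * (a 0 + 1 - b 0)) + zv R 0 = w (0, 0) + zv R e.
  by rewrite (aw (I0 R)) mul1r (addrC (b 0)) subrK addr0; case: sl => _ -> _.
have gf2 : w (1, 0) + zv R e = (l (b 0 + 0 * (a 0 + 1 - b 0)) + zv R 0) + zv R (kap + e).
  by rewrite (bw (I0 R)) mul0r !addr0 zvD addrA.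
have [B1 [cB1 Bk1 BE1]] := periodic_path c1 cg1 fg1 gf1.
have [B2 [cB2 Bk2 BE2]] := periodic_path c2 cg2 fg2 gf2.
have dd : det (- kap) (kap + e) != 0.
  rewrite (_ : det _ _ = det e kap) // /det /=; ring.
have [s [t st]] := curves_meet cB1 cB2 Bk1 Bk2 dd.
have [s' Is h1] := periodic_points Bk1 fg1 BE1 s; have [t' It h2] := periodic_points Bk2 fg2 BE2 t.
rewrite -st !coverD in h2; rewrite !coverD in h1.
have IN : I (1 - s') by move: Is; rewrite !IE => /andP[? ?]; apply/andP; split; hlra.
have u0 : a 1 <= a 1 + s' * (b 1 - a 1) <= b 1 by move: Is; rewrite IE => /andP[? ?]; apply/andP; split; nra.
have v0 : b 0 <= b 0 + t' * (a 0 + 1 - b 0) <= a 0 + 1 by move: It; rewrite IE => /andP[? ?]; apply/andP; split; nra.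
case: h1 h2 => -> [] h.
- have [n en] := lift_eq (esym h); apply: (no_int en); apply/andP; split; hlra.
- have [n [[_ en]|[_ en]]] := rung (I0 R) It h; [apply: (no_int en) | apply: (no_int' en)]; apply/andP; split; hlra.
- by have [n [[_ en]|[_ en]]] := rung (I1 R) IN (esym h); apply: (no_int en); apply/andP; split; hlra.
by have [_ /eqP] := Binj (conj IN (I1 R) : square R (1 - s', 1)) (conj It (I0 R) : square R (t', 0)) h; rewrite oner_eq0.
Qed.

Lemma catp_cover_image (f g : R -> P) r : f 1 = r -> g 0 = r ->
  (fun t => cover (catp f g r t)) @` I = (fun t => cover (f t)) @` I `|` (fun t => cover (g t)) @` I.
Proof.
move=> f1 g0; rewrite -(image_comp (catp f g r) (@cover R)) (catp_image f1 g0).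
by rewrite image_setU !image_comp.
Qed.

Hypothesis ca : continuous a.
Hypothesis cb : continuous b.

Lemma band_curve : (forall y y', I y -> I y' -> y < y' -> b y < b y') -> `|det e kap| = 1 ->
  exists e', [/\ curve ((trace l `\` (fun z => cover (w z)) @` ([set 0; 1] `*` `]0, 1[))
       `|` (fun z => cover (w z)) @` (I `*` [set 0; 1])) e', coprimez e'.1 e'.2 & `|det e e'| = 2].
Proof.
move=> bincr dk; have [A /andP[B1 B2] /andP[C1 C2]] := band_sides; have D := bincr _ _ (I0 R) (I1 R) ltr01.
pose e' := - (kap + kap + e).
pose f1 (u : R) := l (a 1 + u * (b 0 - a 1)) + zv R 0; pose g1 (u : R) := w (1 - u, 0) + zv R (- kap).
pose f2 (u : R) := l (a 0 + u * (b 1 - 1 - a 0)) + zv R (- kap); pose g2 (u : R) := w (1 - u, 1) + zv R e'.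
have [cf1 cf2] : continuous f1 /\ continuous f2 by split; exact: segment_cont.
have cg1 : continuous g1.
  by move=> u; apply: ctD; [apply: (@ct_comp _ _ _ w); [exact: cw | cont] | exact: ct_cst].
have cg2 : continuous g2.
  by move=> u; apply: ctD; [apply: (@ct_comp _ _ _ w); [exact: cw | cont] | exact: ct_cst].
have IN u : I u -> I (1 - u) by rewrite !IE => /andP[? ?]; apply/andP; split; hlra.
have f10 : f1 0 = l (a 1) by rewrite /f1 mul0r !addr0.
have f11 : f1 1 = l (b 0) by rewrite /f1 mul1r (addrC (a 1)) subrK addr0.
have g10 : g1 0 = l (b 0) by rewrite /g1 subr0 (bw (I0 R)) zvN addrK.
have g11 : g1 1 = l (a 0) + zv R (- kap) by rewrite /g1 subrr (aw (I0 R)).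
have f20 : f2 0 = l (a 0) + zv R (- kap) by rewrite /f2 mul0r addr0.
have g20 : g2 0 = l (b 1) + zv R (- (kap + e)).
  by rewrite /g2 subr0 (bw (I1 R)) -addrA -zvD; congr (_ + zv R _); rewrite /e' !opprD; ring.
have f21 : f2 1 = l (b 1) + zv R (- (kap + e)).
  rewrite /f2 mul1r (addrC (a 0)) subrK -(subrK 1 (b 1)) addrK; case: sl => _ -> _.
  by rewrite -addrA -zvD opprD; congr (_ + zv R _); rewrite addrC subrK.
have g21 : g2 1 = f1 0 + zv R e' by rewrite /g2 subrr (aw (I1 R)) f10.
have cg k : cover (f1 k) = cover (l (a 1 + k * (b 0 - a 1))) by rewrite coverD.
have arc1 t : I t -> a 1 <= a 1 + t * (b 0 - a 1) <= b 0.
  by rewrite IE => /andP[? ?]; apply/andP; split; nra.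
have arc2 t : I t -> b 1 - 1 <= a 0 + t * (b 1 - 1 - a 0) <= a 0.
  by rewrite IE => /andP[? ?]; apply/andP; split; nra.
have arc1b t : a 1 + t * (b 0 - a 1) = b 0 -> t = 1.
  move=> h; apply: (@mulIf _ (b 0 - a 1)); first by rewrite subr_eq0 gt_eqF.
  by hlra.
have arc1a t : a 1 + t * (b 0 - a 1) = a 1 -> t = 0.
  move=> h; apply: (@mulIf _ (b 0 - a 1)); first by rewrite subr_eq0 gt_eqF.
  by hlra.
have arc2b t : a 0 + t * (b 1 - 1 - a 0) = b 1 - 1 -> t = 1.
  move=> h; apply: (@mulIf _ (b 1 - 1 - a 0)); first by rewrite subr_eq0 lt_eqF //; hlra.
  by hlra.
have arc2a t : a 0 + t * (b 1 - 1 - a 0) = a 0 -> t = 0.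
  move=> h; apply: (@mulIf _ (b 1 - 1 - a 0)); first by rewrite subr_eq0 lt_eqF //; hlra.
  by hlra.
have gi y k : I y -> cover_inj (fun u => w (1 - u, y) + zv R k).
  move=> Iy s t Is It; rewrite !coverD => h; have : 1 - s = 1 - t by apply: (row_cover_inj Iy) => //; exact: IN.
  by move=> ?; hlra.
have N1 (x : R) : 1 - x = 1 -> x = 0 by move=> ?; hlra.
have N0 (x : R) : 1 - x = 0 -> x = 1 by move=> ?; hlra.
have i1 : cover_inj (catp f1 g1 (l (b 0))).
  apply: catp_cover_inj => //.
  - apply: segment_cover_inj; last by rewrite gt_eqF.
    by apply/andP; split; hlra.
  - exact: gi (I0 R).
  move=> s t Is It; rewrite !coverD => h; have /andP[u0 u1] := arc1 _ Is.
  have [n [[_ en]|[v1 en]]] := rung (I0 R) (IN _ It) h.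
    by case: (no_int en); apply/andP; split; hlra.
  split; last exact: N1.
  by apply: arc1b; apply: (near_int en); apply/andP; split; hlra.
have i2 : cover_inj (catp f2 g2 (l (b 1) + zv R (- (kap + e)))).
  apply: catp_cover_inj => //.
  - apply: segment_cover_inj; last by rewrite lt_eqF //; hlra.
    by apply/andP; split; hlra.
  - exact: gi (I1 R).
  move=> s t Is It; rewrite !coverD => h; have /andP[u0 u1] := arc2 _ Is.
  have [n [[_ en]|[v1 en]]] := rung (I1 R) (IN _ It) h.
    by case: (no_int' en); apply/andP; split; hlra.
  split; last exact: N1.
  apply: arc2b; apply: (@near_int (n + 1)); last by apply/andP; split; hlra.
  by rewrite intrD; hlra.
have cross s t : I s -> I t -> cover (catp f1 g1 (l (b 0)) s) = cover (catp f2 g2 (l (b 1) + zv R (- (kap + e))) t) ->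
    s = 1 /\ t = 0 \/ s = 0 /\ t = 1.
  move=> Is It; have [s' Is' [[-> ->]|[-> ->]]] := catp_half f11 g10 Is;
    have [t' It' [[-> ->]|[-> ->]]] := catp_half f21 g20 It; rewrite !coverD => h.
  - have /andP[u0 u1] := arc1 _ Is'; have /andP[v0 v1] := arc2 _ It'; have [n en] := lift_eq (esym h).
    by case: (no_int' en); apply/andP; split; hlra.
  - have /andP[u0 u1] := arc1 _ Is'; have [n [[v0 en]|[v1 en]]] := rung (I1 R) (IN _ It') h.
      right; rewrite (N0 _ v0) (_ : s' = 0) ?mul0r; last by apply: arc1a; apply: (near_int en); apply/andP; split; hlra.
      by split => //; field.
    by case: (no_int' en); apply/andP; split; hlra.
  - have /andP[u0 u1] := arc2 _ It'; have [n [[v0 en]|[v1 en]]] := rung (I0 R) (IN _ Is') (esym h).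
      left; rewrite (N0 _ v0) (_ : t' = 0) ?mul0r; last by apply: arc2a; apply: (near_int en); apply/andP; split; hlra.
      by split => //; field.
    by case: (no_int' en); apply/andP; split; hlra.
  by have [_ /eqP] := Binj (conj (IN _ Is') (I0 R) : square R (1 - s', 0)) (conj (IN _ It') (I1 R) : square R (1 - t', 1)) h; rewrite eq_sym oner_eq0.
have [P1 P2'] := catp_ends f11 g10; have [Q1 Q2] := catp_ends f21 g20.
have fg : catp f1 g1 (l (b 0)) 1 = catp f2 g2 (l (b 1) + zv R (- (kap + e))) 0 by rewrite P2' Q1 g11 f20.
have gf : catp f2 g2 (l (b 1) + zv R (- (kap + e))) 1 = catp f1 g1 (l (b 0)) 0 + zv R e' by rewrite Q2 P1; exact: g21.
have [l' [sl' tl']] := closed_curve (catp_cont cf1 cg1) (catp_cont cf2 cg2) fg gf i1 i2 cross.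
exists e'; split.
- exists l' => //; rewrite tl' !catp_cover_image //; apply/seteqP; split.
  + move=> _ [[[u Iu <-]|[u Iu <-]]|[[u Iu <-]|[u Iu <-]]]; rewrite coverD.
    * left; split; first exact: trace_all sl.
      move=> [[v y] [v01 /=]]; rewrite in_itv /= => /andP[y0 y1] h.
      have Iy : I y by rewrite IE !ltW.
      have Iv : I v by case: v01 => /= ->; [exact: I0 | exact: I1].
      have /andP[u0 u1] := arc1 _ Iu; have ya := amono Iy (I1 R) y1; have yb := bincr _ _ (I0 R) Iy y0.
      have ya' := amono (I0 R) Iy y0; have /andP[yc yd] := bab Iy.
      have [n [[_ en]|[_ en]]] := rung Iy Iv (esym h); [apply: (no_int en) | apply: (no_int' en)]; apply/andP; split; hlra.
    * by right; exists (1 - u, 0) => //; split; [exact: IN | left].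
    * left; split; first exact: trace_all sl.
      move=> [[v y] [v01 /=]]; rewrite in_itv /= => /andP[y0 y1] h.
      have Iy : I y by rewrite IE !ltW.
      have Iv : I v by case: v01 => /= ->; [exact: I0 | exact: I1].
      have /andP[u0 u1] := arc2 _ Iu; have ya := amono Iy (I1 R) y1; have yb := bincr _ _ Iy (I1 R) y1.
      have ya' := amono (I0 R) Iy y0; have /andP[yc yd] := bab Iy.
      have [n [[_ en]|[_ en]]] := rung Iy Iv (esym h); apply: (no_int' en); apply/andP; split; hlra.
    by right; exists (1 - u, 1) => //; split; [exact: IN | right].
  move=> z [[[u0 _ <-] nz]|[[u y] [/= Iu [->|->]] <-]]; last first.
  - by right; right; exists (1 - u); [exact: IN | rewrite coverD opprB addrC subrK].
  - by left; right; exists (1 - u); [exact: IN | rewrite coverD opprB addrC subrK].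
  have [n] := int_part (u0 - a 0); set u := u0 - n%:~R => n01; have uE : cover (l u0) = cover (l u).
    by rewrite -(cover_lift_int u n sl) /u subrK.
  move: nz; rewrite uE => nz; have /andP[u1 u2] : a 0 <= u < a 0 + 1.
    by rewrite /u; case/andP: n01 => ? ?; apply/andP; split; hlra.
  have side (f : R -> R) v y0 y1 : continuous f -> (v = 0 \/ v = 1) -> (forall y, I y -> cover (w (v, y)) = cover (l (f y))) ->
      f 0 = y0 -> f 1 = y1 -> y0 < u < y1 -> False.
    move=> cf v01 fw fy0 fy1 /andP[h0 h1].
    have [||y] := @IVT R f 0 1 u ler01.
    + exact: continuous_subspaceT.
    + by rewrite fy0 fy1 (min_idPl _) ?(max_idPr _) ?ltW //; hlra.
    rewrite in_itv /= => y01 fy; apply: nz; exists (v, y); last by rewrite fw ?fy // IE.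
    split => //=; rewrite in_itv /= !lt_neqAle; case/andP: y01 => -> ->; rewrite !andbT.
    apply/andP; split; apply/eqP => yy; move: fy; first by rewrite -yy fy0 => ?; hlra.
    by rewrite yy fy1 => ?; hlra.
  have [ua|ua] := ltP u (a 1).
    have [ua0|ua0] := eqVneq u (a 0).
      by right; left; exists 0; [exact: I0 | rewrite f20 coverD ua0].
    case: (@side a 0 (a 0) (a 1)) => //; first by left.
      by move=> y Iy; rewrite aw.
    by rewrite lt_neqAle eq_sym ua0 u1.
  have [ub|ub] := leP u (b 0).
    have d0 : 0 < b 0 - a 1 by rewrite subr_gt0.
    left; left; exists ((u - a 1) / (b 0 - a 1)); last by rewrite coverD divfK ?gt_eqF // addrC subrK.
    by rewrite IE ler_pdivlMr // ler_pdivrMr // mul0r mul1r subr_ge0 ua lerB.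
  have [uc|uc] := ltP u (b 1).
    by case: (@side b 1 (b 0) (b 1)) => //; [right | move=> y Iy; rewrite bw // coverD | rewrite ub].
  have d0 : 0 < a 0 + 1 - b 1 by rewrite subr_gt0.
  right; left; exists ((a 0 + 1 - u) / (a 0 + 1 - b 1)).
    by rewrite IE ler_pdivlMr // ler_pdivrMr // mul0r mul1r subr_ge0 (ltW u2) lerB.
  rewrite coverD -(cover_lift_int _ 1 sl); congr (cover (l _)).
  rewrite (_ : b 1 - 1 - a 0 = - (a 0 + 1 - b 1)); last by ring.
  by rewrite mulrN divfK ?gt_eqF //; ring.
- apply/coprimezP.
  have [d1|d1] : det e kap = 1 \/ det e kap = -1.
    by move: dk; move: (det e kap) => j; clear; lia.
    by exists (- kap.2, kap.1); rewrite /= -d1 /det; ring.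
  by exists (kap.2, - kap.1); rewrite /= -(opprK 1) -d1 /det; ring.
by rewrite (_ : det e e' = - 2 * det e kap); [rewrite normrM dk | rewrite /det /=; ring].
Qed.

End Band.

Section BandStep.
Context (R : realType).
Notation P := (R * R)%type.
Notation P2 := (P * P)%type.
Notation I := (unit_interval R).

Lemma injective_path_monotone (f : R -> R) : continuous f -> injective_on I f ->
  (forall y y', I y -> I y' -> y < y' -> f y < f y') \/ (forall y y', I y -> I y' -> y < y' -> f y' < f y).
Proof.
move=> cf fi; have [|x y|h|h] := @itv_continuous_inj_mono R f `[0, 1].
- exact: continuous_subspaceT.
- by move=> xI yI; exact: fi.
- by left=> x y xI yI; exact: h.
by right=> x y xI yI; exact: h.
Qed.

Lemma ivt (f : R -> R) (x y v : R) : continuous f -> x <= y -> (f x <= v <= f y) \/ (f y <= v <= f x) ->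
  exists2 c, x <= c <= y & f c = v.
Proof.
move=> cf xy h; have [||c] := @IVT R f x y v xy.
- exact: continuous_subspaceT.
- by case: h => /andP[h1 h2]; rewrite ge_min le_max h1 h2 ?orbT.
by rewrite in_itv /= => cI fc; exists c.
Qed.

Definition band_edge (e : int * int) (l : R -> P) (w : P -> P) : set P2 :=
  (trace l `\` (fun z => cover (w z)) @` ([set 0; 1] `*` `]0, 1[)) `|` (fun z => cover (w z)) @` (I `*` [set 0; 1]).

Lemma band_step_increasing (F beta : set P2) e kap l w (a b : R -> R) : coprimez e.1 e.2 -> simple_lift e l ->
  continuous w -> (forall z z', square R z -> square R z' -> cover (w z) = cover (w z') -> z = z') ->
  (forall z, square R z -> trace l (cover (w z)) -> z.1 = 0 \/ z.1 = 1) ->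
  (forall y, I y -> w (0, y) = l (a y)) -> (forall y, I y -> w (1, y) = l (b y) + zv R kap) ->
  continuous a -> continuous b -> (forall y y', I y -> I y' -> y < y' -> a y < a y') ->
  F `&` bV R = trace l -> (fun z => cover (w z)) @` (I `*` [set 2^-1]) = beta ->
  ~ trivial_band R (bV R) F beta ->
  exists e', [/\ curve (band_edge e l w) e', coprimez e'.1 e'.2 & `|det e e'| = 2].
Proof.
move=> ce sl cw Binj Btr aw bw ca cb amono Fl be nt.
have sq v y : v = 0 \/ v = 1 -> I y -> square R (v, y).
  by move=> v01 Iy; split => //=; case: v01 => ->; [exact: I0 | exact: I1].
have Iconv y c : I y -> 0 <= c <= y -> I c.
  by rewrite !IE => /andP[? ?] /andP[? ?]; apply/andP; split; xlra.
have A := amono _ _ (I0 R) (I1 R) ltr01.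
have A1 : a 1 < a 0 + 1.
  rewrite ltNge; apply/negP => h; have [|y y01 ay] := @ivt a 0 1 (a 0 + 1) ca ler01.
    by left; rewrite h andbT; xlra.
  have Iy : I y by rewrite IE.
  have : cover (w (0, y)) = cover (w (0, 0)).
    by rewrite (aw _ Iy) (aw _ (I0 R)) ay -(cover_lift_int (a 0) 1 sl).
  move/(Binj (0, y) (0, 0) (sq _ _ (or_introl erefl) Iy) (sq _ _ (or_introl erefl) (I0 R))) => [y0].
  by move: ay; rewrite y0 => ?; xlra.
have [n n01] := int_part (b 0 - a 0).
pose b' y := b y - n%:~R; have cb' : continuous b' by rewrite /b'; cont.
have bw' y : I y -> w (1, y) = l (b' y) + zv R (kap + (n * e.1, n * e.2)).
  move=> Iy; rewrite (bw _ Iy) -{1}(subrK n%:~R (b y)) (simple_lift_int _ _ sl) -/(b' y) zvD zvZ.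
  by rewrite -addrA (addrC (n%:~R *: _)).
have avoid y v : I y -> a 0 <= v <= a 1 -> cover (l (b' y)) = cover (l v) -> False.
  move=> Iy hv h; have [|x x01 ax] := @ivt a 0 1 v ca ler01; first by left.
  have Ix : I x by rewrite IE.
  have : cover (w (1, y)) = cover (w (0, x)) by rewrite (bw' _ Iy) coverD h (aw _ Ix) ax.
  move/(Binj (1, y) (0, x) (sq _ _ (or_intror erefl) Iy) (sq _ _ (or_introl erefl) Ix)) => [/eqP].
  by rewrite oner_eq0.
have b0 : a 1 < b' 0 < a 0 + 1.
  have h0 : a 0 <= b' 0 < a 0 + 1 by rewrite /b'; case/andP: n01 => ? ?; apply/andP; split; xlra.
  case/andP: h0 => h0 ->; rewrite andbT ltNge; apply/negP => h.
  by apply: (@avoid 0 (b' 0)) => //; [exact: I0 | rewrite h0].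
have bab y : I y -> a 1 < b' y < a 0 + 1.
  move=> Iy; have y0 : 0 <= y by move: Iy; rewrite IE => /andP[].
  case/andP: b0 => h1 h2; apply/andP; split; rewrite ltNge; apply/negP => h.
    have [|c c01 bc] := @ivt b' 0 y (a 1) cb' y0; first by right; rewrite h ltW.
    by apply: (@avoid c (a 1)); [exact: Iconv c01 | rewrite lexx ltW | rewrite bc].
  have [|c c01 bc] := @ivt b' 0 y (a 0 + 1) cb' y0; first by left; rewrite h ltW.
  apply: (@avoid c (a 0)); [exact: Iconv c01 | by rewrite lexx ltW | rewrite bc].
  exact: (cover_lift_int (a 0) 1 sl).
have b'i : injective_on I b'.
  move=> x y Ix Iy h; have : cover (w (1, x)) = cover (w (1, y)) by rewrite (bw' _ Ix) (bw' _ Iy) h.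
  by move/(Binj (1, x) (1, y) (sq _ _ (or_intror erefl) Ix) (sq _ _ (or_intror erefl) Iy)) => [].
have j0 := band_det_neq0 ce sl cw Binj Btr aw bw' amono bab Fl be nt.
have j1 := band_det_small ce sl cw Btr aw bw'.
have [bincr|bdecr] := injective_path_monotone cb' b'i; last first.
  by case: (band_orientation sl cw Binj Btr aw bw' amono bab bdecr j0).
apply: (band_curve sl cw Binj Btr aw bw' amono bab ca cb' bincr).
by move: j0 j1; move: (det e _) => j; clear; lia.
Qed.

Lemma zvB (k k' : int * int) : zv R (k - k') = zv R k - zv R k'.
Proof. by rewrite zvD zvN. Qed.

Lemma band_step (F beta : set P2) e l w : coprimez e.1 e.2 -> simple_lift e l ->
  continuous w -> (forall z z', square R z -> square R z' -> cover (w z) = cover (w z') -> z = z') ->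
  (forall z, square R z -> trace l (cover (w z)) <-> z.1 = 0 \/ z.1 = 1) ->
  F `&` bV R = trace l -> (fun z => cover (w z)) @` (I `*` [set 2^-1]) = beta ->
  ~ trivial_band R (bV R) F beta ->
  exists e', [/\ curve (band_edge e l w) e', coprimez e'.1 e'.2 & `|det e e'| = 2].
Proof.
move=> ce sl cw Binj Btr Fl be nt.
have cl := let: And3 x _ _ := sl in x.
have row v : v = 0 \/ v = 1 -> exists (a : R -> R) k, continuous a /\ forall y, I y -> w (v, y) = l (a y) + zv R k.
  move=> v01; apply: (path_in_curve sl).
    by move=> y; apply: (@ct_comp _ _ _ w (fun y : R => (v, y))); [exact: cw | cont].
  by move=> y Iy; apply/Btr => //; split => //=; case: v01 => ->; [exact: I0 | exact: I1].
have [a [ka [ca aw]]] := row 0 (or_introl erefl); have [b [kb [cb bw]]] := row 1 (or_intror erefl).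
pose w1 z := w z + zv R (- ka).
have cw1 : continuous w1 by rewrite /w1; cont.
have wE z : cover (w1 z) = cover (w z) by rewrite coverD.
have ai : injective_on I a.
  move=> x y Ix Iy h; have : cover (w (0, x)) = cover (w (0, y)) by rewrite aw // aw // h.
  have S z : I z -> square R (0, z) by move=> Iz; split => //=; exact: I0.
  by move/(Binj _ _ (S _ Ix) (S _ Iy)) => [].
have [amono|amono] := injective_path_monotone ca ai.
  rewrite /band_edge -(_ : (fun z => cover (w1 z)) = (fun z => cover (w z))); last by apply/funext.
  apply: (@band_step_increasing F beta e (kb - ka) l w1 a b) => //.
  - by move=> z z' sz sz'; rewrite !wE; exact: Binj.
  - by move=> z sz; rewrite wE => /(Btr _ sz).
  - by move=> y Iy; rewrite /w1 aw // zvN addrK.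
  - by move=> y Iy; rewrite /w1 bw // zvB zvN addrA.
  by rewrite -be; apply: eq_imagel => z _; rewrite wE.
pose fl (z : P) := (z.1, 1 - z.2).
have flK z : fl (fl z) = z by case: z => x y; rewrite /fl /= opprB addrC subrK.
have flI y : I y -> I (1 - y) by rewrite !IE => /andP[? ?]; apply/andP; split; xlra.
have flS z : square R z -> square R (fl z) by move=> [z1 z2]; split => //=; exact: flI.
pose w2 z := w1 (fl z).
have cw2 : continuous w2 by move=> z; apply: (@ct_comp _ _ _ w1); [exact: cw1 | rewrite /fl; cont].
have wE2 z : cover (w2 z) = cover (w (fl z)) by rewrite /w2 wE.
have imE (X : set P) : (forall z, X z -> X (fl z)) -> (fun z => cover (w2 z)) @` X = (fun z => cover (w z)) @` X.
  move=> XX; apply/seteqP; split=> [_ [z Xz <-]|_ [z Xz <-]]; exists (fl z); try exact: XX.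
    by rewrite wE2.
  by rewrite wE2 flK.
have [e' [ce1 ce2 ce3]] : exists e', [/\ curve (band_edge e l w2) e', coprimez e'.1 e'.2 & `|det e e'| = 2].
  apply: (@band_step_increasing F beta e (kb - ka) l w2 (fun y => a (1 - y)) (fun y => b (1 - y))) => //.
  - by move=> z z' sz sz'; rewrite !wE2 => /(Binj _ _ (flS _ sz) (flS _ sz')) h; rewrite -(flK z) -(flK z') h.
  - by move=> z sz; rewrite wE2 => /(Btr _ (flS _ sz)).
  - by move=> y /flI Iy; rewrite /w2 /w1 /fl /= aw // zvN addrK.
  - by move=> y /flI Iy; rewrite /w2 /w1 /fl /= bw // zvB zvN addrA.
  - by cont.
  - by cont.
  - by move=> y y' /flI Iy /flI Iy' yy; apply: amono => //; xlra.
  rewrite -be; apply: imE => -[x y] [/= Ix ->]; split => //=.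
  by apply: (@addIr _ 2^-1); rewrite subrK; field.
exists e'; split => //; move: ce1; rewrite /band_edge !imE // => -[x y] [/= h1 h2]; split => //=.
  by case: h2 => ->; [right; rewrite subr0 | left; rewrite subrr].
by move: h2; rewrite !in_itv /= => /andP[? ?]; apply/andP; split; xlra.
Qed.

Lemma band_sum_curve (F beta F' : set P2) e : nontrivial_band_sum R (V R) (bV R) F beta F' ->
  curve (F `&` bV R) e -> coprimez e.1 e.2 ->
  exists e', [/\ curve (F' `&` bV R) e', coprimez e'.1 e'.2 & `|det e e'| = 2].
Proof.
move=> [[h [[hi [ch chi _ hK]] NbV hb FN [phi [_ _ _ hprop <-]]]] nt] [l sl tl] ce.
have [_ ->] := hprop 1 ltac:(by rewrite ltr01 lexx).
pose g (z : P) := h (clamp 0 1 z.1, clamp 0 1 z.2).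
have Ic (y : R) : I (clamp 0 1 y) by rewrite IE; exact: clamp_itv.
have cg : continuous g by apply: (within_comp ch) => [|z]; [cont | split; exact: Ic].
have [|w cw Hw] := @cover_lift R g 1 ler01 cg.
  by move=> z; apply: NbV; exists (clamp 0 1 z.1, clamp 0 1 z.2) => //; split; exact: Ic.
have wE z : square R z -> cover (w z) = h z.
  move=> [z1 z2]; rewrite Hw; first by rewrite /g !clamp_id //; case: z z1 z2.
  rewrite prod_normE ge_max !ler_norml; move: z1 z2; rewrite !IE => /andP[? ?] /andP[? ?].
  by apply/andP; split; apply/andP; split; xlra.
have imE (X : set P) : X `<=` square R -> (fun z => cover (w z)) @` X = h @` X.
  by move=> XS; apply: eq_imagel => z /XS; exact: wE.
have S01 x : x = 0 \/ x = 1 -> I x by case=> ->; [exact: I0 | exact: I1].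
have Binj z z' : square R z -> square R z' -> cover (w z) = cover (w z') -> z = z'.
  by move=> sz sz'; rewrite !wE // => e'; rewrite -(hK _ sz) -(hK _ sz') e'.
have Btr z : square R z -> trace l (cover (w z)) <-> z.1 = 0 \/ z.1 = 1.
  move=> sz; rewrite tl wE //; split=> [Fz|z01].
    have : ((F `&` bV R) `&` h @` square R) (h z) by split => //; exists z.
    rewrite FN => -[z' [z'0 Iz'] e']; have sz' : square R z' by split => //; exact: S01.
    by rewrite -(hK _ sz) -e' (hK _ sz').
  have : (h @` ([set 0; 1] `*` I)) (h z) by exists z => //; split => //; case: sz.
  by rewrite -FN => -[].
have be : (fun z => cover (w z)) @` (I `*` [set 2^-1]) = beta.
  by rewrite imE // => -[x y] [/= Ix ->]; split => //=; exact: I2.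
have [e' [h1 h2 h3]] := band_step ce sl cw Binj Btr (esym tl) be nt.
exists e'; split => //; move: h1; rewrite /band_edge tl !imE //.
  by move=> -[x y] [/= Ix y01]; split => //; exact: S01.
move=> -[x y] [/= x01]; rewrite in_itv /= => /andP[? ?]; split; first exact: S01.
by rewrite IE /= !ltW.
Qed.

Lemma meridian_curve (D : set P2) : meridian_disk D -> exists e,
  [/\ curve (D `&` bV R) e, coprimez e.1 e.2 & (2 %| e.2)%Z].
Proof.
move=> [_ _ [c01 /isotopic_curves [e [ce cs]]]]; exists e.
have [E|/(congr1 -%R)] := curve_class_uniq cs (@slope_curve_class R _ c01); first by rewrite -E in ce *.
by rewrite opprK => E; rewrite -E in ce *.
Qed.

Lemma even_step (e e' : int * int) : coprimez e.1 e.2 -> (2 %| e.2)%Z -> `|det e e'| = 2 -> (2 %| e'.2)%Z.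
Proof.
move=> ce e2 d; have c2 : coprimez 2 e.1.
  by apply: (coprimez_dvdl e2); rewrite coprimez_sym.
rewrite -(Gauss_dvdzr _ c2) -(subrK (e.2 * e'.1) (e.1 * e'.2)) rpredD //; last exact: dvdz_mulr.
have [->|->] // : e.1 * e'.2 - e.2 * e'.1 = 2 \/ e.1 * e'.2 - e.2 * e'.1 = - 2.
by move: d; rewrite /det; move: (_ - _) => x; clear; lia.
Qed.

End BandStep.

Theorem theorem1p11 (R : realType) (p q : int) (L : topologicalType)
    (g : (R * R) * (R * R) -> (R * R) * (R * R))
    (i1 i2 : (R * R) * (R * R) -> L)
    (F : set L) (n : nat) (Fs beta : nat -> set ((R * R) * (R * R)))
    (D2 : set ((R * R) * (R * R))) :
  coprimez p q -> 2 <= p ->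
  lens_space p q g i1 i2 ->
  closed_surface R F -> connected F ->
  standard_form g i1 i2 F n Fs beta D2 ->
  forall i : nat, (i < n)%N ->
    [/\ exists v, has_slope (Fs i `&` bV R) v,
        exists w, has_slope (Fs i.+1 `&` bV R) w &
        forall v w, has_slope (Fs i `&` bV R) v ->
          has_slope (Fs i.+1 `&` bV R) w -> D2_edge v w].
Proof.
move=> _ _ _ _ _ [mD bs _ _ _].
have inv i : (i <= n)%N -> exists e, [/\ curve (Fs i `&` bV R) e, coprimez e.1 e.2 & (2 %| e.2)%Z].
  elim: i => [_|i IH i_n]; first exact: meridian_curve.
  have [e [ce cop e2]] := IH (ltnW i_n); have [e' [ce' cop' d]] := band_sum_curve (bs i i_n) ce cop.
  by exists e'; split => //; exact: even_step d.
have slope C e : curve C e -> coprimez e.1 e.2 -> exists v, @has_slope R C v.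
  by move=> ce cop; exists (e.2, e.1); split; [rewrite coprimez_sym | exact: curve_isotopic].
move=> i i_n; have [e [ce cop e2]] := inv i (ltnW i_n).
have [e' [ce' cop' d]] := band_sum_curve (bs i i_n) ce cop.
have e2' := even_step cop e2 d.
split; [exact: slope ce cop | exact: slope ce' cop' | move=> v w sv sw].
have hv := slope_class sv ce; have hw := slope_class sw ce'.
have vert u (x : int * int) C : @has_slope R C u -> (u.2, u.1) = x \/ (u.2, u.1) = - x -> (2 %| x.2)%Z -> D2_vertex u.
  move=> [cu _] h x2; split => //; have : u.1 = x.2 \/ u.1 = - x.2 by case: h => [<-|h]; [left | right; rewrite -[LHS]/(u.2, u.1).2 h].
  by case=> ->; rewrite ?rpredN.
split; [exact: vert sv hv e2 | exact: vert sw hw e2' |].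
rewrite -d /frac_dist /det.
have [-> ->] : v.1 = (v.2, v.1).2 /\ v.2 = (v.2, v.1).1 by [].
have [-> ->] : w.1 = (w.2, w.1).2 /\ w.2 = (w.2, w.1).1 by [].
case: hv hw => -> [] ->; rewrite /= ?mulNr ?mulrN ?opprK; lia.
Qed.
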